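(* Let $p\geq 2$ and let $X_N=I_p(f_N)$, $N\geq 1$, with $f_N\in H^{\odot p}$ for all $N\geq 1$, be such that $X_N\xrightarrow[N\to\infty]{(d)}N(0,\sigma^2)$ with $\sigma^2>0$. Let $Y_N=I_q(g_N)$, $g_N\in H^{\odot q}$, with $ap<q<(a+1)p$ for some integer $a\geq 1$. Define $Y_{0,N}=Y_N$ and $Y_{r+1,N}=\langle DX_N,DY_{r,N}\rangle_H$ for $r\geq 0$. Assume that $$(Y_N,Y_{1,N},\ldots,Y_{a,N})\xrightarrow[N\to\infty]{(d)}(Y,Y_1,\ldots,Y_a),$$ and that $Y_1,\ldots,Y_a$ all admit exponential moments, i.e. $\mathbf E[e^{tY_r}]<\infty$ for every $t\in\mathbb R$ and every $r=1,\ldots,a$. Then the characteristic function $\varphi$ of the limit in distribution $(Z,Y)$ of $(X_N,Y_N)$ is given, for every $u,v\in\mathbb R$, by $$\varphi(u,v)=e^{-\sigma^2u^2/2}\,\mathbf E\left[\exp\left(ivY+\sum_{r=1}^a\frac{(-1)^r\,i^{r-1}}{r!}\cdot\frac{u^rv^r}{p^r}\,Y_r\right)\right].$$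
   Context: $H$ is a real separable Hilbert space, $H^{\odot n}$ is the symmetric $n$-th tensor power of $H$ (symmetric elements of $H^{\otimes n}$), $(W(h),h\in H)$ is an isonormal Gaussian process on a probability space $(\Omega,\mathcal A,P)$, and $I_n$ is the multiple Wiener–Itô integral of order $n$ with respect to $W$, normalized so that $\mathbf E[I_n(f)I_m(g)]=n!\langle f,g\rangle_{H^{\otimes n}}$ if $n=m$ and $0$ otherwise, for symmetric $f,g$. $D$ is the Malliavin derivative with respect to $W$, and $i$ is the imaginary unit. $\xrightarrow{(d)}$ denotes convergence in distribution. The expectation in the conclusion is taken with respect to the joint law of the limit vector $(Y,Y_1,\ldots,Y_a)$; $Z\sim N(0,\sigma^2)$. *)

(* Defs.v *)
From HB Require Import structures.
From mathcomp Require Import all_boot all_order all_algebra perm.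
From mathcomp Require Import sesquilinear.
From mathcomp Require Import all_classical all_reals all_analysis.
From mathcomp Require Import complex.

Set Implicit Arguments.
Unset Strict Implicit.
Unset Printing Implicit Defensive.

Import Order.TTheory GRing.Theory Num.Theory.
Import numFieldNormedType.Exports.

Local Open Scope classical_set_scope.
Local Open Scope ring_scope.

Record hilbertType (R : realType) := HilbertType {
  hilbert_sort :> completeNormedModType R;
  inner : {dot hilbert_sort for idfun};
  normr_inner : forall x, `|x| ^+ 2 = inner x x }.

Definition separable (T : topologicalType) :=
  exists2 D : set T, countable D & dense D.

(* A realization of the Hilbert space H^{\otimes n}, as the completion of the
   algebraic tensor power; it is determined up to a unique isometry commuting
   with [pure]. *)
Record tensor_power (R : realType) (H : hilbertType R) (n : nat) :=
  TensorPower {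
  tensor_space :> hilbertType R;
  pure : ('I_n -> H) -> tensor_space;
  pure_multilinear : forall (h : 'I_n -> H) (i : 'I_n) (a : R) (x y : H),
    pure (@dfwith _ (fun=> H) h i (a *: x + y)) =
    a *: pure (@dfwith _ (fun=> H) h i x) + pure (@dfwith _ (fun=> H) h i y);
  inner_pure : forall h k : 'I_n -> H,
    inner tensor_space (pure h) (pure k) = \prod_(i < n) inner H (h i) (k i);
  pure_total : dense [set x : tensor_space |
    exists m (c : 'I_m -> R) (h : 'I_m -> 'I_n -> H),
      x = \sum_(j < m) c j *: pure (h j)] }.

(* Membership in H^{\odot n}: the n-linear form h |-> <f, h_1 (x) ... (x) h_n>
   representing f is symmetric. *)
Definition symmetric_tensor (R : realType) (H : hilbertType R) (n : nat)
    (T : tensor_power H n) (f : T) :=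
  forall (s : {perm 'I_n}) (h : 'I_n -> H),
    inner T f (pure T (h \o s)) = inner T f (pure T h).

Section gaussian.
Context {R : realType} {d : measure_display} {Omega : measurableType d}.
Variable P : probability Omega R.

(* [normal_prob m 0] is not a point mass in the library, hence the case split. *)
Definition gaussian (X : Omega -> R) :=
  exists m s : R, forall A : set R, measurable A ->
    P (X @^-1` A) = if s == 0 then dirac m A else normal_prob m s A.

Definition isonormal (H : hilbertType R) (W : H -> {RV P >-> R}) :=
  [/\ forall m (c : 'I_m -> R) (h : 'I_m -> H),
        gaussian (fun w => \sum_(j < m) c j * W (h j) w),
      forall h, expectation P (W h) = 0%E &
      forall g h, expectation P (fun w => W g w * W h w) = (inner H g h)%:E].

(* The monic (probabilists') Hermite polynomials. *)
Fixpoint hermite (n : nat) : {poly R} :=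
  if n is k.+1 then 'X * hermite k - (hermite k)^`() else 1.

(* The normalized linear isometries I_n from H^{\odot n} onto the n-th Wiener
   chaos; these clauses determine I_n f up to a P-null set for symmetric f,
   since the h^{\otimes n} with |h| = 1 are total in H^{\odot n}. *)
Record multiple_integral (H : hilbertType R) (W : H -> {RV P >-> R})
    (T : forall n, tensor_power H n) (I : forall n, T n -> {RV P >-> R}) :
    Prop := MultipleIntegral {
  integral_linear : forall n (a : R) (f g : T n),
    symmetric_tensor f -> symmetric_tensor g ->
    \forall w \ae P, I n (a *: f + g) w = a * I n f w + I n g w;
  integral_isometry : forall n (f g : T n),
    symmetric_tensor f -> symmetric_tensor g ->
    expectation P (fun w => I n f w * I n g w) = (n`!%:R * inner (T n) f g)%:E;
  integral_orthogonal : forall n m (f : T n) (g : T m), n != m ->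
    symmetric_tensor f -> symmetric_tensor g ->
    expectation P (fun w => I n f w * I m g w) = 0%E;
  integral_hermite : forall n (h : H), `|h| = 1 ->
    \forall w \ae P, I n (pure (T n) (fun=> h)) w = (hermite n).[W h w] }.

Definition partial (m : nat) (i : 'I_m) (phi : 'rV[R]_m -> R) : 'rV[R]_m -> R :=
  'D_(delta_mx 0 i) phi.

(* C^oo functions all of whose partial derivatives have polynomial growth. *)
Definition smooth_poly_growth (m : nat) (phi : 'rV[R]_m -> R) :=
  forall s : seq 'I_m, let psi := foldr (@partial m) phi s in
  [/\ continuous psi,
      forall x i, derivable psi x (delta_mx 0 i) &
      exists (C : R) (k : nat), forall x, `|psi x| <= C * (1 + `|x|) ^+ k].

Definition cylindrical_derivative (H : hilbertType R) (W : H -> {RV P >-> R})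
    (F : Omega -> R) (DF : Omega -> H) :=
  exists m (phi : 'rV[R]_m -> R) (h : 'I_m -> H),
  [/\ smooth_poly_growth phi,
      forall w, F w = phi (\row_j W (h j) w) &
      forall w, DF w = \sum_(i < m) partial i phi (\row_j W (h j) w) *: h i].

(* [F] belongs to the domain D^{1,2} of the closure, from L^2(P) to L^2(P; H),
   of the derivative of cylindrical variables, and [DF] is a version of its
   Malliavin derivative. *)
Definition malliavin_derivative (H : hilbertType R) (W : H -> {RV P >-> R})
    (F : {RV P >-> R}) (DF : Omega -> H) :=
  (forall U : set H, open U -> measurable (DF @^-1` U)) /\
  exists (F_ : nat -> Omega -> R) (DF_ : nat -> Omega -> H),
  [/\ forall k, cylindrical_derivative W (F_ k) (DF_ k),
      expectation P (fun w => (F_ k w - F w) ^+ 2) @[k --> \oo] --> 0%E &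
      expectation P (fun w => `|DF_ k w - DF w| ^+ 2) @[k --> \oo] --> 0%E].

Definition cexp (z : R[i]) : R[i] :=
  Complex (expR (complex.Re z) * cos (complex.Im z))
          (expR (complex.Re z) * sin (complex.Im z)).

Definition cexpectation (f : Omega -> R[i]) : R[i] :=
  Complex (fine (expectation P (fun w => complex.Re (f w))))
          (fine (expectation P (fun w => complex.Im (f w)))).

End gaussian.

Definition cvg_in_distribution (R : realType) (d d' : measure_display)
    (Omega : measurableType d) (Omega' : measurableType d')
    (P : probability Omega R) (P' : probability Omega' R)
    (E : topologicalType) (X_ : nat -> Omega -> E) (X : Omega' -> E) :=
  forall g : E -> R, continuous g -> (exists M : R, forall x, `|g x| <= M) ->
    expectation P (g \o X_ N) @[N --> \oo] --> expectation P' (g \o X).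

Definition charfun2 (R : realType)
    (mu : probability (measurableTypeR R * measurableTypeR R)%type R) (u v : R) :
    R[i] :=
  cexpectation mu (fun z => cexp ('i%C * (u * z.1 + v * z.2)%:C%C)).

(* Main.v *)
(* All the variables involved are limits in L^2 of polynomials in finitely many
   independent Gaussians, on which the Malliavin derivative is the gradient; degrees
   stay bounded, so hypercontractivity turns convergence in law into convergence of
   moments.

   As X_N is asymptotically normal, its fourth cumulant tends to 0, hence <DX, DX>
   concentrates at p sigma^2 and the proper contractions of X with itself vanish:
   Y_(r,N) is asymptotically in the chaos of order q - rp, and Y_(a+1,N) tends to 0.

   The powers v^r of the formula play no role, because Y_r = 0 for r >= 2.  By
   descending induction let Y_(r+2) = 0 with r >= 1, and write U = Y_r, V = Y_(r+1).
   Gaussian integration by parts p E[X F] = E <DX, DF> then gives a two-step recursion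
   for the limits of E[X^m V^i U^j], from which E[U^(2m)] >= c^m m! E[V^(2m)]; and
   E[V^(2m)] >= m! E[V^2]^m because V comes from a chaos of positive order.  The
   growth m!^2 of E[U^(2m)] contradicts the exponential moments of U unless V = 0.

   Since Y_2 = 0, the functions
     n_k(s) = exp(sigma^2 s^2 / 2) E[cos(s X + v Y + b) Y_1^k]
   satisfy n_k' = -(v / p) n_(k+1) + o(1), and the Taylor expansion of n_0 at 0 is the
   exponential series of the formula.  The joint law is the Daniell measure of the
   functional g |-> lim E[g(X_N, Y_N)]. *)

Require Import Defs.
From HB Require Import structures.
From mathcomp Require Import all_boot all_order all_algebra perm.
From mathcomp Require Import sesquilinear.
From mathcomp Require Import all_classical all_reals all_analysis.
From mathcomp Require Import measurable_realfun.
From mathcomp Require Import complex.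
From mathcomp Require Import ring lra zify.
From mathcomp Require mpoly. Import -(notations) mpoly.

Set Implicit Arguments.
Unset Strict Implicit.
Unset Printing Implicit Defensive.

Import Order.TTheory GRing.Theory Num.Theory.
Import numFieldNormedType.Exports.

Local Open Scope classical_set_scope.
Local Open Scope ring_scope.

(** The vectors behind [f N] and [g N] change with [N], and so does the Gaussian algebra: estimates
    are uniform in the dimension, with constants depending only on degrees. Kernels are replaced by
    the numbers E[D_s F], and the multiplication formula by the Leibniz rule and the identity 2 <DF,
    DG> = L(FG) - F LG - G LF for the Ornstein-Uhlenbeck generator L. The joint law of [X] with
    [Y_1, ..., Y_a] is not controlled by the hypotheses; the recursion itself makes the mixed
    moments converge, starting from those without [X]. It closes only if the iterate after V is
    negligible, whence the descent from [a + 1], and it needs exponential moments of U = Y_r,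
    assumed for r >= 1 only: it ends with Y_2 = 0. Two points separate polynomials from the given
    variables. A Malliavin derivative is a limit along some cylindrical sequence, and closability is
    needed to reach it by polynomial approximants instead. Products of derivatives converge a priori
    in L^1 only, while each further iterate needs L^2; bounded fourth moments fill the gap. *)

(* Polynomials in [gdim] independent standard Gaussians [gx i], with their partial
   derivatives [gd i] and expectation [gE]. *)
Record gaussian_algebra (R : realType) := GaussianAlgebra {
  galg :> comAlgType R;
  gdim : nat;
  gd : 'I_gdim -> {linear galg -> galg};
  gx : 'I_gdim -> galg;
  gE : {scalar galg};
  gdM : forall i F G, gd i (F * G) = gd i F * G + F * gd i G;
  gdC : forall i j F, gd i (gd j F) = gd j (gd i F);
  gdx : forall i j, gd i (gx j) = (i == j)%:R;
  gE1 : gE 1 = 1;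
  gE_ibp : forall i F, gE (gx i * F) = gE (gd i F);
  galg_ind : forall S : galg -> Prop, (forall c : R, S c%:A) ->
    (forall F G, S F -> S G -> S (F + G)) ->
    (forall i F, S F -> S (gx i * F)) -> forall F, S F }.

(** * Cauchy-Schwarz inequality for finite sums *)

Section sums.
Context {R : realType}.

Lemma sumr_sqr_ge0 (I : Type) (r : seq I) (f : I -> R) :
  0 <= \sum_(i <- r) f i ^+ 2.
Proof. by apply: sumr_ge0 => i _; exact: sqr_ge0. Qed.

(** The quadratic is evaluated at its minimum [b / c]. The Cauchy-Schwarz inequalities for sums, for
    [gE], for [Ex] and for [inner] are all deduced from it. *)
Lemma discriminant_le (a b c : R) :
  (forall t, 0 <= a - t * b *+ 2 + t ^+ 2 * c) -> 0 <= c -> b ^+ 2 <= a * c.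
Proof.
move=> H; rewrite le_eqVlt => /orP[/eqP c0|c0].
  suff -> : b = 0 by rewrite -c0; nra.
  apply/eqP; apply: contraT => b0.
  (* With c = 0 the form is affine in t; at this t it equals -1. *)
  have := H ((a + 1) / (2 * b)); rewrite -c0.
  have -> : (a + 1) / (2 * b) * b *+ 2 = a + 1 by field.
  lra.
have := H (b / c).
have -> : a - b / c * b *+ 2 + (b / c) ^+ 2 * c = (a * c - b ^+ 2) / c.
  by field; rewrite gt_eqF.
by rewrite pmulr_lge0 ?invr_gt0// subr_ge0.
Qed.

Lemma cauchy_schwarz_sum (I : Type) (r : seq I) (f g : I -> R) :
  (\sum_(i <- r) f i * g i) ^+ 2 <=
  (\sum_(i <- r) f i ^+ 2) * (\sum_(i <- r) g i ^+ 2).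
Proof.
apply: discriminant_le; last exact: sumr_sqr_ge0.
move=> t; have := sumr_sqr_ge0 r (fun i => f i - t * g i).
congr (0 <= _); rewrite mulr_sumr -sumrMnl mulr_sumr -sumrB -big_split/=.
by apply: eq_bigr => i _; ring.
Qed.

End sums.

(** * Gaussian calculus for polynomials *)

Section gaussian_calculus.
Context {R : realType} (A : gaussian_algebra R).
Implicit Types (F G X : A) (s t u v : seq 'I_(gdim A)).

Local Notation J := 'I_(gdim A).
Local Notation E := (gE A).
Local Notation D := (@gd _ A).

Lemma gED F G : E (F + G) = E F + E G. Proof. exact: raddfD. Qed.
Lemma gEB F G : E (F - G) = E F - E G. Proof. exact: raddfB. Qed.
Lemma gEZ (c : R) F : E (c *: F) = c * E F. Proof. by rewrite linearZ. Qed.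
Lemma gE0 : E 0 = 0. Proof. exact: raddf0. Qed.
Lemma gEc (c : R) : E c%:A = c. Proof. by rewrite gEZ gE1 mulr1. Qed.
Lemma gE_sum (I : Type) (r : seq I) (P : pred I) (f : I -> A) :
  E (\sum_(i <- r | P i) f i) = \sum_(i <- r | P i) E (f i).
Proof. exact: raddf_sum. Qed.
Lemma gEMn F k : E (F *+ k) = E F *+ k. Proof. exact: raddfMn. Qed.

Lemma gdD i F G : D i (F + G) = D i F + D i G. Proof. exact: raddfD. Qed.
Lemma gdZ i (c : R) F : D i (c *: F) = c *: D i F. Proof. by rewrite linearZ. Qed.
Lemma gd0 i : D i 0 = 0. Proof. exact: raddf0. Qed.
Lemma gd1 i : D i 1 = 0.
Proof.
have := gdM i (1 : A) 1; rewrite !mulr1 mul1r => H.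
by apply: (addrI (D i 1)); rewrite addr0 -H.
Qed.
Lemma gdc i (c : R) : D i c%:A = 0. Proof. by rewrite gdZ gd1 scaler0. Qed.
Lemma gd_sum i (I : Type) (r : seq I) (P : pred I) (f : I -> A) :
  D i (\sum_(j <- r | P j) f j) = \sum_(j <- r | P j) D i (f j).
Proof. exact: raddf_sum. Qed.

Definition gds s F : A := foldr (fun i => D i) F s.

Lemma gds_cons i s F : gds (i :: s) F = D i (gds s F). Proof. by []. Qed.

Lemma gds_cat s t F : gds (s ++ t) F = gds s (gds t F).
Proof. by rewrite /gds foldr_cat. Qed.

Lemma gds_gd i s F : gds s (D i F) = D i (gds s F).
Proof. by elim: s => //= j s ->; rewrite gdC. Qed.

Lemma gds_gds s t F : gds s (gds t F) = gds t (gds s F).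
Proof. by elim: t => //= i t <-; rewrite gds_gd. Qed.

Lemma gdsD s F G : gds s (F + G) = gds s F + gds s G.
Proof. by elim: s => //= i s ->; rewrite gdD. Qed.
Lemma gdsZ s (c : R) F : gds s (c *: F) = c *: gds s F.
Proof. by elim: s => //= i s ->; rewrite gdZ. Qed.
Lemma gds0 s : gds s 0 = 0.
Proof. by elim: s => //= i s ->; rewrite gd0. Qed.
Lemma gdsB s F G : gds s (F - G) = gds s F - gds s G.
Proof. by rewrite gdsD -scaleN1r gdsZ scaleN1r. Qed.
Lemma gds_sum s (I : Type) (r : seq I) (P : pred I) (f : I -> A) :
  gds s (\sum_(j <- r | P j) f j) = \sum_(j <- r | P j) gds s (f j).
Proof. by apply: (big_morph _ (gdsD s) (gds0 s)). Qed.

(** Words of length [k] in the coordinates, repetitions included: sums over them stand for inner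
    products in the k-th tensor power. *)
Fixpoint ix k : seq (seq J) :=
  if k is k'.+1 then [seq i :: s | i <- enum J, s <- ix k'] else [:: [::]].

Lemma size_ix k s : s \in ix k -> size s = k.
Proof.
elim: k s => [|k IH] s; first by rewrite inE => /eqP ->.
by move=> /allpairsP[[i t]/= [_ /IH <- ->]].
Qed.

Lemma sum_ix0 (V : nmodType) (f : seq J -> V) : \sum_(s <- ix 0) f s = f [::].
Proof. by rewrite big_seq1. Qed.

Lemma sum_ixS (V : nmodType) k (f : seq J -> V) :
  \sum_(s <- ix k.+1) f s = \sum_i \sum_(s <- ix k) f (i :: s).
Proof. by rewrite [LHS]big_allpairs_dep/= big_enum. Qed.

Lemma eq_sum_ix (V : nmodType) k (f g : seq J -> V) :
  (forall s, size s = k -> f s = g s) ->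
  \sum_(s <- ix k) f s = \sum_(s <- ix k) g s.
Proof.
move=> fg; rewrite big_seq [RHS]big_seq; apply: eq_bigr => s /size_ix; exact: fg.
Qed.

Lemma ler_sum_ix k (f g : seq J -> R) :
  (forall s, size s = k -> f s <= g s) ->
  \sum_(s <- ix k) f s <= \sum_(s <- ix k) g s.
Proof.
move=> fg; rewrite big_seq [leRHS]big_seq; apply: ler_sum => s /size_ix; exact: fg.
Qed.

(** By Stroock's formula these are [k!] times the coordinates of the kernel of order
    [k = size s]. *)
Definition coef s F : R := E (gds s F).

Lemma coefD s F G : coef s (F + G) = coef s F + coef s G.
Proof. by rewrite /coef gdsD gED. Qed.
Lemma coefB s F G : coef s (F - G) = coef s F - coef s G.
Proof. by rewrite /coef gdsB gEB. Qed.
Lemma coefZ s c F : coef s (c *: F) = c * coef s F.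
Proof. by rewrite /coef gdsZ gEZ. Qed.
Lemma coef0 s : coef s 0 = 0. Proof. by rewrite /coef gds0 gE0. Qed.
Lemma coef_sum s (I : Type) (r : seq I) (P : pred I) (f : I -> A) :
  coef s (\sum_(j <- r | P j) f j) = \sum_(j <- r | P j) coef s (f j).
Proof. by rewrite /coef gds_sum gE_sum. Qed.
Lemma coef_cons i s F : coef (i :: s) F = coef s (D i F).
Proof. by rewrite /coef gds_gd. Qed.

(** After division by [k!] this is the L^2 inner product of the projections of [F] and [G] on the
    chaos of order [k]. *)
Definition gB k F G : R := \sum_(s <- ix k) coef s F * coef s G.

Lemma gB0 F G : gB 0 F G = E F * E G.
Proof. by rewrite /gB sum_ix0. Qed.

Lemma gBS k F G : gB k.+1 F G = \sum_i gB k (D i F) (D i G).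
Proof.
rewrite /gB sum_ixS; apply: eq_bigr => i _; apply: eq_bigr => s _.
by rewrite !coef_cons.
Qed.

Lemma gBC k F G : gB k F G = gB k G F.
Proof. by apply: eq_bigr => s _; rewrite mulrC. Qed.

Lemma gBDl k F F' G : gB k (F + F') G = gB k F G + gB k F' G.
Proof.
by rewrite /gB -big_split/=; apply: eq_bigr => s _; rewrite coefD mulrDl.
Qed.

Lemma gBDr k F G G' : gB k F (G + G') = gB k F G + gB k F G'.
Proof. by rewrite gBC gBDl !(gBC k F). Qed.

Lemma gB_ge0 k F : 0 <= gB k F F.
Proof.
by rewrite /gB; apply: sumr_ge0 => s _; rewrite -expr2 sqr_ge0.
Qed.

Lemma gB0l k G : gB k 0 G = 0.
Proof. by rewrite /gB big1// => s _; rewrite coef0 mul0r. Qed.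

(** The degree is bounded through derivatives because the algebra is abstract and has no monomials;
    Leibniz gives stability under products. *)
Definition degle n F := forall s, (n < size s)%N -> gds s F = 0.

Lemma degle_leq m n F : degle m F -> (m <= n)%N -> degle n F.
Proof. by move=> h mn s ns; apply: h; exact: leq_ltn_trans ns. Qed.

Lemma degle_gd n i F : degle n F -> degle n.-1 (D i F).
Proof.
move=> h s ns; rewrite gds_gd -gds_cons; apply: h => /=.
by move: ns; clear; lia.
Qed.

Lemma degle_gds n s F : degle n F -> degle (n - size s) (gds s F).
Proof.
by move=> h t ts; rewrite -gds_cat h// size_cat; lia.
Qed.

Lemma degle0_gd i F : degle 0 F -> D i F = 0.
Proof. by move=> /(_ [:: i]); apply. Qed.

Lemma degleD n F G : degle n F -> degle n G -> degle n (F + G).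
Proof. by move=> hF hG s ns; rewrite gdsD hF// hG// addr0. Qed.

Lemma degleZ n c F : degle n F -> degle n (c *: F).
Proof. by move=> hF s ns; rewrite gdsZ hF// scaler0. Qed.

Lemma degle_sum n (I : Type) (r : seq I) (P : pred I) (f : I -> A) :
  (forall i, P i -> degle n (f i)) -> degle n (\sum_(i <- r | P i) f i).
Proof.
by move=> h s ns; rewrite gds_sum; apply: big1 => i Pi; exact: h.
Qed.

Lemma degle0 n : degle n 0.
Proof. by move=> s _; rewrite gds0. Qed.

Lemma deglec c : degle 0 c%:A.
Proof. by case=> // i s _; rewrite gds_cons -gds_gd gdc gds0. Qed.

Lemma degleM m n F G : degle m F -> degle n G -> degle (m + n) (F * G).
Proof.
move=> hF hG s; elim: s m n F G hF hG => // i s IH m n F G hF hG /= mns.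
rewrite -gds_gd gdM gdsD.
have -> : gds s (D i F * G) = 0.
  case: m hF mns => [|m] hF mns; first by rewrite degle0_gd// mul0r gds0.
  by apply: (IH m n) => //; first exact: (degle_gd (n := m.+1)).
have -> : gds s (F * D i G) = 0.
  case: n hG mns => [|n] hG mns; first by rewrite (degle0_gd i hG) mulr0 gds0.
  by apply: (IH m n) => //; [exact: (degle_gd (n := n.+1))|rewrite addnS in mns].
by rewrite addr0.
Qed.

Lemma deglex i : degle 1 (gx i).
Proof.
case=> // j [//|k s] _; rewrite !gds_cons -!gds_gd gdC gdx; case: eqP => _; by rewrite ?gd1 ?gd0 gds0.
Qed.

Lemma degleP F : exists n, degle n F.
Proof.
apply: (galg_ind (S := fun F => exists n, degle n F)) => [c|{}F G|i {}F].
- by exists 0; exact: deglec.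
- move=> [m hm] [n hn]; exists (maxn m n); apply: degleD.
    exact: degle_leq (leq_maxl _ _).
  exact: degle_leq (leq_maxr _ _).
- by move=> [n hn]; exists (1 + n)%N; apply: degleM => //; exact: deglex.
Qed.

Lemma gB_degle n k F G : degle n F -> (n < k)%N -> gB k F G = 0.
Proof.
move=> h nk; rewrite /gB (eq_sum_ix (g := fun=> 0)) ?big1// => s sk.
by rewrite /coef h ?gE0 ?mul0r// sk.
Qed.

(** Among the [k] derivatives of [gx i * F], either none hits [gx i], and integration by parts turns
    this factor into [D i], or one of the [k] does. *)
Lemma gBx k i F G : gB k (gx i * F) G = gB k (D i F) G + k%:R * gB k.-1 F (D i G).
Proof.
elim: k F G => [|k IH] F G; first by rewrite !gB0 gE_ibp mul0r addr0.
have H j : gB k (D j (gx i * F)) (D j G) =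
    (j == i)%:R * gB k F (D i G) + gB k (D i (D j F)) (D j G) +
    k%:R * gB k.-1 (D j F) (D j (D i G)).
  rewrite gdM gdx gBDl IH (gdC j i G) addrA; congr (_ + _ + _).
  case: eqP => [->|_]; first by rewrite !mul1r.
  rewrite !mul0r /gB big1// => s _; by rewrite coef0 mul0r.
rewrite gBS (eq_bigr _ (fun j _ => H j)) !big_split/= -mulr_sumr.
have -> : \sum_(j < gdim A) (j == i)%:R * gB k F (D i G) = gB k F (D i G).
  rewrite (bigD1 i)//= eqxx mul1r big1 ?addr0// => j /negPf ->.
  by rewrite mul0r.
rewrite gBS; under [X in _ + X + _ = _]eq_bigr do rewrite gdC.
case: k {IH H} => [|k]; first by rewrite mul0r addr0 addrC mul1r.
by rewrite /= -!gBS -[k.+2%:R]natr1; ring.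
Qed.

(** The truncation order is left free beyond some [m], so that the property passes to sums and to
    products by a variable; [plancherel] then cuts it at the degree. *)
Definition plancherel_holds F := exists m, forall n, (m <= n)%N -> forall G,
  E (F * G) = \sum_(k < n) gB k F G / k`!%:R.

Lemma plancherel_holdsD F F' :
  plancherel_holds F -> plancherel_holds F' -> plancherel_holds (F + F').
Proof.
move=> [m hm] [m' hm']; exists (maxn m m') => n mn G.
rewrite mulrDl gED (hm n) ?(hm' n)//; try lia.
by rewrite -big_split/=; apply: eq_bigr => k _; rewrite gBDl mulrDl.
Qed.

Lemma plancherel_holdsx i F :
  plancherel_holds F -> plancherel_holds (D i F) -> plancherel_holds (gx i * F).
Proof.
move=> [m hm] [m' hm']; exists (maxn m m').+1 => -[//|n] mn G.
rewrite -mulrA gE_ibp gdM gED (hm n) ?(hm' n.+1)//; try lia.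
rewrite (eq_bigr _ (fun (k : 'I_n.+1) _ => congr1 ( *%R^~ _) (gBx k i F G))).
under eq_bigr do rewrite mulrDl.
rewrite big_split/=; congr (_ + _); rewrite big_ord_recl/= !mul0r add0r.
apply: eq_bigr => k _; rewrite /bump/= add1n add0n factS natrM; field.
by rewrite nat1r !pnatr_eq0 -lt0n fact_gt0.
Qed.

Lemma plancherel n F G : degle n F ->
  E (F * G) = \sum_(k < n.+1) gB k F G / k`!%:R.
Proof.
move=> hF.
have [m Hm] : plancherel_holds F.
  (* The case of [gx i * F] needs [D i F] as well, hence an induction on all derivatives at once. *)
  have [H _] : (forall s, plancherel_holds (gds s F)) /\ True.
    split=> //; move: F {hF}; apply: galg_ind => [c s|F F' HF HF' s|i F HF s].
    - have [m h] : plancherel_holds (gds s c%:A).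
        case: s => [|i s]; last first.
          exists 0%N => l _ {}G; rewrite gds_cons -gds_gd gdc gds0 mul0r gE0.
          by rewrite big1// => k _; rewrite gB0l mul0r.
        exists 1%N => -[//|l _] {}G; rewrite big_ord_recl/= gB0 gEc mulr_algl gEZ.
        rewrite big1 ?addr0 ?divr1// => k _.
        by rewrite (gB_degle (n := 0)) ?mul0r//; exact: deglec.
      by exists m.
    - by rewrite gdsD; exact: plancherel_holdsD.
    - elim: s F HF => [|j s IH] F HF.
        exact: plancherel_holdsx (HF [::]) (HF [:: i]).
      rewrite gds_cons -gds_gd gdM gdx gdsD; apply: plancherel_holdsD.
        case: eqP => _; first by rewrite mul1r.
        exists 0%N => l _ {}G; rewrite mul0r gds0 mul0r gE0.
        by rewrite big1// => k _; rewrite gB0l mul0r.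
      by apply: IH => t; rewrite gds_gd -gds_cons; exact: HF.
  exact: (H [::]).
rewrite (Hm (maxn m n.+1)) ?leq_maxl//.
rewrite -!(big_mkord xpredT (fun k => gB k F G / k`!%:R)).
rewrite (big_cat_nat (n := n.+1)) ?leq_maxr//= [X in _ + X]big1_seq ?addr0//.
move=> k /andP[_]; rewrite mem_index_iota => /andP[nk _].
by rewrite (gB_degle _ hF nk) mul0r.
Qed.

Lemma gEsqr n F : degle n F -> E (F * F) = \sum_(k < n.+1) gB k F F / k`!%:R.
Proof. exact: plancherel. Qed.

(** Positivity is not among the axioms of [gaussian_algebra]; it follows from the Plancherel
    formula. *)
Lemma gE_sqr_ge0 F : 0 <= E (F ^+ 2).
Proof.
have [n hn] := degleP F; rewrite expr2 (gEsqr hn); apply: sumr_ge0 => k _.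
by rewrite divr_ge0 ?gB_ge0.
Qed.

Lemma gE_cauchy_schwarz F G : E (F * G) ^+ 2 <= E (F ^+ 2) * E (G ^+ 2).
Proof.
apply: discriminant_le; last exact: gE_sqr_ge0.
move=> t; have := gE_sqr_ge0 (F - t *: G); congr (0 <= _).
rewrite sqrrB -scalerAr exprZn gED gEB gEMn !gEZ; ring.
Qed.

Definition gam F G : A := \sum_i D i F * D i G.

Lemma gamC F G : gam F G = gam G F.
Proof. by apply: eq_bigr => i _; rewrite mulrC. Qed.
Lemma gamDr F G G' : gam F (G + G') = gam F G + gam F G'.
Proof. by rewrite -big_split; apply: eq_bigr => i _; rewrite gdD mulrDr. Qed.
Lemma gamZr F c G : gam F (c *: G) = c *: gam F G.
Proof. by rewrite scaler_sumr; apply: eq_bigr => i _; rewrite gdZ scalerAr. Qed.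
Lemma gamBr F G G' : gam F (G - G') = gam F G - gam F G'.
Proof. by rewrite gamDr -scaleN1r gamZr scaleN1r. Qed.
Lemma gamMr F G G' : gam F (G * G') = gam F G * G' + G * gam F G'.
Proof.
rewrite mulr_suml mulr_sumr -big_split/=; apply: eq_bigr => i _.
by rewrite gdM; ring.
Qed.

Lemma gd_gam i F G : D i (gam F G) = gam (D i F) G + gam F (D i G).
Proof.
rewrite gd_sum -big_split/=; apply: eq_bigr => j _.
by rewrite gdM (gdC i j F) (gdC i j G).
Qed.

Lemma degle_gam m n F G : degle m F -> degle n G -> degle (m + n) (gam F G).
Proof.
move=> hF hG; apply: degle_sum => i _; apply: (@degle_leq (m.-1 + n.-1)).
  by apply: degleM; exact: degle_gd.
by lia.
Qed.

(** Integration by parts for the number operator, which multiplies the chaos of order [k] by [k]. *)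
Lemma gE_gam n F G : degle n F ->
  E (gam F G) = \sum_(k < n.+1) k%:R * (gB k F G / k`!%:R).
Proof.
move=> hF; rewrite gE_sum big_ord_recl/= mul0r add0r.
have H i : E (D i F * D i G) = \sum_(k < n) gB k (D i F) (D i G) / k`!%:R.
  case: n hF => [|n] hF; first by rewrite degle0_gd// mul0r gE0 big_ord0.
  by rewrite (plancherel _ (degle_gd (n := n.+1) i hF)).
rewrite (eq_bigr _ (fun i _ => H i)) exchange_big/=; apply: eq_bigr => k _.
rewrite -mulr_suml -gBS /bump/= add1n factS natrM; field.
by rewrite nat1r !pnatr_eq0 -lt0n fact_gt0.
Qed.

(** * Finite chaos *)

Definition chaos p F := degle p F /\ forall s, (size s < p)%N -> coef s F = 0.

Lemma chaos_coef p F s : chaos p F -> size s != p -> coef s F = 0.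
Proof.
move=> [h1 h2]; rewrite neq_ltn => /orP[/h2//|/h1 e]; by rewrite /coef e gE0.
Qed.

Lemma chaos_gd p i F : chaos p F -> chaos p.-1 (D i F).
Proof.
move=> [h1 h2]; split; first exact: degle_gd.
by move=> s sp; rewrite -coef_cons h2//= -ltn_predRL.
Qed.

Lemma chaos0_gd i F : chaos 0 F -> D i F = 0.
Proof. by move=> [h _]; exact: degle0_gd. Qed.

Lemma chaos_gds p s F : chaos p F -> chaos (p - size s) (gds s F).
Proof.
elim: s p F => [|i s IH] p F hF /=; first by rewrite subn0.
rewrite -gds_gd; have := IH _ _ (chaos_gd i hF);
  congr (chaos _ _); lia.
Qed.

Lemma chaosD p F G : chaos p F -> chaos p G -> chaos p (F + G).
Proof.
move=> [h1 h2] [h3 h4]; split; first exact: degleD.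
by move=> s sp; rewrite coefD h2// h4// addr0.
Qed.

Lemma chaosZ p c F : chaos p F -> chaos p (c *: F).
Proof.
move=> [h1 h2]; split; first exact: degleZ.
by move=> s sp; rewrite coefZ h2// mulr0.
Qed.

Lemma chaos0 p : chaos p 0.
Proof. by split; [exact: degle0|move=> s _; rewrite coef0]. Qed.

Lemma chaos_sum p (I : Type) (r : seq I) (P : pred I) (f : I -> A) :
  (forall i, P i -> chaos p (f i)) -> chaos p (\sum_(i <- r | P i) f i).
Proof.
move=> h; apply: big_ind => //; [exact: chaos0|move=> *; exact: chaosD].
Qed.

Lemma gB_chaos p k F G : chaos p F -> k != p -> gB k F G = 0.
Proof.
move=> h kp; rewrite /gB (eq_sum_ix (g := fun=> 0)) ?big1// => s sk.
by rewrite (chaos_coef h) ?mul0r// sk.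
Qed.

Lemma chaos_gE p F G : chaos p F -> E (F * G) = gB p F G / p`!%:R.
Proof.
move=> h; rewrite (plancherel _ (proj1 h)) big_ord_recr/= big1 ?add0r// => k _.
by rewrite (gB_chaos _ h) ?mul0r// ltn_eqF.
Qed.

Lemma chaos_gE_gam p F G : chaos p F -> E (gam F G) = p%:R * E (F * G).
Proof.
move=> h; rewrite (gE_gam _ (proj1 h)) (chaos_gE _ h) big_ord_recr/=.
rewrite big1 ?add0r// => k _.
by rewrite (gB_chaos _ h) ?mul0r ?mulr0// ltn_eqF.
Qed.

Lemma chaos_orthogonal p m F G : chaos p F -> chaos m G -> p != m ->
  E (F * G) = 0.
Proof.
move=> hF hG pm; rewrite (chaos_gE _ hF) gBC (gB_chaos _ hG) ?mul0r//.
Qed.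

(** This is 2 <DF, DG> = L(FG) - F LG - G LF, where L multiplies the chaos of order [k] by [-k]. The
    expectation comes from [chaos_gE_gam] used on both sides, the higher orders from Leibniz. *)
Lemma coef_gam_chaos p m s F G : chaos p F -> chaos m G ->
  coef s (gam F G) *+ 2 = (p%:R + m%:R - (size s)%:R) * coef s (F * G).
Proof.
elim: s p m F G => [|i s IH] p m F G hF hG.
  rewrite /coef /= subr0 mulr2n [in X in _ + X]gamC (chaos_gE_gam _ hF).
  by rewrite (chaos_gE_gam _ hG) (mulrC G) mulrDl.
have H1 : coef s (gam (D i F) G) *+ 2 =
    (p%:R + m%:R - (size s).+1%:R) * coef s (D i F * G).
  case: p hF => [|p] hF.
    rewrite chaos0_gd// mul0r /gam big1 ?coef0 ?mulr0 ?mul0rn// => j _.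
    by rewrite gd0 mul0r.
  rewrite (IH p m _ _ (chaos_gd i hF) hG); congr (_ * _).
  by rewrite -!natr1; ring.
have H2 : coef s (gam F (D i G)) *+ 2 =
    (p%:R + m%:R - (size s).+1%:R) * coef s (F * D i G).
  case: m hG {H1} => [|m] hG.
    rewrite chaos0_gd// mulr0 /gam big1 ?coef0 ?mulr0 ?mul0rn// => j _.
    by rewrite gd0 mulr0.
  rewrite (IH p m _ _ hF (chaos_gd i hG)); congr (_ * _).
  by rewrite -!natr1; ring.
by rewrite !coef_cons gd_gam gdM !coefD mulrnDl H1 H2 mulrDr.
Qed.

(** With fewer than [p - m] derivatives, each Leibniz term pairs two chaoses of different orders,
    which are orthogonal. *)
Lemma coef_mul_chaos_lt p m s F G : chaos p F -> chaos m G ->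
  (size s + m < p)%N -> coef s (F * G) = 0.
Proof.
elim: s p m F G => [|i s IH] p m F G hF hG h.
  by rewrite /coef/= (chaos_orthogonal hF hG) ?gtn_eqF.
rewrite coef_cons gdM coefD (IH p.-1 m) ?(IH p m.-1) ?addr0//;
  [exact: chaos_gd|move: h => /=; lia|exact: chaos_gd|move: h => /=; lia].
Qed.

(** At the lowest possible order [p - m], a derivative falling on [G] leaves a term killed by
    [coef_mul_chaos_lt]; only the full contraction of [G] survives. *)
Lemma coef_mul_chaos_eq p m s F G : chaos p F -> chaos m G ->
  (size s + m = p)%N -> coef s (F * G) = E (gds s F * G).
Proof.
elim: s p m F G => [|i s IH] p m F G hF hG h //.
rewrite coef_cons gdM coefD (IH p.-1 m) ?gds_gd//; last 2 first.
  exact: chaos_gd.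
  by move: h => /=; lia.
case: m hG h => [|m] hG h; first by rewrite (chaos0_gd _ hG) mulr0 coef0 addr0.
rewrite (coef_mul_chaos_lt hF (chaos_gd i hG)) ?addr0//.
by move: h => /=; lia.
Qed.

End gaussian_calculus.

(** * Hypercontractivity for bounded degree *)

Section hypercontractivity.
Context {R : realType} (A : gaussian_algebra R).
Implicit Types (F G X : A) (s t u v : seq 'I_(gdim A)).

Local Notation J := 'I_(gdim A).
Local Notation E := (gE A).
Local Notation D := (@gd _ A).
Local Notation ix := (ix A).

Lemma gB_sqrD_le k F G :
  gB k (F + G) (F + G) <= 2 * gB k F F + 2 * gB k G G.
Proof.
rewrite /gB !mulr_sumr -big_split/=; apply: ler_sum => s _.
rewrite coefD; have := sqr_ge0 (coef s F - coef s G); nra.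
Qed.

(** Each of the [k] derivatives goes to [F] or to [G]; squaring the two-term Leibniz sum costs a
    factor 2 on each branch, 4 in all. The index [y] absorbs the derivatives already taken, and [i]
    is an inner summation needed for [gam]. *)
Lemma gB_sum_mul_le (Y I : Type) k (ry : seq Y) (ri : seq I)
    (F G : Y -> I -> A) (M : R) :
  (forall l m, (l + m = k)%N -> \sum_(y <- ry) \sum_(a <- ix l) \sum_(b <- ix m)
     (\sum_(i <- ri) E (gds a (F y i) * gds b (G y i))) ^+ 2 <= M) ->
  \sum_(y <- ry) gB k (\sum_(i <- ri) F y i * G y i)
                      (\sum_(i <- ri) F y i * G y i) <= 4 ^+ k * M.
Proof.
elim: k Y ry F G M => [|k IH] Y ry F G M H.
  rewrite expr0 mul1r; apply: le_trans (H 0%N 0%N erefl).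
  apply: ler_sum => y _; rewrite !sum_ix0 gB0 gE_sum expr2.
  by [].
pose r' := [seq (y, j) | y <- ry, j <- enum J].
have H1 : \sum_(z <- r') gB k (\sum_(i <- ri) D z.2 (F z.1 i) * G z.1 i)
    (\sum_(i <- ri) D z.2 (F z.1 i) * G z.1 i) <= 4 ^+ k * M.
  apply: (IH _ r' (fun z i => D z.2 (F z.1 i)) (fun z i => G z.1 i)) => l m lm.
  rewrite big_allpairs_dep/=.
  apply: le_trans (H l.+1 m _); last by rewrite addSn lm.
  apply: ler_sum => y _; rewrite sum_ixS big_enum/=.
  apply: ler_sum => j _; apply: ler_sum => a _; apply: ler_sum => b _.
  by under eq_bigr do rewrite gds_gd.
have H2 : \sum_(z <- r') gB k (\sum_(i <- ri) F z.1 i * D z.2 (G z.1 i))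
    (\sum_(i <- ri) F z.1 i * D z.2 (G z.1 i)) <= 4 ^+ k * M.
  apply: (IH _ r' (fun z i => F z.1 i) (fun z i => D z.2 (G z.1 i))) => l m lm.
  rewrite big_allpairs_dep/=.
  apply: le_trans (H l m.+1 _); last by rewrite addnS lm.
  apply: ler_sum => y _; rewrite big_enum/= exchange_big/=.
  apply: ler_sum => a _; rewrite sum_ixS.
  apply: ler_sum => j _; apply: ler_sum => b _.
  by under eq_bigr do rewrite gds_gd.
rewrite exprS.
suff : \sum_(y <- ry) gB k.+1 (\sum_(i <- ri) F y i * G y i)
    (\sum_(i <- ri) F y i * G y i) <=
  2 * \sum_(z <- r') gB k (\sum_(i <- ri) D z.2 (F z.1 i) * G z.1 i)
    (\sum_(i <- ri) D z.2 (F z.1 i) * G z.1 i) +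
  2 * \sum_(z <- r') gB k (\sum_(i <- ri) F z.1 i * D z.2 (G z.1 i))
    (\sum_(i <- ri) F z.1 i * D z.2 (G z.1 i)) by lra.
rewrite !big_allpairs_dep/= !mulr_sumr -big_split/=.
apply: ler_sum => y _; rewrite gBS !big_enum/= !mulr_sumr -big_split/=.
apply: ler_sum => j _.
rewrite gd_sum (eq_bigr _ (fun i _ => gdM j (F y i) (G y i))) big_split/=; exact: gB_sqrD_le.
Qed.

Definition gN l F : R := \sum_(s <- ix l) E (gds s F ^+ 2).

Lemma gN_ge0 l F : 0 <= gN l F.
Proof. by apply: sumr_ge0 => s _; exact: gE_sqr_ge0. Qed.

(** On degree at most [n] the number operator is bounded by [n]. *)
Lemma gE_gam_le n F : degle n F -> E (gam F F) <= n%:R * E (F ^+ 2).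
Proof.
move=> h; rewrite (gE_gam _ h) expr2 (gEsqr h) mulr_sumr.
apply: ler_sum => k _; apply: ler_wpM2r; first by rewrite divr_ge0 ?gB_ge0.
by rewrite ler_nat -ltnS.
Qed.

Lemma gN_le n l F : degle n F -> gN l F <= n%:R ^+ l * E (F ^+ 2).
Proof.
elim: l F => [|l IH] F h; first by rewrite /gN sum_ix0 mul1r.
rewrite /gN sum_ixS exprSr -mulrA.
apply: le_trans (ler_wpM2l _ (gE_gam_le h)); last exact: exprn_ge0.
rewrite gE_sum mulr_sumr; apply: ler_sum => i _.
rewrite -expr2; apply: le_trans (IH _ (degle_leq (degle_gd i h) (leq_pred n))).
rewrite le_eqVlt; apply/orP; left; apply/eqP.
by apply: eq_bigr => s _; rewrite gds_gd.
Qed.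

Lemma gE_contr_le m n l k F G : degle m F -> degle n G ->
  \sum_(a <- ix l) \sum_(b <- ix k) E (gds a F * gds b G) ^+ 2 <=
  (m + n)%:R ^+ (l + k) * (E (F ^+ 2) * E (G ^+ 2)).
Proof.
move=> hF hG.
apply: (@le_trans _ _ (gN l F * gN k G)).
  rewrite /gN mulr_suml; apply: ler_sum => a _; rewrite mulr_sumr.
  by apply: ler_sum => b _; exact: gE_cauchy_schwarz.
apply: (@le_trans _ _ ((m%:R ^+ l * E (F ^+ 2)) * (n%:R ^+ k * E (G ^+ 2)))).
  by apply: ler_pM; rewrite ?gN_ge0 ?gN_le.
rewrite mulrACA exprD; apply: ler_wpM2r.
  by rewrite mulr_ge0 ?gE_sqr_ge0.
by apply: ler_pM; rewrite ?exprn_ge0// lerXn2r ?nnegrE// ler_nat ?leq_addr ?leq_addl.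
Qed.

(** For each order [k], the factor [4 ^ k] comes from the Leibniz expansion and [(m + n) ^ k] from
    the derivatives of the two factors. *)
Definition hyperC m n : R := \sum_(k < (m + n).+1) 4 ^+ k * (m + n)%:R ^+ k.

Lemma hyperC_ge0 m n : 0 <= hyperC m n.
Proof. by apply: sumr_ge0 => k _; rewrite mulr_ge0 ?exprn_ge0. Qed.

Lemma fact_div_le (k : nat) (x : R) : 0 <= x -> x / k`!%:R <= x.
Proof.
move=> x0; rewrite ler_pdivrMr ?ltr0n ?fact_gt0//.
by rewrite ler_peMr// ler1n fact_gt0.
Qed.

(** A hypercontractive estimate drawn from Plancherel alone. The constant is crude but depends only
    on the degrees, and induction gives all moments. *)
Lemma gE_hyper m n F G : degle m F -> degle n G ->
  E ((F * G) ^+ 2) <= hyperC m n * (E (F ^+ 2) * E (G ^+ 2)).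
Proof.
move=> hF hG; rewrite expr2 (gEsqr (degleM hF hG)) mulr_suml.
apply: ler_sum => k _; apply: le_trans (fact_div_le _ (gB_ge0 _ _)) _.
rewrite -mulrA.
have := @gB_sum_mul_le unit unit k [:: tt] [:: tt] (fun _ _ => F) (fun _ _ => G)
  ((m + n)%:R ^+ k * (E (F ^+ 2) * E (G ^+ 2))).
move=> H; apply: (@le_trans _ _ _ _ _ _ (H _)); first by rewrite !big_seq1.
move=> l l' ll'.
rewrite big_seq1 -ll'; apply: le_trans (gE_contr_le l l' hF hG).
apply: ler_sum => a _; apply: ler_sum => b _; by rewrite big_seq1.
Qed.

Lemma gam_le m n F G : degle m F -> degle n G ->
  E (gam F G ^+ 2) <= hyperC m n * (m * n)%:R * (E (F ^+ 2) * E (G ^+ 2)).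
Proof.
move=> hF hG.
(* The square of [gam F G] pairs [D i F * D j G] with its transpose in (i, j); half the sum of
   squares bounds the product, which leaves |DF|^2 |DG|^2. *)
apply: (@le_trans _ _ (\sum_i \sum_j E ((D i F * D j G) ^+ 2))).
  have -> : E (gam F G ^+ 2) =
      \sum_i \sum_j E ((D i F * D j G) * (D j F * D i G)).
    rewrite expr2 {1}/gam mulr_suml gE_sum; apply: eq_bigr => i _.
    rewrite mulr_sumr gE_sum; apply: eq_bigr => j _; congr (E _); ring.
  have -> : \sum_i \sum_j E ((D i F * D j G) ^+ 2) =
      \sum_i \sum_j (E ((D i F * D j G) ^+ 2) + E ((D j F * D i G) ^+ 2)) / 2.
    under [RHS]eq_bigr do rewrite -mulr_suml big_split/=.
    rewrite -mulr_suml big_split/= [X in _ = (_ + X) / 2]exchange_big/=; lra.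
  apply: ler_sum => i _; apply: ler_sum => j _.
  have := gE_sqr_ge0 (D i F * D j G - D j F * D i G).
  rewrite sqrrB gED gEB gEMn; lra.
apply: (@le_trans _ _ (\sum_i \sum_j hyperC m n *
    (E (D i F ^+ 2) * E (D j G ^+ 2)))).
  apply: ler_sum => i _; apply: ler_sum => j _; apply: gE_hyper.
    exact: degle_leq (degle_gd i hF) (leq_pred _).
  exact: degle_leq (degle_gd j hG) (leq_pred _).
have -> : \sum_i \sum_j hyperC m n * (E (D i F ^+ 2) * E (D j G ^+ 2)) =
    hyperC m n * (E (gam F F) * E (gam G G)).
  rewrite !gE_sum [X in _ = _ * X]mulr_suml [RHS]mulr_sumr.
  apply: eq_bigr => i _; rewrite -mulr_sumr; congr (_ * _); rewrite -mulr_sumr.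
  by congr (_ * _).
rewrite -mulrA; apply: ler_wpM2l; first exact: hyperC_ge0.
rewrite natrM mulrACA; apply: ler_pM; rewrite ?gE_gam_le// gE_sum;
  by apply: sumr_ge0 => i _; rewrite -expr2 gE_sqr_ge0.
Qed.

Fixpoint momC n k : R := if k is k'.+1 then hyperC n (n * k') * momC n k' else 1.

Lemma momC_ge0 n k : 0 <= momC n k.
Proof. by elim: k => //= k IH; rewrite mulr_ge0 ?hyperC_ge0. Qed.

Lemma degleX n k F : degle n F -> degle (n * k) (F ^+ k).
Proof.
move=> h; elim: k => [|k IH].
  by rewrite muln0 expr0 -(scale1r 1); exact: deglec.
by rewrite exprS mulnS; exact: degleM.
Qed.

Lemma gE_moment_le n k F : degle n F ->
  E ((F ^+ k) ^+ 2) <= momC n k * E (F ^+ 2) ^+ k.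
Proof.
move=> h; elim: k => [|k IH]; first by rewrite !expr0 expr1n gE1 mulr1.
rewrite [F ^+ k.+1]exprS; apply: le_trans (gE_hyper h (degleX (k := k) h)) _.
have -> : momC n k.+1 * E (F ^+ 2) ^+ k.+1 =
    hyperC n (n * k) * (E (F ^+ 2) * (momC n k * E (F ^+ 2) ^+ k)).
  by rewrite /= exprS; ring.
apply: ler_wpM2l; first exact: hyperC_ge0.
by apply: ler_wpM2l; first exact: gE_sqr_ge0.
Qed.

End hypercontractivity.

(** * The fourth cumulant *)

Section fourth_moment.
Context {R : realType} (A : gaussian_algebra R).
Implicit Types (F G X : A) (s t u v : seq 'I_(gdim A)).

Local Notation J := 'I_(gdim A).
Local Notation E := (gE A).
Local Notation D := (@gd _ A).
Local Notation ix := (ix A).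

Definition kappa4 X : R := E ((X ^+ 2) ^+ 2) - 3 * E (X ^+ 2) ^+ 2.

(* The squared norm of the part of X^2 in the chaoses of order 1, ..., 2p-1. *)
Definition midsq p X : R :=
  \sum_(k < p.*2.+1 | (0 < k < p.*2)%N) gB k (X ^+ 2) (X ^+ 2) / k`!%:R.

Lemma midsq_ge0 p X : 0 <= midsq p X.
Proof. by apply: sumr_ge0 => k _; rewrite divr_ge0 ?gB_ge0. Qed.

Lemma degle_sqr p X : degle p X -> degle p.*2 (X ^+ 2).
Proof. by move=> h; rewrite -muln2; exact: degleX. Qed.

Lemma degle_gam_chaos p X : degle p X -> degle p.*2 (gam X X).
Proof. by move=> h; rewrite -addnn; exact: degle_gam. Qed.

Lemma coef_gam_sqr p s X : chaos p X ->
  coef s (gam X X) = (p%:R - (size s)%:R / 2) * coef s (X ^+ 2).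
Proof.
move=> h; have := coef_gam_chaos s h h; rewrite mulr2n -expr2.
move=> H; have -> : coef s (gam X X) = (coef s (gam X X) + coef s (gam X X)) / 2.
  by lra.
by rewrite H; field.
Qed.

Lemma gB_gam_sqr p k X F : chaos p X ->
  gB k (gam X X) F = (p%:R - k%:R / 2) * gB k (X ^+ 2) F.
Proof.
move=> h; rewrite /gB mulr_sumr; apply: eq_sum_ix => s sk.
by rewrite (coef_gam_sqr _ h) sk mulrA.
Qed.

Lemma gB00 X : gB 0 X X = E X ^+ 2.
Proof. by rewrite gB0 expr2. Qed.

Lemma sum_mid n (f : nat -> R) :
  \sum_(k < n.+1) f k = f 0%N + \sum_(k < n.+1 | (0 < k < n)%N) f k +
  (if (0 < n)%N then f n else 0).
Proof.
case: n => [|n] /=.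
  by rewrite big_ord_recl big_ord0 [X in _ + X + _]big1 ?addr0// => -[[|k]].
rewrite big_ord_recl big_ord_recr/= addrA; congr (_ + _ + _).
rewrite [RHS]big_mkcond big_ord_recl/= add0r [RHS]big_ord_recr/=.
rewrite /bump/= add1n ltnn addr0; apply: eq_bigr => k _.
by rewrite add1n ltnS ltn_ord.
Qed.

(** Integration by parts gives p E[X^4] = 3 E[X^2 gam X X], and [gam X X] has the components of
    [X^2] weighted by [p - k / 2]. The order 0 is the term subtracted in [kappa4], and the order 2p
    has weight zero. *)
Lemma kappa4E p X : chaos p X ->
  p%:R * 2 * kappa4 X = 3 * \sum_(k < p.*2.+1 | (0 < k < p.*2)%N)
    (p.*2%:R - k%:R) * (gB k (X ^+ 2) (X ^+ 2) / k`!%:R).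
Proof.
move=> h; have h2 := degle_sqr (proj1 h).
have H4 : p%:R * 2 * E ((X ^+ 2) ^+ 2) =
    3 * \sum_(k < p.*2.+1) (p.*2%:R - k%:R) * (gB k (X ^+ 2) (X ^+ 2) / k`!%:R).
  have -> : p%:R * 2 * E ((X ^+ 2) ^+ 2) = 2 * (p%:R * E (X * (X * (X * X)))).
    have -> : (X ^+ 2) ^+ 2 = X * (X * (X * X)) by ring.
    ring.
  rewrite -(chaos_gE_gam _ h) !gamMr.
  have -> : gam X X * (X * X) + X * (gam X X * X + X * gam X X) =
     (X ^+ 2 * gam X X) *+ 3 by ring.
  rewrite gEMn (plancherel _ h2) mulr_sumr -sumrMnl !mulr_sumr.
  apply: eq_bigr => k _; rewrite gBC (gB_gam_sqr _ _ h).
  have -> : (p.*2%:R : R) = p%:R * 2 by rewrite -muln2 natrM.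
  rewrite -mulr_natl; field.
  by rewrite pnatr_eq0 -lt0n fact_gt0.
rewrite /kappa4 mulrBr H4.
rewrite (sum_mid _ (fun k => (p.*2%:R - k%:R) * (gB k (X ^+ 2) (X ^+ 2) / k`!%:R)))/=.
rewrite subrr mul0r.
rewrite fact0 divr1 gB00 subr0 if_same addr0 -muln2 natrM; ring.
Qed.

Lemma midsq_le p X : chaos p X -> 3 * midsq p X <= p%:R * 2 * kappa4 X.
Proof.
move=> h; rewrite (kappa4E h) ler_wpM2l// /midsq; apply: ler_sum => k /andP[k0 kp].
rewrite ler_peMl ?divr_ge0 ?gB_ge0//.
by rewrite lerBrDr nat1r ler_nat.
Qed.

Lemma kappa4_ge0 p X : (0 < p)%N -> chaos p X -> 0 <= kappa4 X.
Proof.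
move=> p0 h; have := midsq_le h; have := midsq_ge0 p X.
have : (0 : R) < p%:R by rewrite ltr0n.
by nra.
Qed.

(** Centering removes the order 0, the weight [p - k / 2] removes the order 2p, and the orders
    between are bounded by [midsq], hence by the fourth cumulant. *)
Lemma gam_concentration p X : chaos p X ->
  E ((gam X X - (p%:R * E (X ^+ 2))%:A) ^+ 2) <= p%:R ^+ 3 * kappa4 X.
Proof.
move=> h; set c := p%:R * _; have hd := degle_gam_chaos (proj1 h).
have hd' : degle p.*2 (gam X X - c%:A).
  by apply: degleD => //; rewrite -scaleNr; apply: (@degle_leq _ _ 0) => //; exact: deglec.
rewrite expr2 (gEsqr hd').
rewrite (sum_mid _ (fun k => gB k (gam X X - c%:A) (gam X X - c%:A) / k`!%:R))/=.
have -> : gB 0 (gam X X - c%:A) (gam X X - c%:A) / 0`!%:R = 0.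
  rewrite gB00 gEB gEc (chaos_gE_gam _ h) -expr2 /c subrr expr0n/= mul0r//.
have H k : (0 < k)%N -> gB k (gam X X - c%:A) (gam X X - c%:A) =
   (p%:R - k%:R / 2) ^+ 2 * gB k (X ^+ 2) (X ^+ 2).
  move=> k0; rewrite /gB mulr_sumr; apply: eq_sum_ix => s sk.
  rewrite coefB (coef_gam_sqr _ h) sk.
  have -> : coef s (c%:A : A) = 0 by rewrite /coef (deglec c) ?gE0// sk.
  by rewrite subr0; ring.
have -> : (if (0 < p.*2)%N then gB p.*2 (gam X X - c%:A) (gam X X - c%:A) /
    p.*2`!%:R else 0) = 0.
  case: ifP => // /H ->; rewrite -muln2 natrM mulfK// subrr expr0n/=.
  by rewrite !mul0r.
rewrite addr0 add0r.
apply: (@le_trans _ _ (p%:R ^+ 2 * midsq p X)).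
  rewrite /midsq mulr_sumr; apply: ler_sum => k /andP[k0 kp].
  rewrite H// -mulrA; apply: ler_wpM2r; first by rewrite divr_ge0 ?gB_ge0.
  have k0' : (0 : R) <= k%:R by rewrite ler0n.
  have : (k%:R : R) <= p%:R * 2 by rewrite -natrM ler_nat muln2 ltnW.
  nra.
have := midsq_le h; have := midsq_ge0 p X.
have : (0 : R) <= p%:R ^+ 2 by exact: exprn_ge0.
set m := midsq _ _; rewrite [p%:R ^+ 3]exprS.
by move: (p%:R ^+ 2) => q q0 m0 mk; nra.
Qed.

(** * Contractions *)

(** For [X] in the chaos of order [p] this is, up to a constant, the squared norm of the contraction
    of the kernel of [X] with itself along [p - j] indices. *)
Definition gK j X : R := \sum_(u <- ix j) \sum_(v <- ix j) E (gds u X * gds v X) ^+ 2.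

Definition gT j X : A := \sum_(u <- ix j) gds u X ^+ 2.

Definition cT p j k : R := \prod_(i < j) (p%:R - i%:R - k%:R / 2).

(** [gT j.+1] sums [gam] over the derivatives of order [j], which lie in the chaos of order [p - j];
    each step multiplies by the weight of [coef_gam_sqr] at that order. *)
Lemma coef_gT p j s X : chaos p X -> (j <= p)%N ->
  coef s (gT j X) = cT p j (size s) * coef s (X ^+ 2).
Proof.
move=> h; elim: j => [|j IH] jp.
  by rewrite /gT sum_ix0 /cT big_ord0 mul1r.
have -> : gT j.+1 X = \sum_(u <- ix j) gam (gds u X) (gds u X).
  by rewrite /gT sum_ixS exchange_big.
rewrite coef_sum /cT big_ord_recr/= mulrAC -IH ?(ltnW jp)// /gT coef_sum mulr_suml.
apply: eq_sum_ix => u uj; rewrite (coef_gam_sqr _ (chaos_gds u h)) uj.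
by rewrite natrB ?(ltnW jp)// mulrC.
Qed.

Lemma gE_mul_sqr p X G : chaos p X ->
  p%:R * E (X ^+ 2 * G ^+ 2) =
  E (gam X X * G ^+ 2) + (E (X * G * gam X G)) *+ 2.
Proof.
move=> h; have -> : X ^+ 2 * G ^+ 2 = X * (X * (G * G)) by ring.
rewrite -(chaos_gE_gam _ h) !gamMr -gEMn -gED; congr (E _); ring.
Qed.

(** All orders contribute nonnegatively, with weight [(p + m - k) / 2]; the order [p - m], where the
    weight is [m], is the one kept. *)
Lemma gE_mul_gam_ge p m X G : chaos p X -> chaos m G -> (m <= p)%N ->
  m%:R * (gB (p - m) (X * G) (X * G) / (p - m)`!%:R) <= E (X * G * gam X G).
Proof.
move=> hX hG mp; have hd := degleM (proj1 hX) (proj1 hG).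
have H k : gB k (X * G) (gam X G) =
    ((p%:R + m%:R - k%:R) / 2) * gB k (X * G) (X * G).
  rewrite /gB mulr_sumr; apply: eq_sum_ix => s sk.
  have := coef_gam_chaos s hX hG; rewrite sk mulr2n => H.
  have -> : coef s (gam X G) = (coef s (gam X G) + coef s (gam X G)) / 2 by lra.
  by rewrite H; field.
rewrite (plancherel _ hd).
have km : (p - m < (p + m).+1)%N by lia.
rewrite (bigD1 (Ordinal km))//= H natrB//.
have -> : (p%:R + m%:R - (p%:R - m%:R)) / 2 = m%:R :> R by field.
rewrite -mulrA lerDl; apply: sumr_ge0 => k _; rewrite H.
apply: divr_ge0 => //; apply: mulr_ge0; last exact: gB_ge0.
by rewrite divr_ge0// subr_ge0 -natrD ler_nat -ltnS ltn_ord.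
Qed.

(** The difference weights the orders of [X^2] by [k / 2] times [cT]. The first factor kills the
    order 0, and for [j > 0] the leading factor of [cT] kills the order 2p, so only middle orders
    remain. *)
Lemma gB_gT_le p j X : chaos p X -> (0 < j <= p)%N ->
  `|p%:R * E (X ^+ 2 * gT j X) - E (gam X X * gT j X)| <=
  p%:R ^+ j.+1 * midsq p X.
Proof.
move=> h /andP[j0 jp].
rewrite (plancherel _ (degle_sqr (proj1 h))).
rewrite (plancherel _ (degle_gam_chaos (proj1 h))) mulr_sumr -sumrB.
pose c k : R := k%:R / 2 * cT p j k.
rewrite (eq_bigr (fun k : 'I__ => c k * (gB k (X ^+ 2) (X ^+ 2) / k`!%:R))); last first.
  move=> k _; rewrite (gB_gam_sqr _ _ h).
  have -> : gB k (X ^+ 2) (gT j X) = cT p j k * gB k (X ^+ 2) (X ^+ 2).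
    rewrite /gB mulr_sumr; apply: eq_sum_ix => s sk.
    by rewrite (coef_gT _ h)// sk mulrCA.
  by rewrite /c; field; rewrite pnatr_eq0 -lt0n fact_gt0.
rewrite (sum_mid _ (fun k => c k * (gB k (X ^+ 2) (X ^+ 2) / k`!%:R))).
have -> : c 0%N = 0 by rewrite /c mul0r mul0r.
have -> : c p.*2 = 0.
  case: j j0 jp @c => // j _ _; rewrite /cT big_ord_recl/= subr0 -muln2 natrM.
  by rewrite mulfK// subrr mul0r mulr0.
rewrite !mul0r if_same addr0 add0r.
apply: le_trans (ler_norm_sum _ _ _) _; rewrite /midsq mulr_sumr.
apply: ler_sum => k /andP[k0 kp]; rewrite normrM.
rewrite [X in _ * X]ger0_norm ?divr_ge0 ?gB_ge0//.
apply: ler_wpM2r; first by rewrite divr_ge0 ?gB_ge0.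
have kp' : (k%:R : R) <= p%:R * 2 by rewrite -natrM ler_nat muln2 ltnW.
have k0' : (0 : R) <= k%:R by rewrite ler0n.
rewrite /c exprS normrM ger0_norm ?divr_ge0//; apply: ler_pM; rewrite ?divr_ge0//.
  lra.
rewrite /cT; elim: j jp {j0 c} => [|j IH] jp; first by rewrite big_ord0 normr1.
rewrite big_ord_recr/= normrM exprSr; apply: ler_pM => //; first exact: IH (ltnW jp).
have : (j%:R : R) <= p%:R by rewrite ler_nat ltnW.
have : (0 : R) <= j%:R by rewrite ler0n.
by rewrite ler_norml; lra.
Qed.

(** The numbers E[D_u X D_v X] are the coefficients of [X D_u X] at its lowest order [j].
    [gE_mul_gam_ge] dominates them by E[X D_u X <DX, DD_u X>], whose sum over [u] is, by parts, half
    the quantity of [gB_gT_le]. This leads from the fourth cumulant to contractions. *)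
Lemma gK_le p j X : chaos p X -> (0 < j < p)%N ->
  gK j X <= j`!%:R * p%:R ^+ j.+2 * kappa4 X.
Proof.
move=> h /andP[j0 jp].
have -> : gK j X = \sum_(u <- ix j) gB j (X * gds u X) (X * gds u X).
  rewrite /gK exchange_big/= /gB exchange_big/=.
  apply: eq_sum_ix => u uj; apply: eq_sum_ix => v vj.
  by rewrite !(coef_mul_chaos_eq h (chaos_gds u h)) ?uj ?vj ?subnKC ?(ltnW jp)// mulrC expr2.
have H : \sum_(u <- ix j) gB j (X * gds u X) (X * gds u X) <=
    j`!%:R * \sum_(u <- ix j) E (X * gds u X * gam X (gds u X)).
  rewrite mulr_sumr; apply: ler_sum_ix => u uj.
  have := gE_mul_gam_ge h (chaos_gds u h); rewrite uj subKn ?(ltnW jp)//.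
  move=> /(_ (leq_subr _ _)) H.
  have f0 : (0 : R) < j`!%:R by rewrite ltr0n fact_gt0.
  rewrite -ler_pdivrMl// mulrC; apply: le_trans H.
  rewrite ler_peMl ?divr_ge0 ?gB_ge0// ler1n; lia.
apply: le_trans H _; rewrite -mulrA; apply: ler_wpM2l => //.
have -> : \sum_(u <- ix j) E (X * gds u X * gam X (gds u X)) =
    (p%:R * E (X ^+ 2 * gT j X) - E (gam X X * gT j X)) / 2.
  rewrite /gT !mulr_sumr !gE_sum mulr_sumr -sumrB mulr_suml.
  by apply: eq_bigr => u _; rewrite (gE_mul_sqr _ h) mulr2n; lra.
have := le_trans (ler_norm _) (gB_gT_le h (_ : 0 < j <= p)%N).
rewrite j0 (ltnW jp) => /(_ isT).
have := midsq_le h; have := midsq_ge0 p X.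
have : (0 : R) <= p%:R ^+ j.+1 by exact: exprn_ge0.
rewrite [p%:R ^+ j.+2]exprS.
move: (p%:R ^+ j.+1) (midsq p X) => q m q0 m0 mk H; nra.
Qed.

End fourth_moment.

(** * The dominant part of [gam X G] *)

Section contraction.
Context {R : realType} (A : gaussian_algebra R).
Implicit Types (F G X : A) (s t u v : seq 'I_(gdim A)).

Local Notation J := 'I_(gdim A).
Local Notation E := (gE A).
Local Notation D := (@gd _ A).
Local Notation ix := (ix A).

(** The squared norm of a contraction of [f] with [g] is the inner product of the self-contractions
    of [f] and of [g] along the complementary indices. *)
Lemma sum_contraction (S1 S2 S3 : Type) (ra : seq S1) (rb : seq S2)
    (rw : seq S3) (f : S3 -> S1 -> R) (g : S3 -> S2 -> R) :
  \sum_(a <- ra) \sum_(b <- rb) (\sum_(w <- rw) f w a * g w b) ^+ 2 =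
  \sum_(w <- rw) \sum_(w' <- rw) (\sum_(a <- ra) f w a * f w' a) *
                                 (\sum_(b <- rb) g w b * g w' b).
Proof.
under eq_bigr do under eq_bigr do rewrite expr2 mulr_suml.
under eq_bigr do rewrite exchange_big/=.
rewrite exchange_big/=; apply: eq_bigr => w _.
under eq_bigr do under eq_bigr do rewrite mulr_sumr.
under eq_bigr do rewrite exchange_big/=.
rewrite exchange_big/=; apply: eq_bigr => w' _.
rewrite mulr_suml; apply: eq_bigr => a _; rewrite mulr_sumr.
by apply: eq_bigr => b _; ring.
Qed.

Lemma cauchy_schwarz_sum2 (S : Type) (r : seq S) (f g : S -> S -> R) :
  (\sum_(a <- r) \sum_(b <- r) f a b * g a b) ^+ 2 <=
  (\sum_(a <- r) \sum_(b <- r) f a b ^+ 2) *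
  (\sum_(a <- r) \sum_(b <- r) g a b ^+ 2).
Proof.
have := cauchy_schwarz_sum [seq (a, b) | a <- r, b <- r]
  (fun z => f z.1 z.2) (fun z => g z.1 z.2).
by rewrite !big_allpairs_dep.
Qed.

(** [m.+1 ^ p] in place of [m ^ r] gives a constant independent of [r <= p] and valid for
    [m = 0]. *)
Definition contrC p m : R := (p`! * m`! * m.+1 ^ p)%:R.

(** By [sum_contraction] and Cauchy-Schwarz, the contraction of [X] with any [G] is controlled by
    that of [X] with itself. Only the square root of [gK] appears, hence a bound linear in [eps]. *)
Lemma contraction_le p m r eps X G : chaos p X -> chaos m G ->
  (r <= p)%N -> (r <= m)%N -> 0 <= eps -> gK r X <= eps ^+ 2 ->
  \sum_(a <- ix (p - r)) \sum_(b <- ix (m - r)) E (gds a X * gds b G) ^+ 2 <=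
  contrC p m * eps * E (G ^+ 2).
Proof.
move=> hX hG rp rm e0 hK.
pose f (w a : seq J) := coef w (gds a X).
pose g (w b : seq J) := coef w (gds b G).
have r0 : (0 : R) < r`!%:R by rewrite ltr0n fact_gt0.
have G0 := gE_sqr_ge0 G.
apply: (@le_trans _ _ (\sum_(a <- ix (p - r)) \sum_(b <- ix (m - r))
    (\sum_(w <- ix r) f w a * g w b) ^+ 2)).
  apply: ler_sum_ix => a ap; apply: ler_sum => b _.
  have ca : chaos r (gds a X) by have := chaos_gds a hX; rewrite ap subKn.
  rewrite (chaos_gE _ ca) -/(gB _ _ _) expr_div_n ler_pdivrMr ?exprn_gt0//.
  by rewrite ler_peMr ?sqr_ge0// exprn_ege1// ler1n fact_gt0.
rewrite sum_contraction.
set S := \sum_(w <- _) _.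
have P w w' : size w = r -> \sum_(a <- ix (p - r)) f w a * f w' a =
    (p - r)`!%:R * E (gds w X * gds w' X).
  move=> wr; have cw : chaos (p - r) (gds w X) by rewrite -wr; exact: chaos_gds.
  rewrite (chaos_gE _ cw) mulrC divfK ?pnatr_eq0 -?lt0n ?fact_gt0//.
  by apply: eq_bigr => a _; rewrite /f /coef !(gds_gds a).
have Q w w' : size w = r -> \sum_(b <- ix (m - r)) g w b * g w' b =
    (m - r)`!%:R * E (gds w G * gds w' G).
  move=> wr; have cw : chaos (m - r) (gds w G) by rewrite -wr; exact: chaos_gds.
  rewrite (chaos_gE _ cw) mulrC divfK ?pnatr_eq0 -?lt0n ?fact_gt0//.
  by apply: eq_bigr => a _; rewrite /g /coef !(gds_gds a).
have SE : S = (p - r)`!%:R * (m - r)`!%:R * \sum_(w <- ix r) \sum_(w' <- ix r)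
    E (gds w X * gds w' X) * E (gds w G * gds w' G).
  rewrite /S mulr_sumr; apply: eq_sum_ix => w wr; rewrite mulr_sumr.
  by apply: eq_bigr => w' _; rewrite P// Q// mulrACA.
have S0 : 0 <= S.
  rewrite /S -sum_contraction; apply: sumr_ge0 => a _.
  by apply: sumr_ge0 => b _; exact: sqr_ge0.
have KG : \sum_(w <- ix r) \sum_(w' <- ix r) E (gds w G * gds w' G) ^+ 2 <=
    (m%:R ^+ r * E (G ^+ 2)) ^+ 2.
  apply: (@le_trans _ _ (gN r G ^+ 2)).
    rewrite [leRHS]expr2 {1}/gN mulr_suml; apply: ler_sum => w _.
    rewrite mulr_sumr; apply: ler_sum => w' _; exact: gE_cauchy_schwarz.
  by rewrite lerXn2r ?nnegrE ?gN_ge0 ?mulr_ge0 ?exprn_ge0// gN_le//; case: hG.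
have f0 k : (0 : R) <= k`!%:R by [].
rewrite -(ler_pXn2r (n := 2))// ?nnegrE ?mulr_ge0//; last first.
rewrite SE exprMn.
apply: (@le_trans _ _ (((p - r)`!%:R * (m - r)`!%:R) ^+ 2 *
   (eps ^+ 2 * (m%:R ^+ r * E (G ^+ 2)) ^+ 2))).
  apply: ler_wpM2l; first exact: sqr_ge0.
  apply: le_trans (cauchy_schwarz_sum2 _ _ _) _.
  apply: ler_pM => //; apply: sumr_ge0 => w _; apply: sumr_ge0 => w' _;
    exact: sqr_ge0.
rewrite -!exprMn lerXn2r ?nnegrE ?mulr_ge0 ?exprn_ge0//.
have -> : (p - r)`!%:R * (m - r)`!%:R * (eps * (m%:R ^+ r * E (G ^+ 2))) =
  ((p - r)`! * (m - r)`! * m ^ r)%:R * (eps * E (G ^+ 2)).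
  by rewrite !natrM natrX; ring.
rewrite -mulrA; apply: ler_wpM2r; first by rewrite mulr_ge0.
rewrite ler_nat; apply: leq_mul; first by apply: leq_mul; apply: leq_fact; lia.
apply: (@leq_trans (m.+1 ^ r)); first by case: r {rp rm hK f g r0 S P Q SE S0 KG} => // r; rewrite leq_exp2r.
by rewrite leq_pexp2l.
Qed.

(* The part of [gam X G] in the chaos of order [m - p], for [G] in the chaos of
   order [m]: the one that survives when the proper contractions of [X] with
   itself vanish. *)
Definition lower p X G : A := (p.-1`!%:R)^-1 *: \sum_(s <- ix p) coef s X *: gds s G.

Lemma chaos_lower p m X G : chaos m G -> chaos (m - p) (lower p X G).
Proof.
move=> h; apply: chaosZ; rewrite big_seq; apply: chaos_sum => s /size_ix sp.
by apply: chaosZ; rewrite -sp; exact: chaos_gds.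
Qed.

Lemma lower_eq0 p m X G : chaos m G -> (m < p)%N -> lower p X G = 0.
Proof.
move=> [h _] mp; rewrite /lower (eq_sum_ix (g := fun=> 0)) ?big1 ?scaler0// => s sp.
by rewrite h ?scaler0// sp.
Qed.

(** At order [m - p] the factor of [coef_gam_chaos] is [2 p], and the lowest coefficient of [G X] is
    the full contraction of [X]; [p / p!] is the normalization of [lower]. *)
Lemma coef_gam_lower p m s X G : (0 < p)%N -> chaos p X -> chaos m G ->
  (size s + p = m)%N -> coef s (gam X G) = coef s (lower p X G).
Proof.
move=> p0 hX hG sm.
have -> : coef s (gam X G) = p%:R * coef s (G * X).
  have := coef_gam_chaos s hX hG; rewrite -sm natrD mulr2n (mulrC X) => H.
  have -> : coef s (gam X G) = (coef s (gam X G) + coef s (gam X G)) / 2 by lra.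
  by rewrite H; field.
rewrite (coef_mul_chaos_eq hG hX)// mulrC (mulrC (gds _ _)) (chaos_gE _ hX).
rewrite /lower coefZ coef_sum /gB mulrC.
case: p p0 hX sm => // p _ hX sm; rewrite /= factS natrM.
rewrite [in RHS](eq_bigr (fun t => coef t X * coef t (gds s G))); last first.
  by move=> t _; rewrite coefZ {2 4}/coef gds_gds.
field.
by rewrite nat1r !pnatr_eq0 -lt0n fact_gt0.
Qed.

Definition lowerC p m : R :=
  \sum_(k < (p + m).+1) 4 ^+ k * (p%:R ^+ 2 * contrC p m).

Lemma lowerC_ge0 p m : 0 <= lowerC p m.
Proof. by apply: sumr_ge0 => k _; rewrite !mulr_ge0 ?exprn_ge0// /contrC. Qed.

(** The order [m - p] cancels with [lower]. In every other order the terms are contractions along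
    [r] indices with [0 < r < p]: [r = 0] carries the factor [p - l = 0], and [r = p] would be the
    order [m - p]. *)
Lemma gam_lower_le p m eps X G : (0 < p)%N -> chaos p X -> chaos m G ->
  0 <= eps -> (forall r, (0 < r < p)%N -> gK r X <= eps ^+ 2) ->
  E ((gam X G - lower p X G) ^+ 2) <= lowerC p m * eps * E (G ^+ 2).
Proof.
move=> p0 hX hG e0 hK; set H := _ - _; have G0 := gE_sqr_ge0 G.
have c0 : 0 <= contrC p m by rewrite /contrC.
have M0 : 0 <= p%:R ^+ 2 * contrC p m * eps * E (G ^+ 2).
  by rewrite !mulr_ge0 ?exprn_ge0.
have hd : degle (p + m) H.
  apply: degleD; first by apply: degle_gam; [case: hX|case: hG].
  rewrite -scaleN1r; apply: degleZ; apply: degle_leq (proj1 (chaos_lower p X hG)) _.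
  lia.
rewrite expr2 (gEsqr hd) /lowerC !mulr_suml; apply: ler_sum => k _.
apply: le_trans (fact_div_le _ (gB_ge0 _ _)) _.
have M0' : 0 <= p%:R ^+ 2 * (contrC p m * (eps * E (G ^+ 2))).
  by move: M0; rewrite -(mulrA _ eps) -(mulrA _ (contrC _ _)).
rewrite (_ : _ * eps * _ = 4 ^+ k * (p%:R ^+ 2 * (contrC p m * (eps * E (G ^+ 2)))));
  last by ring.
have [kmp|kmp] := eqVneq (k + p)%N m.
  rewrite /gB (eq_sum_ix (g := fun=> 0)) ?big1//.
    by rewrite mulr_ge0 ?exprn_ge0.
  by move=> s sk; rewrite coefB (coef_gam_lower p0 hX hG) ?sk// subrr mul0r.
have -> : gB k H H = gB k (gam X G) (gam X G).
  apply: eq_sum_ix => s sk; rewrite coefB.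
  suff -> : coef s (lower p X G) = 0 by rewrite subr0.
  have [mp|pm] := ltnP m p; first by rewrite (lower_eq0 _ hG mp) coef0.
  by rewrite (chaos_coef (chaos_lower p X hG))// sk; apply: contra_neq kmp => ->; rewrite subnK.
have := @gB_sum_mul_le _ A unit J k [:: tt] (index_enum _) (fun _ i => D i X)
  (fun _ i => D i G) (p%:R ^+ 2 * (contrC p m * (eps * E (G ^+ 2)))).
move=> H'; apply: (@le_trans _ _ _ _ _ _ (H' _)); first by rewrite !big_seq1.
move=> l l' ll'; rewrite big_seq1.
have Eab a b : size a = l -> size b = l' ->
    \sum_i E (gds a (D i X) * gds b (D i G)) =
    (p - l)%:R * E (gds a X * gds b G).
  move=> al bl'; rewrite -(chaos_gE_gam _ (_ : chaos (p - l) (gds a X))); last first.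
    by rewrite -al; exact: chaos_gds.
  by rewrite gE_sum; apply: eq_bigr => i _; rewrite !gds_gd.
pose r := (p - l)%N.
have [rr|rr] := eqVneq (m - l')%N r; last first.
  rewrite (eq_sum_ix (g := fun=> 0)) ?big1// => a al.
  rewrite (eq_sum_ix (g := fun=> 0)) ?big1// => b bl'.
  rewrite Eab// (chaos_orthogonal (chaos_gds a hX) (chaos_gds b hG)).
    by rewrite mulr0 expr0n.
  by rewrite al bl' eq_sym.
have [r0|r0] := posnP r.
  rewrite (eq_sum_ix (g := fun=> 0)) ?big1// => a al.
  rewrite (eq_sum_ix (g := fun=> 0)) ?big1// => b bl'.
  by rewrite Eab// -/r r0 mul0r expr0n.
have rp : (r < p)%N by rewrite /r in rr r0 *; move: kmp r0 rr ll'; move: (nat_of_ord k); lia.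
have El : l = (p - r)%N by rewrite /r; move: r0; rewrite /r; lia.
have El' : l' = (m - r)%N by move: r0; rewrite -rr; lia.
have rm : (r <= m)%N by rewrite -rr leq_subr.
apply: (@le_trans _ _ (p%:R ^+ 2 * \sum_(a <- ix (p - r)) \sum_(b <- ix (m - r))
    E (gds a X * gds b G) ^+ 2)).
  rewrite mulr_sumr -El -El'; apply: ler_sum_ix => a al.
  rewrite mulr_sumr; apply: ler_sum_ix => b bl; rewrite Eab// exprMn.
  apply: ler_wpM2r; first exact: sqr_ge0.
  by rewrite lerXn2r ?nnegrE// ler_nat leq_subr.
apply: ler_wpM2l; first exact: exprn_ge0.
have := contraction_le hX hG (ltnW rp) rm e0 (hK _ _); rewrite r0 rp => /(_ isT).
by rewrite -mulrA.
Qed.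

End contraction.

(** * Bombieri's inequality and moments of a chaos *)

Section bombieri.
Context {R : realType} (A : gaussian_algebra R).
Implicit Types (F G V : A) (s t u v : seq 'I_(gdim A)).

Local Notation J := 'I_(gdim A).
Local Notation E := (gE A).
Local Notation D := (@gd _ A).
Local Notation ix := (ix A).

Lemma degle0_gE F G : degle 0 F -> E (F * G) = E F * E G.
Proof. by move=> h; rewrite (plancherel _ h) big_ord1 gB0 divr1. Qed.

(* [gS k a b c e] collects the terms of the k-fold Leibniz expansion in which the two
   copies of [F] share [a] differentiations and the two copies of [G] share [e]. *)
Definition gS F G k a b c e : R :=
  \sum_(s <- ix a) \sum_(t <- ix b) \sum_(u <- ix c) \sum_(v <- ix e)
    gB k (gds s (gds t F) * gds u (gds v G)) (gds s (gds u F) * gds t (gds v G)).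

Lemma gSS F G k a b c e :
  gS F G k.+1 a b c e = gS F G k a.+1 b c e + gS F G k a b c e.+1 +
                        (gS F G k a b.+1 c e + gS F G k a b c.+1 e).
Proof.
have H s t u v :
  gB k.+1 (gds s (gds t F) * gds u (gds v G)) (gds s (gds u F) * gds t (gds v G)) =
  (\sum_j gB k (gds (j :: s) (gds t F) * gds u (gds v G))
               (gds (j :: s) (gds u F) * gds t (gds v G)) +
   \sum_j gB k (gds s (gds t F) * gds u (gds (j :: v) G))
               (gds s (gds u F) * gds t (gds (j :: v) G))) +
  (\sum_j gB k (gds s (gds (j :: t) F) * gds u (gds v G))
               (gds s (gds u F) * gds (j :: t) (gds v G)) +
   \sum_j gB k (gds s (gds t F) * gds (j :: u) (gds v G))
               (gds s (gds (j :: u) F) * gds t (gds v G))).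
  rewrite gBS -!big_split/=; apply: eq_bigr => j _.
  rewrite !gdM gBDl !gBDr !gds_gd; ring.
rewrite /gS.
under eq_bigr do under eq_bigr do under eq_bigr do under eq_bigr do rewrite H.
have split4 (f g : seq J -> seq J -> seq J -> seq J -> R) :
  \sum_(s <- ix a) \sum_(t <- ix b) \sum_(u <- ix c) \sum_(v <- ix e)
    (f s t u v + g s t u v) =
  \sum_(s <- ix a) \sum_(t <- ix b) \sum_(u <- ix c) \sum_(v <- ix e) f s t u v +
  \sum_(s <- ix a) \sum_(t <- ix b) \sum_(u <- ix c) \sum_(v <- ix e) g s t u v.
  rewrite -big_split; apply: eq_bigr => s _; rewrite -big_split; apply: eq_bigr => t _.
  by rewrite -big_split; apply: eq_bigr => u _; rewrite -big_split.
rewrite split4 !split4; congr (_ + _ + (_ + _)).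
- rewrite sum_ixS [RHS]exchange_big; apply: eq_bigr => s _ /=.
  rewrite [RHS]exchange_big; apply: eq_bigr => t _ /=.
  rewrite [RHS]exchange_big; apply: eq_bigr => u _ /=.
  by rewrite [RHS]exchange_big.
- apply: eq_bigr => s _; apply: eq_bigr => t _; apply: eq_bigr => u _.
  by rewrite sum_ixS [RHS]exchange_big.
- apply: eq_bigr => s _; rewrite sum_ixS [RHS]exchange_big; apply: eq_bigr => t _ /=.
  rewrite [RHS]exchange_big; apply: eq_bigr => u _ /=.
  by rewrite [RHS]exchange_big.
- apply: eq_bigr => s _; apply: eq_bigr => t _.
  rewrite sum_ixS [RHS]exchange_big; apply: eq_bigr => u _ /=.
  by rewrite [RHS]exchange_big.
Qed.

(** When all derivatives are spent every factor is constant, so a nonzero term has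
    [a + b = a + c = n]; then [t] and [u] play symmetric roles and the sum over them is a square. *)
Lemma gS0_ge0 n m F G a b c e : degle n F -> degle m G ->
  (a + b + c + e = n + m)%N -> 0 <= gS F G 0 a b c e.
Proof.
move=> hF hG sz.
have [abn|abn] := eqVneq (a + b)%N n; last first.
  rewrite /gS (eq_sum_ix (g := fun=> 0)) ?big1// => s sa.
  rewrite (eq_sum_ix (g := fun=> 0)) ?big1// => t tb.
  rewrite (eq_sum_ix (g := fun=> 0)) ?big1// => u uc.
  rewrite (eq_sum_ix (g := fun=> 0)) ?big1// => v ve.
  move: abn; rewrite neq_ltn => /orP[abn|nab]; rewrite -!gds_cat.
    rewrite (hG (u ++ v)) ?mulr0 ?gB0l// size_cat uc ve; lia.
  by rewrite (hF (s ++ t)) ?mul0r ?gB0l// size_cat sa tb.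
have [acn|acn] := eqVneq (a + c)%N n; last first.
  rewrite /gS (eq_sum_ix (g := fun=> 0)) ?big1// => s sa.
  rewrite (eq_sum_ix (g := fun=> 0)) ?big1// => t tb.
  rewrite (eq_sum_ix (g := fun=> 0)) ?big1// => u uc.
  rewrite (eq_sum_ix (g := fun=> 0)) ?big1// => v ve.
  move: acn; rewrite neq_ltn gBC => /orP[acn|nac]; rewrite -!gds_cat.
    rewrite (hG (t ++ v)) ?mulr0 ?gB0l// size_cat tb ve; lia.
  by rewrite (hF (s ++ u)) ?mul0r ?gB0l// size_cat sa uc.
have bc : b = c by lia.
subst c.
pose f s t := E (gds s (gds t F)); pose g t v := E (gds t (gds v G)).
rewrite (_ : gS F G 0 a b b e = \sum_(s <- ix a) \sum_(v <- ix e)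
    (\sum_(t <- ix b) f s t * g t v) ^+ 2).
  by apply: sumr_ge0 => s _; apply: sumr_ge0 => v _; exact: sqr_ge0.
rewrite /gS; apply: eq_sum_ix => s sa.
have -> : \sum_(v <- ix e) (\sum_(t <- ix b) f s t * g t v) ^+ 2 =
    \sum_(v <- ix e) \sum_(t <- ix b) \sum_(u <- ix b)
       (f s t * g u v) * (f s u * g t v).
  apply: eq_bigr => v _; rewrite expr2 mulr_suml; apply: eq_bigr => t _.
  by rewrite mulr_sumr; apply: eq_bigr => u _; ring.
rewrite [RHS]exchange_big/=; apply: eq_sum_ix => t tb.
rewrite [RHS]exchange_big/=; apply: eq_sum_ix => u ub.
apply: eq_sum_ix => v ve; rewrite gB0.
have d0 w : size w = b -> degle 0 (gds s (gds w F)).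
  move=> wb; rewrite -gds_cat; have := degle_gds (s := s ++ w) hF.
  by rewrite size_cat sa wb abn subnn.
by rewrite (degle0_gE _ (d0 t tb)) (degle0_gE _ (d0 u ub)) /f /g; ring.
Qed.

Lemma gS_ge0 n m F G k a b c e : degle n F -> degle m G ->
  (k + (a + b + c + e) = n + m)%N -> 0 <= gS F G k a b c e.
Proof.
move=> hF hG; elim: k a b c e => [|k IH] a b c e sz; first exact: gS0_ge0 hF hG _.
by rewrite gSS; do !apply: addr_ge0; apply: IH; lia.
Qed.

(** Only the terms where each derivative is shared by the two copies of one factor are kept. The
    binomial coefficient counts the orders in which derivatives of [F] and of [G] can come, through
    Pascal's rule. *)
Lemma gS_ge n m F G k a e : degle n F -> degle m G -> (a <= n)%N -> (e <= m)%N ->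
  (k + a + e = n + m)%N ->
  'C(k, n - a)%:R * (gB n F F * gB m G G) <= gS F G k a 0 0 e.
Proof.
move=> hF hG; elim: k a e => [|k IH] a e an em sz.
  have -> : a = n by lia. have -> : e = m by lia.
  rewrite subnn bin0 mul1r le_eqVlt; apply/orP; left; apply/eqP.
  rewrite /gS /gB mulr_suml; apply: eq_sum_ix => s sn.
  rewrite !sum_ix0 mulr_sumr; apply: eq_bigr => v _.
  have d0 : degle 0 (gds s F) by have := degle_gds (s := s) hF; rewrite sn subnn.
  by rewrite !sum_ix0 /coef /= !(degle0_gE _ d0) mulrACA.
have B0 : 0 <= gB n F F * gB m G G by rewrite mulr_ge0 ?gB_ge0.
have P1 : 0 <= gS F G k a.+1 0 0 e by apply: gS_ge0 hF hG _; lia.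
have P2 : 0 <= gS F G k a 0 0 e.+1 by apply: gS_ge0 hF hG _; lia.
have P3 : 0 <= gS F G k a 1 0 e by apply: gS_ge0 hF hG _; lia.
have P4 : 0 <= gS F G k a 0 1 e by apply: gS_ge0 hF hG _; lia.
have [an'|an'] := eqVneq a n.
  have := IH a e.+1 an _ _; rewrite an' subnn !bin0 gSS.
  have em' : (e < m)%N by lia.
  move=> /(_ em' _); rewrite -an' => IH'; have := IH' (ltac:(lia)).
  by move: P1 P2 P3 P4; rewrite -?an'; lra.
have an2 : (a < n)%N by rewrite ltn_neqAle an' an.
have I1 := IH a.+1 e an2 em (ltac:(lia)).
rewrite gSS -(subnSK an2) binS natrD mulrDl.
have [em'|em'] := eqVneq e m.
  rewrite bin_small; first by rewrite mul0r add0r; lra.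
  by lia.
have em2 : (e < m)%N by rewrite ltn_neqAle em' em.
have := IH a e.+1 an em2 (ltac:(lia)); rewrite -(subnSK an2); lra.
Qed.

Definition top k F : R := gB k F F / k`!%:R.

Lemma top_ge0 k F : 0 <= top k F.
Proof. by rewrite divr_ge0 ?gB_ge0. Qed.

(** Bombieri's inequality for the leading homogeneous parts: in the Leibniz expansion of
    [gB (n + m)] all groups [gS] are nonnegative, and ['C(n + m, n)] of them amount to the product
    on the left. *)
Lemma bombieri n m F G : degle n F -> degle m G ->
  top n F * top m G <= top (n + m) (F * G).
Proof.
move=> hF hG; have := @gS_ge n m F G (n + m) 0 0 hF hG isT isT.
rewrite !addn0 subn0 => /(_ erefl).
rewrite /gS !sum_ix0/= => H.
have f0 k : (0 : R) < k`!%:R by rewrite ltr0n fact_gt0.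
rewrite /top ler_pdivlMr//; apply: le_trans H.
have : ('C(n + m, n) * (n`! * m`!))%:R = (n + m)`!%:R :> R.
  by have := bin_fact (leq_addr m n); rewrite addKn => ->.
rewrite !natrM => <-; rewrite le_eqVlt; apply/orP; left; apply/eqP.
by field; rewrite !gt_eqF.
Qed.

Lemma gdX i k F : D i (F ^+ k.+1) = (F ^+ k * D i F) *+ k.+1.
Proof.
elim: k => [|k IH]; first by rewrite expr0 mul1r expr1.
by rewrite exprS gdM IH exprS; ring.
Qed.

Lemma gB_MnMn k l F : gB k (F *+ l) (F *+ l) = l%:R ^+ 2 * gB k F F.
Proof.
rewrite /gB mulr_sumr; apply: eq_bigr => s _.
by rewrite -scaler_nat coefZ; ring.
Qed.

(** Repeated use of [bombieri] alone would give no factorial. Differentiating once produces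
    [(k + 1) V^k D_i V], whose square is weighed against the order [n (k + 1)] of the power: a gain
    of [k + 1] at each step. *)
Lemma top_power n k V : (0 < n)%N -> degle n V ->
  k`!%:R * top n V ^+ k <= top (n * k) (V ^+ k).
Proof.
move=> n0 h; elim: k => [|k IH].
  by rewrite muln0 !expr0 mulr1 /top gB0 gE1 mulr1 fact0 divr1.
have -> : (n * k.+1 = (n * k + n.-1).+1)%N by rewrite mulnS; lia.
set l := (_ + _)%N.
have f0 j : (0 : R) < j`!%:R by rewrite ltr0n fact_gt0.
have -> : top l.+1 (V ^+ k.+1) =
    k.+1%:R ^+ 2 / l.+1%:R * \sum_i top l (V ^+ k * D i V).
  rewrite /top gBS mulr_sumr mulr_suml; apply: eq_bigr => i _.
  rewrite gdX gB_MnMn factS natrM; field.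
  by rewrite nat1r !pnatr_eq0 -lt0n fact_gt0.
have H : top (n * k) (V ^+ k) * (n%:R * top n V) <= \sum_i top l (V ^+ k * D i V).
  have -> : n%:R * top n V = \sum_i top n.-1 (D i V).
    rewrite /top -mulr_suml -gBS prednK// -[in n`!](prednK n0) factS prednK// natrM.
    by field; rewrite !pnatr_eq0 -!lt0n fact_gt0 n0.
  by rewrite mulr_sumr; apply: ler_sum => i _; apply: bombieri;
    [exact: degleX|exact: degle_gd].
apply: (@le_trans _ _ (k.+1%:R ^+ 2 / l.+1%:R * (k`!%:R * top n V ^+ k * (n%:R * top n V)))).
  have -> : (l.+1 = n * k.+1)%N by rewrite /l mulnS; lia.
  rewrite natrM factS natrM exprS le_eqVlt; apply/orP; left; apply/eqP.
  by field; rewrite nat1r !pnatr_eq0 /=; lia.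
apply: ler_wpM2l; first by rewrite divr_ge0 ?exprn_ge0.
apply: le_trans H; apply: ler_wpM2r => //; by rewrite mulr_ge0 ?top_ge0.
Qed.

Lemma top_le n k F : degle n F -> (k <= n)%N -> top k F <= E (F ^+ 2).
Proof.
move=> h kn; rewrite expr2 (gEsqr h).
have kn' : (k < n.+1)%N by [].
rewrite (bigD1 (Ordinal kn'))//= lerDl; apply: sumr_ge0 => i _; exact: top_ge0.
Qed.

(** The leading component alone provides the factorial; it is one of the two factorials in the
    growth of the moments of U. *)
Lemma chaos_power_ge n k V : (0 < n)%N -> chaos n V ->
  k`!%:R * E (V ^+ 2) ^+ k <= E ((V ^+ k) ^+ 2).
Proof.
move=> n0 h; rewrite {1}expr2 (chaos_gE _ h) -/(top n V).
apply: le_trans (top_power k n0 (proj1 h)) _.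
by apply: top_le (leqnn _); exact: degleX (proj1 h).
Qed.

End bombieri.

(** * Sequences bounded or vanishing in L^2 *)

Section null_sequences.
Context {R : realType} (A : nat -> gaussian_algebra R).
Implicit Types F G X Y : forall N, A N.

(** With the degree bounded, a bound in L^2 bounds every moment, by [gE_moment_le]. *)
Definition gbdd F := exists D M, forall N,
  degle D (F N) /\ gE (A N) (F N ^+ 2) <= M.

(** By hypercontractivity these sequences absorb products and [gam] with bounded ones ([gnullM],
    [gnull_gam]), so they can be discarded inside polynomial expressions. *)
Definition gnull F := exists2 D, (forall N, degle D (F N)) &
  gE (A N) (F N ^+ 2) @[N --> \oo] --> (0 : R).

Lemma cvg_seq_bounded (u : nat -> R) (l : R) :
  u N @[N --> \oo] --> l -> exists M, 0 <= M /\ forall N, `|u N| <= M.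
Proof.
move=> ul; have : cvgn u by apply/cvg_ex; exists l.
move=> /cvg_seq_bounded [M [Mr HM]].
have HM1 := HM (M + 1); exists (`|M| + 1); split; first exact: addr_ge0.
move=> N; apply: HM => //.
by rewrite (le_lt_trans (ler_norm M))// ltrDl.
Qed.

Lemma squeeze0 (u v : nat -> R) : (forall N, 0 <= u N <= v N) ->
  v N @[N --> \oo] --> (0 : R) -> u N @[N --> \oo] --> (0 : R).
Proof.
move=> uv v0; apply: (squeeze_cvgr (f := fun=> 0) (h := v)) => //.
  by near=> N.
exact: cvg_cst.
Unshelve. all: end_near. Qed.

Lemma cvg_ext (u v : nat -> R) (l : R) : (forall N, u N = v N) ->
  u N @[N --> \oo] --> l -> v N @[N --> \oo] --> l.
Proof. by move=> uv; have -> : u = v by apply: functional_extensionality_dep. Qed.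

Lemma cvg_sqrt0 (u : nat -> R) : u N @[N --> \oo] --> (0 : R) ->
  Num.sqrt (u N) @[N --> \oo] --> (0 : R).
Proof.
move=> h; rewrite -[X in _ --> X]sqrtr0.
by apply: (@continuous_cvg _ _ _ _ _ u Num.sqrt 0) => //; exact: sqrt_continuous.
Qed.

Lemma gnull_bdd F : gnull F -> gbdd F.
Proof.
move=> [D h c]; have [M [_ HM]] := cvg_seq_bounded c.
by exists D, M => N; split=> //; apply: le_trans (HM N); exact: ler_norm.
Qed.

Lemma gbdd_ge0 F : gbdd F -> exists D M, 0 <= M /\ forall N,
  degle D (F N) /\ gE (A N) (F N ^+ 2) <= M.
Proof.
move=> [D [M h]]; exists D, M; split=> //.
by apply: le_trans (proj2 (h 0%N)); exact: gE_sqr_ge0.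
Qed.

Lemma gE_sqrD_le N (F G : A N) :
  gE (A N) ((F + G) ^+ 2) <= 2 * gE (A N) (F ^+ 2) + 2 * gE (A N) (G ^+ 2).
Proof.
have := gE_sqr_ge0 (F - G); rewrite sqrrB sqrrD !gED [gE _ (- _)]raddfN/= !gEMn; lra.
Qed.

Lemma gbddD F G : gbdd F -> gbdd G -> gbdd (fun N => F N + G N).
Proof.
move=> [D [M h]] [D' [M' h']]; exists (maxn D D'), (2 * M + 2 * M') => N.
have [h1 h2] := h N; have [h3 h4] := h' N; split.
  by apply: degleD; [apply: degle_leq h1 _|apply: degle_leq h3 _]; lia.
by apply: le_trans (gE_sqrD_le _ _) _; lra.
Qed.

Lemma gnullD F G : gnull F -> gnull G -> gnull (fun N => F N + G N).
Proof.
move=> [D h1 h2] [D' h3 h4]; exists (maxn D D').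
  move=> N; apply: degleD; [apply: degle_leq (h1 N) _|apply: degle_leq (h3 N) _]; lia.
apply: (@squeeze0 _ (fun N => 2 * gE (A N) (F N ^+ 2) + 2 * gE (A N) (G N ^+ 2))).
  by move=> N; rewrite gE_sqr_ge0 gE_sqrD_le.
rewrite [X in _ --> X](_ : 0 = 2 * 0 + 2 * 0 :> R); last by ring.
by apply: cvgD; apply: cvgM => //; exact: cvg_cst.
Qed.

Lemma gbddM F G : gbdd F -> gbdd G -> gbdd (fun N => F N * G N).
Proof.
move=> [D [M h]] [D' [M' h']]; exists (D + D')%N, (hyperC D D' * (M * M')) => N.
have [h1 h2] := h N; have [h3 h4] := h' N; split; first exact: degleM.
apply: le_trans (gE_hyper h1 h3) _; apply: ler_wpM2l; first exact: hyperC_ge0.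
by apply: ler_pM => //; exact: gE_sqr_ge0.
Qed.

Lemma gbdd_cst (c : R) : gbdd (fun N => c%:A).
Proof.
exists 0%N, (c ^+ 2) => N; split; first exact: deglec.
by rewrite exprZn expr1n gEZ gE1 mulr1.
Qed.

Lemma gbddX F k : gbdd F -> gbdd (fun N => F N ^+ k).
Proof.
move=> h; elim: k => [|k IH].
  have [D [M H]] := gbdd_cst 1; exists D, M => N.
  by rewrite expr0 -(scale1r 1).
have [D [M H]] := gbddM h IH; exists D, M => N.
by rewrite exprS.
Qed.

Lemma gnull_bound (c : R) F G D : (forall N, degle D (F N)) ->
  (forall N, gE (A N) (F N ^+ 2) <= c * gE (A N) (G N ^+ 2)) -> gnull G -> gnull F.
Proof.
move=> hD h [D' _ hG]; exists D => //.
apply: (@squeeze0 _ (fun N => c * gE (A N) (G N ^+ 2))).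
  by move=> N; rewrite gE_sqr_ge0 h.
rewrite [X in _ --> X](_ : 0 = c * 0 :> R); last by ring.
by apply: cvgM => //; exact: cvg_cst.
Qed.

Lemma gnullM F G : gnull F -> gbdd G -> gnull (fun N => F N * G N).
Proof.
move=> hF /gbdd_ge0 [D' [M [M0 h]]]; have [D h1 h2] := hF.
apply: (@gnull_bound (hyperC D D' * M) _ _ (D + D')) hF => N.
  by apply: degleM => //; case: (h N).
have [h3 h4] := h N; apply: le_trans (gE_hyper (h1 N) h3) _.
rewrite -mulrA; apply: ler_wpM2l; first exact: hyperC_ge0.
by rewrite mulrC; apply: ler_wpM2r => //; exact: gE_sqr_ge0.
Qed.

Lemma gbdd_gam F G : gbdd F -> gbdd G -> gbdd (fun N => gam (F N) (G N)).
Proof.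
move=> [D [M h]] [D' [M' h']].
exists (D + D')%N, (hyperC D D' * (D * D')%:R * (M * M')) => N.
have [h1 h2] := h N; have [h3 h4] := h' N; split; first exact: degle_gam.
apply: le_trans (gam_le h1 h3) _; apply: ler_wpM2l.
  by rewrite mulr_ge0 ?hyperC_ge0.
by apply: ler_pM => //; exact: gE_sqr_ge0.
Qed.

Lemma gnull_gam F G : gbdd F -> gnull G -> gnull (fun N => gam (F N) (G N)).
Proof.
move=> /gbdd_ge0 [D [M [M0 h]]] hG; have [D' h1 h2] := hG.
apply: (@gnull_bound (hyperC D D' * (D * D')%:R * M) _ _ (D + D')) hG => N.
  by apply: degle_gam => //; case: (h N).
have [h3 h4] := h N; apply: le_trans (gam_le h3 (h1 N)) _.
rewrite -[leRHS]mulrA; apply: ler_wpM2l; first by rewrite mulr_ge0 ?hyperC_ge0.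
by apply: ler_wpM2r => //; exact: gE_sqr_ge0.
Qed.

Lemma gnull_gE F : gnull F -> gE (A N) (F N) @[N --> \oo] --> (0 : R).
Proof.
move=> [D hD h]; apply/norm_cvg0P.
have : Num.sqrt (gE (A N) (F N ^+ 2)) @[N --> \oo] --> (0 : R).
  exact: cvg_sqrt0 h.
apply: squeeze0 => N; rewrite normr_ge0/= -sqrtr_sqr ler_sqrt ?gE_sqr_ge0//.
by have := gE_cauchy_schwarz (F N) 1; rewrite mulr1 expr1n gE1 mulr1.
Qed.

Lemma gnull_ext F G : (forall N, F N = G N) -> gnull F -> gnull G.
Proof. by move=> FG; have -> : F = G by apply: functional_extensionality_dep. Qed.

Lemma gnullZ c F : gnull F -> gnull (fun N => c *: F N).
Proof.
move=> h; apply: gnull_ext (gnullM h (gbdd_cst c)) => N.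
by rewrite mulrC mulr_algl.
Qed.

Lemma gnullX F G k : gbdd F -> gbdd G -> gnull (fun N => F N - G N) ->
  gnull (fun N => F N ^+ k - G N ^+ k).
Proof.
move=> hF hG h; elim: k => [|k IH].
  exists 0%N => [N|]; first by rewrite subrr; exact: degle0.
  apply: (@squeeze0 _ (fun=> 0)); last exact: cvg_cst.
  by move=> N; rewrite subrr expr0n gE0 lexx.
apply: gnull_ext (gnullD (gnullM h (gbddX k hF)) (gnullM IH hG)) => N.
rewrite !exprS; ring.
Qed.

Lemma gE_cvg_sub F G (l : R) : gnull (fun N => F N - G N) ->
  gE (A N) (F N) @[N --> \oo] --> l -> gE (A N) (G N) @[N --> \oo] --> l.
Proof.
move=> /gnull_gE h hF;
apply: (@cvg_ext (fun N => gE (A N) (F N) - gE (A N) (F N - G N))).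
  by move=> N; rewrite gEB; ring.
by rewrite -[l]subr0; exact: cvgB.
Qed.

End null_sequences.

(** * Asymptotics of the iterated derivatives *)

Section asymptotics.
Context {R : realType} (A : nat -> gaussian_algebra R).
Variables (X : forall N, A N) (p : nat) (s2 : R).
Hypotheses (p_gt0 : (0 < p)%N) (hX : forall N, chaos p (X N)).
Hypothesis X2 : gE (A N) (X N ^+ 2) @[N --> \oo] --> s2.
Hypothesis X4 : gE (A N) ((X N ^+ 2) ^+ 2) @[N --> \oo] --> 3 * s2 ^+ 2.

Lemma kappa4_cvg : kappa4 (X N) @[N --> \oo] --> (0 : R).
Proof.
rewrite [X in _ --> X](_ : 0 = 3 * s2 ^+ 2 - 3 * (s2 ^+ 2)); last by ring.
by apply: cvgB => //; apply: cvgM; [exact: cvg_cst|rewrite !expr2; exact: cvgM].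
Qed.

Lemma gbddX0 : gbdd X.
Proof.
have [M [_ HM]] := cvg_seq_bounded X2; exists p, M => N; split; first by case: (hX N).
by apply: le_trans (HM N); exact: ler_norm.
Qed.

Lemma gam_XX_null : gnull (fun N => gam (X N) (X N) - (p%:R * s2)%:A).
Proof.
have h1 : gnull (fun N => gam (X N) (X N) - (p%:R * gE (A N) (X N ^+ 2))%:A).
  exists (p + p)%N => [N|].
    apply: degleD; first by apply: degle_gam; case: (hX N).
    by rewrite -scaleNr; apply: (@degle_leq _ _ 0) => //; exact: deglec.
  apply: (@squeeze0 _ _ (fun N => p%:R ^+ 3 * kappa4 (X N))).
    by move=> N; rewrite gE_sqr_ge0 gam_concentration.
  rewrite [X in _ --> X](_ : 0 = p%:R ^+ 3 * 0 :> R); last by ring.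
  by apply: cvgM; [exact: cvg_cst|exact: kappa4_cvg].
have h2 : gnull (fun N => (p%:R * gE (A N) (X N ^+ 2) - p%:R * s2)%:A : A N).
  exists 0%N => [N|]; first exact: deglec.
  rewrite [X in _ --> X](_ : 0 = (p%:R * s2 - p%:R * s2) * (p%:R * s2 - p%:R * s2) :> R);
    last by ring.
  have H : p%:R * gE (A N) (X N ^+ 2) - p%:R * s2 @[N --> \oo] -->
      p%:R * s2 - p%:R * s2.
    apply: cvgB; last exact: cvg_cst.
    by apply: cvgM => //; exact: cvg_cst.
  apply: cvg_ext (cvgM H H) => N; by rewrite exprZn expr1n gEZ gE1 mulr1 expr2.
apply: gnull_ext (gnullD h1 h2) => N.
by rewrite scalerBl addrA subrK.
Qed.

(** Every proper contraction is bounded by a multiple of [kappa4]; the sum [C] of the constants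
    gives a single [eps N], tending to 0, for [gam_lower_le]. *)
Lemma gam_lower_null m (G : forall N, A N) : (forall N, chaos m (G N)) -> gbdd G ->
  gnull (fun N => gam (X N) (G N) - lower p (X N) (G N)).
Proof.
move=> hG /gbdd_ge0 [D [M [M0 hM]]].
pose C : R := \sum_(r < p) (r`!%:R * p%:R ^+ r.+2).
pose eps N := Num.sqrt (C * kappa4 (X N)).
have C0 : 0 <= C by apply: sumr_ge0 => r _; rewrite mulr_ge0 ?exprn_ge0.
have k0 N : 0 <= kappa4 (X N) by exact: kappa4_ge0 (hX N).
exists (p + m)%N => [N|].
  apply: degleD; first by apply: degle_gam; [case: (hX N)|case: (hG N)].
  rewrite -scaleN1r; apply: degleZ; apply: degle_leq (proj1 (chaos_lower p (X N) (hG N))) _.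
  lia.
apply: (@squeeze0 _ _ (fun N => lowerC p m * M * eps N)).
  move=> N; rewrite gE_sqr_ge0/=.
  have := @gam_lower_le _ (A N) p m (eps N) (X N) (G N) p_gt0 (hX N) (hG N) (sqrtr_ge0 _) _.
  move=> H; apply: le_trans (H _) _; last first.
    rewrite mulrAC; apply: ler_wpM2r; first exact: sqrtr_ge0.
    by apply: ler_wpM2l; [exact: lowerC_ge0|case: (hM N)].
  move=> r /andP[r0 rp]; rewrite sqr_sqrtr ?mulr_ge0//.
  apply: le_trans (gK_le (hX N) _) _; first by rewrite r0 rp.
  apply: ler_wpM2r => //; rewrite /C (bigD1 (Ordinal rp))//= lerDl.
  by apply: sumr_ge0 => i _; rewrite mulr_ge0 ?exprn_ge0.
rewrite [X in _ --> X](_ : 0 = lowerC p m * M * 0); last by ring.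
apply: cvgM; first exact: cvg_cst.
apply: cvg_sqrt0.
have H : C * kappa4 (X N) @[N --> \oo] --> (0 : R).
  rewrite [X in _ --> X](_ : 0 = C * 0); last by ring.
  by apply: cvgM; [exact: cvg_cst|exact: kappa4_cvg].
exact: H.
Qed.

Variables (Y : forall N, A N) (q : nat).
Hypotheses (hY : forall N, chaos q (Y N)) (bY : gbdd Y).

Definition gY r N : A N := iter r (gam (X N)) (Y N).

Definition gYo r N : A N := iter r (lower p (X N)) (Y N).

Lemma chaos_gYo r N : chaos (q - r * p) (gYo r N).
Proof.
elim: r => [|r IH]; first by rewrite subn0.
by have := chaos_lower p (X N) IH; rewrite -subnDA mulSn addnC.
Qed.

Lemma gbdd_gY r : gbdd (gY r).
Proof. by elim: r => [|r IH]; [exact: bY|exact: gbdd_gam gbddX0 IH]. Qed.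

(** Iterates of [lower] stay exactly in a chaos, those of [gam] do not; the error made at each step
    passes through the following ones by [gnull_gam]. *)
Lemma gY_concentrated r : gbdd (gYo r) /\ gnull (fun N => gY r N - gYo r N).
Proof.
elim: r => [|r [IH1 IH2]].
  split; first exact: bY.
  exists 0%N => [N|]; first by rewrite subrr; exact: degle0.
  apply: (@squeeze0 _ _ (fun=> 0)); last exact: cvg_cst.
  by move=> N; rewrite subrr expr0n gE0 lexx.
have H := gam_lower_null (chaos_gYo r) IH1.
have H' : gnull (fun N => gY r.+1 N - gYo r.+1 N).
  apply: gnull_ext (gnullD (gnull_gam gbddX0 IH2) H) => N.
  by rewrite gamBr addrA subrK.
split=> //; have := gbddD (gbdd_gY r.+1) (gnull_bdd (gnullZ (-1) H')).
move=> [D [M h]]; exists D, M => N; have := h N.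
by rewrite scaleN1r opprB addrC subrK.
Qed.

(** The chaos of order [q - (a - 1) p < p] is too low for a full contraction with [X], so [lower]
    kills it. *)
Lemma gY_vanish a : (q < a * p)%N -> (a * p <= q + p)%N -> gnull (gY a).
Proof.
case: a => [//|a] qa qa'; have [_] := gY_concentrated a.+1.
apply: gnull_ext => N.
by rewrite /gYo iterS (lower_eq0 _ (chaos_gYo a N)) ?subr0//; move: qa; rewrite mulSn; lia.
Qed.

(** [chaos_power_ge] holds for [gYo r], whose order [q - r p] is positive; the moments of [gY r]
    have the same limits. *)
Lemma gY_power_ge r m (l1 l2 : R) : (r * p < q)%N ->
  gE (A N) (gY r N ^+ 2) @[N --> \oo] --> l1 ->
  gE (A N) ((gY r N ^+ m) ^+ 2) @[N --> \oo] --> l2 ->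
  m`!%:R * l1 ^+ m <= l2.
Proof.
move=> rpq h1 h2; have [b n] := gY_concentrated r.
have b' := gbdd_gY r.
have h1' : gE (A N) (gYo r N ^+ 2) @[N --> \oo] --> l1.
  exact: gE_cvg_sub (gnullX 2 b' b n) h1.
have h2' : gE (A N) ((gYo r N ^+ m) ^+ 2) @[N --> \oo] --> l2.
  apply: gE_cvg_sub h2.
  exact: gnullX 2 (gbddX m b') (gbddX m b) (gnullX m b' b n).
have h3 : m`!%:R * gE (A N) (gYo r N ^+ 2) ^+ m @[N --> \oo] --> m`!%:R * l1 ^+ m.
  apply: cvgM; first exact: cvg_cst.
  exact: (continuous_cvg _ (@exprn_continuous _ m l1) h1').
apply: (ler_cvg_to h3 h2'); near=> N.
apply: chaos_power_ge (chaos_gYo r N); lia.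
Unshelve. all: end_near. Qed.

(** In p E[X F] = E[gam X F], [gam X X] is replaced by [p s2], [gam X] sends [gY r] to [gY r.+1]
    exactly, and [gY r.+2] is negligible. Predecessors taken at 0 are multiplied by 0. *)
Lemma gE_Xmul_cvg m i j r (l1 l2 : R) : gnull (gY r.+2) ->
  gE (A N) (X N ^+ m.-1 * gY r.+1 N ^+ i * gY r N ^+ j) @[N --> \oo] --> l1 ->
  gE (A N) (X N ^+ m * gY r.+1 N ^+ i.+1 * gY r N ^+ j.-1) @[N --> \oo] --> l2 ->
  gE (A N) (X N ^+ m.+1 * gY r.+1 N ^+ i * gY r N ^+ j) @[N --> \oo] -->
    m%:R * s2 * l1 + j%:R / p%:R * l2.
Proof.
move=> n2 h1 h2.
pose G1 N := X N ^+ m.-1 * gY r.+1 N ^+ i * gY r N ^+ j.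
pose G2 N := X N ^+ m * gY r.+1 N ^+ i.+1 * gY r N ^+ j.-1.
pose G3 N := X N ^+ m * gY r.+1 N ^+ i.-1 * gY r N ^+ j.
have bX := gbddX0; have b0 := gbdd_gY r; have b1 := gbdd_gY r.+1.
have gamX k N (F : A N) : gam (X N) (F ^+ k) = k%:R * (F ^+ k.-1 * gam (X N) F).
  rewrite mulr_natl.
  elim: k => [|k IH].
    by rewrite expr0 mulr0n /gam big1// => l _; rewrite gd1 mulr0.
  rewrite exprS gamMr IH; case: k IH => [|k] IH.
    by rewrite /= mulr0n mulr0 addr0 expr0 mulrC.
  by rewrite /= exprS; ring.
have E1 N : p%:R * gE (A N) (X N ^+ m.+1 * gY r.+1 N ^+ i * gY r N ^+ j) =
    m%:R * gE (A N) ((gam (X N) (X N) - (p%:R * s2)%:A) * G1 N) +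
    m%:R * (p%:R * s2) * gE (A N) (G1 N) + j%:R * gE (A N) (G2 N) +
    i%:R * gE (A N) (gY r.+2 N * G3 N).
  have nE k (F : A N) : gE (A N) (k%:R * F) = k%:R * gE (A N) F.
    by rewrite mulr_natl gEMn mulr_natl.
  rewrite -(mulrA m%:R) -[(p%:R * s2) * _]gEZ -(mulr_algl _ (G1 N)).
  move: (p%:R * s2)%:A => c.
  rewrite [X N ^+ m.+1]exprS -!(mulrA (X N)) -(chaos_gE_gam _ (hX N)).
  rewrite -!nE -!gED; congr (gE _ _).
  rewrite !gamMr !gamX /G1 /G2 /G3.
  rewrite -[gam (X N) (gY r.+1 N)]/(gY r.+2 N) -[gam (X N) (gY r N)]/(gY r.+1 N).
  rewrite [gY r.+1 N ^+ i.+1]exprS.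
  move: (X N ^+ m.-1) (X N ^+ m) (gY r.+1 N ^+ i.-1) (gY r.+1 N ^+ i) => x1 x2 u1 u2.
  move: (gY r N ^+ j.-1) (gY r N ^+ j) (gam (X N) (X N)) => w1 w2 g.
  move: (gY r.+1 N) (gY r.+2 N) (m%:R : A N) (i%:R : A N) (j%:R : A N) => v z m' i' j'.
  ring.
have c1 : gE (A N) ((gam (X N) (X N) - (p%:R * s2)%:A) * G1 N) @[N --> \oo] --> (0 : R).
  apply: gnull_gE; apply: gnullM gam_XX_null _.
  by do 2?apply: gbddM; exact: gbddX.
have c2 : gE (A N) (gY r.+2 N * G3 N) @[N --> \oo] --> (0 : R).
  by apply: gnull_gE; apply: gnullM n2 _; do 2?apply: gbddM; exact: gbddX.
have p0 : (p%:R : R) != 0 by rewrite pnatr_eq0 -lt0n.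
rewrite [X in _ --> X](_ : _ = p%:R^-1 * (m%:R * 0 + m%:R * (p%:R * s2) * l1 + j%:R * l2 +
   i%:R * 0)); last by field.
have : p%:R^-1 * (m%:R * gE (A N) ((gam (X N) (X N) - (p%:R * s2)%:A) * G1 N) +
    m%:R * (p%:R * s2) * gE (A N) (G1 N) + j%:R * gE (A N) (G2 N) +
    i%:R * gE (A N) (gY r.+2 N * G3 N)) @[N --> \oo] --> p%:R^-1 * (m%:R * 0 + m%:R * (p%:R * s2) * l1 + j%:R * l2 +
   i%:R * 0).
  apply: cvgM; first exact: cvg_cst.
  by do 3?apply: cvgD; apply: cvgM => //; exact: cvg_cst.
by apply: cvg_ext => N; rewrite -E1 mulKf.
Qed.

End asymptotics.

(** * Growth of moments *)

Section two_step_moments.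
Context {R : realType}.
Variables (h : nat -> nat -> nat -> R) (s2 c : R).
Hypothesis s2_ge0 : 0 <= s2.
Hypothesis c_ge0 : 0 <= c.
(* [h m i j] stands for E[X^m V^i U^j], where E[X F] = c E[A F] for a derivation A
   with A U = V, A V = 0 and c A X = s2. *)
Hypothesis hS : forall m i j,
  h m.+1 i j = m%:R * s2 * h m.-1 i j + j%:R * c * h m i.+1 j.-1.
Hypothesis h0_ge0 : forall i j, ~~ odd i -> ~~ odd j -> 0 <= h 0 i j.

(** The parity condition is preserved by both terms of the recursion and ends on even moments. *)
Lemma two_step_ge0 m i j : odd i = odd m -> odd j = odd m -> 0 <= h m i j.
Proof.
elim/ltn_ind: m i j => -[_ i j /= oi oj|m IH i j /= oi oj].
  by apply: h0_ge0; rewrite ?oi ?oj.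
rewrite hS addr_ge0//.
  case: m IH oi oj => [|m] IH oi oj; first by rewrite mul0r mul0r.
  by rewrite !mulr_ge0// IH//= ?oi ?oj /= negbK.
case: j oj => [|j] oj; first by rewrite mul0r mul0r.
rewrite !mulr_ge0// IH//=; first by rewrite oi negbK.
by move: oj => /= /negb_inj.
Qed.

(** Only the second term of the recursion is kept, [m] times: each X turns a factor U into V. *)
Lemma two_step_ge m i : odd i = odd m ->
  m`!%:R * c ^+ m * h 0 (i + m) 0 <= h m i m.
Proof.
elim: m i => [|m IH] i oi; first by rewrite fact0 !mul1r addn0.
rewrite hS /= factS natrM exprS addnS -addSn.
have H0 : 0 <= m%:R * s2 * h m.-1 i m.+1.
  case: m {IH} oi => [|m] oi; first by rewrite mul0r mul0r.
  by rewrite !mulr_ge0//; apply: two_step_ge0; rewrite ?oi /= ?negbK.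
have := IH i.+1; rewrite /= oi /= negbK => /(_ erefl) H.
have := ler_wpM2l (mulr_ge0 (ler0n R m.+1) c_ge0) H.
move: H0; set x := h _ _ _; set y := h _ _ _; set z := h _ _ _; nra.
Qed.

(** Without U only the first term is left, and X behaves as a Gaussian independent of V; its moment
    (2m - 1)!! is bounded by [2 ^ m m!]. *)
Lemma two_step_le m i : ~~ odd i ->
  h m.*2 i 0 <= (2 * s2) ^+ m * m`!%:R * h 0 i 0.
Proof.
move=> oi; elim: m => [|m IH]; first by rewrite expr0 fact0 !mul1r.
rewrite doubleS hS /= mul0r mul0r addr0 exprS factS natrM.
have h0 : 0 <= h m.*2 i 0 by rewrite two_step_ge0//= odd_double; exact: negbTE.
have : m.*2.+1%:R * s2 * h m.*2 i 0 <= 2 * m.+1%:R * s2 * h m.*2 i 0.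
  apply: ler_wpM2r => //; apply: ler_wpM2r => //.
  by rewrite -natrM ler_nat; lia.
move=> H; apply: le_trans H _.
have := ler_wpM2l (mulr_ge0 (mulr_ge0 (ler0n R 2) (ler0n R m.+1)) s2_ge0) IH.
by move=> H; apply: le_trans H _; rewrite le_eqVlt; apply/orP; left; apply/eqP; ring.
Qed.

Hypothesis h_cauchy_schwarz : forall m, h m m m ^+ 2 <= h m.*2 m.*2 0 * h 0 0 m.*2.

(** E[X^m V^m U^m] is bounded below by [two_step_ge] and above by Cauchy-Schwarz and [two_step_le];
    division by [m! E[V^(2m)]] leaves one factorial. *)
Lemma two_step_moments m :
  m`!%:R * (c ^+ 2) ^+ m * h 0 m.*2 0 <= (2 * s2) ^+ m * h 0 0 m.*2.
Proof.
have v0 : 0 <= h 0 m.*2 0 by apply: h0_ge0; rewrite ?odd_double.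
have u0 : 0 <= h 0 0 m.*2 by apply: h0_ge0; rewrite ?odd_double.
move: (v0); rewrite le_eqVlt => /orP[/eqP <-|v1].
  by rewrite mulr0 mulr_ge0 ?exprn_ge0 ?mulr_ge0.
have f0 : (0 : R) < m`!%:R by rewrite ltr0n fact_gt0.
have H1 := @two_step_ge m m erefl; rewrite addnn in H1.
have H2 := @two_step_le m m.*2 (ltac:(by rewrite odd_double)).
have H3 := h_cauchy_schwarz m.
have H4 : (m`!%:R * c ^+ m * h 0 m.*2 0) ^+ 2 <=
    (2 * s2) ^+ m * m`!%:R * h 0 m.*2 0 * h 0 0 m.*2.
  apply: le_trans (_ : h m m m ^+ 2 <= _); last first.
    by apply: le_trans H3 _; exact: ler_wpM2r.
  rewrite lerXn2r ?nnegrE//; first by rewrite !mulr_ge0 ?exprn_ge0.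
  by apply: le_trans H1; rewrite !mulr_ge0 ?exprn_ge0.
rewrite -(ler_pM2r (mulr_gt0 f0 v1)).
apply: le_trans (_ : (m`!%:R * c ^+ m * h 0 m.*2 0) ^+ 2 <= _).
  by rewrite le_eqVlt; apply/orP; left; apply/eqP; rewrite -exprM mulnC exprM; ring.
by apply: le_trans H4 _; rewrite le_eqVlt; apply/orP; left; apply/eqP; ring.
Qed.

End two_step_moments.

Section growth.
Context {R : realType}.

Lemma fact_double_le m : (m.*2`! <= 4 ^ m * (m`! * m`!))%N.
Proof.
have mm : (m <= m.*2)%N by lia.
have := bin_fact mm; rewrite -addnn addnK addnn => <-.
rewrite leq_mul2r; apply/orP; right.
have -> : (4 ^ m = 2 ^ m.*2)%N by rewrite -mul2n expnM.
have : ('C(m.*2, m) <= \sum_(i < m.*2.+1) 'C(m.*2, i) * (1 ^ (m.*2 - i) * 1 ^ i))%N.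
  have mm' : (m < m.*2.+1)%N by lia.
  by rewrite (bigD1 (Ordinal mm'))//= !exp1n !muln1 leq_addr.
by rewrite -expnDn.
Qed.

Lemma factorial_growth_eq0 (a : R) (u : nat -> R) : 0 <= a ->
  (forall m, m`!%:R ^+ 2 * a ^+ m <= u m) ->
  (forall t : R, 0 < t -> exists K, forall m, u m * t ^+ m.*2 <= m.*2`!%:R * K) ->
  a = 0.
Proof.
rewrite le_eqVlt => /orP[/eqP <-//|a0] hu hK; exfalso.
(* Since (2m)! is at most [4 ^ m m!^2], this value leaves [2 ^ m <= K] for every [m]. *)
pose t := Num.sqrt (8 / a).
have t0 : 0 < t by rewrite sqrtr_gt0 divr_gt0.
have [K HK] := hK t t0.
have K1 m : 2 ^+ m <= K.
  have f0 : (0 : R) < m`!%:R by rewrite ltr0n fact_gt0.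
  have tE : t ^+ m.*2 = (8 / a) ^+ m.
    by rewrite -mul2n exprM sqr_sqrtr// divr_ge0// ltW.
  have : m`!%:R ^+ 2 * 8 ^+ m <= m.*2`!%:R * K.
    apply: le_trans (HK m); rewrite tE expr_div_n.
    have := ler_wpM2r (_ : 0 <= 8 ^+ m / a ^+ m) (hu m).
    move=> /(_ (ltac:(by rewrite divr_ge0 ?exprn_ge0// ltW))).
    rewrite -mulrA [a ^+ m * _]mulrC divfK// expf_neq0// gt_eqF//.
  have Kp : 0 <= K.
    have := HK 0%N; rewrite expr0 mulr1 fact0 mul1r; apply: le_trans.
    by apply: le_trans (hu 0%N); rewrite fact0 expr1n expr0 mulr1.
  have := ler_wpM2r Kp (_ : m.*2`!%:R <= (4 ^ m * (m`! * m`!))%:R :> R).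
  rewrite ler_nat => /(_ (fact_double_le m)) H1 H2.
  have := le_trans H2 H1; rewrite !natrM natrX.
  have -> : 8 = 2 * 4 :> R by ring.
  rewrite exprMn.
  have -> : m`!%:R ^+ 2 * (2 ^+ m * 4 ^+ m) = (m`!%:R * m`!%:R * 4 ^+ m) * 2 ^+ m :> R.
    ring.
  have -> : 4%:R ^+ m * (m`!%:R * m`!%:R) * K = (m`!%:R * m`!%:R * 4 ^+ m) * K by ring.
  by rewrite ler_pM2l// !mulr_gt0// exprn_gt0.
have : K < 2 ^+ (Num.truncn K).+1.
  apply: lt_le_trans (_ : (Num.truncn K).+1%:R <= _); first exact: truncnS_gt.
  by rewrite -natrX ler_nat ltnW// ltn_expl.
by rewrite ltNge K1.
Qed.

End growth.

(** * Integration on a probability space *)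

Lemma cvg_near_ext (R : realType) (u v : nat -> R) (l : R) :
  (\forall N \near \oo, u N = v N) ->
  u N @[N --> \oo] --> l -> v N @[N --> \oo] --> l.
Proof. by move=> uv; apply: cvg_trans; exact: near_eq_cvg. Qed.

Lemma squeeze0_near (R : realType) (u v : nat -> R) :
  (\forall N \near \oo, 0 <= u N <= v N) ->
  v N @[N --> \oo] --> (0 : R) -> u N @[N --> \oo] --> (0 : R).
Proof.
by move=> uv v0; apply: (squeeze_cvgr (f := fun=> 0) (h := v)) => //; exact: cvg_cst.
Qed.

Lemma measurable_fun_cos d (T : measurableType d) (R : realType) (f : T -> R) :
  measurable_fun setT f -> measurable_fun setT (fun w => cos (f w)).
Proof.
move=> mf; have mc : measurable_fun setT (@cos R).
  exact: (continuous_measurable_fun (@continuous_cos R)).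
exact: (measurableT_comp mc mf).
Qed.

Section expectations.
Context d (T : measurableType d) (R : realType) (P : probability T R).
Implicit Types F G : T -> R.

Definition Ex F : R := \int[P]_w F w.
Definition int1 F := P.-integrable setT (EFin \o F).

Lemma int1_meas F : int1 F -> measurable_fun setT F.
Proof. by move=> /integrableP[/measurable_EFinP]. Qed.

Lemma ExpE F : expectation P F = (\int[P]_w (F w)%:E)%E.
Proof. by rewrite unlock. Qed.

Lemma Ex_fin F : int1 F -> (Ex F)%:E = (\int[P]_w (F w)%:E)%E.
Proof. by move=> h; rewrite /Ex /Rintegral fineK//; exact: integrable_fin_num. Qed.

Lemma ExE F : Ex F = fine (expectation P F).
Proof. by rewrite ExpE. Qed.

Lemma Ex_expectation F : int1 F -> expectation P F = (Ex F)%:E.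
Proof. by move=> h; rewrite ExpE Ex_fin. Qed.

Lemma int1_cst c : int1 (fun=> c).
Proof. exact: finite_measure_integrable_cst. Qed.

Lemma int1_le F G : measurable_fun setT F -> int1 G ->
  (forall w, `|F w| <= G w) -> int1 F.
Proof.
move=> mF iG h; apply: (le_integrable _ _ _ iG) => //; first exact/measurable_EFinP.
by move=> w _ /=; rewrite lee_fin; apply: le_trans (h w) (ler_norm _).
Qed.

Lemma int1D F G : int1 F -> int1 G -> int1 (fun w => F w + G w).
Proof. exact: integrableD. Qed.
Lemma int1B F G : int1 F -> int1 G -> int1 (fun w => F w - G w).
Proof. exact: integrableB. Qed.
Lemma int1Z c F : int1 F -> int1 (fun w => c * F w).
Proof. exact: integrableZl. Qed.
Lemma int1_norm F : int1 F -> int1 (fun w => `|F w|).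
Proof. exact: integrable_norm. Qed.

Lemma int1_sum (I : Type) (r : seq I) (F : I -> T -> R) :
  (forall i, int1 (F i)) -> int1 (fun w => \sum_(i <- r) F i w).
Proof.
move=> h; elim: r => [|i r IH].
  by under eq_fun do rewrite big_nil; exact: int1_cst.
by under eq_fun do rewrite big_cons; exact: int1D.
Qed.

Lemma int1_bounded F M : measurable_fun setT F -> (forall w, `|F w| <= M) -> int1 F.
Proof. by move=> mF; apply: int1_le => //; exact: int1_cst. Qed.

Lemma ExD F G : int1 F -> int1 G -> Ex (fun w => F w + G w) = Ex F + Ex G.
Proof. exact: RintegralD. Qed.
Lemma ExB F G : int1 F -> int1 G -> Ex (fun w => F w - G w) = Ex F - Ex G.
Proof. exact: RintegralB. Qed.
Lemma ExZ c F : int1 F -> Ex (fun w => c * F w) = c * Ex F.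
Proof. exact: RintegralZl. Qed.
Lemma Ex_cst c : Ex (fun=> c) = c.
Proof.
by rewrite /Ex Rintegral_cst//= probability_setT mulr1.
Qed.
Lemma Ex_sum (I : Type) (r : seq I) (F : I -> T -> R) :
  (forall i, int1 (F i)) -> Ex (fun w => \sum_(i <- r) F i w) = \sum_(i <- r) Ex (F i).
Proof.
move=> h; elim: r => [|i r IH].
  by under eq_fun do rewrite big_nil; rewrite big_nil Ex_cst.
under eq_fun do rewrite big_cons.
by rewrite ExD ?IH ?big_cons//; exact: int1_sum.
Qed.

Lemma Ex_le F G : int1 F -> int1 G -> (forall w, F w <= G w) -> Ex F <= Ex G.
Proof. by move=> iF iG h; apply: le_Rintegral. Qed.
Lemma Ex_ge0 F : (forall w, 0 <= F w) -> 0 <= Ex F.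
Proof. by move=> h; apply: Rintegral_ge0. Qed.
Lemma Ex_norm F : int1 F -> `|Ex F| <= Ex (fun w => `|F w|).
Proof. exact: le_normr_Rintegral. Qed.

Lemma Ex_norm_le F G : int1 F -> int1 G -> (forall w, `|F w| <= G w) -> `|Ex F| <= Ex G.
Proof.
by move=> iF iG h; apply: le_trans (Ex_norm iF) (Ex_le (int1_norm iF) iG h).
Qed.

Lemma Ex_ae F G : measurable_fun setT F -> measurable_fun setT G ->
  {ae P, forall w, F w = G w} -> Ex F = Ex G.
Proof.
move=> mF mG h; congr fine; apply: ae_eq_integral => //;
  [exact/measurable_EFinP|exact/measurable_EFinP|].
by apply: filterS h => w /= ->.
Qed.

Lemma int1_ae F G : int1 F -> measurable_fun setT G ->
  {ae P, forall w, F w = G w} -> int1 G.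
Proof.
move=> iF mG h; apply/integrableP; split; first exact/measurable_EFinP.
have [mF fF] := integrableP _ _ _ iF.
rewrite (ae_eq_integral (fun w => `|(F w)%:E|%E)) //.
- by do 2 apply: measurableT_comp => //.
- exact: measurableT_comp.
- by apply: filterS h => w /= ->.
Qed.

Lemma Ex_le_ae F G : int1 F -> int1 G -> {ae P, forall w, F w <= G w} -> Ex F <= Ex G.
Proof.
move=> iF iG h; have mF := int1_meas iF; have mG := int1_meas iG.
have mM : measurable_fun setT (fun w => Num.max (F w) (G w)) by exact: measurable_maxr.
have iM : int1 (fun w => Num.max (F w) (G w)).
  apply: int1_ae iG mM _; apply: filterS h => w Hw; exact/esym/max_idPr.
have -> : Ex G = Ex (fun w => Num.max (F w) (G w)).
  by apply: Ex_ae => //; apply: filterS h => w Hw; exact/esym/max_idPr.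
by apply: Ex_le => // w; rewrite le_max lexx.
Qed.

Definition sqi F := measurable_fun setT F /\ int1 (fun w => F w ^+ 2).

Lemma sqi_mul F G : sqi F -> sqi G -> int1 (fun w => F w * G w).
Proof.
move=> [mF iF] [mG iG]; apply: (int1_le _ (int1D iF iG)).
  exact: measurable_funM.
move=> w; rewrite normrM -(real_normK (num_real (F w))) -(real_normK (num_real (G w))).
have := sqr_ge0 (`|F w| - `|G w|).
have := sqr_ge0 (`|F w| + `|G w|); nra.
Qed.

Lemma sqi_cst c : sqi (fun=> c).
Proof. by split; [exact: measurable_cst|exact: int1_cst]. Qed.

Lemma sqi_int1 F : sqi F -> int1 F.
Proof.
move=> h; have := sqi_mul h (sqi_cst 1); by under eq_fun do rewrite mulr1.
Qed.

Lemma sqiD F G : sqi F -> sqi G -> sqi (fun w => F w + G w).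
Proof.
move=> hF hG; split.
  by apply: measurable_funD; [case: hF|case: hG].
under eq_fun do rewrite sqrrD.
apply: int1D; last by case: hG.
by apply: int1D; [case: hF|under eq_fun do rewrite mulr2n; apply: int1D; exact: sqi_mul].
Qed.

Lemma sqiZ c F : sqi F -> sqi (fun w => c * F w).
Proof.
move=> [mF iF]; split; first exact: measurable_funM.
by under eq_fun do rewrite exprMn; exact: int1Z.
Qed.

Lemma sqiB F G : sqi F -> sqi G -> sqi (fun w => F w - G w).
Proof.
move=> hF hG; have := sqiD hF (sqiZ (-1) hG).
by under eq_fun do rewrite mulN1r.
Qed.

Lemma sqi_sum (I : Type) (r : seq I) (F : I -> T -> R) :
  (forall i, sqi (F i)) -> sqi (fun w => \sum_(i <- r) F i w).
Proof.
move=> h; elim: r => [|i r IH].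
  by under eq_fun do rewrite big_nil; exact: sqi_cst.
by under eq_fun do rewrite big_cons; exact: sqiD.
Qed.

Lemma Ex_cauchy_schwarz F G : sqi F -> sqi G ->
  Ex (fun w => F w * G w) ^+ 2 <= Ex (fun w => F w ^+ 2) * Ex (fun w => G w ^+ 2).
Proof.
move=> hF hG; apply: discriminant_le; last first.
  by apply: Ex_ge0 => w; exact: sqr_ge0.
move=> t; have FG := sqi_mul hF hG.
have : 0 <= Ex (fun w => (F w - t * G w) ^+ 2).
  by apply: Ex_ge0 => w; exact: sqr_ge0.
have -> : (fun w => (F w - t * G w) ^+ 2) =
   (fun w => F w ^+ 2 - (t * 2) * (F w * G w) + t ^+ 2 * G w ^+ 2).
  by apply/funext => w; ring.
rewrite ExD ?ExB ?ExZ//; last 5 first.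
- by case: hG.
- by case: hF.
- exact: int1Z.
- by apply: int1B; [case: hF|exact: int1Z].
- by apply: int1Z; case: hG.
lra.
Qed.

Lemma Ex_norm_sqrt F : sqi F -> `|Ex F| <= Num.sqrt (Ex (fun w => F w ^+ 2)).
Proof.
move=> h; rewrite -sqrtr_sqr ler_sqrt.
  have := Ex_cauchy_schwarz h (sqi_cst 1).
  rewrite expr1n Ex_cst mulr1; by under eq_fun do rewrite mulr1.
by apply: Ex_ge0 => w; exact: sqr_ge0.
Qed.

(** An algebra containing Gaussian and bounded variables, which makes integrability side conditions
    structural. *)
Definition moments F := measurable_fun setT F /\ forall k, int1 (fun w => `|F w| ^+ k).

Lemma moments_le F G : measurable_fun setT F -> moments G ->
  (forall w, `|F w| <= `|G w|) -> moments F.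
Proof.
move=> mF [mG iG] h; split=> // k; apply: int1_le (iG k) _.
  by apply: measurable_funX; exact: measurableT_comp.
by move=> w; rewrite normrX normr_id lerXn2r// nnegrE.
Qed.

Lemma moments_cst c : moments (fun=> c).
Proof. by split; [exact: measurable_cst|move=> k; exact: int1_cst]. Qed.

Lemma momentsD F G : moments F -> moments G -> moments (fun w => F w + G w).
Proof.
move=> [mF iF] [mG iG]; split=> [|k]; first exact: measurable_funD.
apply: (int1_le _ (int1Z (2 ^+ k) (int1D (iF k) (iG k)))).
  by apply: measurable_funX; apply: measurableT_comp => //; exact: measurable_funD.
move=> w; rewrite normrX normr_id.
apply: le_trans (_ : (2 * Num.max `|F w| `|G w|) ^+ k <= _).
  rewrite lerXn2r ?nnegrE ?mulr_ge0 ?le_max ?normr_ge0//.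
  apply: le_trans (ler_normD _ _) _.
  have : `|F w| <= Num.max `|F w| `|G w| by rewrite le_max lexx.
  have : `|G w| <= Num.max `|F w| `|G w| by rewrite le_max lexx orbT.
  lra.
rewrite exprMn ler_wpM2l ?exprn_ge0//.
by rewrite maxEle; case: ifP => _; rewrite ?lerDr ?lerDl exprn_ge0.
Qed.

Lemma momentsM F G : moments F -> moments G -> moments (fun w => F w * G w).
Proof.
move=> [mF iF] [mG iG]; split=> [|k]; first exact: measurable_funM.
apply: (int1_le _ (int1D (iF (k * 2)%N) (iG (k * 2)%N))).
  by apply: measurable_funX; apply: measurableT_comp => //; exact: measurable_funM.
move=> w; rewrite normrX normr_id normrM exprMn !exprM.
have := sqr_ge0 (`|F w| ^+ k - `|G w| ^+ k).
have : 0 <= `|F w| ^+ k by rewrite exprn_ge0.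
have : 0 <= `|G w| ^+ k by rewrite exprn_ge0.
nra.
Qed.

Lemma momentsX F k : moments F -> moments (fun w => F w ^+ k).
Proof.
move=> h; elim: k => [|k IH]; first exact: moments_cst.
by under eq_fun do rewrite exprS; exact: momentsM.
Qed.

Lemma momentsZ c F : moments F -> moments (fun w => c * F w).
Proof. by move=> h; apply: momentsM => //; exact: moments_cst. Qed.

Lemma moments_norm F : moments F -> moments (fun w => `|F w|).
Proof.
move=> h; apply: moments_le (h) _; last by move=> w; rewrite normr_id.
by apply: measurableT_comp => //; case: h.
Qed.

Lemma moments_sum (I : Type) (r : seq I) (F : I -> T -> R) :
  (forall i, moments (F i)) -> moments (fun w => \sum_(i <- r) F i w).
Proof.
move=> h; elim: r => [|i r IH].
  by under eq_fun do rewrite big_nil; exact: moments_cst.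
by under eq_fun do rewrite big_cons; exact: momentsD.
Qed.

Lemma moments_int1 F : moments F -> int1 F.
Proof.
by move=> [mF iF]; apply: int1_le (iF 1%N) _.
Qed.

Lemma moments_sqi F : moments F -> sqi F.
Proof. by move=> h; split; [case: h|exact: moments_int1 (momentsX 2 h)]. Qed.

Lemma moments_bounded F M : measurable_fun setT F -> (forall w, `|F w| <= M) -> moments F.
Proof.
move=> mF h; apply: moments_le mF (moments_cst M) _ => w.
exact: le_trans (h w) (ler_norm _).
Qed.

Lemma Ex_dominated (F : nat -> T -> R) (G H : T -> R) :
  (forall n, measurable_fun setT (F n)) ->
  (forall w, F n w @[n --> \oo] --> G w) -> int1 H ->
  (forall n w, `|F n w| <= H w) -> Ex (F n) @[n --> \oo] --> Ex G /\ int1 G.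
Proof.
move=> mF cF iH h.
have mG : measurable_fun setT G.
  by apply: (measurable_fun_cvg mF) => w _; exact: cF.
have cFG : {ae P, forall x, setT x -> (EFin \o F n) x @[n --> \oo] --> (EFin \o G) x}.
  by apply: aeW => w _; apply: cvg_EFin; [exact: nearW|exact: cF].
have [iG _ cE] := @dominated_convergence _ _ _ P setT measurableT
  (fun n => EFin \o F n) (EFin \o G) (EFin \o H)
  (fun n => (measurable_EFinP _ _).2 (mF n)) ((measurable_EFinP _ _).2 mG)
  cFG iH
  (aeW _ (fun w n _ => h n w)).
split=> //; apply: fine_cvg; rewrite fineK//; exact: integrable_fin_num.
Qed.

Lemma int1_fatou (F : nat -> T -> R) (G : T -> R) C :
  (forall n, int1 (F n)) -> (forall n w, 0 <= F n w) ->
  (forall w, F n w @[n --> \oo] --> G w) -> (forall n, Ex (F n) <= C) -> int1 G.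
Proof.
move=> iF F0 cF h; have mG : measurable_fun setT G.
  by apply: (measurable_fun_cvg (fun n => int1_meas (iF n))) => w _; exact: cF.
apply/integrableP; split; first exact/measurable_EFinP.
have G0 w : 0 <= G w.
  rewrite -(cvg_lim _ (cF w))//; apply: limr_ge; first exact: cvgP (cF w).
  exact: nearW.
rewrite (eq_integral (fun w => limn_einf (fun n => (F n w)%:E))); last first.
  move=> w _; rewrite /= ger0_norm//.
  have c : (F n w)%:E @[n --> \oo] --> (G w)%:E by apply: cvg_EFin; [exact: nearW|exact: cF].
  by rewrite is_cvg_limn_einfE; [exact/esym/cvg_lim|exact: cvgP c].
apply: le_lt_trans (_ : _ <= C%:E)%E _; last exact: ltry.
apply: le_trans (fatou _ _ _ _) _ => //.
- by move=> n; apply/measurable_EFinP; exact: int1_meas.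
- by move=> n w _; rewrite lee_fin.
rewrite limn_einf_lim; apply: lime_le; first exact: is_cvg_einfs.
apply: nearW => n; apply: ereal_inf_le; exists (Ex (F n))%:E; last by rewrite lee_fin.
by exists n => //=; rewrite Ex_fin.
Qed.

End expectations.

(** * Gaussian laws on the line *)

Section normal_density_integrals.
Context {R : realType}.
Variables m s : R.
Hypothesis s0 : s != 0.
Local Notation N := (normal_prob m s).
Local Notation mu := (@lebesgue_measure R).
Local Notation pdf := (normal_pdf m s).

Lemma integral_normal (f : R -> \bar R) (U : set R) :
  measurable U -> N.-integrable U f ->
  (\int[N]_(x in U) f x = \int[mu]_(x in U) (f x * (pdf x)%:E))%E.
Proof.
move=> mU intf; have mf := measurable_int _ intf.
have dom := @normal_prob_dominates R m s.
rewrite -(Radon_Nikodym_change_of_variables dom)//=.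
apply: ae_eq_integral => //.
- apply: emeasurable_funM => //; apply: (measurable_int mu).
  apply: (integrableS _ _ (@subsetT _ _)) => //=.
  by apply: Radon_Nikodym_integrable; exact: dom.
- apply: emeasurable_funM => //=; apply/measurableT_comp => //=.
  by apply/measurable_funTS; exact: measurable_normal_pdf.
- apply: ae_eqe_mul2l => /=.
  rewrite Radon_NikodymE//=.
  case: cid => /= h [h1 h2 h3].
  apply: integral_ae_eq => //=.
  + exact: integrableS h2.
  + by apply/measurable_funTS/measurableT_comp => //; exact: measurable_normal_pdf.
  + by move=> E E01 mE; rewrite -h3.
Qed.

(** Integration by parts is done on segments; truncated integrands are treated there, and the
    segment then grows to the line. *)
Definition cut (n : R) (f : R -> R) (x : R) : R := f x * \1_(`[- n, n] : set R) x.

Lemma cut_Rintegral n (f : R -> R) : continuous f -> 0 <= n ->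
  int1 N (cut n f) /\ Ex N (cut n f) = \int[mu]_(x in `[- n, n]) (f x * pdf x).
Proof.
move=> cf n0; have mf : measurable_fun setT f by exact: continuous_measurable_fun.
have mc : measurable_fun setT (cut n f).
  by apply: measurable_funM => //; exact: measurable_indic.
have [M [Mr HM]] : bounded_set (f @` (`[- n, n] : set R)).
  apply: compact_bounded; apply: continuous_compact; last exact: segment_compact.
  by apply/continuous_subspaceT.
have iC : int1 N (cut n f).
  apply: (@int1_bounded _ _ _ _ _ (`|M| + 1)) => // x.
  rewrite /cut indicE; have [xn|_] := boolP (x \in _).
    rewrite mulr1; apply: (HM (`|M| + 1)) => //.
      by rewrite (le_lt_trans (ler_norm M))// ltrDl.
    by exists x => //; move: xn; rewrite inE.
  by rewrite mulr0 normr0 addr_ge0.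
split=> //; rewrite /Ex /Rintegral.
rewrite integral_normal//; congr fine; rewrite [RHS]integral_mkcond/=.
apply: eq_integral => x _; rewrite /cut indicE /= patchE.
by case: ifP => _; rewrite ?mulr1 ?mulr0 ?mul0e -?EFinM.
Qed.

Lemma is_derive_pdf (x : R) : is_derive x (1 : R) pdf (- ((x - m) / s ^+ 2) * pdf x).
Proof.
rewrite normal_pdfE// /normal_fun.
have H : is_derive x (1 : R) (fun x : R => - (x - m) ^+ 2 / (s ^+ 2 *+ 2)) (- ((x - m) / s ^+ 2)).
  apply: is_derive_eq; rewrite /GRing.scale/=; field.
  by rewrite s0.
by apply: is_derive_eq; rewrite /GRing.scale/=; ring.
Qed.

Lemma derive_oo_LRcontinuous (f g : R -> R) (a b : R) :
  (forall x : R, is_derive x (1 : R) f (g x)) -> derivable_oo_LRcontinuous f a b.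
Proof.
move=> h; have cf : continuous f.
  by move=> x; apply: differentiable_continuous; apply/derivable1_diffP; case: (h x).
split; first by move=> x _; case: (h x).
  exact: cvg_at_right_filter (cf a).
exact: cvg_at_left_filter (cf b).
Qed.

End normal_density_integrals.

Section normal_law.
Context {R : realType}.
Variable s : R.
Hypothesis s0 : s != 0.
Local Notation N := (normal_prob 0 s).
Local Notation mu := (@lebesgue_measure R).
Local Notation pdf := (normal_pdf 0 s).

(** From [y^k <= k! e^y] with [y = x^2 / (2 s^2)]; the exponent [k] is first raised to [2 k] when
    [|x| > 1]. *)
Lemma pdf_decay k : exists C, forall x : R, `|x| ^+ k * pdf x <= C.
Proof.
exists (normal_peak s * ((k`!%:R * (s ^+ 2 *+ 2) ^+ k) + 1)) => x.
rewrite normal_pdfE// mulrCA; apply: ler_wpM2l; first exact: normal_peak_ge0.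
have s2 : 0 < s ^+ 2 *+ 2 by rewrite mulrn_wgt0// exprn_even_gt0.
rewrite /normal_fun subr0 mulNr expRN ler_pdivrMr ?expR_gt0//.
pose y := x ^+ 2 / (s ^+ 2 *+ 2).
have y0 : 0 <= y by rewrite divr_ge0 ?sqr_ge0// ltW.
rewrite -/y.
have e1 : 1 <= expR y by rewrite -expR0 ler_expR.
have [x1|x1] := leP `|x| 1.
  apply: le_trans (_ : 1 <= _); first exact: exprn_ile1.
  rewrite mulrDl mul1r; apply: le_trans e1 _; rewrite lerDr.
  by rewrite !mulr_ge0 ?exprn_ge0 ?expR_ge0// ltW.
apply: le_trans (_ : `|x| ^+ (2 * k) <= _).
  by rewrite ler_weXn2l ?ltW//; lia.
rewrite exprM -normrX ger0_norm ?sqr_ge0//.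
have -> : x ^+ 2 = y * (s ^+ 2 *+ 2) by rewrite divfK// gt_eqF.
rewrite exprMn mulrDl mul1r.
apply: le_trans (_ : k`!%:R * (s ^+ 2 *+ 2) ^+ k * expR y <= _); last first.
  by rewrite lerDl expR_ge0.
rewrite mulrC -mulrA mulrCA; apply: ler_wpM2l; first by rewrite exprn_ge0// ltW.
have f0 : (0 : R) < k`!%:R by rewrite ltr0n fact_gt0.
rewrite -ler_pdivrMl// mulrC.
case: k {f0} => [|k]; first by rewrite expr0 fact0 divr1.
by apply: le_trans (expR_ge1Dxn k y0); rewrite lerDr.
Qed.

Lemma normal_cut_ibp (f g : R -> R) n : (forall x : R, is_derive x (1 : R) f (g x)) ->
  continuous g -> 0 < n ->
  Ex N (cut n (fun x => x * f x)) =
  s ^+ 2 * (Ex N (cut n g) - (f n * pdf n - f (- n) * pdf (- n))).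
Proof.
move=> hf cg n0; have cf : continuous f.
  by move=> x; apply: differentiable_continuous; apply/derivable1_diffP; case: (hf x).
have cx : continuous (fun x : R => x * f x)
  by move=> x; apply: cvgM; [exact: cvg_id|exact: cf].
have cp : continuous pdf by exact: continuous_normal_pdf.
have [_ ->] := cut_Rintegral 0 s cx (ltW n0).
have [_ ->] := cut_Rintegral 0 s cg (ltW n0).
have nn : - n < n by lra.
pose g' x := - ((x - 0) / s ^+ 2) * pdf x.
have cg' : continuous g'.
  move=> x; apply: cvgM; last exact: cp.
  apply: cvgN; apply: cvgM; last exact: cvg_cst.
  by apply: cvgB; [exact: cvg_id|exact: cvg_cst].
have E1 : {in `](- n), n[, derive1 f =1 g}.
  by move=> x _; rewrite derive1E; case: (hf x).
have E2 : {in `](- n), n[, derive1 pdf =1 g'}.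
  by move=> x _; rewrite derive1E; case: (is_derive_pdf 0 s0 x).
have H := @Rintegration_by_parts R f pdf g g' (- n) n nn
  (continuous_subspaceT cg) (derive_oo_LRcontinuous _ _ hf) E1
  (continuous_subspaceT cg') (derive_oo_LRcontinuous _ _ (is_derive_pdf 0 s0)) E2.
have -> : \int[mu]_(x in `[(- n), n]) (x * f x * pdf x) =
    - s ^+ 2 * \int[mu]_(x in `[(- n), n]) (f x * g' x).
  rewrite -RintegralZl//.
    apply: eq_Rintegral => x _; rewrite /g'; field.
    by rewrite s0.
  apply: continuous_compact_integrable; first exact: segment_compact.
  by apply: continuous_subspaceT => x; apply: cvgM; [exact: cf|exact: cg'].
by rewrite H; ring.
Qed.

Lemma cut_cvg (f : R -> R) (x : R) : cut k%:R f x @[k --> \oo] --> f x.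
Proof.
apply: cvg_near_cst; near=> k; rewrite /cut indicE mem_set ?mulr1//= in_itv/= -ler_norml.
near: k; exact: nbhs_infty_ger.
Unshelve. all: end_near. Qed.

(** Truncated moments satisfy the recursion of integration by parts, with boundary terms of
    favourable sign for an odd power. The bound is uniform in the truncation, and Fatou's lemma
    gives integrability. *)
Lemma even_moment_normal k : int1 N (fun x => x ^+ k.*2) /\
  exists C, forall n, 0 < n -> Ex N (cut n (fun x => x ^+ k.*2)) <= C.
Proof.
suff : exists C, forall n, 0 < n -> Ex N (cut n (fun x => x ^+ k.*2)) <= C.
  move=> [C HC]; split; last by exists C.
  apply: (@int1_fatou _ (measurableTypeR R) R N (fun n => cut n.+1%:R (fun x => x ^+ k.*2)) _ C).
  - move=> n; apply: (proj1 (cut_Rintegral 0 s _ _)) => //.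
    exact: exprn_continuous.
  - by move=> n x; rewrite mulr_ge0// exprn_even_ge0// odd_double.
  - move=> x; have := @cut_cvg (fun x => x ^+ k.*2) x.
    by rewrite -(cvg_shiftS (fun n => cut n%:R _ x)).
  - by move=> n; apply: HC; rewrite ltr0n.
elim: k => [|k [C HC]].
  exists 1 => n n0; have [i _] := cut_Rintegral 0 s (@exprn_continuous R 0) (ltW n0).
  apply: le_trans (Ex_le i (int1_cst _ 1) _) _; last by rewrite Ex_cst.
  by move=> x; rewrite /cut expr0 mul1r indicE; case: (_ \in _).
exists (s ^+ 2 * (k.*2.+1%:R * C)) => n n0.
have H1 (x : R) : is_derive x (1 : R) (fun x => x ^+ k.*2.+1) (k.*2.+1%:R * x ^+ k.*2).
  by have := @is_deriveX _ R id k.*2.+1 x 1 1 (is_derive_id x 1); rewrite exprfctE /GRing.scale/= mulr1.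
have H2 : continuous (fun x : R => k.*2.+1%:R * x ^+ k.*2).
  by move=> x; apply: cvgM; [exact: cvg_cst|exact: exprn_continuous].
have -> : (fun x : R => x ^+ (k.+1).*2) = (fun x => x * x ^+ k.*2.+1).
  by apply/funext => x; rewrite doubleS !exprS.
rewrite (normal_cut_ibp H1 H2 n0).
apply: ler_wpM2l; first exact: sqr_ge0.
have [i _] := cut_Rintegral 0 s (@exprn_continuous R k.*2) (ltW n0).
have -> : cut n (fun x => k.*2.+1%:R * x ^+ k.*2) =
   (fun x => k.*2.+1%:R * cut n (fun x => x ^+ k.*2) x).
  by apply/funext => x; rewrite /cut mulrA.
rewrite ExZ//; have := ler_wpM2l (ler0n R k.*2.+1) (HC n n0).
have p1 : 0 <= n ^+ k.*2.+1 * pdf n by rewrite mulr_ge0 ?exprn_ge0 ?normal_pdf_ge0// ltW.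
have p2 : (- n) ^+ k.*2.+1 * pdf (- n) = - (n ^+ k.*2.+1 * pdf (- n)).
  by rewrite exprNn -signr_odd /= odd_double expr1 mulN1r mulNr.
have p3 : 0 <= n ^+ k.*2.+1 * pdf (- n).
  by rewrite mulr_ge0 ?exprn_ge0 ?normal_pdf_ge0// ltW.
rewrite p2; lra.
Qed.

Lemma moments_normal : moments N (fun x => x).
Proof.
split=> [|k]; first exact: measurable_id.
have [i _] := even_moment_normal k.
apply: (int1_le _ (int1D (int1_cst N 1) i)).
  apply: measurable_funX; exact: normr_measurable.
move=> x; rewrite normrX normr_id -mul2n exprM -(real_normK (num_real x)) -exprM.
have [x1|x1] := leP `|x| 1.
  by apply: le_trans (_ : 1 <= _); [exact: exprn_ile1|rewrite lerDl exprn_ge0].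
apply: le_trans (_ : `|x| ^+ (2 * k) <= _); last by rewrite lerDr.
by rewrite ler_weXn2l ?ltW//; lia.
Qed.

Definition growth1 (f : R -> R) := exists C k, forall x, `|f x| <= C * (1 + `|x|) ^+ k.

Lemma moments_growth1 (f : R -> R) : continuous f -> growth1 f -> moments N f.
Proof.
move=> cf [C [k h]].
apply: (@moments_le _ (measurableTypeR R) R N f (fun x => C * (1 + `|x|) ^+ k)).
- exact: continuous_measurable_fun.
- apply: momentsZ; apply: momentsX; apply: momentsD; first exact: moments_cst.
  exact/moments_norm/moments_normal.
- by move=> x; apply: le_trans (h x) (ler_norm _).
Qed.

Lemma growth1_pdf (f : R -> R) : growth1 f ->
  f n%:R * pdf n%:R @[n --> \oo] --> 0 /\ f (- n%:R) * pdf (- n%:R) @[n --> \oo] --> 0.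
Proof.
move=> [C [k h]].
have [D HD] := pdf_decay k.+1.
have C0 : 0 <= C.
  by have := h 0; rewrite normr0 addr0 expr1n mulr1; exact: le_trans.
have H (y : nat -> R) : (forall n, `|y n| = n%:R) -> f (y n) * pdf (y n) @[n --> \oo] --> 0.
  move=> yn; apply/norm_cvg0P.
  rewrite -(cvg_shiftS (fun n => `|f (y n) * pdf (y n)|)).
  have Hc : (C * 2 ^+ k * D) * n.+1%:R^-1 @[n --> \oo] --> 0.
    rewrite [X in _ --> X](_ : 0 = C * 2 ^+ k * D * 0); last by ring.
    apply: cvgM; first exact: cvg_cst.
    exact: cvg_harmonic.
  apply: squeeze0 Hc => n; rewrite normr_ge0/= normrM (ger0_norm (normal_pdf_ge0 _ _ _)).
  have n1 : (1 : R) <= n.+1%:R by rewrite ler1n.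
  have n0 : (0 : R) < n.+1%:R by rewrite ltr0n.
  rewrite ler_pdivlMr//.
  apply: le_trans (_ : C * (2 ^+ k * n.+1%:R ^+ k) * pdf (y n.+1) * n.+1%:R <= _).
    apply: ler_wpM2r; first exact: ltW.
    apply: ler_wpM2r; first exact: normal_pdf_ge0.
    apply: le_trans (h _) _; apply: ler_wpM2l => //; rewrite -exprMn yn.
    by rewrite lerXn2r ?nnegrE//; lra.
  rewrite -!mulrA; apply: ler_wpM2l => //; apply: ler_wpM2l; first exact: exprn_ge0.
  by have := HD (y n.+1); rewrite yn exprS; lra.
by split; apply: H => n; rewrite ?normrN normr_nat.
Qed.

Lemma Ex_cut_cvg (f : R -> R) : continuous f -> int1 N f ->
  Ex N (cut k%:R f) @[k --> \oo] --> Ex N f.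
Proof.
move=> cf iF; apply: (proj1 (Ex_dominated _ _ (int1_norm iF) _)).
- move=> n; apply: measurable_funM; last exact: measurable_indic.
  exact: continuous_measurable_fun.
- by move=> x; exact: cut_cvg.
- move=> n x; rewrite /cut normrM indicE.
  by case: (_ \in _); rewrite ?normr1 ?normr0 ?mulr1 ?mulr0.
Qed.

(** Stein's identity: in the truncated version the boundary terms vanish in the limit, polynomial
    growth losing against the density. *)
Lemma normal_ibp (f g : R -> R) : (forall x : R, is_derive x (1 : R) f (g x)) ->
  continuous g -> growth1 f -> growth1 g ->
  Ex N (fun x => x * f x) = s ^+ 2 * Ex N g.
Proof.
move=> hf cg gf gg; have cf : continuous f.
  by move=> x; apply: differentiable_continuous; apply/derivable1_diffP; case: (hf x).
have cx : continuous (fun x : R => x * f x)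
  by move=> x; apply: cvgM; [exact: cvg_id|exact: cf].
have mx : int1 N (fun x => x * f x).
  by apply/moments_int1/momentsM; [exact: moments_normal|exact: moments_growth1].
have mg : int1 N g by apply/moments_int1/moments_growth1.
have L := Ex_cut_cvg cx mx; have M := Ex_cut_cvg cg mg.
have [B1 B2] := growth1_pdf gf.
have L' : s ^+ 2 * (Ex N (cut k%:R g) - (f k%:R * pdf k%:R - f (- k%:R) * pdf (- k%:R)))
    @[k --> \oo] --> s ^+ 2 * (Ex N g - (0 - 0)).
  apply: cvgM; first exact: cvg_cst.
  by apply: cvgB => //; exact: cvgB.
rewrite subrr subr0 in L'.
apply: (cvg_unique _ L); first by [].
apply: cvg_near_ext L'; near=> k.
rewrite (normal_cut_ibp hf cg)// ltr0n; near: k; exact: nbhs_infty_gt.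
Unshelve. all: end_near. Qed.

End normal_law.

(** Truncated to [-n, n], [x - m] integrates to a difference of boundary values of the density,
    which tends to 0, whereas the limit is [- m]. *)
Lemma normal_mean0 (R : realType) (m s : R) : s != 0 ->
  int1 (normal_prob m s) (fun x => x) -> Ex (normal_prob m s) (fun x => x) = 0 -> m = 0.
Proof.
move=> s0 iid E0; pose N := normal_prob m s; pose pdf := normal_pdf m s.
have cm : continuous (fun x : R => x - m).
  by move=> x; apply: cvgB; [exact: cvg_id|exact: cvg_cst].
have cp : continuous pdf by exact: continuous_normal_pdf.
have im : int1 N (fun x => x - m) by apply: int1B => //; exact: int1_cst.
have cE n : 0 < n -> Ex N (cut n (fun x => x - m)) = - s ^+ 2 * (pdf n - pdf (- n)).
  move=> n0; have [_ ->] := cut_Rintegral m s cm (ltW n0).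
  have nn : - n < n by lra.
  pose g' x := - ((x - m) / s ^+ 2) * pdf x.
  have cg' : continuous g'.
    move=> x; apply: cvgM; last exact: cp.
    by apply: cvgN; apply: cvgM; [exact: cm|exact: cvg_cst].
  have c0 : continuous (fun _ : R => 0 : R) by move=> x; exact: cvg_cst.
  have E1 : {in `](- n), n[, derive1 (fun _ : R => 1 : R) =1 (fun=> 0)}.
    by move=> x _; rewrite derive1E; apply: derive_val.
  have E2 : {in `](- n), n[, derive1 pdf =1 g'}.
    by move=> x _; rewrite derive1E; case: (is_derive_pdf m s0 x).
  have := @Rintegration_by_parts R (fun=> 1) pdf (fun=> 0) g' (- n) n nn
    (continuous_subspaceT c0) (derive_oo_LRcontinuous _ _ (fun x => is_derive_cst (1 : R) x (1 : R)))
    E1 (continuous_subspaceT cg') (derive_oo_LRcontinuous _ _ (is_derive_pdf m s0)) E2.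
  under [X in _ = _ - X]eq_Rintegral do rewrite mul0r.
  rewrite Rintegral_cst//= mul0r subr0 !mul1r => <-.
  rewrite -RintegralZl//.
    apply: eq_Rintegral => x _; rewrite /g' /pdf mul1r; field.
    by rewrite s0.
  apply: continuous_compact_integrable; first exact: segment_compact.
  by apply: continuous_subspaceT => x; apply: cvgM; [exact: cvg_cst|exact: cg'].
have [C HC] := pdf_decay s0 1.
have pdfE x : pdf x = normal_pdf 0 s (x - m).
  by rewrite /pdf !normal_pdfE// /normal_fun subr0.
have plim (y : nat -> R) : (forall n, `|m| + n%:R <= `|y n|) -> pdf (y n) @[n --> \oo] --> 0.
  move=> yn; rewrite -(cvg_shiftS (fun n => pdf (y n))).
  have Hc : C * n.+1%:R^-1 @[n --> \oo] --> 0.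
    rewrite [X in _ --> X](_ : 0 = C * 0); last by ring.
    by apply: cvgM; [exact: cvg_cst|exact: cvg_harmonic].
  apply: squeeze0 Hc => n; rewrite normal_pdf_ge0/=.
  rewrite ler_pdivlMr ?ltr0n// pdfE mulrC; apply: le_trans (HC (y n.+1 - m)).
  rewrite expr1; apply: ler_wpM2r; first exact: normal_pdf_ge0.
  have := yn n.+1; have := ler_normD (y n.+1 - m) m; rewrite subrK; lra.
have L : Ex N (cut k%:R (fun x => x - m)) @[k --> \oo] --> Ex N (fun x => x - m).
  apply: (proj1 (Ex_dominated _ _ (int1_norm im) _)).
  - move=> n; apply: measurable_funM; last exact: measurable_indic.
    exact: continuous_measurable_fun.
  - by move=> x; exact: cut_cvg.
  - move=> n x; rewrite /cut normrM indicE.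
    by case: (_ \in _); rewrite ?normr1 ?normr0 ?mulr1 ?mulr0.
rewrite ExB// ?Ex_cst ?E0 in L; last exact: int1_cst.
(* The shift by [t >= |m|] keeps the points [n + t] and [- (n + t)] at distance at least [n] from
   the mean. *)
pose t := (Num.truncn `|m|).+1.
have tm : `|m| <= t%:R by exact/ltW/truncnS_gt.
have yt n : `|m| + n%:R <= `|(n + t)%:R : R|.
  by rewrite normr_nat natrD addrC lerD2l.
have B1 := plim (fun n => (n + t)%:R) yt.
have B2 : pdf (- (n + t)%:R) @[n --> \oo] --> 0.
  by apply: (plim (fun n => - (n + t)%:R)) => n; rewrite normrN.
have L2 : Ex N (cut (n + t)%:R (fun x => x - m)) @[n --> \oo] --> 0.
  have : - s ^+ 2 * (pdf (n + t)%:R - pdf (- (n + t)%:R)) @[n --> \oo] --> - s ^+ 2 * (0 - 0).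
    by apply: cvgM; [exact: cvg_cst|exact: cvgB].
  rewrite subrr mulr0; apply: cvg_ext => n; rewrite cE// ltr0n /t; lia.
have L3 : Ex N (cut (n + t)%:R (fun x => x - m)) @[n --> \oo] --> 0 - m.
  by rewrite (cvg_shiftn t (fun n => Ex N (cut n%:R (fun x => x - m)))).
have := cvg_lim (@Rhausdorff R) L2; rewrite (cvg_lim (@Rhausdorff R) L3).
by move=> /(_ _)/eqP; rewrite sub0r oppr_eq0 => /eqP.
Qed.

(** * Approximation by trigonometric sums *)

Section stone_weierstrass.
Context {R : realType} {T : ptopologicalType}.
Implicit Types f g : T -> R.

Lemma uniform_limit_continuous f :
  (forall e, 0 < e -> exists2 g, continuous g & forall x, `|f x - g x| <= e) ->
  continuous f.
Proof.
move=> h x; apply/cvgrPdist_le => e e0.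
have [g cg hg] := h (e / 3) (ltac:(by rewrite divr_gt0)).
have e3 : 0 < e / 3 by rewrite divr_gt0.
have /cvgrPdist_le/(_ _ e3) := cg x.
apply: filterS => y; have := hg x; have := hg y; rewrite !ler_norml; lra.
Qed.

Variable S : set (T -> R).
Hypothesis S_cst : forall c, S (fun=> c).
Hypothesis S_add : forall f g, S f -> S g -> S (fun x => f x + g x).
Hypothesis S_mul : forall f g, S f -> S g -> S (fun x => f x * g x).
Hypothesis S_continuous : forall f, S f -> continuous f.
Hypothesis S_bounded : forall f, S f -> exists M, forall x, `|f x| <= M.

(** Approximation is uniform on the whole space, so that global bounds survive; compactness enters
    only when [g] is compared on [K]. *)
Definition uniformly_approximable f :=
  forall e, 0 < e -> exists2 g, S g & forall x, `|f x - g x| <= e.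

Local Notation UA := uniformly_approximable.

Lemma UA_S f : S f -> UA f.
Proof. by move=> Sf e e0; exists f => // x; rewrite subrr normr0 ltW. Qed.

Lemma UA_continuous f : UA f -> continuous f.
Proof.
move=> h; apply: uniform_limit_continuous => e e0.
by have [g /S_continuous cg hg] := h e e0; exists g.
Qed.

Lemma UA_bounded f : UA f -> exists2 M, 0 < M & forall x, `|f x| <= M.
Proof.
move=> h; have [g /S_bounded [M HM] hg] := h 1 ltr01.
exists (`|M| + 1) => [|x]; first by rewrite ltr_wpDl.
apply: le_trans (_ : `|g x| + `|f x - g x| <= _).
  by rewrite -[X in `|X| <= _](subrK (g x)) addrC ler_normD.
by apply: lerD => //; apply: le_trans (HM x) (ler_norm _).
Qed.

Lemma UA_lim f : (forall e, 0 < e -> exists2 g, UA g & forall x, `|f x - g x| <= e) -> UA f.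
Proof.
move=> h e e0; have e2 : 0 < e / 2 by rewrite divr_gt0.
have [g hg fg] := h _ e2; have [k Sk gk] := hg _ e2; exists k => // x.
by have := fg x; have := gk x; rewrite !ler_norml; lra.
Qed.

Lemma UA_add f g : UA f -> UA g -> UA (fun x => f x + g x).
Proof.
move=> hf hg e e0; have e2 : 0 < e / 2 by rewrite divr_gt0.
have [f' Sf ff'] := hf _ e2; have [g' Sg gg'] := hg _ e2.
exists (fun x => f' x + g' x); first exact: S_add.
by move=> x; have := ff' x; have := gg' x; rewrite !ler_norml; lra.
Qed.

Lemma UA_mul f g : UA f -> UA g -> UA (fun x => f x * g x).
Proof.
move=> hf hg; have [M M0 HM] := UA_bounded hf; have [M' M'0 HM'] := UA_bounded hg.
move=> e e0; pose e1 := Num.min 1 (e / (M + M' + 1)).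
have D0 : 0 < M + M' + 1 by lra.
have e10 : 0 < e1 by rewrite lt_min ltr01 divr_gt0.
have [f' Sf ff'] := hf _ e10; have [g' Sg gg'] := hg _ e10.
exists (fun x => f' x * g' x); first exact: S_mul.
move=> x; have -> : f x * g x - f' x * g' x =
   f x * (g x - g' x) + g x * (f x - f' x) - (f x - f' x) * (g x - g' x) by ring.
apply: le_trans (ler_normB _ _) _.
apply: le_trans (lerD (ler_normD _ _) (lexx _)) _; rewrite !normrM.
have e11 : e1 <= 1 by rewrite ge_min lexx.
have e1e : e1 * (M + M' + 1) <= e by rewrite -ler_pdivlMr// ge_min lexx orbT.
have A := ler_pM (normr_ge0 _) (normr_ge0 _) (HM x) (gg' x).
have B := ler_pM (normr_ge0 _) (normr_ge0 _) (HM' x) (ff' x).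
have C := ler_pM (normr_ge0 _) (normr_ge0 _) (ff' x) (gg' x).
have D : e1 * e1 <= 1 * e1 by rewrite ler_wpM2r// ltW.
lra.
Qed.

Lemma UA_cst c : UA (fun=> c). Proof. exact/UA_S/S_cst. Qed.

Lemma UA_scale c f : UA f -> UA (fun x => c * f x).
Proof. by move=> hf; apply: UA_mul => //; exact: UA_cst. Qed.

(* The iteration p_(n+1) = p_n + (y^2 - p_n^2) / 2 converges to |y| on [-1, 1]. *)
Fixpoint abs_approx (n : nat) (y : R) : R :=
  if n is m.+1 then abs_approx m y + (y ^+ 2 - abs_approx m y ^+ 2) / 2 else 0.

Lemma abs_approxP n (y : R) : `|y| <= 1 ->
  0 <= abs_approx n y <= `|y| /\ (`|y| - abs_approx n y) * n.+1%:R <= 2.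
Proof.
move=> y1; have y0 := normr_ge0 y.
have yy : y ^+ 2 = `|y| ^+ 2 by rewrite real_normK// num_real.
elim: n => [|n [/andP[IH1 IH2] IH3]] /=.
  by rewrite lexx y0 subr0 mulr1; split=> //; lra.
rewrite yy; move: (abs_approx n y) (`|y|) y1 y0 IH1 IH2 IH3 => p a a1 a0 p0 pa IH3.
have E : a - (p + (a ^+ 2 - p ^+ 2) / 2) = (a - p) * (1 - (a + p) / 2) by field.
have F : 0 <= (a - p) * (1 - (a + p) / 2).
  by rewrite mulr_ge0// ?subr_ge0//; lra.
split; first by apply/andP; split; [nra|rewrite -subr_ge0 E].
rewrite E.
have G : (a - p) * (1 - (a + p) / 2) <= (a - p) * (1 - (a - p) / 2).
  by apply: ler_wpM2l; lra.
apply: le_trans (_ : (a - p) * (1 - (a - p) / 2) * n.+2%:R <= 2).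
  by apply: ler_wpM2r.
have : 0 <= a - p <= 1 by apply/andP; split; lra.
move: (a - p) IH3 => t IH3 /andP[t0 t1].
rewrite -[n.+2%:R]natr1; have n0 : (1 : R) <= n.+1%:R by rewrite ler1n.
move: n.+1%:R n0 IH3 => m m1 IH3.
have : 0 <= (1 - t) * (2 - t * m) by rewrite mulr_ge0// subr_ge0.
by have := mulr_ge0 t0 t0; nra.
Qed.

Lemma UA_abs_approx n f : UA f -> UA (fun x => abs_approx n (f x)).
Proof.
move=> hf; elim: n => [|n IH] /=; first exact: UA_cst.
have -> : (fun x => abs_approx n (f x) + (f x ^+ 2 - abs_approx n (f x) ^+ 2) / 2) =
  (fun x => abs_approx n (f x) + 2^-1 * (f x * f x + (-1) * (abs_approx n (f x) * abs_approx n (f x)))).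
  by apply/funext => x; field.
apply: UA_add => //; apply: UA_scale; apply: UA_add; first exact: UA_mul.
by apply: UA_scale; exact: UA_mul.
Qed.

Lemma UA_norm f : UA f -> UA (fun x => `|f x|).
Proof.
move=> hf; have [M M0 HM] := UA_bounded hf; apply: UA_lim => e e0.
pose n := Num.truncn (2 * M / e).
exists (fun x => M * abs_approx n (M^-1 * f x)).
  by apply: UA_scale; apply: UA_abs_approx; exact: UA_scale.
move=> x; have y1 : `|M^-1 * f x| <= 1.
  by rewrite normrM gtr0_norm ?invr_gt0// mulrC ler_pdivrMr// mul1r.
have [/andP[p0 p1] p2] := abs_approxP n y1.
have -> : `|f x| = M * `|M^-1 * f x|.
  by rewrite normrM gtr0_norm ?invr_gt0// mulVKf// gt_eqF.
move: (abs_approx n _) (`|M^-1 * f x|) y1 p0 p1 p2 => p a a1 p0 p1 p2.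
rewrite -mulrBr ger0_norm ?mulr_ge0 ?subr_ge0// ?(ltW M0)//.
have n0 : (0 : R) < n.+1%:R by rewrite ltr0n.
rewrite -(ler_pM2r n0) -mulrA; apply: le_trans (_ : M * 2 <= _).
  by apply: ler_wpM2l => //; exact: ltW.
have := truncnS_gt (2 * M / e); rewrite ltr_pdivrMr// -/n; lra.
Qed.

Lemma UA_max f g : UA f -> UA g -> UA (fun x => Num.max (f x) (g x)).
Proof.
move=> hf hg; have -> : (fun x => Num.max (f x) (g x)) =
  (fun x => 2^-1 * ((f x + g x) + `|f x + (-1) * g x|)).
  apply/funext => x; by rewrite mulN1r maxr_absE; field.
apply: UA_scale; apply: UA_add; first exact: UA_add.
by apply: UA_norm; apply: UA_add => //; exact: UA_scale.
Qed.

Lemma UA_min f g : UA f -> UA g -> UA (fun x => Num.min (f x) (g x)).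
Proof.
move=> hf hg; have -> : (fun x => Num.min (f x) (g x)) =
  (fun x => (-1) * Num.max ((-1) * f x) ((-1) * g x)).
  by apply/funext => x; rewrite !mulN1r -oppr_min opprK.
by apply: UA_scale; apply: UA_max; exact: UA_scale.
Qed.

Variable K : set T.
Hypothesis K_compact : compact K.
Hypothesis S_separates : forall x y, K x -> K y -> x <> y ->
  exists2 f, S f & f x <> f y.

Lemma UA_interpolate x y a b : K x -> K y -> (x = y -> a = b) ->
  exists2 f, UA f & f x = a /\ f y = b.
Proof.
move=> Kx Ky ab; have [xy|xy] := EM (x = y).
  by exists (fun=> a); [exact: UA_cst|rewrite -ab].
have [f Sf fxy] := S_separates Kx Ky xy.
have d0 : f x - f y != 0 by rewrite subr_eq0; apply/eqP.
exists (fun z => b + ((a - b) / (f x - f y)) * (f z + (- f y))).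
  apply: UA_add; first exact: UA_cst.
  by apply: UA_scale; apply: UA_add; [exact: UA_S|exact: UA_cst].
split; first by rewrite divfK// addrC subrK.
by rewrite subrr mulr0 addr0.
Qed.

Lemma compact_cover_fin (U : T -> set T) :
  (forall x, K x -> open (U x)) -> (forall x, K x -> U x x) ->
  exists2 s : seq T, (forall x, x \in s -> K x) & forall x, K x -> exists2 y, y \in s & U y x.
Proof.
move=> oU Ux; have := K_compact; rewrite compact_cover.
move=> /(_ T K U oU) []; first by move=> x Kx; exists x => //; exact: Ux.
move=> D DK KD; exists (finmap.enum_fset D).
  by move=> x xD; have := DK x xD; rewrite inE.
by move=> x /KD [y yD Uyx]; exists y.
Qed.

(** The lattice argument: for each point of [K] a finite maximum of interpolating functions stays
    above [g - e] on [K], then a finite minimum of such functions stays below [g + e] as well. *)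
Theorem stone_weierstrass g e : continuous g -> 0 < e ->
  exists2 f, UA f & forall x, K x -> `|f x - g x| <= e.
Proof.
move=> cg e0.
have openlt (f h : T -> R) c : continuous f -> continuous h -> open [set z | f z - h z < c].
  move=> cf ch; apply: (open_comp (f := fun z => f z - h z) (D := [set t | t < c])).
    by move=> z _; apply: cvgB; [exact: cf|exact: ch].
  exact: open_lt.
have opengt (f h : T -> R) c : continuous f -> continuous h -> open [set z | c < f z - h z].
  move=> cf ch; apply: (open_comp (f := fun z => f z - h z) (D := [set t | c < t])).
    by move=> z _; apply: cvgB; [exact: cf|exact: ch].
  exact: open_gt.
have step1 x : K x -> exists2 f, UA f & f x <= g x + e / 2 /\ forall z, K z -> g z - e < f z.
  move=> Kx.
  have H y : exists f, K y -> [/\ UA f, f x = g x & f y = g y].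
    have [Ky|nKy] := EM (K y); last by exists g.
    by have [f Uf [fx fy]] := UA_interpolate Kx Ky (fun E => congr1 g E); exists f.
  have [F HF] := choice H.
  have [s sK Hs] : exists2 s : seq T, (forall y, y \in s -> K y) &
      forall z, K z -> exists2 y, y \in s & - e < F y z - g z.
    have := @compact_cover_fin (fun y => [set z | - e < F y z - g z]).
    apply.
      by move=> y Ky; apply: opengt => //; apply: UA_continuous; case: (HF y Ky).
    by move=> y Ky /=; have [_ _ ->] := HF y Ky; rewrite subrr oppr_lt0.
  have : exists2 f, UA f & f x <= g x + e / 2 /\
      forall z, (exists2 y, y \in s & - e < F y z - g z) -> - e < f z - g z.
    elim: s sK {Hs} => [|y s IH] sK.
      exists (fun=> g x); first exact: UA_cst.
      by split; [rewrite lerDl divr_ge0// ltW|move=> z [y]].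
    have [f Uf [fx Hf]] := IH (fun y ys => sK y (ltac:(by rewrite inE ys orbT))).
    have [UF Fx Fy] := HF y (sK y (mem_head _ _)).
    exists (fun z => Num.max (F y z) (f z)); first exact: UA_max.
    split; first by rewrite ge_max fx Fx lerDl divr_ge0// ltW.
    move=> z [y']; rewrite inE => /orP[/eqP ->|ys] H'.
      by apply: lt_le_trans H' _; rewrite lerD2r le_max lexx.
    apply: lt_le_trans (Hf z _) _; first by exists y'.
    by rewrite lerD2r le_max lexx orbT.
  move=> [f Uf [fx Hf]]; exists f => //; split=> // z Kz.
  by have := Hf z (Hs z Kz); lra.
have H x : exists f, K x -> [/\ UA f, f x <= g x + e / 2 & forall z, K z -> g z - e < f z].
  have [Kx|nKx] := EM (K x); last by exists g.
  by have [f Uf [fx Hf]] := step1 x Kx; exists f.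
have [F HF] := choice H.
have [s sK Hs] : exists2 s : seq T, (forall y, y \in s -> K y) &
    forall z, K z -> exists2 y, y \in s & F y z - g z < e.
  have := @compact_cover_fin (fun y => [set z | F y z - g z < e]).
  apply.
    by move=> y Ky; apply: openlt => //; apply: UA_continuous; case: (HF y Ky).
  by move=> y Ky /=; have [_ Fy _] := HF y Ky; lra.
have : exists2 f, UA f & (forall z, K z -> g z - e < f z) /\
    forall z, (exists2 y, y \in s & F y z - g z < e) -> f z - g z < e.
  elim: s sK {Hs} => [|y s IH] sK.
    have [M HM] : exists M, forall z, K z -> g z <= M.
      have [M [Mr HM]] : bounded_set (g @` K).
        apply: compact_bounded; apply: continuous_compact => //.
        exact: continuous_subspaceT.
      exists (`|M| + 1) => z Kz; apply: le_trans (ler_norm _) (HM _ _ _ _).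
        by rewrite (le_lt_trans (ler_norm M))// ltrDl.
      by exists z.
    exists (fun=> M); first exact: UA_cst.
    by split; [move=> z Kz; have := HM z Kz; lra|move=> z [y]].
  have [f Uf [fx Hf]] := IH (fun y ys => sK y (ltac:(by rewrite inE ys orbT))).
  have [UF Fx Fy] := HF y (sK y (mem_head _ _)).
  exists (fun z => Num.min (F y z) (f z)); first exact: UA_min.
  split; first by move=> z Kz; rewrite lt_min Fy// fx.
  move=> z [y']; rewrite inE => /orP[/eqP ->|ys] H'.
    by apply: le_lt_trans H'; rewrite lerD2r ge_min lexx.
  apply: le_lt_trans (Hf z _); first by rewrite lerD2r ge_min lexx orbT.
  by exists y'.
move=> [f Uf [f1 f2]]; exists f => // z Kz.
by have := f1 z Kz; have := f2 z (Hs z Kz); rewrite ler_norml => ? ?; apply/andP; split; lra.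
Qed.

(* Clamping keeps the approximation globally bounded, which polynomials in the
   generators of [S] are not uniformly. *)
Corollary stone_weierstrass_bounded g M e : continuous g -> 0 < e ->
  (forall x, `|g x| <= M) ->
  exists f, [/\ S f, forall x, K x -> `|f x - g x| <= e & forall x, `|f x| <= M + e].
Proof.
move=> cg e0 gM; have e2 : 0 < e / 2 by rewrite divr_gt0.
have [f Uf fg] := stone_weierstrass cg e2.
pose h x := Num.max (- M) (Num.min M (f x)).
have Uh : UA h by apply: UA_max; [exact: UA_cst|apply: UA_min => //; exact: UA_cst].
have [k Sk hk] := Uh _ e2; exists k; split=> // x.
  move=> Kx; have := hk x; have := fg x Kx; have := gM x; rewrite /h !ler_norml.
  move=> /andP[g1 g2] /andP[f1 f2].
  have c1 : g x - e / 2 <= Num.max (- M) (Num.min M (f x)).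
    by rewrite le_max le_min; apply/orP; right; apply/andP; split; lra.
  have c2 : Num.max (- M) (Num.min M (f x)) <= g x + e / 2.
    by rewrite ge_max ge_min; apply/andP; split; [lra|apply/orP; right; lra].
  by lra.
have M0 : 0 <= M := le_trans (normr_ge0 _) (gM x).
have c1 : - M <= h x by rewrite le_max lexx.
have c2 : h x <= M by rewrite ge_max ge_min lexx andbT; lra.
by have := hk x; rewrite !ler_norml; lra.
Qed.

End stone_weierstrass.

Section trigonometric_sums.
Context {R : realType} {T : ptopologicalType} {V : lmodType R}.
Variable l : V -> T -> R.
Hypothesis lD : forall s t x, l (s + t) x = l s x + l t x.
Hypothesis lZ : forall c t x, l (c *: t) x = c * l t x.
Hypothesis l_continuous : forall t, continuous (l t).
Hypothesis l_separates : forall x y, x <> y -> exists t, l t x <> l t y.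
Variable K : nat -> set T.
Hypothesis K_compact : forall n, compact (K n).
Hypothesis K_exhausts : forall x, \forall n \near \oo, K n x.

(** The phase [z.2] includes sines and makes the class stable under products, by the formula for cos
    a cos b. *)
Definition trig_sum (s : seq (R * V * R)) (x : T) : R :=
  \sum_(z <- s) z.1.1 * cos (l z.1.2 x + z.2).

Definition trig : set (T -> R) := [set f | exists s, f = trig_sum s].

Lemma trig_cst c : trig (fun=> c).
Proof.
exists [:: (c, 0, 0)]; apply/funext => x; rewrite /trig_sum big_seq1/= addr0.
by have := lZ 0 0 x; rewrite scale0r mul0r => ->; rewrite cos0 mulr1.
Qed.

Lemma trig_add f g : trig f -> trig g -> trig (fun x => f x + g x).
Proof.
move=> [s ->] [t ->]; exists (s ++ t); apply/funext => x.
by rewrite /trig_sum big_cat.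
Qed.

Lemma trig_mul f g : trig f -> trig g -> trig (fun x => f x * g x).
Proof.
move=> [s ->] [t ->].
exists ([seq (z.1.1 * w.1.1 / 2, z.1.2 + w.1.2, z.2 + w.2) | z <- s, w <- t] ++
        [seq (z.1.1 * w.1.1 / 2, z.1.2 - w.1.2, z.2 - w.2) | z <- s, w <- t]).
apply/funext => x; rewrite /trig_sum big_cat/= !big_allpairs_dep/=.
rewrite mulr_suml -big_split/=; apply: eq_bigr => z _.
rewrite mulr_sumr -big_split/=; apply: eq_bigr => w _.
have lN : l (- w.1.2) x = - l w.1.2 x by rewrite -scaleN1r lZ mulN1r.
rewrite !lD lN.
set a := l z.1.2 x; set b := l w.1.2 x.
have -> : a + b + (z.2 + w.2) = (a + z.2) + (b + w.2) by ring.
have -> : a - b + (z.2 - w.2) = (a + z.2) - (b + w.2) by ring.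
by rewrite cosB (cosD (a + z.2) (b + w.2)); field.
Qed.

Lemma trig_continuous f : trig f -> continuous f.
Proof.
move=> [s ->]; elim: s => [|z s IH] x.
  by rewrite /trig_sum; under eq_fun do rewrite big_nil; exact: cvg_cst.
have -> : trig_sum (z :: s) = (fun x => z.1.1 * cos (l z.1.2 x + z.2) + trig_sum s x).
  by apply/funext => y; rewrite /trig_sum big_cons.
apply: cvgD; last exact: IH.
apply: cvgM; first exact: cvg_cst.
apply: (@continuous_comp _ _ _ (fun x => l z.1.2 x + z.2) cos); last exact: continuous_cos.
by apply: cvgD; [exact: l_continuous|exact: cvg_cst].
Qed.

Lemma trig_bounded f : trig f -> exists M, forall x, `|f x| <= M.
Proof.
move=> [s ->]; exists (\sum_(z <- s) `|z.1.1|) => x.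
apply: le_trans (ler_norm_sum _ _ _) _; apply: ler_sum => z _.
by rewrite normrM ler_piMr// ler_norml cos_geN1 cos_le1.
Qed.

Lemma trig_separates x y : x <> y -> exists2 f, trig f & f x <> f y.
Proof.
move=> /l_separates [t lt].
have d0 : l t y - l t x != 0 by rewrite subr_eq0; apply/eqP => e; exact: lt.
(* This scaling puts the two phases a quarter turn apart, with values 1 and 0. *)
pose c := pi / 2 / (l t y - l t x).
exists (trig_sum [:: (1, c *: t, - (c * l t x))]); first by eexists.
rewrite /trig_sum !big_seq1/= !lZ !mul1r subrr -mulrBr divfK// cos0 cos_pihalf.
by apply/eqP; rewrite oner_eq0.
Qed.

Lemma trig_dense (g : T -> R) (M e : R) n : continuous g -> 0 < e -> (forall x, `|g x| <= M) ->
  exists f, [/\ trig f, forall x, K n x -> `|f x - g x| <= e & forall x, `|f x| <= M + e].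
Proof.
move=> cg e0 gM; apply: stone_weierstrass_bounded => //.
- exact: trig_cst.
- exact: trig_add.
- exact: trig_mul.
- exact: trig_continuous.
- exact: trig_bounded.
- by move=> x y _ _; exact: trig_separates.
Qed.

(** Approximation within [1 / (n + 1)] on [K n] yields a bounded pointwise approximation, the form
    that dominated convergence uses. *)
Lemma trig_approx (g : T -> R) (M : R) : continuous g -> (forall x, `|g x| <= M) ->
  exists f : nat -> T -> R, [/\ forall n, trig (f n),
    forall x, f n x @[n --> \oo] --> g x & forall n x, `|f n x| <= M + 1].
Proof.
move=> cg gM.
have H n : exists f, [/\ trig f, forall x, K n x -> `|f x - g x| <= n.+1%:R^-1 &
    forall x, `|f x| <= M + n.+1%:R^-1].
  by apply: trig_dense => //; rewrite invr_gt0 ltr0n.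
have [F HF] := choice H; exists F; split.
- by move=> n; case: (HF n).
- move=> x; apply/subr_cvg0/norm_cvg0P.
  apply: (@squeeze0_near _ _ (fun n => n.+1%:R^-1)); last exact: cvg_harmonic.
  apply: filterS (K_exhausts x) => n Kx; rewrite normr_ge0/=.
  by have [_ h _] := HF n; exact: h.
- move=> n x; have [_ _ h] := HF n; apply: le_trans (h x) _.
  by rewrite lerD2l invf_le1// ler1n.
Qed.

Definition clamp (n : nat) (y : R) : R := Num.max (- n%:R) (Num.min n%:R y).

Lemma clamp_le n y : `|clamp n y| <= n%:R.
Proof.
rewrite /clamp ler_norml le_max lexx/= ge_max ge_min lexx/= andbT.
by have : (0 : R) <= n%:R by []; lra.
Qed.

Lemma clamp_norm n y : `|clamp n y| <= `|y|.
Proof.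
have n0 : (0 : R) <= n%:R by [].
have := ler_norm y; have := ler_norm (- y); rewrite normrN => h1 h2.
rewrite /clamp ler_norml le_max le_min ge_max ge_min.
have y0 := normr_ge0 y; apply/andP; split; first by apply/orP; right; apply/andP; split; lra.
by apply/andP; split; [lra|apply/orP; right].
Qed.

Lemma clamp_id n y : `|y| <= n%:R -> clamp n y = y.
Proof.
rewrite ler_norml => /andP[h1 h2]; rewrite /clamp.
by rewrite (min_idPr _)// (max_idPr _).
Qed.

Lemma clamp_cvg y : clamp n y @[n --> \oo] --> y.
Proof.
apply: cvg_near_cst; near=> n; apply: clamp_id; near: n; exact: nbhs_infty_ger.
Unshelve. all: end_near. Qed.

Lemma clamp_continuous n (g : T -> R) : continuous g -> continuous (fun x => clamp n (g x)).
Proof.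
move=> cg x; apply: (@continuous_max _ _ (fun=> _) (fun x => Num.min _ (g x))).
  exact: cvg_cst.
by apply: (@continuous_min _ _ (fun=> _) g); [exact: cvg_cst|exact: cg].
Qed.

Section one_space.
Context d (Om : measurableType d) (X : Om -> T).
Hypothesis X_measurable : forall t, measurable_fun setT (fun w => l t (X w)).

Lemma measurable_trig f : trig f -> measurable_fun setT (fun w => f (X w)).
Proof.
move=> [s ->]; rewrite /trig_sum.
apply: measurable_sum => z; apply: measurable_funM => //.
by apply: measurable_fun_cos; apply: measurable_funD.
Qed.

(** Measurability is only known for the linear forms of [X]; a clamped continuous function is a
    pointwise limit of trigonometric sums, measurable through these forms. *)
Lemma measurable_continuous (g : T -> R) : continuous g -> measurable_fun setT (fun w => g (X w)).
Proof.
move=> cg; apply: (measurable_fun_cvg (h := fun n w => clamp n (g (X w)))); last first.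
  by move=> w _; exact: clamp_cvg.
move=> n; have [f [tf cf _]] := trig_approx (clamp_continuous (n := n) cg) (fun x => clamp_le n _).
apply: (measurable_fun_cvg (h := fun k w => f k (X w))); last by move=> w _; exact: cf.
by move=> k; exact: measurable_trig.
Qed.

End one_space.

Context d d' (Om : measurableType d) (Om' : measurableType d').
Variables (P : probability Om R) (P' : probability Om' R) (X : Om -> T) (X' : Om' -> T).
Hypothesis mX : forall t, measurable_fun setT (fun w => l t (X w)).
Hypothesis mX' : forall t, measurable_fun setT (fun w => l t (X' w)).
Hypothesis same_cos : forall t b,
  Ex P (fun w => cos (l t (X w) + b)) = Ex P' (fun w => cos (l t (X' w) + b)).

Lemma same_law_trig f : trig f -> Ex P (fun w => f (X w)) = Ex P' (fun w => f (X' w)).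
Proof.
move=> [s ->]; rewrite /trig_sum.
have i t b : int1 P (fun w => cos (l t (X w) + b)).
  apply: (@int1_bounded _ _ _ _ _ 1) => //; last by move=> w; exact: cos_max.
  by apply: measurable_fun_cos; exact: measurable_funD.
have i' t b : int1 P' (fun w => cos (l t (X' w) + b)).
  apply: (@int1_bounded _ _ _ _ _ 1) => //; last by move=> w; exact: cos_max.
  by apply: measurable_fun_cos; exact: measurable_funD.
rewrite !Ex_sum; last 2 first.
- by move=> z; exact: int1Z.
- by move=> z; exact: int1Z.
by apply: eq_bigr => z _; rewrite !ExZ// same_cos.
Qed.

Lemma same_law_bounded (g : T -> R) (M : R) : continuous g -> (forall x, `|g x| <= M) ->
  Ex P (fun w => g (X w)) = Ex P' (fun w => g (X' w)).
Proof.
move=> cg gM; have [f [tf cf fM]] := trig_approx cg gM.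
have [c1 _] := @Ex_dominated _ _ _ P (fun n w => f n (X w)) (fun w => g (X w)) (fun=> M + 1)
  (fun n => measurable_trig mX (tf n)) (fun w => cf (X w)) (int1_cst _ _) (fun n w => fM n _).
have [c2 _] := @Ex_dominated _ _ _ P' (fun n w => f n (X' w)) (fun w => g (X' w)) (fun=> M + 1)
  (fun n => measurable_trig mX' (tf n)) (fun w => cf (X' w)) (int1_cst _ _) (fun n w => fM n _).
apply: (cvg_unique _ c1) => //.
have -> : (fun n => Ex P (fun w => f n (X w))) = (fun n => Ex P' (fun w => f n (X' w))).
  by apply/funext => n; exact: same_law_trig.
exact: c2.
Qed.

(** The Cramer-Wold principle: equality on cosines of linear forms extends to trigonometric sums, to
    bounded continuous functions by [trig_approx], and to integrable ones by clamping. Fatou's lemma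
    gives integrability on the second space. *)
Theorem same_law (g : T -> R) : continuous g -> int1 P (fun w => g (X w)) ->
  int1 P' (fun w => g (X' w)) /\ Ex P (fun w => g (X w)) = Ex P' (fun w => g (X' w)).
Proof.
move=> cg ig.
have mg := measurable_continuous mX cg; have mg' := measurable_continuous mX' cg.
have cn : continuous (fun x => `|g x|).
  by move=> x; apply: (@continuous_comp _ _ _ g Num.norm); [exact: cg|exact: norm_continuous].
have ig' : int1 P' (fun w => g (X' w)).
  have : int1 P' (fun w => `|g (X' w)|).
    apply: (@int1_fatou _ _ _ P' (fun n w => `|clamp n `|g (X' w)| |) _ (Ex P (fun w => `|g (X w)|))).
    - move=> n; apply: (@int1_bounded _ _ _ _ _ n%:R).
        apply: measurableT_comp => //.
        exact: (measurable_continuous (g := fun x => clamp n `|g x|) mX' (clamp_continuous (n := n) cn)).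
      by move=> w; rewrite normr_id clamp_le.
    - by [].
    - move=> w; have := @clamp_cvg `|g (X' w)| => /cvg_norm; by rewrite normr_id.
    - move=> n; have cc : continuous (fun x => `|clamp n `|g x| |).
        move=> x; apply: (@continuous_comp _ _ _ (fun x => clamp n `|g x|) Num.norm).
          exact: clamp_continuous.
        exact: norm_continuous.
      rewrite -(same_law_bounded (g := fun x => `|clamp n `|g x| |) (M := n%:R) cc); last first.
        by move=> x; rewrite normr_id clamp_le.
      apply: Ex_le; [|exact: int1_norm|]; last first.
        by move=> w; apply: le_trans (clamp_norm _ _) _; rewrite normr_id.
      apply: (@int1_bounded _ _ _ _ _ n%:R); first exact: (measurable_continuous mX cc).
      by move=> w; rewrite normr_id clamp_le.
  by move=> H; apply: int1_le mg' H _.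
split=> //.
have [c1 _] := @Ex_dominated _ _ _ P (fun n w => clamp n (g (X w))) (fun w => g (X w))
  (fun w => `|g (X w)|) (fun n => measurable_continuous mX (clamp_continuous (n := n) cg))
  (fun w => @clamp_cvg _) (int1_norm ig) (fun n w => clamp_norm n _).
have [c2 _] := @Ex_dominated _ _ _ P' (fun n w => clamp n (g (X' w))) (fun w => g (X' w))
  (fun w => `|g (X' w)|) (fun n => measurable_continuous mX' (clamp_continuous (n := n) cg))
  (fun w => @clamp_cvg _) (int1_norm ig') (fun n w => clamp_norm n _).
apply: (cvg_unique _ c1) => //.
have -> : (fun n => Ex P (fun w => clamp n (g (X w)))) = (fun n => Ex P' (fun w => clamp n (g (X' w)))).
  apply/funext => n; apply: (same_law_bounded (g := fun x => clamp n (g x)) (M := n%:R)).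
    exact: clamp_continuous.
  by move=> x; exact: clamp_le.
exact: c2.
Qed.

End trigonometric_sums.

(** * Linear forms on row vectors *)

Section row_vectors.
Context {R : realType} {m : nat}.

Definition dotrow (t x : 'rV[R]_m) : R := \sum_(j < m) t 0 j * x 0 j.

Lemma dotrowD s t x : dotrow (s + t) x = dotrow s x + dotrow t x.
Proof. by rewrite -big_split; apply: eq_bigr => j _; rewrite mxE mulrDl. Qed.

Lemma dotrowZ c t x : dotrow (c *: t) x = c * dotrow t x.
Proof. by rewrite mulr_sumr; apply: eq_bigr => j _; rewrite mxE mulrA. Qed.

Lemma dotrow_continuous t : continuous (dotrow t).
Proof.
move=> x; rewrite /dotrow; elim: (index_enum _) => [|j r IH].
  have -> : (fun y : 'rV[R]_m => \sum_(j <- [::]) t 0 j * y 0 j) = fun=> 0.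
    by apply/funext => y; rewrite big_nil.
  exact: cst_continuous.
have -> : (fun y : 'rV[R]_m => \sum_(i <- j :: r) t 0 i * y 0 i) =
    (fun y => t 0 j * y 0 j + \sum_(i <- r) t 0 i * y 0 i).
  by apply/funext => y; rewrite big_cons.
apply: (continuousD (f := fun y : 'rV[R]_m => t 0 j * y 0 j)); last exact: IH.
apply: (continuousM (s := fun y : 'rV[R]_m => t 0 j)); first exact: cst_continuous.
exact: coord_continuous.
Qed.

Lemma dotrow_separates (x y : 'rV[R]_m) : x <> y -> exists t, dotrow t x <> dotrow t y.
Proof.
move=> xy; apply: contrapT => /forallNP H; apply: xy; apply/rowP => j.
have dE (z : 'rV[R]_m) : dotrow (delta_mx 0 j) z = z 0 j.
  rewrite /dotrow (bigD1 j)//= mxE !eqxx mul1r big1 ?addr0// => i ij.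
  by rewrite mxE eqxx (negPf ij) mul0r.
by have := H (delta_mx 0 j) => /contrapT; rewrite !dE.
Qed.

Definition rowball (n : nat) : set 'rV[R]_m := [set x | `|x| <= n%:R].

Lemma rowball_compact n : compact (rowball n).
Proof.
apply: bounded_closed_compact.
  exists n%:R; split; first exact: num_real.
  by move=> M nM x /= xn; apply: le_trans xn (ltW nM).
rewrite /rowball; apply: (closed_comp (f := fun x : 'rV[R]_m => `|x|) (D := [set t | t <= n%:R])).
  by move=> x _; exact: norm_continuous.
exact: closed_le.
Qed.

Lemma rowball_exhausts x : \forall n \near \oo, rowball n x.
Proof. exact: nbhs_infty_ger. Qed.

Definition same_law_row d d' Om Om' P P' X X' mX mX' H :=
  @same_law R 'rV[R]_m 'rV[R]_m dotrow dotrowD dotrowZ dotrow_continuous dotrow_separates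
   rowball rowball_compact rowball_exhausts d d' Om Om' P P' X X' mX mX' H.

Definition measurable_continuous_row d Om X mX :=
  @measurable_continuous R 'rV[R]_m 'rV[R]_m dotrow dotrowD dotrowZ dotrow_continuous
   dotrow_separates rowball rowball_compact rowball_exhausts d Om X mX.

End row_vectors.

(** * Differentiation of real functions and of expectations *)

Section calculus.
Context {R : realType}.
Implicit Types f g : R -> R.

Lemma is_derive_continuous f g : (forall x : R, is_derive x (1 : R) f (g x)) -> continuous f.
Proof.
by move=> h x; apply: differentiable_continuous; apply/derivable1_diffP; case: (h x).
Qed.

(** The intermediate point is written [a + t (b - a)] so that [a] and [b] may come in either
    order. *)
Lemma mean_value f g a b : (forall x : R, is_derive x (1 : R) f (g x)) ->
  exists2 t, 0 <= t <= 1 & f b - f a = g (a + t * (b - a)) * (b - a).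
Proof.
move=> h; have cf := is_derive_continuous h.
have [ab|ba|->] := ltgtP a b; last first.
- by exists 0; rewrite ?lexx ?ler01// !subrr mulr0.
- have [c] := MVT ba (fun x _ => h x) (continuous_subspaceT cf).
  rewrite in_itv/= => /andP[bc ca] E; exists ((a - c) / (a - b)).
    apply/andP; split; first by rewrite divr_ge0// subr_ge0 ltW.
    by rewrite ler_pdivrMr ?subr_gt0// mul1r; lra.
  have -> : a + (a - c) / (a - b) * (b - a) = c by field; rewrite subr_eq0 gt_eqF.
  by rewrite -opprB E; ring.
- have [c] := MVT ab (fun x _ => h x) (continuous_subspaceT cf).
  rewrite in_itv/= => /andP[ac cb] E; exists ((c - a) / (b - a)).
    apply/andP; split; first by rewrite divr_ge0// subr_ge0 ltW.
    by rewrite ler_pdivrMr ?subr_gt0// mul1r; lra.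
  have -> // : a + (c - a) / (b - a) * (b - a) = c by field; rewrite subr_eq0 gt_eqF.
Qed.

Lemma le_derive f g f' g' u : (forall x : R, is_derive x (1 : R) f (f' x)) ->
  (forall x : R, is_derive x (1 : R) g (g' x)) -> 0 <= u ->
  (forall x, 0 <= x <= u -> f' x <= g' x) -> f 0 <= g 0 -> f u <= g u.
Proof.
move=> hf hg u0 h fg0.
have [t /andP[t0 t1]] := @mean_value (fun x => g x - f x) (fun x => g' x - f' x) 0 u
  (fun x => is_deriveB (hg x) (hf x)).
rewrite !subr0 add0r => E.
have : 0 <= (g' (t * u) - f' (t * u)) * u.
  rewrite mulr_ge0// subr_ge0 h// mulr_ge0//=.
  by rewrite -[leRHS]mul1r ler_wpM2r.
rewrite -E; lra.
Qed.

Lemma is_derive_quadratic f l x C : (forall h, `|f (x + h) - f x - h * l| <= C * h ^+ 2) ->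
  is_derive x (1 : R) f l.
Proof.
move=> h; have L : (fun t => t^-1 *: ((f \o shift x) (t *: (1 : R)) - f x)) @ 0^' --> l.
  apply/cvgrPdist_le => e e0.
  have e1 : 0 < e / (`|C| + 1) by rewrite divr_gt0// ltr_wpDl.
  near=> t.
  have t0 : t != 0 by near: t; exact: nbhs_dnbhs_neq.
  have te : `|t| <= e / (`|C| + 1) by apply: ltW; near: t; exact: dnbhs0_lt.
  rewrite /= /shift /GRing.scale/= mulr1 [t + x]addrC.
  have -> : l - t^-1 * (f (x + t) - f x) = - (t^-1 * (f (x + t) - f x - t * l)).
    by field.
  rewrite normrN normrM normfV ler_pdivrMl ?normr_gt0//.
  apply: le_trans (h t) _; rewrite -(real_normK (num_real t)) expr2 mulrA mulrC.
  apply: ler_wpM2l => //; apply: le_trans (_ : `|C| * `|t| <= _).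
    by apply: ler_wpM2r => //; exact: ler_norm.
  move: te; rewrite ler_pdivlMr ?ltr_wpDl//; have := normr_ge0 t; nra.
by apply: DeriveDef; [exact: cvgP L|exact: cvg_lim L].
Unshelve. all: end_near. Qed.

Lemma cos_taylor1 (a h : R) : `|cos (a + h) - cos a + h * sin a| <= h ^+ 2.
Proof.
have [t /andP[t0 t1] E] := @mean_value cos (fun x => - sin x) a (a + h) (fun x => is_derive_cos x).
have [t' _ E'] := @mean_value sin cos a (a + t * h) (fun x => is_derive_sin x).
have ah : a + h - a = h by ring.
rewrite ah in E; have ath : a + t * h - a = t * h by ring.
rewrite ath in E'; rewrite E.
have -> : - sin (a + t * h) * h + h * sin a = - ((sin (a + t * h) - sin a) * h) by ring.
rewrite E' normrN !normrM -(real_normK (num_real h)) expr2.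
apply: ler_wpM2r => //; rewrite -[leRHS]mul1r; apply: ler_pM => //; first exact: cos_max.
by rewrite ger0_norm// -[leRHS]mul1r ler_wpM2r.
Qed.

End calculus.

Section characteristic_functions.
Context d (T : measurableType d) {R : realType} (P : probability T R).

Lemma moments_cos (F G : T -> R) : measurable_fun setT F -> moments P G ->
  moments P (fun w => cos (F w) * G w).
Proof.
move=> mF hG; apply: momentsM => //; apply: moments_bounded.
  exact: measurable_fun_cos.
by move=> w; exact: cos_max.
Qed.

Lemma sin_cos (x : R) : sin x = cos (x - pi / 2).
Proof. by rewrite cosB cos_pihalf sin_pihalf mulr0 mulr1 add0r. Qed.

(** The second-order Taylor bound on the cosine stays integrable after multiplication by [|G|], so
    [is_derive_quadratic] applies directly to the expectation. *)
Lemma is_derive_Ex_cos (X Y G : T -> R) (s : R) : moments P X -> measurable_fun setT Y ->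
  moments P G ->
  is_derive s (1 : R) (fun s => Ex P (fun w => cos (s * X w + Y w) * G w))
    (Ex P (fun w => - (sin (s * X w + Y w) * (X w * G w)))).
Proof.
move=> hX mY hG; have mX : measurable_fun setT X by case: hX.
have mL t : measurable_fun setT (fun w => t * X w + Y w).
  by apply: measurable_funD => //; exact: measurable_funM.
have ms t : measurable_fun setT (fun w => t * X w + Y w - pi / 2).
  by apply: measurable_funB => //; exact: mL.
have i1 t := moments_int1 (moments_cos (mL t) hG).
have i2 : int1 P (fun w => - (sin (s * X w + Y w) * (X w * G w))).
  have := moments_int1 (momentsZ (-1) (moments_cos (ms s) (momentsM hX hG))).
  by under eq_fun do rewrite -sin_cos mulN1r.
have i3 : int1 P (fun w => X w ^+ 2 * `|G w|).
  by apply/moments_int1/momentsM; [exact: momentsX|exact: moments_norm].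
apply: (@is_derive_quadratic _ _ _ _ (Ex P (fun w => X w ^+ 2 * `|G w|))) => h.
rewrite -ExB// -ExZ// -ExB//; last 2 first.
- exact: int1B.
- exact: int1Z.
rewrite mulrC -ExZ//; apply: Ex_norm_le.
- by apply: int1B; [exact: int1B|exact: int1Z].
- exact: int1Z.
move=> w; have := cos_taylor1 (s * X w + Y w) (h * X w).
have -> : s * X w + Y w + h * X w = (s + h) * X w + Y w by ring.
have -> : cos ((s + h) * X w + Y w) * G w - cos (s * X w + Y w) * G w -
  h * - (sin (s * X w + Y w) * (X w * G w)) =
  (cos ((s + h) * X w + Y w) - cos (s * X w + Y w) + h * X w * sin (s * X w + Y w)) * G w by ring.
rewrite normrM mulrA exprMn => H; exact: ler_wpM2r.
Qed.

End characteristic_functions.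

(** * Characteristic functions of Gaussian variables *)

Section gaussian_variables.
Context {R : realType}.

Lemma growth1_bounded (f : R -> R) M : (forall x, `|f x| <= M) -> growth1 f.
Proof. by move=> h; exists M, 0%N => x; rewrite expr0 mulr1. Qed.

(** Stein's identity gives [c'(t) = - s^2 t c(t)], so [exp(s^2 t^2 / 2) c(t)] is constant, equal to
    its value cos b at 0. *)
Lemma normal_cos (s b t : R) : s != 0 ->
  Ex (normal_prob 0 s) (fun x => cos (t * x + b)) =
  expR (- (s ^+ 2 * t ^+ 2) / 2) * cos b.
Proof.
move=> s0; pose N := normal_prob 0 s; pose c t := Ex N (fun x => cos (t * x + b)).
have hd u : is_derive u (1 : R) c (- (s ^+ 2 * u) * c u).
  have := @is_derive_Ex_cos _ (measurableTypeR R) R N (fun x => x) (fun=> b) (fun=> 1) u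
    (moments_normal s0) (measurable_cst _) (moments_cst _ _).
  have -> : (fun s => Ex N (fun w => cos (s * w + b) * 1)) = c.
    by apply/funext => v; rewrite /c; under eq_fun do rewrite mulr1.
  move=> H; apply: (is_derive_eq H).
  have -> : (fun w : R => - (sin (u * w + b) * (w * 1))) = (fun w => (-1) * (w * sin (u * w + b))).
    by apply/funext => w; ring.
  have cl : continuous (fun x : R => u * x + b).
    by move=> x; apply: cvgD; [apply: cvgM; [exact: cvg_cst|exact: cvg_id]|exact: cvg_cst].
  have cs : continuous (fun x : R => sin (u * x + b)).
    by move=> x; apply: (@continuous_comp _ _ _ (fun x => u * x + b) sin); [exact: cl|exact: continuous_sin].
  have gs : growth1 (fun x => sin (u * x + b)) by apply: growth1_bounded => x; exact: sin_max.
  rewrite ExZ; last first.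
    apply/moments_int1/momentsM; first exact: moments_normal.
    exact: moments_growth1.
  have hs (x : R) : is_derive x (1 : R) (fun x => sin (u * x + b)) (u * cos (u * x + b)).
    apply: is_derive_eq; rewrite /GRing.scale/=; ring.
  have cc : continuous (fun x : R => u * cos (u * x + b)).
    move=> x; apply: cvgM; first exact: cvg_cst.
    by apply: (@continuous_comp _ _ _ (fun x => u * x + b) cos); [exact: cl|exact: continuous_cos].
  have gc : growth1 (fun x => u * cos (u * x + b)).
    by exists `|u|, 0%N => x; rewrite expr0 mulr1 normrM ler_piMr//; exact: cos_max.
  rewrite (normal_ibp s0 hs cc gs gc).
  rewrite ExZ; last first.
    apply: (@int1_bounded _ (measurableTypeR R) _ _ _ 1); last by move=> x; exact: cos_max.
    by apply: measurable_fun_cos; exact: continuous_measurable_fun.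
  rewrite -/(c u); ring.
pose e u : R := expR (s ^+ 2 * u ^+ 2 / 2).
have he u : is_derive u (1 : R) e (s ^+ 2 * u * e u).
  by apply: is_derive_eq; rewrite /GRing.scale/= /e; field.
have hec u : is_derive u (1 : R) (fun u => e u * c u) 0.
  have h1 := he u; have h2 := hd u.
  apply: is_derive_eq; rewrite /GRing.scale/=; ring.
have [t' _] := mean_value 0 t hec; rewrite mul0r => /eqP; rewrite subr_eq0 => /eqP E.
have c0 : c 0 = cos b.
  by rewrite /c; under eq_fun do rewrite mul0r add0r; rewrite Ex_cst.
have e0 : e 0 = 1 by rewrite /e expr0n/= mulr0 mul0r expR0.
rewrite e0 mul1r c0 in E; rewrite -E mulrA mulNr -mulNr -/(c t) /e -expRD mulNr.
by rewrite addNr expR0 mul1r.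
Qed.

End gaussian_variables.

Section transfer.
Context d d' (T : measurableType d) (S : measurableType d') {R : realType} (P : probability T R).
Variables (X : T -> S) (N : probability S R).
Hypothesis mX : measurable_fun setT X.
Hypothesis XN : forall A : set S, measurable A -> P (X @^-1` A) = N A.

Lemma int1_law (F : S -> R) : measurable_fun setT F -> int1 N F <-> int1 P (fun w => F (X w)).
Proof.
move=> mF; have mFX : measurable_fun setT (fun w => F (X w)) by exact: measurableT_comp.
have mN : measurable_fun setT (fun x => `|(F x)%:E|%E).
  by do 2 apply: measurableT_comp => //.
have E : (\int[N]_x `|(F x)%:E| = \int[P]_w `|(F (X w))%:E|)%E.
  rewrite (eq_measure_integral (pushforward P X)); last by move=> A mA _; exact/esym/XN.
  by rewrite (ge0_integral_pushforward (phi := X) mX).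
by split=> /integrableP[_ h]; apply/integrableP; split;
  [exact/measurable_EFinP|rewrite -E|exact/measurable_EFinP|rewrite E].
Qed.

Lemma Ex_law (F : S -> R) : int1 N F -> Ex P (fun w => F (X w)) = Ex N F.
Proof.
move=> iF; have mF := int1_meas iF; have /int1_law := mF => /proj1/(_ iF) iFX.
rewrite /Ex /Rintegral (eq_measure_integral (pushforward P X)); last first.
  by move=> A mA _; exact/esym/XN.
by rewrite (integral_pushforward (phi := X) mX)//; exact/measurable_EFinP.
Qed.

End transfer.

Section product_expectation.
Context d d' (T : measurableType d) (T' : measurableType d') {R : realType}.
Variables (P : probability T R) (P' : probability T' R).

Lemma Ex_fubini (F : T * T' -> R) (f : T' -> R) : int1 (P \x P')%E F ->
  (forall w, int1 P (fun x => F (x, w))) -> (forall w, Ex P (fun x => F (x, w)) = f w) ->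
  Ex (P \x P')%E F = Ex P' f.
Proof.
move=> iF i1 Ef.
have fE : (fun y => \int[P]_x (F (x, y))%:E)%E = (fun y => (f y)%:E).
  by apply/funext => y; rewrite -Ex_fin// Ef.
by rewrite /Ex /Rintegral -integral21_prod_meas1// /fubini_G fE.
Qed.

End product_expectation.

Section gaussian_variables.
Context {R : realType} d (T : measurableType d) (P : probability T R).

(** For a nonnegative square, a finite value of the extended integral already yields
    integrability. *)
Lemma expectation_sqi (F : T -> R) (v : R) : measurable_fun setT F ->
  expectation P (fun w => F w ^+ 2) = v%:E -> sqi P F /\ Ex P (fun w => F w ^+ 2) = v.
Proof.
move=> mF; rewrite ExpE => E; have mF2 : measurable_fun setT (fun w => F w ^+ 2).
  exact: measurable_funX.
split; last by rewrite /Ex /Rintegral E.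
split=> //; apply/integrableP; split; first exact/measurable_EFinP.
rewrite (eq_integral (fun w => (F w ^+ 2)%:E)) ?E ?ltry//.
by move=> w _; rewrite /= ger0_norm// sqr_ge0.
Qed.

(** The parameters are identified from the first two moments; the mean of a nondegenerate law is
    forced to 0 by [normal_mean0]. *)
Lemma gaussian_cases (X : T -> R) (v : R) : measurable_fun setT X -> gaussian P X ->
  sqi P X -> Ex P X = 0 -> Ex P (fun w => X w ^+ 2) = v ->
  (v = 0 /\ {ae P, forall w, X w = 0}) \/
  exists s, [/\ s != 0, s ^+ 2 = v &
    forall A : set R, measurable A -> P (X @^-1` A) = normal_prob 0 s A].
Proof.
move=> mX [m [s h]] sX E0 E2; case: (eqVneq s 0) h => [_|s0] h.
- left.
  have ae : {ae P, forall w, X w = m}.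
    exists (X @^-1` (~` [set m])); split.
    + by rewrite -[X @^-1` _]setTI; apply: mX => //; exact: measurableC.
    + by rewrite h ?diracE; [rewrite memNset//=; exact|exact: measurableC].
    + by move=> w /= H /= E; exact: H.
  have m0 : m = 0.
    by rewrite -E0 -[LHS](Ex_cst P); apply: Ex_ae => //; apply: filterS ae => w ->.
  rewrite m0 in ae; split=> //; rewrite -E2 -[RHS](Ex_cst P).
  apply: Ex_ae => //; first exact: measurable_funX.
  by apply: filterS ae => w ->; rewrite expr0n.
- right; exists s.
  have iid : int1 (normal_prob m s) (fun x => x).
    apply: (proj2 (@int1_law _ _ _ (measurableTypeR R) _ P X _ mX h _ (@measurable_id _ _ _))).
    exact: sqi_int1.
  have m0 : m = 0.
    by apply: (normal_mean0 s0 iid); rewrite -(@Ex_law _ _ _ (measurableTypeR R) _ P X _ mX h _ iid).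
  rewrite m0 in h; split=> //.
  have M := moments_normal (R := R) s0; have i2 := moments_int1 (momentsX 2 M).
  rewrite -E2 (@Ex_law _ _ _ (measurableTypeR R) _ P X _ mX h _ i2).
  have i1 : growth1 (fun x : R => x).
    by exists 1, 1%N => x; rewrite expr1 mul1r lerDr.
  have := normal_ibp s0 (fun x => is_derive_id x (1 : R)) (fun x => @cvg_cst _ _ _ _ _) i1
    (growth1_bounded (M := 1) _).
  rewrite Ex_cst mulr1 => <- //; last by move=> x; rewrite normr1.
Qed.

Lemma gaussian_moments (X : T -> R) : measurable_fun setT X -> gaussian P X ->
  sqi P X -> Ex P X = 0 -> moments P X.
Proof.
move=> mX gX sX E0; have [[_ ae]|[s [s0 _ h]]] := gaussian_cases mX gX sX E0 erefl.
- split=> // k; apply: (int1_ae (int1_cst P (0 ^+ k))).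
    by apply: measurable_funX; exact: measurableT_comp.
  by apply: filterS ae => w ->; rewrite normr0.
- split=> // k; apply: (proj1 (@int1_law _ _ _ (measurableTypeR R) _ P X _ mX h (fun x => `|x| ^+ k) _)).
    by apply: measurable_funX; exact: normr_measurable.
  by have [_] := moments_normal (R := R) s0; exact.
Qed.

Lemma gaussian_cos (X : T -> R) (b v : R) : measurable_fun setT X -> gaussian P X ->
  sqi P X -> Ex P X = 0 -> Ex P (fun w => X w ^+ 2) = v ->
  Ex P (fun w => cos (X w + b)) = expR (- v / 2) * cos b.
Proof.
move=> mX gX sX E0 Ev; have [[v0 ae]|[s [s0 sv h]]] := gaussian_cases mX gX sX E0 Ev.
- rewrite v0 oppr0 mul0r expR0 mul1r -[RHS](Ex_cst P); apply: Ex_ae => //.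
    by apply: measurable_fun_cos; exact: measurable_funD.
  by apply: filterS ae => w ->; rewrite add0r.
- have mc : measurable_fun setT (fun x : R => cos (x + b)).
    by apply: measurable_fun_cos; exact: measurable_funD.
  rewrite (@Ex_law _ _ _ (measurableTypeR R) _ P X _ mX h (fun x => cos (x + b))); last first.
    by apply: (@int1_bounded _ _ _ _ _ 1) => // x; exact: cos_max.
  by have := normal_cos b 1 s0; under eq_fun do rewrite mul1r; rewrite expr1n mulr1 sv.
Qed.

End gaussian_variables.

(** * Inner products *)

Section inner_product.
Context {R : realType} {H : hilbertType R}.
Local Notation ip := (inner H).

Lemma ipC (x y : H) : ip x y = ip y x.
Proof. by have := hermC (inner H) x y; rewrite expr0 mul1r. Qed.

Lemma ipDl (x y z : H) : ip (x + y) z = ip x z + ip y z.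
Proof. exact: linearDl. Qed.
Lemma ipZl (a : R) (x y : H) : ip (a *: x) y = a * ip x y.
Proof. exact: linearZl_LR. Qed.
Lemma ip0l (x : H) : ip 0 x = 0.
Proof. by rewrite -(scale0r (0 : H)) ipZl mul0r. Qed.
Lemma ipNl (x y : H) : ip (- x) y = - ip x y.
Proof. by rewrite -scaleN1r ipZl mulN1r. Qed.
Lemma ipBl (x y z : H) : ip (x - y) z = ip x z - ip y z.
Proof. by rewrite ipDl ipNl. Qed.
Lemma ip_suml (I : Type) (r : seq I) (P : pred I) (f : I -> H) (y : H) :
  ip (\sum_(i <- r | P i) f i) y = \sum_(i <- r | P i) ip (f i) y.
Proof. exact: (big_morph (fun x => ip x y) (fun a b => ipDl a b y) (ip0l y)). Qed.
Lemma ipDr (x y z : H) : ip z (x + y) = ip z x + ip z y.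
Proof. by rewrite ipC ipDl !(ipC z). Qed.
Lemma ipZr (a : R) (x y : H) : ip y (a *: x) = a * ip y x.
Proof. by rewrite ipC ipZl (ipC y). Qed.
Lemma ip0r (x : H) : ip x 0 = 0. Proof. by rewrite ipC ip0l. Qed.
Lemma ipBr (x y z : H) : ip z (x - y) = ip z x - ip z y.
Proof. by rewrite ipC ipBl !(ipC z). Qed.
Lemma ip_sumr (I : Type) (r : seq I) (P : pred I) (f : I -> H) (y : H) :
  ip y (\sum_(i <- r | P i) f i) = \sum_(i <- r | P i) ip y (f i).
Proof. by rewrite ipC ip_suml; apply: eq_bigr => i _; rewrite ipC. Qed.
Lemma ip_ge0 (x : H) : 0 <= ip x x.
Proof. by rewrite -normr_inner exprn_ge0. Qed.

Lemma ip_cauchy_schwarz (x y : H) : ip x y ^+ 2 <= ip x x * ip y y.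
Proof.
apply: discriminant_le; last exact: ip_ge0.
move=> t; have := ip_ge0 (x - t *: y).
rewrite !(ipBl, ipBr, ipZl, ipZr) (ipC y x); congr (0 <= _); ring.
Qed.

Lemma ip_norm_le (x y : H) : `|ip x y| <= `|x| * `|y|.
Proof.
rewrite -(@ler_pXn2r _ 2) ?nnegrE ?mulr_ge0// exprMn !normr_inner.
by rewrite real_normK ?num_real// ip_cauchy_schwarz.
Qed.

Lemma ip_continuousr (x : H) : continuous (fun y : H => ip x y).
Proof.
move=> y; apply/cvgrPdist_le => e e0.
have e1 : 0 < e / (`|x| + 1) by rewrite divr_gt0// ltr_wpDl.
have : \forall z \near y, `|y - z| <= e / (`|x| + 1).
  by apply/nbhs_ballP; exists (e / (`|x| + 1)) => //= z; rewrite -ball_normE/= => /ltW.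
apply: filterS => z yz; rewrite -ipBr; apply: le_trans (ip_norm_le _ _) _.
apply: le_trans (_ : (`|x| + 1) * (e / (`|x| + 1)) <= _).
  by apply: ler_pM => //; rewrite lerDl.
by rewrite mulrC divfK// gt_eqF// ltr_wpDl.
Qed.

End inner_product.

(** * Polynomial growth and directional derivatives *)

Section growth.
Context {R : realType}.

Definition growth (m : nat) (phi : 'rV[R]_m -> R) :=
  exists C k, forall x, `|phi x| <= C * (1 + `|x|) ^+ k.

Lemma growth_norm m (phi : 'rV[R]_m -> R) : growth phi ->
  exists C k, 0 <= C /\ forall x, `|phi x| <= C * (1 + `|x|) ^+ k.
Proof.
move=> [C [k h]]; exists C, k; split=> //.
by have := h 0; rewrite normr0 addr0 expr1n mulr1; exact: le_trans.
Qed.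

Lemma growthD m (phi psi : 'rV[R]_m -> R) : growth phi -> growth psi ->
  growth (fun x => phi x + psi x).
Proof.
move=> /growth_norm[C [k [C0 hC]]] /growth_norm[D [l [D0 hD]]].
exists (C + D), (k + l)%N => x; apply: le_trans (ler_normD _ _) _.
have x1 : 1 <= 1 + `|x| by rewrite lerDl.
rewrite mulrDl; apply: lerD.
  by apply: le_trans (hC x) _; rewrite ler_wpM2l// ler_weXn2l// leq_addr.
by apply: le_trans (hD x) _; rewrite ler_wpM2l// ler_weXn2l// leq_addl.
Qed.

Lemma growthM m (phi psi : 'rV[R]_m -> R) : growth phi -> growth psi ->
  growth (fun x => phi x * psi x).
Proof.
move=> /growth_norm[C [k [C0 hC]]] /growth_norm[D [l [D0 hD]]].
exists (C * D), (k + l)%N => x; rewrite normrM exprD.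
rewrite [leRHS](_ : _ = (C * (1 + `|x|) ^+ k) * (D * (1 + `|x|) ^+ l)); last by ring.
by apply: ler_pM.
Qed.

Lemma growth_cst m c : growth (fun _ : 'rV[R]_m => c).
Proof. by exists `|c|, 0%N => x; rewrite expr0 mulr1. Qed.

Lemma ler_coord_norm m (x : 'rV[R]_m) j : `|x 0 j| <= `|x|.
Proof. by rewrite [leRHS]/Num.norm/= mx_normrE; exact: (le_bigmax _ _ (0, j)). Qed.

Lemma rV_norm_le m (x : 'rV[R]_m) c : 0 <= c -> (forall j, `|x 0 j| <= c) -> `|x| <= c.
Proof.
by move=> c0 h; rewrite /Num.norm/= mx_normrE; apply: bigmax_le => // -[i j] _; rewrite ord1 h.
Qed.

Lemma growth_coord m (j : 'I_m) : growth (fun x : 'rV[R]_m => x 0 j).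
Proof.
exists 1, 1%N => x; rewrite expr1 mul1r; by apply: le_trans (ler_coord_norm x j) _; rewrite lerDr.
Qed.

Definition rsel m n (s : 'I_m -> 'I_n) (x : 'rV[R]_n) : 'rV[R]_m := \row_j x 0 (s j).

Lemma rsel_norm m n (s : 'I_m -> 'I_n) (x : 'rV[R]_n) : `|rsel s x| <= `|x|.
Proof. by apply: rV_norm_le => // j; rewrite mxE ler_coord_norm. Qed.

Lemma rsel_continuous m n (s : 'I_m -> 'I_n) : continuous (rsel s : 'rV[R]_n -> 'rV[R]_m).
Proof.
move=> x; have FF : Filter (nbhs x) by exact: nbhs_filter.
apply/(cvgrPdist_le (FF := FF)) => e e0.
have : \forall z \near x, `|x - z| <= e.
  by apply/nbhs_ballP; exists e => //= z; rewrite -ball_normE/= => /ltW.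
apply: filterS => z; apply: le_trans.
by rewrite -[rsel s x - _](_ : rsel s (x - z) = _) ?rsel_norm//; apply/rowP => j; rewrite !mxE.
Qed.

Lemma growth_rsel m n (s : 'I_m -> 'I_n) phi : growth phi -> growth (fun x => phi (rsel s x)).
Proof.
move=> /growth_norm[C [k [C0 h]]]; exists C, k => x; apply: le_trans (h _) _.
by rewrite ler_wpM2l// lerXn2r ?nnegrE ?addr_ge0// lerD2l rsel_norm.
Qed.

Lemma growth_line m (phi : 'rV[R]_m -> R) (a c : 'rV[R]_m) : growth phi ->
  growth1 (fun x => phi (a + x *: c)).
Proof.
move=> /growth_norm[C [k [C0 h]]]; exists (C * (1 + `|a| + `|c|) ^+ k), k => x.
rewrite -mulrA -exprMn; apply: le_trans (h _) _; rewrite ler_wpM2l// lerXn2r ?nnegrE//.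
have := ler_normD a (x *: c); rewrite normrZ => H.
have := normr_ge0 a; have := normr_ge0 x; have := normr_ge0 c; nra.
Qed.

End growth.

Section directional_derivatives.
Context {R : realType} {m : nat}.
Implicit Types (phi : 'rV[R]_m -> R) (u v x : 'rV[R]_m).

(** Derivability is asked at every point of every line along [v], as the mean value theorem and
    one-dimensional integration by parts require. *)
Definition dirder v phi phi' := forall x t,
  is_derive (t : R) (1 : R) (fun t => phi (x + t *: v)) (phi' (x + t *: v)).

Lemma line_continuous (a v : 'rV[R]_m) : continuous (fun t : R => a + t *: v).
Proof. by move=> t; apply: cvgD; [exact: cvg_cst|apply: cvgZl; exact: cvg_id]. Qed.

Lemma comp_line_continuous (psi : 'rV[R]_m -> R) (a v : 'rV[R]_m) : continuous psi ->
  continuous (fun t : R => psi (a + t *: v)).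
Proof.
move=> cpsi t.
apply: (@continuous_comp R 'rV[R]_m R (fun t => a + t *: v) psi); last exact: cpsi.
exact: line_continuous.
Qed.

Lemma is_derive_quotient (f : R -> R) (l t : R) :
  h^-1 * (f (t + h) - f t) @[h --> 0^'] --> l -> is_derive t (1 : R) f l.
Proof.
move=> h; have L : (fun h => h^-1 *: ((f \o shift t) (h *: (1 : R)) - f t)) @ 0^' --> l.
  have -> // : (fun h => h^-1 *: ((f \o shift t) (h *: (1 : R)) - f t)) =
    (fun h => h^-1 * (f (t + h) - f t)).
  by apply/funext => u; rewrite /= /shift /GRing.scale/= mulr1 [u + t]addrC.
by apply: DeriveDef; [exact: cvgP L|exact: cvg_lim L].
Qed.

Lemma quotient_is_derive (f : R -> R) (l t : R) : is_derive t (1 : R) f l ->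
  h^-1 * (f (t + h) - f t) @[h --> 0^'] --> l.
Proof.
move=> [dv E]; have := dv; rewrite /derivable -/('D_1 f t) => /cvg_ex[l' L].
have ll' : l' = l by rewrite -E; exact/esym/cvg_lim.
rewrite -ll'; have -> // : (fun h => h^-1 * (f (t + h) - f t)) =
  (fun h => h^-1 *: ((f \o shift t) (h *: (1 : R)) - f t)).
by apply/funext => u; rewrite /= /shift /GRing.scale/= mulr1 [u + t]addrC.
Qed.

(** The increment along [u + v] is split at [y + h u]; the second piece is a derivative along [v] at
    a nearby point, whence the continuity of [gv]. *)
Lemma dirderD_dir u v phi gu gv : continuous gv -> dirder u phi gu -> dirder v phi gv ->
  dirder (u + v) phi (fun x => gu x + gv x).
Proof.
move=> cv hu hv x t; apply: is_derive_quotient; set y := x + t *: (u + v).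
have h1 := quotient_is_derive (hu y 0); rewrite scale0r addr0 in h1.
have h2 : h^-1 * (phi (y + h *: u + h *: v) - phi (y + h *: u)) @[h --> 0^'] --> gv y.
  apply/cvgrPdist_le => e e0.
  have := cv y => /cvgrPdist_le/(_ e e0)/nbhs_ballP[r/= r0 hr].
  have uv : 0 < `|u| + `|v| + 1 by rewrite ltr_wpDl// addr_ge0.
  have r1 : 0 < r / (`|u| + `|v| + 1) by rewrite divr_gt0.
  near=> h.
  have h0 : h != 0 by near: h; exact: nbhs_dnbhs_neq.
  have hr1 : `|h| < r / (`|u| + `|v| + 1) by near: h; exact: dnbhs0_lt.
  have [k /andP[k0 k1]] := mean_value 0 h (fun s => hv (y + h *: u) s).
  rewrite scale0r addr0 subr0 add0r => ->; rewrite mulrCA mulVf// mulr1.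
  have yE (a b : 'rV[R]_m) : y - (y + a + b) = - (a + b).
    by apply/rowP => j; move: (y) => z; rewrite !mxE; ring.
  apply: hr; rewrite -ball_normE/= yE normrN.
  apply: le_lt_trans (ler_normD _ _) _; rewrite !normrZ.
  move: hr1; rewrite ltr_pdivlMr// => hr1; apply: le_lt_trans hr1.
  rewrite (ger0_norm k0); have := normr_ge0 h; have := normr_ge0 u; have := normr_ge0 v.
  move: (`|h|) (`|u|) (`|v|) => H U V V0 U0 H0.
  have : 0 <= H * V * (1 - k) by rewrite !mulr_ge0// subr_ge0.
  nra.
have -> : (fun h => h^-1 * (phi (x + (t + h) *: (u + v)) - phi y)) =
  (fun h => h^-1 * (phi (y + h *: u) - phi y) + h^-1 * (phi (y + h *: u + h *: v) - phi (y + h *: u))).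
  apply/funext => h; have -> : x + (t + h) *: (u + v) = y + h *: u + h *: v.
    by rewrite /y scalerDl (scalerDr h) !addrA.
  ring.
apply: cvgD h2; have -> // : (fun h => h^-1 * (phi (y + h *: u) - phi y)) =
  (fun h => h^-1 * (phi (y + (0 + h) *: u) - phi y)).
by apply/funext => h; rewrite add0r.
Unshelve. all: end_near. Qed.

Lemma dirderZ_dir c v phi g : dirder v phi g -> dirder (c *: v) phi (fun x => c * g x).
Proof.
move=> hv x t; have h1 : is_derive t (1 : R) (fun t => t * c) c.
  by apply: is_derive_eq; rewrite /GRing.scale/=; ring.
have := @is_derive1_comp _ (fun s => phi (x + s *: v)) (fun t => t * c) t _ _ (hv x (t * c)) h1.
rewrite /comp -scalerA => H; apply: is_derive_eq.
  have -> : (fun t => phi (x + t *: (c *: v))) = (fun t => phi (x + (t * c) *: v)).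
    by apply/funext => s; rewrite scalerA.
  exact: H.
by rewrite mulrC scalerA.
Qed.

Lemma dirder_sum (I : Type) (r : seq I) (c : I -> R) (v : I -> 'rV[R]_m) phi
    (g : I -> 'rV[R]_m -> R) :
  (forall i, continuous (g i)) -> (forall i, dirder (v i) phi (g i)) ->
  dirder (\sum_(i <- r) c i *: v i) phi (fun x => \sum_(i <- r) c i * g i x).
Proof.
move=> cg hg; elim: r => [|i r IH].
  move=> x t; rewrite !big_nil.
  have -> : (fun t => phi (x + t *: (0 : 'rV[R]_m))) = fun=> phi x.
    by apply/funext => s; rewrite scaler0 addr0.
  exact: is_derive_cst.
move=> x t; rewrite !big_cons addrC; rewrite [X in is_derive _ _ _ X]addrC.
apply: (dirderD_dir _ IH (dirderZ_dir (c i) (hg i))).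
move=> z; apply: (continuousM (s := fun=> c i)); first exact: cst_continuous.
exact: cg.
Qed.

End directional_derivatives.

Section integrals_of_squares.
Context d (T : measurableType d) {R : realType} (P : probability T R).

Lemma Ex_eq0 (F : T -> R) : int1 P F -> (forall w, 0 <= F w) -> Ex P F = 0 ->
  {ae P, forall w, F w = 0}.
Proof.
move=> iF F0 E0; have mF := int1_meas iF.
have : (\int[P]_w `|(F w)%:E| = 0)%E.
  rewrite (eq_integral (fun w => (F w)%:E)); last by move=> w _; rewrite gee0_abs// lee_fin.
  by rewrite -Ex_fin// E0.
move=> /(ae_eq_integral_abs P measurableT ((measurable_EFinP _ _).2 mF)).
by apply: filterS => w H; have [] := H I.
Qed.

Lemma Ex_sqr_eq0 (F : T -> R) : sqi P F -> Ex P (fun w => F w ^+ 2) = 0 ->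
  {ae P, forall w, F w = 0}.
Proof.
move=> [_ iF] E0; apply: filterS (Ex_eq0 iF (fun w => sqr_ge0 _) E0) => w /eqP.
by rewrite sqrf_eq0 => /eqP.
Qed.

End integrals_of_squares.

(** * Integration by parts for the isonormal process *)

Section isonormal_process.
Context {R : realType} {H : hilbertType R} d (Om : measurableType d).
Context (P : probability Om R) (W : H -> {RV P >-> R}).
Hypothesis isoW : isonormal W.
Local Notation ip := (inner H).

Lemma W_measurable h : measurable_fun setT (W h).
Proof. exact: measurable_funPT. Qed.

Lemma W_sqi h : sqi P (W h) /\ Ex P (fun w => W h w ^+ 2) = ip h h.
Proof.
apply: expectation_sqi; first exact: W_measurable.
by case: isoW => _ _ <-.
Qed.

Lemma Ex_W h : Ex P (W h) = 0.
Proof. by rewrite ExE; case: isoW => _ -> _. Qed.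

Lemma Ex_WW g h : Ex P (fun w => W g w * W h w) = ip g h.
Proof. by rewrite ExE; case: isoW => _ _ ->. Qed.

Lemma W_comb m (c : 'I_m -> R) (h : 'I_m -> H) (F := fun w => \sum_(j < m) c j * W (h j) w) :
  [/\ measurable_fun setT F, gaussian P F, sqi P F, Ex P F = 0 &
    Ex P (fun w => F w ^+ 2) = ip (\sum_j c j *: h j) (\sum_j c j *: h j)].
Proof.
have sF j : sqi P (fun w => c j * W (h j) w) by apply: sqiZ; case: (W_sqi (h j)).
have sS : sqi P F by exact: sqi_sum.
split=> //.
- by case: sS.
- by case: isoW => G _ _; exact: G.
- rewrite Ex_sum => [|j]; last exact: sqi_int1.
  by rewrite big1// => j _; rewrite ExZ ?Ex_W ?mulr0//; apply: sqi_int1; case: (W_sqi (h j)).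
- have -> : (fun w => F w ^+ 2) = fun w => \sum_(i < m) \sum_(j < m)
      (c i * c j) * (W (h i) w * W (h j) w).
    apply/funext => w; rewrite expr2 /F mulr_suml; apply: eq_bigr => i _.
    by rewrite mulr_sumr; apply: eq_bigr => j _; ring.
  have i2 i j : int1 P (fun w => W (h i) w * W (h j) w).
    by apply: sqi_mul; [case: (W_sqi (h i))|case: (W_sqi (h j))].
  rewrite Ex_sum => [|i]; last by apply: int1_sum => j; exact: int1Z.
  rewrite ip_suml; apply: eq_bigr => i _; rewrite ip_sumr Ex_sum => [|j]; last exact: int1Z.
  by apply: eq_bigr => j _; rewrite ExZ// Ex_WW ipZl ipZr mulrA.
Qed.

Lemma W_moments h : moments P (W h).
Proof.
have [m g s E _] := @W_comb 1 (fun=> 1) (fun=> h).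
have FE : (fun w => \sum_(j < 1) 1 * W h w) = W h.
  by apply/funext => w; rewrite big_ord1 mul1r.
by rewrite FE in m g s E; exact: gaussian_moments.
Qed.

(** The second moment of the difference, computed from the covariance of [W], is zero. Linearity
    thus holds outside a null set that depends on the combination. *)
Lemma W_linear m (c : 'I_m -> R) (h : 'I_m -> H) :
  {ae P, forall w, W (\sum_j c j *: h j) w = \sum_j c j * W (h j) w}.
Proof.
pose g := \sum_j c j *: h j.
have [_ _ s _ E] := W_comb c h; have [sg Eg] := W_sqi g.
suff : {ae P, forall w, W g w - \sum_j c j * W (h j) w = 0}.
  by apply: filterS => w /eqP; rewrite subr_eq0 => /eqP.
apply: Ex_sqr_eq0; first exact: sqiB.
have -> : (fun w => (W g w - \sum_j c j * W (h j) w) ^+ 2) =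
  (fun w => W g w ^+ 2 - 2 * (\sum_j c j * (W g w * W (h j) w)) + (\sum_j c j * W (h j) w) ^+ 2).
  apply/funext => w; rewrite sqrrB; congr (_ - _ + _); rewrite mulr_natl; congr (_ *+ 2).
  by rewrite mulr_sumr; apply: eq_bigr => j _; ring.
have i2 j : int1 P (fun w => W g w * W (h j) w).
  by apply: sqi_mul => //; case: (W_sqi (h j)).
have i3 : int1 P (fun w => \sum_j c j * (W g w * W (h j) w)) by apply: int1_sum => j; exact: int1Z.
rewrite ExD ?ExB ?ExZ//; last 4 first.
- by case: sg.
- exact: int1Z.
- by apply: int1B; [case: sg|exact: int1Z].
- by case: s.
rewrite E Eg Ex_sum => [|j]; last exact: int1Z.
have -> : \sum_(i < m) Ex P (fun w => c i * (W g w * W (h i) w)) = ip g g.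
  by rewrite {2}/g ip_sumr; apply: eq_bigr => j _; rewrite ExZ// Ex_WW ipZr.
by rewrite -/g; ring.
Qed.

Definition Wrow n (h : 'I_n -> H) (w : Om) : 'rV[R]_n := \row_j W (h j) w.

Lemma Wrow_meas n (h : 'I_n -> H) t : measurable_fun setT (fun w => dotrow t (Wrow h w)).
Proof.
have [m _ _ _ _] := W_comb (fun j => t 0 j) h; apply: eq_measurable_fun m => w _.
by apply: eq_bigr => j _; rewrite mxE.
Qed.

Lemma moments_growth n (h : 'I_n -> H) phi : continuous phi -> growth phi ->
  moments P (fun w => phi (Wrow h w)).
Proof.
move=> cphi /growth_norm[C [k [C0 hC]]].
have mphi := measurable_continuous_row (Wrow_meas h) cphi.
apply: (moments_le (G := fun w => C * (1 + \sum_j `|W (h j) w|) ^+ k)) => //.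
  apply: momentsZ; apply: momentsX; apply: momentsD; first exact: moments_cst.
  by apply: moments_sum => j; exact/moments_norm/W_moments.
move=> w; apply: le_trans (hC _) _; apply: le_trans (ler_norm _).
have S0 : 0 <= \sum_j `|W (h j) w| by apply: sumr_ge0.
rewrite ler_wpM2l// lerXn2r ?nnegrE ?addr_ge0// lerD2l.
apply: rV_norm_le => // j; rewrite mxE (bigD1 j)//= lerDl.
by apply: sumr_ge0.
Qed.

Section rotation.
Variables (n : nat) (h : 'I_n -> H) (i0 : 'I_n).
Let e := h i0.
Hypothesis e0 : e != 0.
Let s := `|e|.
Let c : 'rV[R]_n := \row_j (ip (h j) e / s ^+ 2).
Let N := normal_prob 0 s.

Let s0 : s != 0. Proof. by rewrite normr_eq0. Qed.
Let s2 : s ^+ 2 = ip e e. Proof. exact: normr_inner. Qed.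

(** [c] holds the regression coefficients of the [W (h j)] on [W e]. The residual is uncorrelated
    with [W e], which is replaced by an independent variable [z.1] of the same law. *)
Definition Wshift (z : R * Om) : 'rV[R]_n := Wrow h z.2 + (z.1 - W e z.2) *: c.

Lemma dotrow_Wshift t x w : dotrow t (Wshift (x, w)) =
  dotrow t c * x + \sum_j (t 0 j - (j == i0)%:R * dotrow t c) * W (h j) w.
Proof.
have -> : \sum_j (t 0 j - (j == i0)%:R * dotrow t c) * W (h j) w =
    \sum_j t 0 j * W (h j) w - dotrow t c * W e w.
  under eq_bigr do rewrite mulrBl; rewrite sumrB; congr (_ - _).
  rewrite (bigD1 i0)//= eqxx mul1r big1 ?addr0// => j ji.
  by rewrite (negPf ji) !mul0r.
rewrite /Wshift /dotrow /=.
under eq_bigr do rewrite !mxE mulrDr.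
rewrite big_split/= [X in _ + X = _](_ : _ = (\sum_j t 0 j * c 0 j) * (x - W e w)); first by ring.
by rewrite mulr_suml; apply: eq_bigr => j _; rewrite mxE; ring.
Qed.

Lemma Wshift_meas t : measurable_fun setT (fun z : measurableTypeR R * Om => dotrow t (Wshift z)).
Proof.
under eq_fun do rewrite [X in Wshift X]surjective_pairing dotrow_Wshift.
apply: measurable_funD.
  by apply: measurable_funM => //; exact: measurable_fst.
have [m _ _ _ _] := W_comb (fun j => t 0 j - (j == i0)%:R * dotrow t c) h.
exact: (measurableT_comp m (@measurable_snd _ _ _ _)).
Qed.

(** Both sides are Gaussian characteristic functions, and Pythagoras splits the variance into the
    part along [e] and the residual. *)
Lemma Wshift_cos t b : Ex P (fun w => cos (dotrow t (Wrow h w) + b)) =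
  Ex (N \x P)%E (fun z => cos (dotrow t (Wshift z) + b)).
Proof.
have [m1 g1 q1 E1 V1] := W_comb (fun j => t 0 j) h.
have -> : (fun w => cos (dotrow t (Wrow h w) + b)) = (fun w => cos (\sum_j t 0 j * W (h j) w + b)).
  by apply/funext => w; congr (cos (_ + _)); apply: eq_bigr => j _; rewrite mxE.
rewrite (gaussian_cos b m1 g1 q1 E1 V1).
pose c' j := t 0 j - (j == i0)%:R * dotrow t c.
have [m2 g2 q2 E2 V2] := W_comb c' h.
pose U w := \sum_j c' j * W (h j) w.
have mcos : measurable_fun setT (fun z : measurableTypeR R * Om => cos (dotrow t (Wshift z) + b)).
  by apply: measurable_fun_cos; apply: measurable_funD => //; exact: Wshift_meas.
rewrite (@Ex_fubini _ _ _ _ _ _ _ _ (fun w => expR (- (s ^+ 2 * dotrow t c ^+ 2) / 2) * cos (U w + b))).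
- rewrite ExZ ?(gaussian_cos b m2 g2 q2 E2 V2); last first.
    apply: (@int1_bounded _ _ _ _ _ 1); last by move=> w; exact: cos_max.
    by apply: measurable_fun_cos; exact: measurable_funD.
  rewrite mulrA -expRD; congr (expR _ * _); rewrite -mulrDl; congr (_ / 2).
  have gE : \sum_j c' j *: h j = \sum_j t 0 j *: h j - dotrow t c *: e.
    under eq_bigr do rewrite scalerBl; rewrite sumrB; congr (_ - _).
    rewrite (bigD1 i0)//= eqxx mul1r big1 ?addr0// => j ji.
    by rewrite (negPf ji) mul0r scale0r.
  have ge : ip (\sum_j t 0 j *: h j) e = dotrow t c * s ^+ 2.
    rewrite ip_suml /dotrow mulr_suml; apply: eq_bigr => j _.
    by rewrite ipZl mxE -mulrA divfK// expf_neq0.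
  rewrite gE !(ipBl, ipBr, ipZl, ipZr) (ipC e) ge -s2; ring.
- by apply: (@int1_bounded _ _ _ _ _ 1) => // z; exact: cos_max.
- move=> w; apply: (@int1_bounded _ _ _ _ _ 1); last by move=> z; exact: cos_max.
  apply: measurable_fun_cos; apply: measurable_funD => //.
  by under eq_fun do rewrite dotrow_Wshift; apply: measurable_funD => //; exact: measurable_funM.
- move=> w; rewrite -(normal_cos _ _ s0); congr Ex; apply/funext => x.
  by rewrite dotrow_Wshift -addrA.
Qed.

Lemma Ex_Wshift g : continuous g -> growth g ->
  int1 (N \x P)%E (fun z => g (Wshift z)) /\
  Ex P (fun w => g (Wrow h w)) = Ex (N \x P)%E (fun z => g (Wshift z)).
Proof.
move=> cg gg; apply: (same_law_row (Wrow_meas h) Wshift_meas Wshift_cos cg).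
exact/moments_int1/moments_growth.
Qed.

(** On the product space [W e] has become an independent coordinate; Stein's identity applies to it
    for each fixed value of the residual. *)
Lemma ibp_row phi phi' : continuous phi -> continuous phi' -> growth phi -> growth phi' ->
  dirder (\row_j ip (h j) e) phi phi' ->
  Ex P (fun w => W e w * phi (Wrow h w)) = Ex P (fun w => phi' (Wrow h w)).
Proof.
move=> cphi cphi' gphi gphi' dphi.
have ci : continuous (fun x : 'rV[R]_n => x 0 i0) by exact: coord_continuous.
have [i1 E1] := @Ex_Wshift (fun x => x 0 i0 * phi x) (fun x => continuousM (ci x) (cphi x))
  (growthM (growth_coord i0) gphi).
have [i2 E2] := Ex_Wshift cphi' gphi'.
have -> : (fun w => W e w * phi (Wrow h w)) = (fun w => (Wrow h w) 0 i0 * phi (Wrow h w)).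
  by apply/funext => w; rewrite mxE.
have c1 : c 0 i0 = 1 by rewrite mxE -s2 divff// expf_neq0.
pose a w := Wrow h w - W e w *: c.
have aE x w : Wshift (x, w) = a w + x *: c.
  by rewrite /Wshift /a/= scalerBl [x *: c - _]addrC addrA.
have cl (psi : 'rV[R]_n -> R) w : continuous psi -> continuous (fun x : R => psi (a w + x *: c) : R).
  exact: comp_line_continuous.
have il (psi : 'rV[R]_n -> R) w : continuous psi -> growth psi ->
    int1 N (fun x => psi (a w + x *: c)).
  move=> cpsi gpsi; apply: moments_int1; apply: (moments_growth1 s0 (cl _ w cpsi)).
  exact: growth_line.
rewrite E1 E2 (Ex_fubini (f := fun w => Ex N (fun x => phi' (a w + x *: c))) i2); last 2 first.
- by move=> w; under eq_fun do rewrite aE; exact: il.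
- by move=> w; under eq_fun do rewrite aE.
rewrite (Ex_fubini (f := fun w => Ex N (fun x => phi' (a w + x *: c))) i1)//.
- move=> w; under eq_fun do rewrite aE.
  apply: (il (fun x => x 0 i0 * phi x)).
    by move=> x; exact: continuousM (ci x) (cphi x).
  exact: growthM (growth_coord i0) gphi.
move=> w; have dc : dirder c phi (fun x => (s ^+ 2)^-1 * phi' x).
  have -> : c = (s ^+ 2)^-1 *: \row_j ip (h j) e.
    by apply/rowP => j; rewrite !mxE mulrC.
  exact: dirderZ_dir.
have c2 : continuous (fun x : R => (s ^+ 2)^-1 * phi' (a w + x *: c) : R).
  move=> x; apply: (continuousM (s := fun=> (s ^+ 2)^-1)); first exact: cst_continuous.
  exact: cl.
have g2 : growth1 (fun x => (s ^+ 2)^-1 * phi' (a w + x *: c)).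
  exact: (@growth_line _ _ _ (a w) c (growthM (growth_cst n (s ^+ 2)^-1) gphi')).
have := normal_ibp s0 (dc (a w)) c2 (growth_line (a w) c gphi) g2.
rewrite ExZ; last exact: il.
rewrite mulrA divff ?expf_neq0// mul1r => <-; congr Ex; apply/funext => x.
have z0 : (a w + x *: c) 0 i0 = x.
  rewrite /a [LHS]mxE [X in X + _]mxE [X in _ + X]mxE [X in _ + X + _]mxE [X in - X]mxE c1 mxE.
  by rewrite -/e; ring.
by rewrite aE z0.
Qed.

End rotation.

(** For [F = phi(W h_1, ..., W h_n)], the function [phi'] represents <DF, e>, the derivative of [F]
    in the direction [e]. *)
Definition dirc (e : H) n (h : 'I_n -> H) (phi phi' : 'rV[R]_n -> R) :=
  [/\ continuous phi, continuous phi', growth phi, growth phi' &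
    dirder (\row_j ip (h j) e) phi phi'].

Lemma dircD e n (h : 'I_n -> H) f f' g g' : dirc e h f f' -> dirc e h g g' ->
  dirc e h (fun x => f x + g x) (fun x => f' x + g' x).
Proof.
move=> [cf cf' gf gf' df] [cg cg' gg gg' dg]; split.
- by move=> x; exact: continuousD (cf x) (cg x).
- by move=> x; exact: continuousD (cf' x) (cg' x).
- exact: growthD.
- exact: growthD.
- by move=> x t; exact: is_deriveD (df x t) (dg x t).
Qed.

Lemma dircM e n (h : 'I_n -> H) f f' g g' : dirc e h f f' -> dirc e h g g' ->
  dirc e h (fun x => f x * g x) (fun x => f' x * g x + f x * g' x).
Proof.
move=> [cf cf' gf gf' df] [cg cg' gg gg' dg]; split.
- by move=> x; exact: continuousM (cf x) (cg x).
- by move=> x; exact: continuousD (continuousM (cf' x) (cg x)) (continuousM (cf x) (cg' x)).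
- exact: growthM.
- by apply: growthD; exact: growthM.
- move=> x t; have d1 := df x t; have d2 := dg x t.
  by apply: is_derive_eq; rewrite /GRing.scale/=; ring.
Qed.

Lemma dirc_cst e n (h : 'I_n -> H) c : dirc e h (fun=> c) (fun=> 0).
Proof.
split; [exact: cst_continuous|exact: cst_continuous|exact: growth_cst|exact: growth_cst|].
by move=> x t; exact: is_derive_cst.
Qed.

Lemma dirc_coord e n (h : 'I_n -> H) j : dirc e h (fun x => x 0 j) (fun=> ip (h j) e).
Proof.
split; [exact: coord_continuous|exact: cst_continuous|exact: growth_coord|exact: growth_cst|].
move=> x t; have -> : (fun t : R => (x + t *: \row_j0 ip (h j0) e) 0 j) =
    fun t => x 0 j + t * ip (h j) e by apply/funext => s; rewrite !mxE.
by apply: is_derive_eq; rewrite /GRing.scale/=; ring.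
Qed.

Lemma dirc_rsel e m n (s : 'I_m -> 'I_n) (h : 'I_n -> H) phi phi' :
  dirc e (fun j => h (s j)) phi phi' ->
  dirc e h (fun x => phi (rsel s x)) (fun x => phi' (rsel s x)).
Proof.
move=> [c1 c2 g1 g2 dphi]; split; [| |exact: growth_rsel|exact: growth_rsel|].
- move=> x; apply: (@continuous_comp _ _ _ (rsel s) phi); [exact: rsel_continuous|exact: c1].
- move=> x; apply: (@continuous_comp _ _ _ (rsel s) phi'); [exact: rsel_continuous|exact: c2].
move=> x t; have E u : rsel s (x + u *: \row_j ip (h j) e) = rsel s x + u *: \row_j ip (h (s j)) e.
  by apply/rowP => j; rewrite !mxE.
by under eq_fun do rewrite E; rewrite E; exact: dphi.
Qed.

Definition dircyl (e : H) (F F' : Om -> R) := exists n (h : 'I_n -> H) phi phi',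
  [/\ dirc e h phi phi', forall w, F w = phi (Wrow h w) & forall w, F' w = phi' (Wrow h w)].

Lemma rsel_Wrow m n (s : 'I_m -> 'I_n) (h : 'I_n -> H) w :
  rsel s (Wrow h w) = Wrow (fun j => h (s j)) w.
Proof. by apply/rowP => j; rewrite !mxE. Qed.

(** The two lists of vectors are concatenated, so that both variables become functions of one
    Gaussian vector. *)
Lemma dircyl_common e e' F F' G G' : dircyl e F F' -> dircyl e' G G' ->
  exists n (h : 'I_n -> H) f f' g g', [/\ dirc e h f f', dirc e' h g g' &
    forall w, [/\ F w = f (Wrow h w), F' w = f' (Wrow h w),
      G w = g (Wrow h w) & G' w = g' (Wrow h w)]].
Proof.
move=> [m [h [f [f' [df FE F'E]]]]] [n [k [g [g' [dg GE G'E]]]]].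
pose hk (j : 'I_(m + n)) := match fintype.split j with inl a => h a | inr b => k b end.
have hE : (fun j => hk (lshift n j)) = h.
  by apply/funext => j; rewrite /hk; case: splitP => [a /= ja|b /= jb];
    [congr h; exact/val_inj|have := ltn_ord j; rewrite jb ltnNge leq_addr].
have kE : (fun j => hk (rshift m j)) = k.
  by apply/funext => j; rewrite /hk; case: splitP => [a /= ja|b /= /addnI jb];
    [have := ltn_ord a; rewrite -ja ltnNge leq_addr|congr k; exact/val_inj].
exists (m + n)%N, hk, (fun x => f (rsel (lshift n) x)), (fun x => f' (rsel (lshift n) x)),
  (fun x => g (rsel (@rshift m n) x)), (fun x => g' (rsel (@rshift m n) x)); split.
- by apply: (@dirc_rsel _ _ _ (lshift n)); rewrite hE; exact: df.
- by apply: (@dirc_rsel _ _ _ (@rshift m n)); rewrite kE; exact: dg.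
- by move=> w; rewrite !rsel_Wrow hE kE; split.
Qed.

Lemma dircylD e F F' G G' : dircyl e F F' -> dircyl e G G' ->
  dircyl e (fun w => F w + G w) (fun w => F' w + G' w).
Proof.
move=> hF hG; have [n [h [f [f' [g [g' [df dg E]]]]]]] := dircyl_common hF hG.
exists n, h, (fun x => f x + g x), (fun x => f' x + g' x); split; first exact: dircD df dg.
- by move=> w; have [-> _ -> _] := E w.
- by move=> w; have [_ -> _ ->] := E w.
Qed.

Lemma dircylM e F F' G G' : dircyl e F F' -> dircyl e G G' ->
  dircyl e (fun w => F w * G w) (fun w => F' w * G w + F w * G' w).
Proof.
move=> hF hG; have [n [h [f [f' [g [g' [df dg E]]]]]]] := dircyl_common hF hG.
exists n, h, (fun x => f x * g x), (fun x => f' x * g x + f x * g' x).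
split; first exact: dircM df dg.
- by move=> w; have [-> _ -> _] := E w.
- by move=> w; have [-> -> -> ->] := E w.
Qed.

Lemma dircyl_cst e c : dircyl e (fun=> c) (fun=> 0).
Proof. by exists 0%N, (fun=> 0), (fun=> c), (fun=> 0); split=> //; exact: dirc_cst. Qed.

Lemma dircyl_W e u : dircyl e (W u) (fun=> ip u e).
Proof.
exists 1%N, (fun=> u), (fun x => x 0 0), (fun=> ip u e); split=> //.
  exact: (dirc_coord e (fun=> u) 0).
by move=> w; rewrite mxE.
Qed.

Lemma dircylN e F F' : dircyl e F F' -> dircyl e (fun w => - F w) (fun w => - F' w).
Proof.
move=> hF; have := dircylM (dircyl_cst e (-1)) hF.
by under eq_fun do rewrite mulN1r; under [X in dircyl _ _ X]eq_fun do rewrite mul0r add0r mulN1r.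
Qed.

Lemma dircyl_moments e F F' : dircyl e F F' -> moments P F /\ moments P F'.
Proof.
move=> [n [h [f [f' [[c1 c2 g1 g2 _] FE F'E]]]]]; split.
  by rewrite (funext FE); exact: moments_growth.
by rewrite (funext F'E); exact: moments_growth.
Qed.

Lemma dircyl_ibp e F F' : dircyl e F F' -> Ex P (fun w => W e w * F w) = Ex P F'.
Proof.
move=> hF; have [e0|e0] := eqVneq e 0.
  have [s0 E0] := W_sqi e; rewrite {2 3}e0 ip0l in E0.
  have ae := Ex_sqr_eq0 s0 E0; have [mF mF'] := dircyl_moments hF.
  have -> : Ex P (fun w => W e w * F w) = Ex P (fun=> 0).
    apply: Ex_ae => //; last by apply: filterS ae => w ->; rewrite mul0r.
    by have [] := momentsM (W_moments e) mF.
  case: hF => n [h [f [f' [[_ _ _ _ df] _ F'E]]]]; congr Ex; apply/funext => w.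
  rewrite F'E; set x := Wrow h w; have := df x 0; rewrite scale0r addr0.
  have -> : \row_j ip (h j) e = 0 by apply/rowP => j; rewrite !mxE e0 ip0r.
  have -> : (fun t : R => f (x + t *: (0 : 'rV[R]_n))) = fun=> f x.
    by apply/funext => t; rewrite scaler0 addr0.
  by case=> _ <-; rewrite derive_cst.
have [n [h [f [f' [g [g' [df dg E]]]]]]] := dircyl_common hF (dircyl_W e e).
(* [ibp_row] needs [e] among the vectors; it is added as coordinate 0. *)
pose k (j : 'I_n.+1) := if unlift ord0 j is Some i then h i else e.
have kE : (fun j => k (lift ord0 j)) = h by apply/funext => j; rewrite /k liftK.
have k0 : k ord0 = e by rewrite /k unlift_none.
have df1 : dirc e k (fun x => f (rsel (lift ord0) x)) (fun x => f' (rsel (lift ord0) x)).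
  by apply: dirc_rsel; rewrite kE.
case: df1 => c1 c2 g1 g2 d1.
have := @ibp_row _ k ord0 _ _ _ c1 c2 g1 g2; rewrite k0 => /(_ e0 d1).
under eq_fun do rewrite rsel_Wrow kE; under [X in _ = Ex _ X]eq_fun do rewrite rsel_Wrow kE.
have -> : (fun w => W e w * F w) = (fun w => W e w * f (Wrow h w)).
  by apply/funext => w; have [-> _ _ _] := E w.
by move=> ->; congr Ex; apply/funext => w; have [_ -> _ _] := E w.
Qed.

(* The first-order Taylor formula along [e] is obtained one coordinate at a time. *)
Lemma smooth_dirc e m (phi : 'rV[R]_m -> R) (h : 'I_m -> H) : smooth_poly_growth phi ->
  dirc e h phi (fun x => \sum_(i < m) ip (h i) e * partial i phi x).
Proof.
move=> sphi; have [c0 d0 g0] := sphi [::].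
have c1 i : continuous (partial i phi) by have [] := sphi [:: i].
have g1 i : growth (partial i phi) by have [_ _] := sphi [:: i].
split=> //.
- move=> x; elim: (index_enum _) => [|i r IH].
    under eq_fun do rewrite big_nil; exact: cst_continuous.
  under eq_fun do rewrite big_cons; apply: (continuousD _ IH).
  by apply: (continuousM (s := fun=> ip (h i) e)); [exact: cst_continuous|exact: c1].
- elim: (index_enum _) => [|i r IH]; first by under eq_fun do rewrite big_nil; exact: growth_cst.
  by under eq_fun do rewrite big_cons; apply: growthD IH; apply: growthM => //; exact: growth_cst.
- have -> : \row_j ip (h j) e = \sum_(i < m) ip (h i) e *: delta_mx 0 i.
    by rewrite [LHS]row_sum_delta; apply: eq_bigr => i _; rewrite mxE.
  apply: dirder_sum => // i x t; apply: is_derive_quotient.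
  have := d0 (x + t *: delta_mx 0 i) i; rewrite /derivable => /cvg_ex[l L].
  have ll : partial i phi (x + t *: delta_mx 0 i) = l by exact/cvg_lim.
  rewrite ll; have -> // : (fun u => u^-1 * (phi (x + (t + u) *: delta_mx 0 i) -
      phi (x + t *: delta_mx 0 i))) =
    (fun u => u^-1 *: ((phi \o shift (x + t *: delta_mx 0 i)) (u *: delta_mx 0 i) -
      phi (x + t *: delta_mx 0 i))).
  apply/funext => u; rewrite /= /shift scalerDl addrA [u *: _ + _]addrC //.
Qed.

End isonormal_process.

(** * Orthonormal families *)

Section gram_schmidt.
Context {R : realType} {H : hilbertType R}.
Local Notation ip := (inner H).

Definition orthonormal n (e : 'I_n -> H) := forall i j, ip (e i) (e j) = (i == j)%:R.

Definition spanned n (e : 'I_n -> H) (u : H) := u = \sum_(i < n) ip u (e i) *: e i.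

Lemma gram_schmidt (s : seq H) : exists n (e : 'I_n -> H),
  orthonormal e /\ forall u, u \in s -> spanned e u.
Proof.
elim: s => [|u s [n [e [oe se]]]]; first by exists 0%N, (fun=> 0); split=> [[]|].
pose v := u - \sum_(i < n) ip u (e i) *: e i.
have ve i : ip v (e i) = 0.
  rewrite ipBl ip_suml (bigD1 i)//= ipZl oe eqxx mulr1 big1 ?addr0 ?subrr// => j ji.
  by rewrite ipZl oe (negPf ji) mulr0.
have [v0|v0] := eqVneq v 0.
  exists n, e; split=> // x; rewrite inE => /orP[/eqP ->|/se//].
  by apply/eqP; rewrite -subr_eq0 -/v v0.
have nv : `|v| != 0 by rewrite normr_eq0.
pose e' (j : 'I_n.+1) := if unlift ord0 j is Some i then e i else `|v|^-1 *: v.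
have e'0 : e' ord0 = `|v|^-1 *: v by rewrite /e' unlift_none.
have e'S i : e' (lift ord0 i) = e i by rewrite /e' liftK.
exists n.+1, e'; split.
  move=> i j; case: (unliftP ord0 i) => [a|] ->; case: (unliftP ord0 j) => [b|] ->.
  - by rewrite !e'S oe (inj_eq lift_inj).
  - by rewrite e'S e'0 ipZr ipC ve mulr0.
  - by rewrite e'S e'0 ipZl ve mulr0.
  - by rewrite e'0 ipZl ipZr eqxx -normr_inner expr2 (mulrA _ `|v|) mulVf// mul1r mulVf.
move=> x; rewrite inE /spanned big_ord_recl e'0 => /orP[/eqP ->|/se xs].
  under eq_bigr do rewrite e'S.
  have uv : ip u v = `|v| ^+ 2.
    have -> : u = v + \sum_(i < n) ip u (e i) *: e i by rewrite subrK.
    rewrite ipDl ip_suml big1 ?addr0 ?normr_inner// => i _.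
    by rewrite ipZl (ipC _ v) ve mulr0.
  rewrite ipZr scalerA uv; have -> : `|v|^-1 * `|v| ^+ 2 * `|v|^-1 = 1 by field.
  by rewrite scale1r /v subrK.
under eq_bigr do rewrite e'S.
have -> : ip x (`|v|^-1 *: v) = 0.
  rewrite ipZr {1}xs ip_suml big1 ?mulr0// => i _.
  by rewrite ipZl (ipC _ v) ve mulr0.
by rewrite scale0r add0r.
Qed.

End gram_schmidt.

(** * Polynomials in finitely many variables of the process *)

Section gaussian_polynomials.
Context {R : realType} {H : hilbertType R} d (Om : measurableType d).
Context (P : probability Om R) (W : H -> {RV P >-> R}).
Hypothesis isoW : isonormal W.
Local Notation ip := (inner H).

Section instance.
Variables (n : nat) (e : 'I_n -> H).
Hypothesis oe : orthonormal e.
Local Notation A := (mpoly n R).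

Definition evW (p : A) (w : Om) : R := meval (fun i => W (e i) w) p.

Lemma mnm_subxx (m : multinom n) : mnm_sub m m = mnm0.
Proof. by apply/mnmP => i; rewrite mnmBE mnm0E subnn. Qed.

Lemma mpoly_mulX_ind (S : A -> Prop) : (forall c : R, S c%:A) ->
  (forall F G, S F -> S G -> S (F + G)) ->
  (forall i F, S F -> S (mpolyX R (mnm1 i) * F)) -> forall F, S F.
Proof.
move=> Sc SD SX F; rewrite [F]mpolyE.
have S0 : S 0 by have := Sc 0; rewrite scale0r.
have SXk i k G : S G -> S (mpolyX R (mnm1 i) ^+ k * G).
  by move=> SG; elim: k => [|k IH]; rewrite ?expr0 ?mul1r// exprS -mulrA; exact: SX.
elim: (msupp F) => [|m r IH]; first by rewrite big_nil.
rewrite big_cons; apply: SD IH; rewrite -[mpolyX _ _]mulr1 scalerAr mpolyXE_id.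
elim: (index_enum _) => [|i s IH]; first by rewrite big_nil mul1r; exact: Sc.
by rewrite big_cons -mulrA; exact: SXk.
Qed.

Lemma evWc c w : evW c%:A w = c.
Proof. by rewrite /evW alg_mpolyC mevalC. Qed.
Lemma evWD p q w : evW (p + q) w = evW p w + evW q w.
Proof. exact: mevalD. Qed.
Lemma evWM p q w : evW (p * q) w = evW p w * evW q w.
Proof. exact: mevalM. Qed.
Lemma evWZ c p w : evW (c *: p) w = c * evW p w.
Proof. exact: mevalZ. Qed.
Lemma evWX i w : evW (mpolyX R (mnm1 i)) w = W (e i) w.
Proof. exact: mevalXU. Qed.

Lemma dircyl_evW i p : dircyl W (e i) (evW p) (evW (mderiv i p)).
Proof.
elim/mpoly_mulX_ind: p => [c|p q hp hq|j p hp].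
- have -> : evW c%:A = fun=> c by apply/funext => w; rewrite /evW alg_mpolyC mevalC.
  rewrite alg_mpolyC mderivC; have -> : evW 0 = fun=> 0 by apply/funext => w; rewrite /evW meval0.
  exact: dircyl_cst.
- have := dircylD hp hq; congr dircyl; apply/funext => w; rewrite /evW ?mderivD mevalD//.
- have := dircylM (dircyl_W W (e i) (e j)) hp; congr dircyl; apply/funext => w.
    by rewrite /evW mevalM mevalXU.
  rewrite /evW mderivM mevalD !mevalM mevalXU; congr (_ * _ + _).
  rewrite mderivX mevalZ mnm1E oe; case: eqVneq => [->|ij]; rewrite ?mul0r//.
  by rewrite mnm_subxx mpolyX0 meval1 mulr1.
Qed.

Lemma evW_moments p : moments P (evW p).
Proof.
elim/mpoly_mulX_ind: p => [c|p q hp hq|j p hp].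
- have -> : evW c%:A = fun=> c by apply/funext => w; rewrite /evW alg_mpolyC mevalC.
  exact: moments_cst.
- have := momentsD hp hq; congr moments; apply/funext => w; rewrite /evW mevalD//.
- have := momentsM (W_moments isoW (e j)) hp; congr moments; apply/funext => w.
  by rewrite /evW mevalM mevalXU.
Qed.

Definition ExW (p : A) : R := Ex P (evW p).

Lemma ExW_linear : scalar ExW.
Proof.
move=> a p q; rewrite /ExW.
have -> : evW (a *: p + q) = fun w => a * evW p w + evW q w.
  by apply/funext => w; rewrite /evW mevalD mevalZ.
have ip1 := moments_int1 (evW_moments p); have iq := moments_int1 (evW_moments q).
by rewrite ExD ?ExZ//; exact: int1Z.
Qed.

HB.instance Definition _ := GRing.isLinear.Build R A R *%R ExW ExW_linear.

Lemma ExW1 : ExW 1 = 1.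
Proof.
rewrite /ExW -[RHS](Ex_cst P); congr Ex; apply/funext => w.
by rewrite /evW meval1.
Qed.

Lemma ExW_ibp i p : ExW (mpolyX R (mnm1 i) * p) = ExW (mderiv i p).
Proof.
rewrite /ExW -(dircyl_ibp isoW (dircyl_evW i p)); congr Ex; apply/funext => w.
by rewrite /evW mevalM mevalXU.
Qed.

Lemma mderiv_mpolyX i j : mderiv i (mpolyX R (mnm1 j)) = (i == j)%:R :> A.
Proof.
rewrite mderivX mnm1E eq_sym; case: eqVneq => [->|ij]; rewrite ?scale0r//.
by rewrite mnm_subxx mpolyX0 scale1r.
Qed.

(** Elements are formal polynomials rather than random variables: identities hold exactly, and
    expectations are taken after evaluation at the [W (e i)]. *)
Definition walg : gaussian_algebra R := @GaussianAlgebra R A n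
  (fun i => mderiv i) (fun i => mpolyX R (mnm1 i)) ExW
  (fun i => mderivM i) (fun i j => mderiv_comm j i) mderiv_mpolyX ExW1 ExW_ibp
  mpoly_mulX_ind.

End instance.

End gaussian_polynomials.

(** Syntax for polynomials in the [W u], for arbitrary vectors [u], with a symbolic gradient. The
    orthonormal family, hence the algebra, depends on the vectors present; an expression is
    independent of it, can be translated by [tr] into any of these algebras, and is evaluated
    pointwise by [ev]. *)
Inductive wexp (R : realType) (H : hilbertType R) : Type :=
| Wc of R | Wv of H | Wadd of wexp H & wexp H | Wmul of wexp H & wexp H.
Arguments Wc {R H}.
Arguments Wv {R H}.

Section polynomial_expressions.
Context {R : realType} {H : hilbertType R}.
Local Notation ip := (inner H).
Implicit Types (a b : wexp H) (u e : H).

Fixpoint dirw u a : wexp H :=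
  match a with
  | Wc _ => Wc 0
  | Wv x => Wc (ip x u)
  | Wadd a b => Wadd (dirw u a) (dirw u b)
  | Wmul a b => Wadd (Wmul (dirw u a) b) (Wmul a (dirw u b))
  end.

(** The symbolic form of <Da, Db>; [tr_wgam] gives its meaning in the algebras and [ip_grad_grad]
    its meaning pointwise. *)
Fixpoint wgam a b : wexp H :=
  match a with
  | Wc _ => Wc 0
  | Wv u => dirw u b
  | Wadd a1 a2 => Wadd (wgam a1 b) (wgam a2 b)
  | Wmul a1 a2 => Wadd (Wmul (wgam a1 b) a2) (Wmul a1 (wgam a2 b))
  end.

Definition wsub a b := Wadd a (Wmul (Wc (-1)) b).

Definition wsum n (f : 'I_n -> wexp H) := \big[@Wadd R H/Wc 0]_(i < n) f i.

Fixpoint wdeg a : nat :=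
  match a with
  | Wc _ => 0
  | Wv _ => 1
  | Wadd a b => maxn (wdeg a) (wdeg b)
  | Wmul a b => wdeg a + wdeg b
  end.

Fixpoint vecs a : seq H :=
  match a with
  | Wc _ => [::]
  | Wv u => [:: u]
  | Wadd a b | Wmul a b => vecs a ++ vecs b
  end.

Lemma wdeg_dirw u a : (wdeg (dirw u a) <= wdeg a)%N.
Proof. by elim: a => [c|x|a IHa b IHb|a IHa b IHb]//=; lia. Qed.

Lemma wdeg_wgam a b : (wdeg (wgam a b) <= wdeg a + wdeg b)%N.
Proof. by elim: a => [c|x|a IHa a' IHa'|a IHa a' IHa']//=; [have := wdeg_dirw x b| |]; lia. Qed.

Lemma vecs_dirw u a x : x \in vecs (dirw u a) -> x \in vecs a.
Proof.
elim: a => [c|y|a IHa b IHb|a IHa b IHb]//=.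
  by rewrite !mem_cat => /orP[/IHa ->|/IHb ->]; rewrite ?orbT.
by rewrite !mem_cat => /orP[/orP[/IHa|]|/orP[|/IHb]] ->; rewrite ?orbT.
Qed.

Lemma vecs_wgam a b x : x \in vecs (wgam a b) -> (x \in vecs a) || (x \in vecs b).
Proof.
elim: a => [c|y|a IHa a' IHa'|a IHa a' IHa']//=.
- by move=> /vecs_dirw ->; rewrite orbT.
- by rewrite !mem_cat => /orP[/IHa|/IHa'] /orP[|] ->; rewrite ?orbT.
- rewrite !mem_cat => /orP[/orP[/IHa /orP[|]|]|/orP[|/IHa' /orP[|]]] ->; rewrite ?orbT//.
Qed.

Section translation.
Variables (A : gaussian_algebra R) (e : 'I_(gdim A) -> H).

Definition gvec u : A := \sum_i ip u (e i) *: gx i.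

Fixpoint tr a : A :=
  match a with
  | Wc c => c%:A
  | Wv u => gvec u
  | Wadd a b => tr a + tr b
  | Wmul a b => tr a * tr b
  end.

Lemma gd_gvec i u : gd i (gvec u) = (ip u (e i))%:A.
Proof.
rewrite /gvec linear_sum (bigD1 i)//= linearZ/= gdx eqxx big1 ?addr0// => j ji.
by rewrite linearZ/= gdx eq_sym (negPf ji) scaler0.
Qed.

Lemma gd_tr i a : gd i (tr a) = tr (dirw (e i) a).
Proof.
elim: a => [c|u|a IHa b IHb|a IHa b IHb] /=.
- by rewrite gdc scale0r.
- exact: gd_gvec.
- by rewrite linearD IHa IHb.
- by rewrite gdM IHa IHb.
Qed.

Lemma tr_dirw u a : spanned e u -> tr (dirw u a) = \sum_i ip u (e i) *: gd i (tr a).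
Proof.
move=> su; elim: a => [c|x|a IHa b IHb|a IHa b IHb] /=.
- by rewrite scale0r big1// => i _; rewrite gdc scaler0.
- rewrite [in LHS]su ip_sumr scaler_suml; apply: eq_bigr => i _.
  by rewrite gd_gvec ipZr scalerA.
- by rewrite IHa IHb -big_split; apply: eq_bigr => i _; rewrite linearD scalerDr.
- rewrite IHa IHb mulr_suml mulr_sumr -big_split; apply: eq_bigr => i _.
  by rewrite gdM scalerDr scalerAl scalerAr.
Qed.

Lemma tr_wgam a b : (forall u, u \in vecs a -> spanned e u) -> tr (wgam a b) = gam (tr a) (tr b).
Proof.
elim: a => [c|u|a IHa a' IHa'|a IHa a' IHa'] /= sa.
- rewrite scale0r /gam big1// => i _.
  by rewrite gdc mul0r.
- rewrite tr_dirw; last by apply: sa; rewrite inE.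
  by apply: eq_bigr => i _; rewrite gd_gvec mulr_algl.
- rewrite IHa ?IHa'; [|by move=> u ua; apply: sa; rewrite mem_cat ua ?orbT..].
  by rewrite [RHS]gamC gamDr !(gamC (tr b)).
- rewrite IHa ?IHa'; [|by move=> u ua; apply: sa; rewrite mem_cat ua ?orbT..].
  rewrite (gamC (tr a * _)) gamMr !(gamC (tr b)) addrC; congr (_ + _); exact: mulrC.
Qed.

Lemma degle_tr a : degle (wdeg a) (tr a).
Proof.
elim: a => [c|u|a IHa b IHb|a IHa b IHb] /=.
- exact: deglec.
- by apply: degle_sum => i _; apply: degleZ; exact: deglex.
- by apply: degleD; [apply: (degle_leq IHa)|apply: (degle_leq IHb)]; rewrite ?leq_maxl ?leq_maxr.
- exact: degleM.
Qed.

Lemma tr_wsub a b : tr (wsub a b) = tr a - tr b.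
Proof. by rewrite /= scaleN1r mulN1r. Qed.

Lemma tr_wsum n (f : 'I_n -> wexp H) : tr (wsum f) = \sum_i tr (f i).
Proof.
rewrite /wsum; elim: (index_enum _) => [|i r IH]; rewrite ?(big_nil, big_cons) /= ?scale0r//.
by rewrite IH.
Qed.

End translation.

Section evaluation.
Context d (Om : measurableType d) (P : probability Om R) (W : H -> {RV P >-> R}).

Fixpoint ev a (w : Om) : R :=
  match a with
  | Wc c => c
  | Wv u => W u w
  | Wadd a b => ev a w + ev b w
  | Wmul a b => ev a w * ev b w
  end.

Fixpoint grad a (w : Om) : H :=
  match a with
  | Wc c => 0
  | Wv u => u
  | Wadd a b => grad a w + grad b w
  | Wmul a b => ev b w *: grad a w + ev a w *: grad b w
  end.

Lemma ip_grad a u w : ip (grad a w) u = ev (dirw u a) w.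
Proof.
elim: a => [c|x|a IHa b IHb|a IHa b IHb] //=; rewrite ?ip0l ?ipDl ?IHa ?IHb//.
by rewrite !ipZl IHa IHb; ring.
Qed.

Lemma ip_grad_grad a b w : ip (grad a w) (grad b w) = ev (wgam a b) w.
Proof.
elim: a => [c|x|a IHa a' IHb|a IHa a' IHb] //=.
- by rewrite ip0l.
- by rewrite ipC ip_grad.
- by rewrite ipDl IHa IHb.
- by rewrite ipDl !ipZl IHa IHb; ring.
Qed.

Lemma ev_wsub a b w : ev (wsub a b) w = ev a w - ev b w.
Proof. by rewrite /=; ring. Qed.

Lemma grad_wsub a b w : grad (wsub a b) w = grad a w - grad b w.
Proof. by rewrite /= scaler0 add0r scaleN1r. Qed.

Lemma ev_wsum n (f : 'I_n -> wexp H) w : ev (wsum f) w = \sum_i ev (f i) w.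
Proof.
by rewrite /wsum; elim: (index_enum _) => [|i r IH]; rewrite ?(big_nil, big_cons) /= ?IH.
Qed.

Lemma dircyl_ev e a : dircyl W e (ev a) (ev (dirw e a)).
Proof.
elim: a => [c|x|a IHa b IHb|a IHa b IHb] /=.
- exact: dircyl_cst.
- exact: dircyl_W.
- exact: dircylD.
- exact: dircylM.
Qed.

Hypothesis isoW : isonormal W.

Lemma ev_moments a : moments P (ev a).
Proof. by have [] := dircyl_moments isoW (dircyl_ev 0 a). Qed.

Variables (n : nat) (e : 'I_n -> H).
Hypothesis oe : orthonormal e.
Let A := walg isoW oe.
Let e' : 'I_(gdim A) -> H := e.

(** Almost sure only: decomposing [u] on the family uses the linearity of [W], which is itself
    almost sure. *)
Lemma evW_tr a : (forall u, u \in vecs a -> spanned e u) ->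
  {ae P, forall w, evW W e (tr e' a) w = ev a w}.
Proof.
elim: a => [c|u|a IHa b IHb|a IHa b IHb] /= sa.
- by apply: aeW => w; exact: evWc.
- have su := sa u (mem_head _ _).
  have := W_linear isoW (fun i => ip u (e i)) e; rewrite -su.
  apply: filterS => w /= ->; rewrite /gvec.
  elim: (index_enum _) => [|i r IH].
    by rewrite !big_nil -(scale0r (1 : A)); exact: evWc.
  by rewrite !big_cons evWD evWZ evWX IH.
- apply: filterS2 (IHa _) (IHb _) => [w <- <-|u ua|u ua].
  + exact: evWD.
  + by apply: sa; rewrite mem_cat ua.
  + by apply: sa; rewrite mem_cat ua orbT.
- apply: filterS2 (IHa _) (IHb _) => [w <- <-|u ua|u ua].
  + exact: evWM.
  + by apply: sa; rewrite mem_cat ua.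
  + by apply: sa; rewrite mem_cat ua orbT.
Qed.

Lemma gE_tr a : (forall u, u \in vecs a -> spanned e u) -> gE A (tr e' a) = Ex P (ev a).
Proof.
move=> sa; apply: Ex_ae; last exact: evW_tr.
- by case: (evW_moments isoW e (tr e' a)).
- by case: (ev_moments a).
Qed.

End evaluation.

End polynomial_expressions.

(** * Random fields and their divergence *)

Section square_integrable_fields.
Context {R : realType} {H : hilbertType R} d (Om : measurableType d).
Context (P : probability Om R) (W : H -> {RV P >-> R}).
Hypothesis isoW : isonormal W.
Local Notation ip := (inner H).

Lemma Ex_sqrD_le (F G : Om -> R) : sqi P F -> sqi P G ->
  Ex P (fun w => (F w + G w) ^+ 2) <= 2 * Ex P (fun w => F w ^+ 2) + 2 * Ex P (fun w => G w ^+ 2).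
Proof.
move=> sF sG; have [_ iF] := sF; have [_ iG] := sG; have [_ iS] := sqiD sF sG.
rewrite -!ExZ// -ExD; [|exact: int1Z..].
apply: Ex_le => //; first by apply: int1D; exact: int1Z.
by move=> w; have := sqr_ge0 (F w - G w); rewrite !expr2; nra.
Qed.

Lemma sqi_le (F G : Om -> R) : measurable_fun setT F -> sqi P G ->
  (forall w, `|F w| <= `|G w|) -> sqi P F.
Proof.
move=> mF [_ iG] h; split=> //; apply: (int1_le _ iG); first exact: measurable_funX.
by move=> w; rewrite normrX -[leRHS]real_normK ?num_real// lerXn2r ?nnegrE.
Qed.

(** Weak measurability together with that of the norm, which is what the integrals of norms and
    inner products below use. *)
Definition hmeas (V : Om -> H) :=
  (forall u, measurable_fun setT (fun w => ip (V w) u)) /\ measurable_fun setT (fun w => `|V w|).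

Definition hsqi V := hmeas V /\ sqi P (fun w => `|V w|).

Definition E2 (V : Om -> H) := Ex P (fun w => `|V w| ^+ 2).

Lemma E2_ge0 V : 0 <= E2 V.
Proof. by apply: Ex_ge0 => w; exact: sqr_ge0. Qed.

(** Fields with values in a finite-dimensional space and coefficients having all moments;
    subtracting one preserves [hmeas]. *)
Inductive hfin : (Om -> H) -> Prop :=
| hfin0 : hfin (fun=> 0)
| hfinD b h V : moments P b -> hfin V -> hfin (fun w => b w *: h + V w).

Lemma normB_sqr (x y : H) : `|x - y| ^+ 2 = `|x| ^+ 2 - 2 * ip x y + `|y| ^+ 2.
Proof. by rewrite !normr_inner !(ipBl, ipBr) (ipC y x); ring. Qed.

Lemma measurable_norm_sqr (V : Om -> H) :
  measurable_fun setT (fun w => `|V w| ^+ 2) -> measurable_fun setT (fun w => `|V w|).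
Proof.
move=> m; have ms : measurable_fun setT (@Num.sqrt R).
  exact: (continuous_measurable_fun (@sqrt_continuous R)).
have -> : (fun w => `|V w|) = (fun w => Num.sqrt (`|V w| ^+ 2)).
  by apply/funext => w; rewrite sqrtr_sqr normr_id.
exact: (measurableT_comp ms m).
Qed.

Lemma hmeas_fin V U : hfin V -> hmeas U -> hmeas (fun w => U w - V w).
Proof.
move=> fV; elim: fV U => [U hU|b h V' mb fV' IH U [mU nU]].
  by have -> : (fun w => U w - 0) = U by apply/funext => w; rewrite subr0.
have -> : (fun w => U w - (b w *: h + V' w)) = (fun w => (U w - b w *: h) - V' w).
  by apply/funext => w; rewrite opprD addrA.
have mb' : measurable_fun setT b by case: mb.
apply: IH; split=> [u|].
  under eq_fun do rewrite ipBl ipZl.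
  by apply: measurable_funB => //; exact: measurable_funM.
apply: measurable_norm_sqr; under eq_fun do rewrite normB_sqr ipZr normrZ exprMn.
apply: measurable_funD; last first.
  by apply: measurable_funM => //; apply: measurable_funX; exact: measurableT_comp.
apply: measurable_funB; first exact: measurable_funX.
apply: measurable_funM => //; apply: measurable_funM => //; exact: mU.
Qed.

Lemma hfin_add V V' : hfin V -> hfin V' -> hfin (fun w => V w + V' w).
Proof.
move=> fV fV'; elim: fV => [|b h U mb _ IH].
  by have -> : (fun w => 0 + V' w) = V' by apply/funext => w; rewrite add0r.
have -> : (fun w => b w *: h + U w + V' w) = (fun w => b w *: h + (U w + V' w)).
  by apply/funext => w; rewrite addrA.
exact: hfinD.
Qed.

Lemma hfin_opp V : hfin V -> hfin (fun w => - V w).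
Proof.
elim=> [|b h U mb _ IH].
  by have -> : (fun _ : Om => - (0 : H)) = (fun=> 0); [apply/funext => w; rewrite oppr0|exact: hfin0].
have -> : (fun w => - (b w *: h + U w)) = (fun w => (-1 * b w) *: h + - U w).
  by apply/funext => w; rewrite opprD mulN1r scaleNr.
by apply: hfinD => //; exact: momentsZ.
Qed.

Lemma hfin_sub V V' : hfin V -> hfin V' -> hfin (fun w => V w - V' w).
Proof. by move=> fV fV'; apply: hfin_add => //; exact: hfin_opp. Qed.

Lemma hmeas_hfin V : hfin V -> hmeas V.
Proof.
move=> fV; have : hmeas (fun w => 0 - - V w).
  apply: hmeas_fin; first exact: hfin_opp.
  split=> [u|]; last by under eq_fun do rewrite normr0; exact: measurable_cst.
  by under eq_fun do rewrite ip0l; exact: measurable_cst.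
by under eq_fun do rewrite sub0r opprK.
Qed.

Lemma hfin_norm V : hfin V -> moments P (fun w => `|V w|).
Proof.
move=> fV; have [_ m] := hmeas_hfin fV; elim: fV m => [|b h U mb fU IH] m.
  by under eq_fun do rewrite normr0; exact: moments_cst.
have [_ mU] := hmeas_hfin fU.
apply: (moments_le (G := fun w => `|b w| * `|h| + `|U w|)) => //.
  by apply: momentsD (IH mU); apply: momentsM; [exact: moments_norm|exact: moments_cst].
move=> w; rewrite normr_id [leRHS]ger0_norm ?addr_ge0 ?mulr_ge0//.
by rewrite -normrZ ler_normD.
Qed.

Lemma hfin_hsqi V : hfin V -> hsqi V.
Proof. by move=> fV; split; [exact: hmeas_hfin|exact/moments_sqi/hfin_norm]. Qed.

Lemma measurable_ip V U : hmeas U -> hfin V -> measurable_fun setT (fun w => ip (U w) (V w)).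
Proof.
move=> [mU _]; elim=> [|b h V' mb _ IH].
  by under eq_fun do rewrite ip0r; exact: measurable_cst.
under eq_fun do rewrite ipDr ipZr; apply: measurable_funD => //.
by apply: measurable_funM => //; case: mb.
Qed.

Lemma hsqi_ip V U : hsqi U -> hfin V -> int1 P (fun w => ip (U w) (V w)).
Proof.
move=> [hU sU] fV; have [_ sV] := hfin_hsqi fV.
apply: (int1_le (measurable_ip hU fV) (sqi_mul sU sV)) => w.
exact: ip_norm_le.
Qed.

Lemma hsqi_sub V U : hsqi U -> hfin V -> hsqi (fun w => U w - V w).
Proof.
move=> [hU sU] fV; have hUV := hmeas_fin fV hU; have [_ sV] := hfin_hsqi fV.
split=> //; apply: (sqi_le (G := fun w => `|U w| + `|V w|)); [by case: hUV|exact: sqiD|].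
by move=> w; rewrite normr_id [leRHS]ger0_norm ?addr_ge0// ler_normB.
Qed.

Lemma hsqi_sub_inv V U : hmeas U -> hfin V -> sqi P (fun w => `|U w - V w|) -> hsqi U.
Proof.
move=> hU fV s; have [_ sV] := hfin_hsqi fV; split=> //.
apply: (sqi_le (G := fun w => `|U w - V w| + `|V w|)); [by case: hU|exact: sqiD|].
by move=> w; rewrite normr_id [leRHS]ger0_norm ?addr_ge0// -{1}(subrK (V w) (U w)) ler_normD.
Qed.

Lemma E2_sub_le (V V' : Om -> H) : sqi P (fun w => `|V w|) -> sqi P (fun w => `|V' w|) ->
  measurable_fun setT (fun w => `|V w - V' w|) ->
  E2 (fun w => V w - V' w) <= 2 * E2 V + 2 * E2 V'.
Proof.
move=> sV sV' m; have s := sqiD sV sV'.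
apply: le_trans (Ex_sqrD_le sV sV'); have [_ i] := s.
have [_ i'] : sqi P (fun w => `|V w - V' w|).
  by apply: sqi_le m s _ => w; rewrite normr_id [leRHS]ger0_norm ?addr_ge0// ler_normB.
by apply: Ex_le => // w; rewrite lerXn2r ?nnegrE ?addr_ge0// ler_normB.
Qed.

Lemma E2_triangle (U V V' : Om -> H) : sqi P (fun w => `|U w - V w|) ->
  sqi P (fun w => `|U w - V' w|) -> measurable_fun setT (fun w => `|V w - V' w|) ->
  E2 (fun w => V w - V' w) <= 2 * E2 (fun w => U w - V w) + 2 * E2 (fun w => U w - V' w).
Proof.
move=> sV sV' m; rewrite addrC.
have E : (fun w => V w - V' w) = (fun w => (U w - V' w) - (U w - V w)).
  by apply/funext => w; rewrite opprB [RHS]addrC addrA subrK.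
rewrite E; apply: E2_sub_le => //; move: m.
by rewrite (funext (fun w => f_equal Num.norm (congr1 (fun f => f w) E))).
Qed.

(* [delta] is the Skorokhod integral of the field [V]. *)
Inductive nice : (Om -> H) -> (Om -> R) -> Prop :=
| nice0 : nice (fun=> 0) (fun=> 0)
| niceD b b' h V delta : dircyl W h b b' -> nice V delta ->
    nice (fun w => b w *: h + V w) (fun w => W h w * b w - b' w + delta w).

Lemma nice_hfin V delta : nice V delta -> hfin V.
Proof.
elim=> [|b b' h U de hb _ IH]; first exact: hfin0.
by apply: hfinD IH; have [] := dircyl_moments isoW hb.
Qed.

Lemma nice_moments V delta : nice V delta -> moments P delta.
Proof.
elim=> [|b b' h U de hb _ IH]; first exact: moments_cst.
have [mb mb'] := dircyl_moments isoW hb.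
apply: momentsD IH; have := momentsD (momentsM (W_moments isoW h) mb) (momentsZ (-1) mb').
by under eq_fun do rewrite mulN1r.
Qed.

Definition cyl (G : Om -> R) (DG : Om -> H) :=
  hfin DG /\ forall e, dircyl W e G (fun w => ip (DG w) e).

(** Integration by parts along each [h] is applied to the product [G b]; the extra term [G b'] of
    its derivative is removed by the divergence. *)
Lemma nice_ibp G DG V delta : cyl G DG -> nice V delta ->
  Ex P (fun w => ip (DG w) (V w)) = Ex P (fun w => G w * delta w).
Proof.
move=> [fDG hG]; elim=> [|b b' h U de hb nU IH].
  by congr Ex; apply/funext => w; rewrite ip0r mulr0.
have [mG mDG] := dircyl_moments isoW (hG h); have [mb mb'] := dircyl_moments isoW hb.
have mde := nice_moments nU; have fU := nice_hfin nU.
under eq_fun do rewrite ipDr ipZr.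
rewrite ExD; last 2 first.
- exact/moments_int1/momentsM.
- exact: hsqi_ip (hfin_hsqi fDG) fU.
rewrite IH; have -> : (fun w => G w * (W h w * b w - b' w + de w)) =
    (fun w => (W h w * (G w * b w) - G w * b' w) + G w * de w).
  by apply/funext => w; ring.
have i1 : int1 P (fun w => W h w * (G w * b w)).
  by apply/moments_int1/momentsM; [exact: W_moments|exact: momentsM].
have i2 : int1 P (fun w => G w * b' w) by exact/moments_int1/momentsM.
have i3 : int1 P (fun w => G w * de w) by exact/moments_int1/momentsM.
rewrite ExD//; last exact: int1B.
congr (_ + _); rewrite ExB// (dircyl_ibp isoW (dircylM (hG h) hb)) ExD//; last first.
  exact/moments_int1/momentsM.
by rewrite addrK; congr Ex; apply/funext => w; rewrite mulrC.
Qed.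

Lemma nice_sum n (b b' : 'I_n -> Om -> R) (h : 'I_n -> H) :
  (forall i, dircyl W (h i) (b i) (b' i)) ->
  exists delta, nice (fun w => \sum_i b i w *: h i) delta.
Proof.
move=> hb; elim: (index_enum _) => [|i r [de IH]].
  exists (fun=> 0); have -> : (fun w => \sum_(i <- [::]) b i w *: h i) = fun=> 0.
    by apply/funext => w; rewrite big_nil.
  exact: nice0.
eexists; have -> : (fun w => \sum_(j <- i :: r) b j w *: h j) =
   (fun w => b i w *: h i + \sum_(j <- r) b j w *: h j) by apply/funext => w; rewrite big_cons.
exact: niceD (hb i) IH.
Qed.

Lemma cylindrical_cyl F DF : cylindrical_derivative W F DF ->
  cyl F DF /\ exists delta, nice DF delta.
Proof.
move=> [m [phi [h [sphi FE DFE]]]].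
have hb i e : dircyl W e (fun w => partial i phi (Wrow W h w))
    (fun w => \sum_(j < m) ip (h j) e * partial j (partial i phi) (Wrow W h w)).
  have sphi' : smooth_poly_growth (partial i phi).
    by move=> s; have := sphi (rcons s i); rewrite -cats1 foldr_cat.
  exists m, h, (partial i phi), (fun x => \sum_(j < m) ip (h j) e * partial j (partial i phi) x).
  by split; first exact: (smooth_dirc e h sphi').
have [de nde] := nice_sum (fun i => hb i (h i)).
have DFE' : DF = (fun w => \sum_i partial i phi (Wrow W h w) *: h i) by exact/funext.
rewrite DFE'; split; last by exists de.
split; first exact: nice_hfin nde.
move=> e; exists m, h, phi, (fun x => \sum_(i < m) ip (h i) e * partial i phi x).
split; [exact: (smooth_dirc e h sphi)|exact: FE|].
by move=> w; rewrite ip_suml; apply: eq_bigr => i _; rewrite ipZl mulrC.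
Qed.

(** In an orthonormal family spanning the vectors of [a], the coefficients of the gradient are again
    expressions, so the divergence is explicit. *)
Lemma grad_nice a : exists delta, nice (grad W a) delta.
Proof.
have [n [e [oe se]]] := gram_schmidt (vecs a).
have [de nde] := nice_sum (fun i => dircyl_ev W (e i) (dirw (e i) a)).
exists de; suff <- : (fun w => \sum_i ev W (dirw (e i) a) w *: e i) = grad W a by [].
apply/funext => w; rewrite (_ : grad W a w = \sum_i ip (grad W a w) (e i) *: e i).
  by apply: eq_bigr => i _; rewrite ip_grad.
elim: a se {de nde} => [c|x|a IHa b IHb|a IHa b IHb] /= se.
- by rewrite big1// => i _; rewrite ip0l scale0r.
- by apply: se; rewrite inE.
- have sa u : u \in vecs a -> spanned e u by move=> ua; apply: se; rewrite mem_cat ua.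
  have sb u : u \in vecs b -> spanned e u by move=> ub; apply: se; rewrite mem_cat ub orbT.
  transitivity (\sum_i ip (grad W a w) (e i) *: e i + \sum_i ip (grad W b w) (e i) *: e i).
    by rewrite -IHa// -IHb.
  by rewrite -big_split; apply: eq_bigr => i _; rewrite ipDl scalerDl.
- have sa u : u \in vecs a -> spanned e u by move=> ua; apply: se; rewrite mem_cat ua.
  have sb u : u \in vecs b -> spanned e u by move=> ub; apply: se; rewrite mem_cat ub orbT.
  transitivity (ev W b w *: (\sum_i ip (grad W a w) (e i) *: e i) +
    ev W a w *: (\sum_i ip (grad W b w) (e i) *: e i)); first by rewrite -IHa// -IHb.
  rewrite !scaler_sumr -big_split; apply: eq_bigr => i _.
  by rewrite ipDl !ipZl scalerDl !scalerA.
Qed.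

Lemma ev_cyl a : cyl (ev W a) (grad W a).
Proof.
have [de nde] := grad_nice a; split; first exact: nice_hfin nde.
move=> e; have := dircyl_ev W e a.
by have -> : ev W (dirw e a) = (fun w => ip (grad W a w) e) by apply/funext => w; rewrite ip_grad.
Qed.

(** On bounded degree the derivative is a bounded operator in L^2: this is [gE_gam_le] read through
    [tr]. *)
Lemma E2_grad_le a : E2 (grad W a) <= (wdeg a)%:R * Ex P (fun w => ev W a w ^+ 2).
Proof.
have [n [e [oe se]]] := gram_schmidt (vecs a).
have := gE_gam_le (@degle_tr _ _ (walg isoW oe) e a).
rewrite -tr_wgam// -[_ ^+ 2]/(@tr _ _ (walg isoW oe) e (Wmul a a)) !gE_tr//=; last 2 first.
- by move=> u; rewrite mem_cat => /orP[] /se.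
- by move=> u /vecs_wgam /orP[] /se.
have -> // : ev W (wgam a a) = (fun w => `|grad W a w| ^+ 2).
by apply/funext => w; rewrite normr_inner ip_grad_grad.
Qed.

End square_integrable_fields.

Section sequences_of_reals.
Context {R : realType}.
Implicit Types (u v : nat -> R).

Lemma cvg_ge_near u c l : (\forall n \near \oo, c <= u n) -> u n @[n --> \oo] --> l -> c <= l.
Proof. by move=> h ul; rewrite -(cvg_lim (@Rhausdorff R) ul); apply: limr_ge h; exact: cvgP ul. Qed.

Lemma cvg_le_near u c l : (\forall n \near \oo, u n <= c) -> u n @[n --> \oo] --> l -> l <= c.
Proof. by move=> h ul; rewrite -(cvg_lim (@Rhausdorff R) ul); apply: limr_le h; exact: cvgP ul. Qed.

Lemma cvg_ge u c l : (forall n, c <= u n) -> u n @[n --> \oo] --> l -> c <= l.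
Proof. by move=> h; apply: cvg_ge_near; exact: nearW. Qed.

Lemma cvg_le u c l : (forall n, u n <= c) -> u n @[n --> \oo] --> l -> l <= c.
Proof. by move=> h; apply: cvg_le_near; exact: nearW. Qed.

Lemma maxr_lip (a x y : R) : `|Num.max a x - Num.max a y| <= `|x - y|.
Proof.
have := ler_norm (x - y); have := ler_norm (y - x); rewrite distrC => h1 h2.
have := normr_ge0 (x - y); rewrite !maxEle => h0.
by case: (leP a x) => H1; case: (leP a y) => H2; rewrite ler_norml; apply/andP; split; lra.
Qed.

Lemma minr_lip (a x y : R) : `|Num.min a x - Num.min a y| <= `|x - y|.
Proof.
have := ler_norm (x - y); have := ler_norm (y - x); rewrite distrC => h1 h2.
have := normr_ge0 (x - y); rewrite !minEle => h0.
by case: (leP a x) => H1; case: (leP a y) => H2; rewrite ler_norml; apply/andP; split; lra.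
Qed.

Lemma clamp_lip n (x y : R) : `|clamp n x - clamp n y| <= `|x - y|.
Proof. exact: le_trans (maxr_lip _ _ _) (minr_lip _ _ _). Qed.

End sequences_of_reals.

(** * Closability of the Malliavin derivative *)

Section malliavin_closability.
Context {R : realType} {H : hilbertType R} d (Om : measurableType d).
Context (P : probability Om R) (W : H -> {RV P >-> R}).
Hypothesis isoW : isonormal W.
Local Notation ip := (inner H).

Lemma momentsB (F G : Om -> R) : moments P F -> moments P G -> moments P (fun w => F w - G w).
Proof.
by move=> hF hG; have := momentsD hF (momentsZ (-1) hG); under eq_fun do rewrite mulN1r.
Qed.

Lemma expectation_cvg0 (G : nat -> Om -> R) : (forall k, measurable_fun setT (G k)) ->
  expectation P (fun w => G k w ^+ 2) @[k --> \oo] --> 0%E ->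
  (\forall k \near \oo, sqi P (G k)) /\ Ex P (fun w => G k w ^+ 2) @[k --> \oo] --> 0.
Proof.
move=> mG /fine_cvgP[fin c]; split.
  apply: filterS fin => k fk; have [] // := @expectation_sqi _ _ _ P (G k)
    (fine (expectation P (fun w => G k w ^+ 2))) (mG k).
  by rewrite fineK.
by apply: cvg_ext c => k; rewrite ExE.
Qed.

Lemma open_preimage_comp (V : Om -> H) (phi : H -> R) :
  (forall U : set H, open U -> measurable (V @^-1` U)) -> continuous phi ->
  measurable_fun setT (fun w => phi (V w)).
Proof.
move=> mV cphi; apply: (measurability _ (RGenOpens.measurableE R)) => _ [_ [a [b ->]] <-].
rewrite setTI; apply: (mV (phi @^-1` (`]a, b[ : set R))).
by apply: open_comp; [move=> x _; exact: cphi|exact: interval_open].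
Qed.

Lemma open_preimage_hmeas (V : Om -> H) :
  (forall U : set H, open U -> measurable (V @^-1` U)) -> hmeas V.
Proof.
move=> mV; split=> [u|]; last exact: (open_preimage_comp mV (@norm_continuous _ H)).
by under eq_fun do rewrite ipC; exact: (open_preimage_comp mV (@ip_continuousr _ _ u)).
Qed.

Lemma Ex_sqr_triangle (F G K : Om -> R) : sqi P (fun w => F w - G w) ->
  sqi P (fun w => F w - K w) -> Ex P (fun w => (G w - K w) ^+ 2) <=
  2 * Ex P (fun w => (F w - G w) ^+ 2) + 2 * Ex P (fun w => (F w - K w) ^+ 2).
Proof.
move=> sG sK; have := Ex_sqrD_le (sqiZ (-1) sG) sK.
have -> : (fun w => (-1 * (F w - G w) + (F w - K w)) ^+ 2) = (fun w => (G w - K w) ^+ 2).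
  by apply/funext => w; congr (_ ^+ 2); ring.
have -> // : (fun w => (-1 * (F w - G w)) ^+ 2) = (fun w => (F w - G w) ^+ 2).
by apply/funext => w; rewrite exprMn sqrrN expr1n mul1r.
Qed.

(* With [G_l := F_l - a_l --> 0], the divergence formula makes [E <DG_l, DG_m>]
   vanish as [l] grows, while [DG_l] is Cauchy. *)
Theorem malliavin_closed (Y : {RV P >-> R}) (DY : Om -> H) (a : nat -> wexp H) (D : nat) :
  malliavin_derivative W Y DY -> (forall l, (wdeg (a l) <= D)%N) -> sqi P Y ->
  Ex P (fun w => (Y w - ev W (a l) w) ^+ 2) @[l --> \oo] --> 0 ->
  hsqi P DY /\ E2 P (fun w => DY w - grad W (a l) w) @[l --> \oo] --> 0.
Proof.
move=> [mDY [F [DF [cF cF1 cDF1]]]] aD sY ca.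
have hDY := open_preimage_hmeas mDY.
have cyF k := (cylindrical_cyl isoW (cF k)).1.
have niF k := (cylindrical_cyl isoW (cF k)).2.
have fDF k : hfin P (DF k) by case: (cyF k).
have mF k : moments P (F k) by have [_ h] := cyF k; have [] := dircyl_moments isoW (h 0).
have sFY k : sqi P (fun w => F k w - Y w) by apply: sqiB => //; exact: moments_sqi.
have [_ v0] := expectation_cvg0 (fun k => int1_meas (sqi_int1 (sFY k))) cF1.
have mDFDY k : measurable_fun setT (fun w => `|DF k w - DY w|).
  have [_] := hmeas_fin (fDF k) hDY.
  by under [X in _ -> measurable_fun _ X]eq_fun do rewrite distrC.
have [nsD u0] := expectation_cvg0 mDFDY cDF1.
have sDY : hsqi P DY.
  have [k _ /(_ k (leqnn _))] := nsD; under eq_fun do rewrite distrC.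
  exact: hsqi_sub_inv.
have fga l : hfin P (grad W (a l)) by case: (ev_cyl isoW (a l)).
have sDF k : sqi P (fun w => `|DY w - DF k w|) by case: (hsqi_sub sDY (fDF k)).
have sga k : sqi P (fun w => `|DY w - grad W (a k) w|) by case: (hsqi_sub sDY (fga k)).
pose u k := E2 P (fun w => DY w - DF k w).
have u0' : u k @[k --> \oo] --> 0.
  by apply: cvg_ext u0 => k; rewrite /u /E2; under eq_fun do rewrite distrC.
pose eps l := Ex P (fun w => (Y w - ev W (a l) w) ^+ 2).
pose G l w := F l w - ev W (a l) w; pose DG l w := DF l w - grad W (a l) w.
have sYa l : sqi P (fun w => Y w - ev W (a l) w) by apply: sqiB => //; exact/moments_sqi/ev_moments.
have sYF l : sqi P (fun w => Y w - F l w) by apply: sqiB => //; exact/moments_sqi.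
have v0' : Ex P (fun w => (Y w - F k w) ^+ 2) @[k --> \oo] --> 0.
  apply: cvg_ext v0 => k; congr Ex; apply/funext => w; rewrite -[LHS]sqrrN; congr (_ ^+ 2); ring.
have G0 : Ex P (fun w => G l w ^+ 2) @[l --> \oo] --> 0.
  apply: (@squeeze0 _ _ (fun l => 2 * Ex P (fun w => (Y w - F l w) ^+ 2) + 2 * eps l)) => [l|].
    by rewrite Ex_ge0 ?Ex_sqr_triangle// => w; exact: sqr_ge0.
  rewrite [X in _ --> X](_ : 0 = 2 * 0 + 2 * 0); last by ring.
  by apply: cvgD; (apply: cvgM; [exact: cvg_cst|]).
have fDG l : hfin P (DG l) by exact: hfin_sub.
have mDG l m : moments P (fun w => `|DG l w - DG m w|) by apply: hfin_norm; exact: hfin_sub.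
have sG l : sqi P (G l) by apply/moments_sqi; apply: momentsB => //; exact: ev_moments.
have cG l : cyl W (G l) (DG l).
  split=> // e; have [_ hF] := cyF l; have [_ ha] := ev_cyl isoW (a l).
  have := dircylD (hF e) (dircylN (ha e)); congr dircyl; apply/funext => w.
  by rewrite /DG ipBl.
(* By duality this is the expectation of [G l] against the divergence of [DG m], which is fixed
   while [G l] tends to 0 in L^2. *)
have pair m : Ex P (fun w => ip (DG l w) (DG m w)) @[l --> \oo] --> 0.
  have [de1 n1] := niF m; have [de2 n2] := grad_nice W (a m).
  have s1 := moments_sqi (nice_moments isoW n1); have s2 := moments_sqi (nice_moments isoW n2).
  have E l : Ex P (fun w => ip (DG l w) (DG m w)) = Ex P (fun w => G l w * (de1 w - de2 w)).
    have -> : (fun w => ip (DG l w) (DG m w)) =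
        (fun w => ip (DG l w) (DF m w) - ip (DG l w) (grad W (a m) w)).
      by apply/funext => w; rewrite [DG m w]/DG ipBr.
    rewrite ExB; [|exact: hsqi_ip (hfin_hsqi (fDG l)) _..].
    rewrite (nice_ibp isoW (cG l) n1) (nice_ibp isoW (cG l) n2) -ExB; [|exact: sqi_mul..].
    by congr Ex; apply/funext => w; ring.
  apply/norm_cvg0P; apply: (@squeeze0 _ _ (fun l => Num.sqrt (Ex P (fun w => G l w ^+ 2) *
      Ex P (fun w => (de1 w - de2 w) ^+ 2)))) => [l|].
    rewrite normr_ge0 E -sqrtr_sqr ler_wsqrtr// Ex_cauchy_schwarz//; exact: sqiB.
  apply: cvg_sqrt0; rewrite [X in _ --> X](_ : 0 = 0 * Ex P (fun w => (de1 w - de2 w) ^+ 2)).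
    by apply: cvgM => //; exact: cvg_cst.
  by rewrite mul0r.
pose t m := E2 P (DG m).
have tle m : t m <= 4 * u m + 4 * D%:R * eps m.
  (* |DG_l - DG_m|^2 is expanded and |DG_l|^2 dropped. The norm of the difference is then split into
     the parts from [DF] and from the polynomials, and letting [l] grow removes the terms in [l]. *)
  have bound l : t m <= 4 * u l + 4 * u m + 4 * D%:R * (eps l + eps m) +
      2 * Ex P (fun w => ip (DG l w) (DG m w)).
    have i1 : int1 P (fun w => `|DG m w| ^+ 2) by exact/moments_int1/momentsX/hfin_norm.
    have i2 : int1 P (fun w => `|DG l w - DG m w| ^+ 2) by exact/moments_int1/momentsX.
    have i3 : int1 P (fun w => ip (DG l w) (DG m w)) := hsqi_ip (hfin_hsqi (fDG l)) (fDG m).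
    have T1 : t m <= E2 P (fun w => DG l w - DG m w) + 2 * Ex P (fun w => ip (DG l w) (DG m w)).
      rewrite -ExZ// -ExD//; last exact: int1Z.
      apply: Ex_le => //; first by apply: int1D => //; exact: int1Z.
      by move=> w; rewrite normB_sqr; have := sqr_ge0 `|DG l w|; lra.
    apply: le_trans T1 _; rewrite lerD2r.
    have T2 := E2_triangle (sDF l) (sDF m) (proj2 (hmeas_hfin (hfin_sub (fDF l) (fDF m)))).
    have T3 : E2 P (fun w => grad W (a l) w - grad W (a m) w) <=
        D%:R * (2 * eps l + 2 * eps m).
      have -> : (fun w => grad W (a l) w - grad W (a m) w) = grad W (wsub (a l) (a m)).
        by apply/funext => w; rewrite grad_wsub.
      apply: le_trans (E2_grad_le isoW _) _; apply: ler_pM => //.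
      - by apply: Ex_ge0 => w; exact: sqr_ge0.
      - by rewrite ler_nat /=; have := aD l; have := aD m; lia.
      - by under eq_fun do rewrite ev_wsub; exact: Ex_sqr_triangle.
    have T4 : E2 P (fun w => DG l w - DG m w) <= 2 * E2 P (fun w => DF l w - DF m w) +
        2 * E2 P (fun w => grad W (a l) w - grad W (a m) w).
      have -> : (fun w => DG l w - DG m w) =
          (fun w => (DF l w - DF m w) - (grad W (a l) w - grad W (a m) w)).
        by apply/funext => w; rewrite /DG opprD addrACA -opprD.
      have f1 := hfin_sub (fDF l) (fDF m); have f2 := hfin_sub (fga l) (fga m).
      apply: E2_sub_le; [exact/moments_sqi/hfin_norm|exact/moments_sqi/hfin_norm|].
      by have [_] := hmeas_hfin (hfin_sub f1 f2).
    move: T2 T3 T4; rewrite -/(u l) -/(u m); lra.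
  have L : 4 * u l + 4 * u m + 4 * D%:R * (eps l + eps m) +
      2 * Ex P (fun w => ip (DG l w) (DG m w)) @[l --> \oo] -->
      4 * 0 + 4 * u m + 4 * D%:R * (0 + eps m) + 2 * 0.
    apply: cvgD; last by apply: cvgM => //; exact: cvg_cst.
    apply: cvgD; last by apply: cvgM; [exact: cvg_cst|apply: cvgD => //; exact: cvg_cst].
    by apply: cvgD; [apply: cvgM => //; exact: cvg_cst|exact: cvg_cst].
  have := cvg_ge bound L; lra.
split=> //.
apply: (@squeeze0 _ _ (fun l => 2 * u l + 2 * (4 * u l + 4 * D%:R * eps l))) => [l|]; last first.
  rewrite [X in _ --> X](_ : 0 = 2 * 0 + 2 * (4 * 0 + 4 * D%:R * 0)); last by ring.
  apply: cvgD; first by apply: cvgM => //; exact: cvg_cst.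
  apply: cvgM; first exact: cvg_cst.
  by apply: cvgD; (apply: cvgM => //; exact: cvg_cst).
rewrite E2_ge0/=.
have sDF' : sqi P (fun w => `|DF l w - DY w|) by under eq_fun do rewrite distrC.
have sDG : sqi P (fun w => `|DF l w - grad W (a l) w|) := moments_sqi (hfin_norm (fDG l)).
have := E2_triangle sDF' sDG (int1_meas (sqi_int1 (sga l))).
have -> : E2 P (fun w => DF l w - DY w) = u l.
  by rewrite /u /E2; under eq_fun do rewrite distrC.
by have := tle l; rewrite /t /DG; lra.
Qed.

Lemma sqr_le_split (x M : R) : 0 <= x -> 0 < M -> x ^+ 2 <= M * x + (M ^+ 2)^-1 * x ^+ 4.
Proof.
move=> x0 M0; have [xM|xM] := leP x M.
  rewrite -[x ^+ 2]addr0 lerD//; first by rewrite expr2 ler_wpM2r.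
  by rewrite mulr_ge0// ?invr_ge0 exprn_ge0// ltW.
rewrite -[x ^+ 2]add0r lerD//; first by rewrite mulr_ge0// ltW.
rewrite ler_pdivlMl ?exprn_gt0// (exprD x 2 2) ler_wpM2r ?exprn_ge0//.
by rewrite lerXn2r ?nnegrE// ltW.
Qed.

Lemma pow4D_le (x y : R) : (x + y) ^+ 4 <= 8 * x ^+ 4 + 8 * y ^+ 4.
Proof.
have h (s t : R) : (s + t) ^+ 2 <= 2 * s ^+ 2 + 2 * t ^+ 2.
  by have := sqr_ge0 (s - t); rewrite !expr2; nra.
rewrite !(exprM _ 2 2).
apply: le_trans (_ : (2 * x ^+ 2 + 2 * y ^+ 2) ^+ 2 <= _).
  by rewrite lerXn2r ?nnegrE ?h// ?sqr_ge0// addr_ge0// mulr_ge0// sqr_ge0.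
apply: le_trans (h _ _) _; rewrite !exprMn; lra.
Qed.

(** Bounded fourth moments keep mass from escaping: [x^2 <= M x + M^-2 x^4] for [x >= 0], with [M]
    large. The fourth moment of the limit is first bounded by clamping and Fatou's lemma. *)
Lemma cvg_L1_L2 (Z : Om -> R) (Z_ : nat -> Om -> R) (C : R) : measurable_fun setT Z ->
  (forall l, moments P (Z_ l)) -> (forall l, Ex P (fun w => Z_ l w ^+ 4) <= C) ->
  (forall l, int1 P (fun w => Z w - Z_ l w)) ->
  Ex P (fun w => `|Z w - Z_ l w|) @[l --> \oo] --> 0 ->
  sqi P Z /\ Ex P (fun w => (Z w - Z_ l w) ^+ 2) @[l --> \oo] --> 0.
Proof.
move=> mZ mZl hC iZ cZ.
have i4 l : int1 P (fun w => Z_ l w ^+ 4) by exact/moments_int1/momentsX.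
have mcl n : measurable_fun setT (fun w => clamp n (Z w)).
  have cc : continuous (fun x : R => clamp n x).
    by apply: (@clamp_continuous R R n id) => x; exact: cvg_id.
  exact: (measurableT_comp (continuous_measurable_fun cc) mZ).
have i4n n : int1 P (fun w => clamp n (Z w) ^+ 4).
  apply: (@int1_bounded _ _ _ _ _ (n%:R ^+ 4)); first exact: measurable_funX.
  by move=> w; rewrite normrX lerXn2r ?nnegrE ?clamp_le.
have Bn n : Ex P (fun w => clamp n (Z w) ^+ 4) <= 8 * C.
  have L : 8 * (2 * n%:R) ^+ 3 * Ex P (fun w => `|Z w - Z_ l w|) + 8 * C @[l --> \oo] -->
      8 * (2 * n%:R) ^+ 3 * 0 + 8 * C.
    by apply: cvgD; [apply: cvgM => //|]; exact: cvg_cst.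
  rewrite mulr0 add0r in L; apply: cvg_ge L => l.
  apply: le_trans (_ : Ex P (fun w => 8 * (2 * n%:R) ^+ 3 * `|Z w - Z_ l w| + 8 * Z_ l w ^+ 4) <= _).
    apply: Ex_le => //; first by apply: int1D; [apply: int1Z; exact: int1_norm|exact: int1Z].
    move=> w; set z := Z w; set y := Z_ l w.
    have -> : clamp n z = (clamp n z - clamp n y) + clamp n y by rewrite subrK.
    apply: le_trans (pow4D_le _ _) _; apply: lerD.
      rewrite -mulrA ler_wpM2l//; apply: le_trans (ler_norm _) _; rewrite normrX exprSr.
      apply: ler_pM; rewrite ?exprn_ge0//; last exact: clamp_lip.
      rewrite lerXn2r ?nnegrE ?mulr_ge0//; apply: le_trans (ler_normB _ _) _.
      by have := clamp_le n z; have := clamp_le n y; lra.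
    rewrite ler_wpM2l//; apply: le_trans (ler_norm _) _; rewrite normrX.
    rewrite -[leRHS](@ger0_norm _ (y ^+ 4)) ?normrX; last by rewrite (exprM y 2 2) sqr_ge0.
    by rewrite lerXn2r ?nnegrE ?clamp_norm.
  rewrite ExD ?ExZ//; [|exact: int1_norm|by apply: int1Z; exact: int1_norm|exact: int1Z].
  by rewrite lerD2l ler_wpM2l.
have ccl w : clamp n (Z w) ^+ 4 @[n --> \oo] --> Z w ^+ 4.
  have c1 := @clamp_cvg R (Z w).
  have c2 : clamp n (Z w) * clamp n (Z w) @[n --> \oo] --> Z w * Z w by exact: cvgM.
  have : (clamp n (Z w) * clamp n (Z w)) * (clamp n (Z w) * clamp n (Z w)) @[n --> \oo] -->
    (Z w * Z w) * (Z w * Z w) by exact: cvgM.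
  rewrite [X in _ --> X](_ : _ = Z w ^+ 4); last by rewrite /=; ring.
  by apply: cvg_ext => n /=; ring.
have iZ4 : int1 P (fun w => Z w ^+ 4).
  apply: (int1_fatou (F := fun n w => clamp n (Z w) ^+ 4) i4n _ ccl Bn) => n w.
  by rewrite (exprM _ 2 2) sqr_ge0.
have BZ : Ex P (fun w => Z w ^+ 4) <= 8 * C.
  have le n w : `|clamp n (Z w) ^+ 4| <= Z w ^+ 4.
    rewrite normrX -[leRHS](@ger0_norm _ (Z w ^+ 4)) ?normrX; last by rewrite (exprM _ 2 2) sqr_ge0.
    by rewrite lerXn2r ?nnegrE ?clamp_norm.
  have [c _] := Ex_dominated (fun n => int1_meas (i4n n)) ccl iZ4 le.
  exact: cvg_le Bn c.
have sZ : sqi P Z.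
  split=> //; apply: (int1_le _ (int1D (int1_cst P 1) iZ4)); first exact: measurable_funX.
  move=> w; rewrite ger0_norm ?sqr_ge0// (exprM _ 2 2).
  by have := sqr_ge0 (Z w ^+ 2 - 1); have := sqr_ge0 (Z w); rewrite !expr2; nra.
split=> //.
have iD4 l : int1 P (fun w => `|Z w - Z_ l w| ^+ 4).
  apply: (int1_le _ (int1D (int1Z 8 iZ4) (int1Z 8 (i4 l)))).
    apply: measurable_funX; apply: measurableT_comp => //.
    by apply: measurable_funB => //; case: (mZl l).
  move=> w; rewrite normrX normr_id -normrX ger0_norm; last by rewrite (exprM _ 2 2) sqr_ge0.
  have := pow4D_le (Z w) (- Z_ l w); rewrite !(exprM _ 2 2) sqrrN //.
(* The constant is 72 = 8 x 8 + 8: [pow4D_le] with the bound [8 C] for [Z] and [C] for [Z_ l]. *)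
have BD l : Ex P (fun w => `|Z w - Z_ l w| ^+ 4) <= 72 * C.
  apply: le_trans (_ : Ex P (fun w => 8 * Z w ^+ 4 + 8 * Z_ l w ^+ 4) <= _).
    apply: Ex_le => //; first by apply: int1D; exact: int1Z.
    move=> w; rewrite -normrX ger0_norm; last by rewrite (exprM _ 2 2) sqr_ge0.
    have := pow4D_le (Z w) (- Z_ l w); rewrite !(exprM _ 2 2) sqrrN //.
  rewrite ExD ?ExZ//; [|exact: int1Z..].
  by have := hC l; have := BZ; lra.
have C0 : 0 <= C.
  by apply: le_trans (hC 0%N); apply: Ex_ge0 => w; rewrite (exprM _ 2 2) sqr_ge0.
apply/cvgrPdist_le => e e0.
have [M M0 hM] : exists2 M, 0 < M & (M ^+ 2)^-1 * (72 * C) <= e / 2.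
  exists (1 + 144 * C / e); first by rewrite ltr_pwDl// divr_ge0 ?mulr_ge0// ltW.
  set t := 144 * C / e; have t0 : 0 <= t by rewrite divr_ge0 ?mulr_ge0// ltW.
  have -> : 72 * C = t * (e / 2) by rewrite /t; field; rewrite gt_eqF.
  have e2 : 0 <= e / 2 by lra.
  rewrite mulrA -[leRHS]mul1r ler_wpM2r//.
  by rewrite ler_pdivrMl ?exprn_gt0 ?ltr_pwDl// mulr1 expr2; nra.
have e2 : 0 < e / (2 * M) by rewrite divr_gt0// mulr_gt0.
have /cvgrPdist_le/(_ _ e2) := cZ; apply: filterS => l.
rewrite !sub0r !normrN !ger0_norm ?Ex_ge0// => [h|w]; last exact: sqr_ge0.
have iN := int1_norm (iZ l).
apply: le_trans (_ : Ex P (fun w => M * `|Z w - Z_ l w| + (M ^+ 2)^-1 * `|Z w - Z_ l w| ^+ 4) <= _).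
  apply: Ex_le.
  - by have [] := sqiB sZ (moments_sqi (mZl l)).
  - by apply: int1D; exact: int1Z.
  - by move=> w; rewrite -(real_normK (num_real (Z w - Z_ l w))) sqr_le_split.
rewrite ExD ?ExZ//; [|exact: int1Z..].
have M2 : 0 <= (M ^+ 2)^-1 by rewrite invr_ge0 exprn_ge0// ltW.
have := ler_wpM2l M2 (BD l); have := ler_wpM2l (ltW M0) h.
have -> : M * (e / (2 * M)) = e / 2 by field; rewrite gt_eqF.
lra.
Qed.

End malliavin_closability.

(** * Polynomial approximation of iterated derivatives *)

Section polynomial_approximation.
Context {R : realType} {H : hilbertType R} d (Om : measurableType d).
Context (P : probability Om R) (W : H -> {RV P >-> R}).
Hypothesis isoW : isonormal W.
Local Notation ip := (inner H).

(** The family is chosen once for each list, so that [alg_of] is a function of the list. *)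
Lemma gram_schmidt_sig (s : seq H) : {z : {n : nat & 'I_n -> H} |
  orthonormal (projT2 z) /\ forall u, u \in s -> spanned (projT2 z) u}.
Proof. by apply: cid; have [n [e h]] := gram_schmidt s; exists (existT _ n e). Qed.

Definition onb (s : seq H) := projT2 (sval (gram_schmidt_sig s)).
Arguments onb : clear implicits.

Lemma onb_orthonormal s : orthonormal (onb s).
Proof. by rewrite /onb; case: (svalP (gram_schmidt_sig s)). Qed.

Lemma onb_spanned s u : u \in s -> spanned (onb s) u.
Proof. by rewrite /onb; case: (svalP (gram_schmidt_sig s)) => _; exact. Qed.

Definition alg_of (s : seq H) : gaussian_algebra R := walg isoW (@onb_orthonormal s).

Definition tr_of s (a : wexp H) : alg_of s := @tr R H (alg_of s) (onb s) a.

Lemma gE_tr_of s a : {subset vecs a <= s} -> gE (alg_of s) (tr_of s a) = Ex P (ev W a).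
Proof. by move=> h; apply: gE_tr => u /h; exact: onb_spanned. Qed.

Lemma gE_tr_of_sqr s a : {subset vecs a <= s} ->
  gE (alg_of s) (tr_of s a ^+ 2) = Ex P (fun w => ev W a w ^+ 2).
Proof.
move=> h; rewrite -[tr_of s a ^+ 2]/(tr_of s (Wmul a a)) gE_tr_of// => u /=.
by rewrite mem_cat => /orP[]; exact: h.
Qed.

Lemma tr_of_wgam s a b : {subset vecs a <= s} -> tr_of s (wgam a b) = gam (tr_of s a) (tr_of s b).
Proof. by move=> h; apply: tr_wgam => u /h; exact: onb_spanned. Qed.

Lemma int1_le_ae (F G : Om -> R) : measurable_fun setT F -> int1 P G ->
  {ae P, forall w, `|F w| <= G w} -> int1 P F.
Proof.
move=> mF iG h; have mG := int1_meas iG.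
pose F' w := Num.max (- `|G w|) (Num.min `|G w| (F w)).
have mN : measurable_fun setT (fun w => `|G w|) by exact: measurableT_comp.
have mF' : measurable_fun setT F'.
  apply: measurable_maxr; last exact: measurable_minr.
  by apply: measurableT_comp mN.
have iF' : int1 P F'.
  apply: (int1_le mF' (int1_norm iG)) => w; rewrite ler_norml /F' le_max lexx/= ge_max ge_min lexx.
  by rewrite andbT; apply: le_trans (normr_ge0 _); rewrite oppr_le0.
apply: int1_ae iF' mF _; apply: filterS h => w; rewrite /F' => FG.
have {}FG := le_trans FG (ler_norm _).
by move: FG; rewrite ler_norml => /andP[h1 h2]; rewrite (min_idPr _)// (max_idPr _).
Qed.

Lemma Ex_mul_cvg0 (F G : nat -> Om -> R) (C : R) : (forall l, sqi P (F l)) -> (forall l, sqi P (G l)) ->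
  (forall l w, 0 <= F l w) -> (forall l w, 0 <= G l w) ->
  (forall l, Ex P (fun w => F l w ^+ 2) <= C) -> Ex P (fun w => G l w ^+ 2) @[l --> \oo] --> 0 ->
  Ex P (fun w => F l w * G l w) @[l --> \oo] --> 0.
Proof.
move=> sF sG F0 G0 FC cG.
have C0 : 0 <= C by apply: le_trans (FC 0%N); apply: Ex_ge0 => w; exact: sqr_ge0.
apply: (@squeeze0 _ _ (fun l => Num.sqrt (C * Ex P (fun w => G l w ^+ 2)))) => [l|].
  rewrite Ex_ge0/= => [|w]; last exact: mulr_ge0.
  rewrite -[leLHS]ger0_norm; last by apply: Ex_ge0 => w; exact: mulr_ge0.
  rewrite -sqrtr_sqr ler_wsqrtr//; apply: le_trans (Ex_cauchy_schwarz (sF l) (sG l)) _.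
  by rewrite ler_wpM2r// Ex_ge0// => w; exact: sqr_ge0.
apply: cvg_sqrt0; rewrite [X in _ --> X](_ : 0 = C * 0); last by rewrite mulr0.
by apply: cvgM => //; exact: cvg_cst.
Qed.

Lemma Ex_sqr_bounded (F : Om -> R) (F_ : nat -> Om -> R) : sqi P F -> (forall l, sqi P (F_ l)) ->
  Ex P (fun w => (F w - F_ l w) ^+ 2) @[l --> \oo] --> 0 ->
  exists C, forall l, Ex P (fun w => F_ l w ^+ 2) <= C.
Proof.
move=> sF sFl c; have [M [_ HM]] := cvg_seq_bounded c.
exists (2 * Ex P (fun w => F w ^+ 2) + 2 * M) => l.
have := Ex_sqrD_le sF (sqiZ (-1) (sqiB sF (sFl l))).
have -> : (fun w => (F w + -1 * (F w - F_ l w)) ^+ 2) = (fun w => F_ l w ^+ 2).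
  by apply/funext => w; congr (_ ^+ 2); ring.
have -> : (fun w => (-1 * (F w - F_ l w)) ^+ 2) = (fun w => (F w - F_ l w) ^+ 2).
  by apply/funext => w; rewrite exprMn sqrrN expr1n mul1r.
by have := le_trans (ler_norm _) (HM l); lra.
Qed.

Lemma gbdd_tr_of (s : nat -> seq H) (a : nat -> wexp H) D C : (forall l, {subset vecs (a l) <= s l}) ->
  (forall l, (wdeg (a l) <= D)%N) -> (forall l, Ex P (fun w => ev W (a l) w ^+ 2) <= C) ->
  gbdd (fun l => tr_of (s l) (a l)).
Proof.
move=> hs hD hC; exists D, C => l; split; last by rewrite gE_tr_of_sqr.
exact: (degle_leq (@degle_tr _ _ (alg_of (s l)) (onb (s l)) (a l)) (hD l)).
Qed.

Lemma wgam_moment4 (a b : nat -> wexp H) D C :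
  (forall l, (wdeg (a l) <= D)%N) -> (forall l, Ex P (fun w => ev W (a l) w ^+ 2) <= C) ->
  (forall l, (wdeg (b l) <= D)%N) -> (forall l, Ex P (fun w => ev W (b l) w ^+ 2) <= C) ->
  exists C', forall l, Ex P (fun w => ev W (wgam (a l) (b l)) w ^+ 4) <= C'.
Proof.
move=> aD aC bD bC; pose s l := vecs (a l) ++ vecs (b l).
have sa l : {subset vecs (a l) <= s l} by move=> u ua; rewrite mem_cat ua.
have sb l : {subset vecs (b l) <= s l} by move=> u ua; rewrite mem_cat ua orbT.
have ga := gbdd_tr_of sa aD aC; have gb := gbdd_tr_of sb bD bC.
have := gbdd_gam ga gb => gg; have [D' [C' h]] := gbddM gg gg.
exists C' => l; have [_] := h l; rewrite -tr_of_wgam//.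
set c := wgam _ _; rewrite -[_ * _]/(tr_of (s l) (Wmul c c)) gE_tr_of_sqr.
  by congr (_ <= _); congr Ex; apply/funext => w /=; ring.
by move=> u /=; rewrite mem_cat orbb => /vecs_wgam; rewrite -mem_cat.
Qed.

Definition wY (a b : wexp H) r := iter r (wgam a) b.

Lemma wdeg_wY a b r D : (wdeg a <= D)%N -> (wdeg b <= D)%N -> (wdeg (wY a b r) <= r * D + D)%N.
Proof.
move=> aD bD; elim: r => [|r IH]; first by rewrite mul0n.
by rewrite /wY iterS; apply: leq_trans (wdeg_wgam _ _) _; rewrite -/(wY a b r); lia.
Qed.

Lemma ip_sub_le (x y x' y' : H) : `|ip x y - ip x' y'| <=
  `|y| * `|x - x'| + `|x| * `|y - y'| + `|x - x'| * `|y - y'|.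
Proof.
have -> : ip x y - ip x' y' = ip (x - x') y + ip x (y - y') - ip (x - x') (y - y').
  by rewrite !(ipBl, ipBr); ring.
apply: le_trans (ler_normB _ _) _; apply: lerD; last exact: ip_norm_le.
apply: le_trans (ler_normD _ _) _; apply: lerD; last exact: ip_norm_le.
by rewrite mulrC ip_norm_le.
Qed.

(** A product of two L^2 limits converges in L^1 only. The expressions [wgam] have bounded degree,
    hence bounded fourth moments, and [cvg_L1_L2] upgrades the convergence to L^2, which permits
    iteration. *)
Lemma inner_derivatives_cvg (X Y Z : {RV P >-> R}) (DX DY : Om -> H) (a b : nat -> wexp H) D :
  malliavin_derivative W X DX -> malliavin_derivative W Y DY ->
  (\forall w \ae P, Z w = ip (DX w) (DY w)) ->
  (forall l, (wdeg (a l) <= D)%N) -> (forall l, (wdeg (b l) <= D)%N) -> sqi P X -> sqi P Y ->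
  Ex P (fun w => (X w - ev W (a l) w) ^+ 2) @[l --> \oo] --> 0 ->
  Ex P (fun w => (Y w - ev W (b l) w) ^+ 2) @[l --> \oo] --> 0 ->
  sqi P Z /\ Ex P (fun w => (Z w - ev W (wgam (a l) (b l)) w) ^+ 2) @[l --> \oo] --> 0.
Proof.
move=> hX hY hZ aD bD sX sY ca cb.
have [sDX cDX] := malliavin_closed isoW hX aD sX ca.
have [sDY cDY] := malliavin_closed isoW hY bD sY cb.
have [Ca hCa] := Ex_sqr_bounded sX (fun l => moments_sqi (ev_moments isoW (a l))) ca.
have [Cb hCb] := Ex_sqr_bounded sY (fun l => moments_sqi (ev_moments isoW (b l))) cb.
have hCa' l : Ex P (fun w => ev W (a l) w ^+ 2) <= Num.max Ca Cb by rewrite le_max hCa.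
have hCb' l : Ex P (fun w => ev W (b l) w ^+ 2) <= Num.max Ca Cb by rewrite le_max hCb orbT.
have [C4 hC4] := wgam_moment4 aD hCa' bD hCb'.
have fa l : hfin P (grad W (a l)) by case: (ev_cyl isoW (a l)).
have fb l : hfin P (grad W (b l)) by case: (ev_cyl isoW (b l)).
have [_ sNX] := sDX; have [_ sNY] := sDY.
have sda l : sqi P (fun w => `|DX w - grad W (a l) w|) by case: (hsqi_sub sDX (fa l)).
have sdb l : sqi P (fun w => `|DY w - grad W (b l) w|) by case: (hsqi_sub sDY (fb l)).
have mZ : measurable_fun setT Z by exact: measurable_funPT.
pose G l w := `|DY w| * `|DX w - grad W (a l) w| + `|DX w| * `|DY w - grad W (b l) w| +
  `|DX w - grad W (a l) w| * `|DY w - grad W (b l) w|.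
have i1 l := sqi_mul sNY (sda l); have i2 l := sqi_mul sNX (sdb l); have i3 l := sqi_mul (sda l) (sdb l).
have iG l : int1 P (G l) by apply: int1D => //; exact: int1D.
have hG l : {ae P, forall w, `|Z w - ev W (wgam (a l) (b l)) w| <= G l w}.
  by apply: filterS hZ => w ->; rewrite -ip_grad_grad; exact: ip_sub_le.
have mD l : measurable_fun setT (fun w => Z w - ev W (wgam (a l) (b l)) w).
  by apply: measurable_funB => //; case: (ev_moments isoW (wgam (a l) (b l))).
have iD l := int1_le_ae (mD l) (iG l) (hG l).
apply: (cvg_L1_L2 mZ (fun l => ev_moments isoW _) hC4 iD).
apply: (@squeeze0 _ _ (fun l => Ex P (G l))) => [l|].
  by rewrite Ex_ge0//= Ex_le_ae//; exact: int1_norm.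
have -> : (fun l => Ex P (G l)) = (fun l => Ex P (fun w => `|DY w| * `|DX w - grad W (a l) w|) +
   Ex P (fun w => `|DX w| * `|DY w - grad W (b l) w|) +
   Ex P (fun w => `|DX w - grad W (a l) w| * `|DY w - grad W (b l) w|)).
  by apply/funext => l; rewrite /G ExD ?ExD//; exact: int1D.
have [M [_ HM]] := cvg_seq_bounded cDX.
rewrite [X in _ --> X](_ : 0 = 0 + 0 + 0); last by rewrite !addr0.
apply: cvgD; first apply: cvgD.
- by apply: (Ex_mul_cvg0 (C := E2 P DY)).
- by apply: (Ex_mul_cvg0 (C := E2 P DX)).
- apply: (Ex_mul_cvg0 (C := M)) => // l; exact: le_trans (ler_norm _) (HM l).
Qed.

Lemma iterated_derivatives_cvg (X : {RV P >-> R}) (Y : nat -> {RV P >-> R})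
    (DX : Om -> H) (DY : nat -> Om -> H) (a b : nat -> wexp H) D :
  malliavin_derivative W X DX -> (forall r, malliavin_derivative W (Y r) (DY r)) ->
  (forall r, \forall w \ae P, Y r.+1 w = ip (DX w) (DY r w)) ->
  (forall l, (wdeg (a l) <= D)%N) -> (forall l, (wdeg (b l) <= D)%N) -> sqi P X -> sqi P (Y 0%N) ->
  Ex P (fun w => (X w - ev W (a l) w) ^+ 2) @[l --> \oo] --> 0 ->
  Ex P (fun w => (Y 0%N w - ev W (b l) w) ^+ 2) @[l --> \oo] --> 0 ->
  forall r, sqi P (Y r) /\ Ex P (fun w => (Y r w - ev W (wY (a l) (b l) r) w) ^+ 2) @[l --> \oo] --> 0.
Proof.
move=> hX hY YS aD bD sX sY ca cb; elim=> [|r [sYr cr]]; first by split.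
have aD' l : (wdeg (a l) <= r * D + D)%N by apply: leq_trans (aD l) _; exact: leq_addl.
have bD' l : (wdeg (wY (a l) (b l) r) <= r * D + D)%N by exact: wdeg_wY.
exact: (inner_derivatives_cvg hX (hY r) (YS r) aD' bD' sX sYr ca cr).
Qed.

End polynomial_approximation.

(** * Permanents and symmetric tensors *)

Section ryser.
Context {R : comRingType} {n : nat}.

(** The sign [(-1)^(n - |S|)] of inclusion-exclusion. *)
Definition sgnset (S : {set 'I_n}) : R := \prod_i (if i \in S then 1 else -1).

Lemma prod_indic (I : finType) (p : pred I) : \prod_i (p i)%:R = [forall i, p i]%:R :> R.
Proof.
case: (boolP [forall i, p i]) => [/forallP h|/forallPn[i hi]].
  by rewrite big1// => i _; rewrite h.
by rewrite (bigD1 i)//= (negPf hi) mul0r.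
Qed.

Lemma injectiveb_codom (f : {ffun 'I_n -> 'I_n}) : injectiveb f = [forall j, j \in codom f].
Proof.
apply/injectiveP/forallP => [fi j|h]; first by apply/codomP; exists (invF fi j); rewrite f_invF.
have : #|codom f| == #|'I_n|.
  by apply/eqP/eq_card => j; rewrite h.
by move=> /image_injP h' x y; exact: h'.
Qed.

(* Inclusion-exclusion over the sets [S] containing the image of [f]. *)
Lemma sgnset_cover (f : {ffun 'I_n -> 'I_n}) :
  \sum_(S : {set 'I_n}) sgnset S * \prod_i (f i \in S)%:R = (injectiveb f)%:R.
Proof.
transitivity (\prod_j (1 + - (j \notin codom f)%:R : R)).
  rewrite bigA_distr; apply: eq_bigr => S _.
  transitivity (\prod_j ((if j \in S then 1 else -1 : R) * ((j \in S) || (j \notin codom f))%:R)).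
    rewrite big_split/= /sgnset; congr (_ * _); rewrite !prod_indic; congr (nat_of_bool _)%:R.
    apply/forallP/forallP => h.
    - move=> j; case: (boolP (j \in codom f)) => [/codomP[i ->]|]; last by rewrite orbT.
      by rewrite h.
    - by move=> i; have := h (f i); rewrite codom_f orbF.
  by apply: eq_bigr => j _; case: (j \in S); rewrite ?mulr1// mulN1r.
rewrite injectiveb_codom -prod_indic; apply: eq_bigr => j _.
by case: (j \in codom f); rewrite ?subr0 ?subrr.
Qed.

(** Expanding the product over [i] gives a sum over all maps; the alternating sum over the sets
    containing the image keeps the bijections. *)
Theorem ryser_permanent (M : 'I_n -> 'I_n -> R) :
  \sum_(S : {set 'I_n}) sgnset S * \prod_i \sum_(j in S) M i j =
  \sum_(s : {perm 'I_n}) \prod_i M i (s i).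
Proof.
transitivity (\sum_(f : {ffun 'I_n -> 'I_n}) (\prod_i M i (f i)) * (injectiveb f)%:R).
  under [RHS]eq_bigr do rewrite -sgnset_cover mulr_sumr.
  rewrite exchange_big; apply: eq_bigr => S _ /=.
  transitivity (sgnset S * \prod_i \sum_j (M i j * (j \in S)%:R)).
    congr (_ * _); apply: eq_bigr => i _; rewrite big_mkcond; apply: eq_bigr => j _.
    by case: (j \in S); rewrite ?mulr1 ?mulr0.
  rewrite bigA_distr_bigA mulr_sumr; apply: eq_bigr => f _.
  by rewrite big_split/= mulrCA.
rewrite (bigID (fun f : {ffun 'I_n -> 'I_n} => injectiveb f)) /= addrC big1 ?add0r => [|f].
  rewrite (reindex (@pval _)) /=; last first.
    pose in_Sn := insubd (1%g : {perm 'I_n}).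
    by exists in_Sn => /= f Uf; first apply: val_inj; apply: insubdK.
  by apply: eq_big => /= [s | s _]; rewrite ?(valP s)// mulr1; apply: eq_bigr => i _; rewrite pvalE.
by move=> /negPf ->; rewrite mulr0.
Qed.

End ryser.

Section symmetric_tensors.
Context {R : realType} {H : hilbertType R} {n : nat} (T : tensor_power H n).
Local Notation ip := (inner H).
Local Notation ipT := (inner (tensor_space T)).
Local Notation pw v := (pure T (fun=> v)).

Lemma pure_dense (f : T) (eps : R) : 0 < eps -> exists m (c : 'I_m -> R) (h : 'I_m -> 'I_n -> H),
  `|f - \sum_(j < m) c j *: pure T (h j)| < eps.
Proof.
move=> e0; have := @pure_total _ _ _ T (ball f eps).
have ne : ball f eps !=set0 by exists f; exact: ballxx.
move=> /(_ ne (ball_open f eps))[x [hb [m [c [h xE]]]]].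
by exists m, c, h; move: hb; rewrite -ball_normE/= xE.
Qed.

Lemma pure_separates (x y : T) : (forall k, ipT x (pure T k) = ipT y (pure T k)) -> x = y.
Proof.
move=> h; apply/eqP; rewrite -subr_eq0 -normr_eq0 -sqrf_eq0; apply/eqP.
set z := x - y; have hz k : ipT z (pure T k) = 0 by rewrite ipBl h subrr.
apply/eqP; rewrite eq_le sqr_ge0 andbT; apply/ler_addgt0Pl => e e0.
have e1 : 0 < e / (`|z| + 1) by rewrite divr_gt0// ltr_wpDl.
have [m [c [k hk]]] := pure_dense z e1.
set g := \sum_j _ in hk; have zg : ipT z g = 0.
  by rewrite ip_sumr big1// => j _; rewrite ipZr hz mulr0.
have -> : `|z| ^+ 2 = ipT z (z - g) by rewrite ipBr zg subr0 normr_inner.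
apply: le_trans (ler_norm _) _; apply: le_trans (ip_norm_le _ _) _.
rewrite addr0; apply: le_trans (_ : (`|z| + 1) * (e / (`|z| + 1)) <= _).
  by apply: ler_pM => //; rewrite ?lerDl// ltW.
by rewrite mulrC divfK// gt_eqF// ltr_wpDl.
Qed.

(** Tested against a pure tensor, both sides are the permanent of the matrix of inner products, so
    Ryser's formula becomes the polarization identity. *)
Lemma pure_polarization (h : 'I_n -> H) :
  \sum_(s : {perm 'I_n}) pure T (h \o s) = \sum_(S : {set 'I_n}) sgnset S *: pw (\sum_(i in S) h i).
Proof.
apply: pure_separates => k; rewrite !ip_suml.
transitivity (\sum_(s : {perm 'I_n}) \prod_i ip (h (s i)) (k i)).
  by apply: eq_bigr => s _; rewrite inner_pure.
rewrite -(ryser_permanent (fun i j => ip (h j) (k i))); apply: eq_bigr => S _.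
by rewrite ipZl inner_pure; congr (_ * _); apply: eq_bigr => i _; rewrite ip_suml.
Qed.

Lemma symmetric_tensorD (a : R) (f g : T) : symmetric_tensor f -> symmetric_tensor g ->
  symmetric_tensor (a *: f + g).
Proof. by move=> sf sg s h; rewrite !ipDl !ipZl sf sg. Qed.

Lemma symmetric_tensor0 : symmetric_tensor (0 : T).
Proof. by move=> s h; rewrite !ip0l. Qed.

Lemma symmetric_pw (v : H) : symmetric_tensor (pw v).
Proof.
by move=> s h; rewrite !inner_pure [RHS](reindex_inj (@perm_inj _ s)).
Qed.

Lemma pwZ (c : R) (v : H) : pw (c *: v) = c ^+ n *: pw v.
Proof.
apply: pure_separates => k; rewrite ipZl !inner_pure.
under eq_bigr do rewrite ipZl.
by rewrite big_split/= prodr_const card_ord.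
Qed.

(** Permuting the factors of [g] leaves its distance to the symmetric [f] unchanged, and averaging
    over permutations cannot increase it. *)
Lemma symmetrization_le (f : T) (m : nat) (c : 'I_m -> R) (h : 'I_m -> 'I_n -> H)
    (g := \sum_(j < m) c j *: pure T (h j)) : symmetric_tensor f ->
  `|f - n`!%:R^-1 *: \sum_(s : {perm 'I_n}) \sum_(j < m) c j *: pure T (h j \o s)| <= `|f - g|.
Proof.
move=> sf; pose gs (s : {perm 'I_n}) := \sum_(j < m) c j *: pure T (h j \o s).
have E s : `|f - gs s| = `|f - g|.
  apply: (@pexpIrn _ 2); rewrite ?nnegrE// !normB_sqr; congr (_ - 2 * _ + _).
    by rewrite !ip_sumr; apply: eq_bigr => j _; rewrite !ipZr sf.
  rewrite !normr_inner !ip_suml; apply: eq_bigr => i _; rewrite !ip_sumr; apply: eq_bigr => j _.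
  rewrite !ipZl !ipZr !inner_pure; congr (_ * (_ * _)).
  by rewrite [RHS](reindex_inj (@perm_inj _ s)).
have nf : n`!%:R != 0 :> R by rewrite pnatr_eq0 -lt0n fact_gt0.
have card : #|{perm 'I_n}| = n`! by rewrite card_Sn.
have -> : f - n`!%:R^-1 *: \sum_s gs s = n`!%:R^-1 *: \sum_(s : {perm 'I_n}) (f - gs s).
  rewrite sumrB sumr_const card scalerBr; congr (_ - _).
  by rewrite -[f *+ _]scaler_nat scalerA mulVf// scale1r.
rewrite normrZ ger0_norm ?invr_ge0// ler_pdivrMl ?ltr0n ?fact_gt0//.
apply: le_trans (ler_norm_sum _ _ _) _; rewrite (eq_bigr _ (fun s _ => E s)).
by rewrite sumr_const card mulr_natl.
Qed.

(** Powers of unit vectors are the tensors on which [multiple_integral] is explicit; they are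
    reached by symmetrizing, polarizing and normalizing. *)
Lemma symmetric_approx (f : T) (eps : R) : (0 < n)%N -> symmetric_tensor f -> 0 < eps ->
  exists L : seq (R * H), (forall x, x \in L -> `|x.2| = 1) /\
    `|f - \sum_(x <- L) x.1 *: pw x.2| < eps.
Proof.
move=> n0 sf e0; have [m [c [h hb]]] := pure_dense f e0.
have := le_lt_trans (symmetrization_le c h sf) hb; set g := _ *: _ => hg.
suff [L [hL gE]] : exists L : seq (R * H), (forall x, x \in L -> `|x.2| = 1) /\
    g = \sum_(x <- L) x.1 *: pw x.2 by exists L; rewrite -gE.
have cat L1 L2 g1 g2 : (forall x, x \in L1 -> `|x.2| = 1) /\ g1 = \sum_(x <- L1) x.1 *: pw x.2 ->
    (forall x, x \in L2 -> `|x.2| = 1) /\ g2 = \sum_(x <- L2) x.1 *: pw x.2 ->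
    exists L : seq (R * H), (forall x, x \in L -> `|x.2| = 1) /\ g1 + g2 = \sum_(x <- L) x.1 *: pw x.2.
  move=> [h1 ->] [h2 ->]; exists (L1 ++ L2); split; last by rewrite big_cat.
  by move=> x; rewrite mem_cat => /orP[/h1|/h2].
rewrite /g exchange_big scaler_sumr; elim: (index_enum _) => [|j r [L2 H2]].
  by exists [::]; rewrite !big_nil.
rewrite big_cons -scaler_sumr pure_polarization !scaler_sumr.
suff [L1 H1] : exists L : seq (R * H), (forall x, x \in L -> `|x.2| = 1) /\
    \sum_i n`!%:R^-1 *: (c j *: (sgnset i *: pw (\sum_(i0 in i) h j i0))) =
    \sum_(x <- L) x.1 *: pw x.2 by exact: cat H1 H2.
elim: (index_enum _) => [|S t [L3 H3]]; first by exists [::]; rewrite !big_nil.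
rewrite big_cons; set u := \sum_(i in S) _; have [u0|u0] := eqVneq u 0.
  (* A zero vector cannot be normalized; its tensor power is zero because [n > 0]. *)
  exists L3; rewrite u0; have -> : pw 0 = 0.
    by have := pwZ 0 0; rewrite scale0r expr0n (gtn_eqF n0) scale0r.
  by rewrite !scaler0 add0r.
apply: (cat [:: (n`!%:R^-1 * c j * sgnset S * `|u| ^+ n, `|u|^-1 *: u)] _ _ _ _ H3).
have nu : `|u| != 0 by rewrite normr_eq0.
split=> [x|]; first by rewrite inE => /eqP ->/=; rewrite normrZ normfV normr_id mulVf.
by rewrite big_seq1/= pwZ !scalerA -!mulrA -exprMn mulfV// expr1n mulr1.
Qed.

End symmetric_tensors.

(** * Hermite polynomials *)

Section hermite_polynomials.
Context {R : realType} {H : hilbertType R}.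
Local Notation ip := (inner H).

Lemma deriv_hermite n : (hermite (R := R) n.+1)^`() = n.+1%:R *: hermite n.
Proof.
elim: n => [|n IH]; first by rewrite /= mulr1 derivC subr0 derivX scale1r.
have -> : hermite n.+2 = 'X * hermite n.+1 - (hermite n.+1)^`() :> {poly R} by [].
rewrite derivB derivM derivX mul1r IH derivZ -scalerAr -addrA -scalerBr.
by rewrite -[n.+2%:R in RHS]natr1 scalerDl scale1r addrC.
Qed.

(* [(hermp v n).1] is H_n(W v) and [(hermp v n).2] is H_n'(W v) = n H_{n-1}(W v). *)
Fixpoint hermp (v : H) n : wexp H * wexp H :=
  if n is k.+1 then
    (wsub (Wmul (Wv v) (hermp v k).1) (hermp v k).2, Wmul (Wc k.+1%:R) (hermp v k).1)
  else (Wc 1, Wc 0).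

Lemma wdeg_hermp v n : (wdeg (hermp v n).1 <= n)%N /\ (wdeg (hermp v n).2 <= n)%N.
Proof. by elim: n => [|n [IH1 IH2]]; split=> //=; lia. Qed.

Lemma vecs_hermp v n : (0 < n)%N -> v \in vecs (hermp v n).1.
Proof. by case: n => // n _; rewrite /= inE eqxx. Qed.

Lemma ev_hermp d (Om : measurableType d) (P : probability Om R) (W : H -> {RV P >-> R}) v n w :
  ev W (hermp v n).1 w = (hermite n).[W v w] /\ ev W (hermp v n).2 w = (hermite n)^`().[W v w].
Proof.
elim: n => [|n [IH1 IH2]]; first by rewrite /= derivC !hornerE.
split; last by rewrite deriv_hermite hornerZ -IH1.
by rewrite /= -/(ev W) IH1 IH2 !hornerE; ring.
Qed.

Section chaos.
Variables (A : gaussian_algebra R) (e : 'I_(gdim A) -> H) (v : H).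
Hypothesis sv : spanned e v.
Hypothesis v1 : `|v| = 1.
Local Notation h n := (tr e (hermp v n).1).
Local Notation h' n := (tr e (hermp v n).2).

Lemma tr_hermpS n : h n.+1 = gvec e v * h n - h' n.
Proof. by rewrite /= scaleN1r mulN1r. Qed.

Lemma tr_hermpS' n : h' n.+1 = n.+1%:R *: h n.
Proof. by rewrite /= mulr_algl. Qed.

Lemma gd_hermp i n : gd i (h n) = ip v (e i) *: h' n.
Proof.
elim/ltn_ind: n => -[|n] IH; first by rewrite /= gdc scale0r scaler0.
have gdB F G : gd i (F - G) = gd i F - gd i G by exact: raddfB.
rewrite tr_hermpS' tr_hermpS gdB gdM gd_gvec (IH n)// mulr_algl.
case: n IH => [|n] IH.
  have -> : h' 0%N = 0 by rewrite /= scale0r.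
  by rewrite scaler0 mulr0 raddf0 subr0 addr0 scale1r.
rewrite tr_hermpS' gdZ (IH n)// tr_hermpS -!scalerAr.
move: (gvec e v * h n) (h' n) => x y.
have -> : n.+2%:R = 1 + n.+1%:R :> R by rewrite -natr1 addrC.
rewrite scalerDl scale1r [RHS]scalerDr !scalerBr -addrA; congr (_ + (_ - _)).
by rewrite !scalerA mulrC.
Qed.

Lemma sum_ip_sqr : \sum_i ip v (e i) ^+ 2 = 1.
Proof.
have := normr_inner v; rewrite v1 expr1n [X in inner H X _]sv ip_suml => ->.
by apply: eq_bigr => i _; rewrite ipZl expr2 (ipC v (e i)).
Qed.

Lemma gE_gvec_mul F : gE A (gvec e v * F) = \sum_i ip v (e i) * gE A (gd i F).
Proof.
rewrite /gvec mulr_suml raddf_sum/=; apply: eq_bigr => i _.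
by rewrite -scalerAl gEZ gE_ibp.
Qed.

Lemma gE_hermp n : gE A (h n.+1) = 0.
Proof.
rewrite tr_hermpS gEB gE_gvec_mul.
under eq_bigr do rewrite gd_hermp gEZ mulrA -expr2.
by rewrite -mulr_suml sum_ip_sqr mul1r subrr.
Qed.

Lemma gds_hermp s n : (size s <= n)%N -> exists c, gds s (h n) = c *: h (n - size s).
Proof.
elim: s => [|i s IH] sn; first by exists 1; rewrite /= subn0 scale1r.
have [c E] := IH (ltnW sn).
have -> : (n - size (i :: s) = (n - size s).-1)%N by rewrite /= subnS.
rewrite gds_cons E gdZ gd_hermp; move: (sn); rewrite /= -subn_gt0.
case: (n - size s)%N => // k _; rewrite tr_hermpS' !scalerA; eexists; reflexivity.
Qed.

(** Derivatives of H_n(W v) are multiples of H_(n-|s|)(W v), which is centered as long as |s| <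
    n. *)
Lemma chaos_hermp n : chaos n (h n).
Proof.
split; first exact: (degle_leq (@degle_tr _ _ A e _) (proj1 (wdeg_hermp v n))).
move=> s sn; have [c E] := gds_hermp (ltnW sn); rewrite /coef E gEZ.
by move: sn; rewrite -subn_gt0; case: (n - size s)%N => // k _; rewrite gE_hermp mulr0.
Qed.

End chaos.

End hermite_polynomials.

(** * Approximation inside a fixed chaos *)

Section chaos_approximation.
Context {R : realType} {H : hilbertType R} d (Om : measurableType d).
Context (P : probability Om R) (W : H -> {RV P >-> R}).
Hypothesis isoW : isonormal W.
Context (T : forall n, tensor_power H n) (I : forall n, T n -> {RV P >-> R}).
Hypothesis hI : multiple_integral W I.

Lemma integral_sqi n (f : T n) : symmetric_tensor f ->
  sqi P (I f) /\ Ex P (fun w => I f w ^+ 2) = n`!%:R * inner (T n) f f.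
Proof.
move=> sf; apply: expectation_sqi; first exact: measurable_funPT.
exact: (integral_isometry hI).
Qed.

Lemma integral0 n : {ae P, forall w, I (0 : T n) w = 0}.
Proof.
have := integral_linear hI 1 (symmetric_tensor0 (T n)) (symmetric_tensor0 (T n)).
by rewrite scaler0 addr0; apply: filterS => w h; lra.
Qed.

Lemma integral_comb n (L : seq (R * H)) : (forall x, x \in L -> `|x.2| = 1) ->
  symmetric_tensor (\sum_(x <- L) x.1 *: pure (T n) (fun=> x.2)) /\
  {ae P, forall w, I (\sum_(x <- L) x.1 *: pure (T n) (fun=> x.2)) w =
    \sum_(x <- L) x.1 * (hermite n).[W x.2 w]}.
Proof.
elim: L => [|x L IH] hL.
  rewrite big_nil; split; first exact: symmetric_tensor0.
  by apply: filterS (integral0 n) => w ->; rewrite big_nil.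
have [sL aL] := IH (fun y yL => hL y (ltac:(by rewrite inE yL orbT))).
have hx : `|x.2| = 1 by apply: hL; rewrite inE eqxx.
rewrite big_cons; split; first by apply: symmetric_tensorD => //; exact: symmetric_pw.
have a1 := integral_linear hI x.1 (symmetric_pw (T n) x.2) sL.
have a2 := integral_hermite hI n hx.
by apply: filterS3 a1 a2 aL => w -> -> ->; rewrite big_cons.
Qed.

Definition hermsum n (L : seq (R * H)) : wexp H :=
  foldr (fun x a => Wadd (Wmul (Wc x.1) (hermp x.2 n).1) a) (Wc 0) L.

Lemma ev_hermsum n L w : ev W (hermsum n L) w = \sum_(x <- L) x.1 * (hermite n).[W x.2 w].
Proof.
elim: L => [|x L IH]; first by rewrite big_nil.
by rewrite big_cons /= IH (proj1 (ev_hermp W x.2 n w)).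
Qed.

Lemma wdeg_hermsum n L : (wdeg (hermsum n L) <= n)%N.
Proof. by elim: L => //= x L IH; have [h _] := wdeg_hermp x.2 n; lia. Qed.

Lemma chaos_hermsum n L s : (0 < n)%N -> (forall x, x \in L -> `|x.2| = 1) ->
  {subset vecs (hermsum n L) <= s} -> chaos n (tr_of isoW s (hermsum n L)).
Proof.
move=> n0; elim: L => [|x L IH] hL hs.
  rewrite /tr_of /= scale0r; exact: chaos0.
apply: chaosD; last first.
  by apply: IH => [y yL|u us]; [apply: hL; rewrite inE yL orbT|apply: hs; rewrite /= mem_cat us orbT].
rewrite /= mulr_algl; apply: chaosZ; apply: chaos_hermp.
  by apply: onb_spanned; apply: hs; rewrite /= mem_cat vecs_hermp.
by apply: hL; rewrite inE eqxx.
Qed.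

(** The isometry turns approximation of the tensor into approximation in L^2, and the Hermite clause
    identifies the approximant as a polynomial. *)
Theorem chaos_approx n (f : T n) eps : (0 < n)%N -> symmetric_tensor f -> 0 < eps ->
  exists a : wexp H, [/\ (wdeg a <= n)%N,
    forall s, {subset vecs a <= s} -> chaos n (tr_of isoW s a) &
    Ex P (fun w => (I f w - ev W a w) ^+ 2) <= eps].
Proof.
move=> n0 sf e0.
(* The bound by 1 makes the squared norm at most the norm itself. *)
have e1 : 0 < Num.min 1 (eps / n`!%:R) by rewrite lt_min ltr01 divr_gt0// ltr0n fact_gt0.
have [L [hL hf]] := symmetric_approx n0 sf e1.
exists (hermsum n L); split; [exact: wdeg_hermsum|by move=> s; exact: chaos_hermsum|].
set g := \sum_(x <- L) _ in hf; have [sg ag] := integral_comb n hL.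
have sfg : symmetric_tensor (-1 *: g + f) by exact: symmetric_tensorD.
have [sI E] := integral_sqi sfg.
have a1 := integral_linear hI (-1) sg sf.
have -> : Ex P (fun w => (I f w - ev W (hermsum n L) w) ^+ 2) =
    Ex P (fun w => I (-1 *: g + f) w ^+ 2).
  apply: Ex_ae.
  - apply: measurable_funX; apply: measurable_funB; first exact: measurable_funPT.
    by case: (ev_moments isoW (hermsum n L)).
  - by case: sI => m _; exact: measurable_funX.
  - apply: filterS2 a1 ag => w -> E'; congr (_ ^+ 2); rewrite ev_hermsum -E'; ring.
rewrite E -normr_inner scaleN1r addrC; move: hf; rewrite lt_min => /andP[h1 h2].
have f0 : 0 < n`!%:R :> R by rewrite ltr0n fact_gt0.
rewrite mulrC -ler_pdivlMr//; apply: le_trans (ltW h2).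
by rewrite expr2 -[leRHS]mul1r ler_wpM2r// ltW.
Qed.

End chaos_approximation.

(** * Convergence in law of row vectors *)

Section laws_on_row_vectors.
Context {R : realType} {m : nat}.
Local Notation dot := (@dotrow R m).

Section one_space.
Context d (Om : measurableType d) (P : probability Om R).

(* Chebyshev's inequality makes a bound on the second moment a uniform tightness. *)
Lemma trig_controls (g : 'rV[R]_m -> R) (M C eps : R) : continuous g -> (forall x, `|g x| <= M) ->
  0 < eps -> exists2 f, trig dot f &
  forall V : Om -> 'rV[R]_m, (forall t, measurable_fun setT (fun w => dot t (V w))) ->
    int1 P (fun w => `|V w| ^+ 2) -> Ex P (fun w => `|V w| ^+ 2) <= C ->
    `|Ex P (fun w => g (V w)) - Ex P (fun w => f (V w))| <= eps.
Proof.
move=> cg gM e0; have M0 : 0 <= M := le_trans (normr_ge0 _) (gM 0).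
pose e := Num.min (eps / 2) 1; have e1 : 0 < e by rewrite lt_min ltr01 divr_gt0.
(* Outside the ball of radius [n >= 1] the difference is at most [2 M + 1], and |V|^2 / n is at
   least 1; this [n] makes that contribution at most [eps / 2]. *)
pose n := (Num.truncn (1 + (2 * M + 1) * `|C| * 2 / eps)).+1.
have [f [tf fg fM]] := trig_dense (@dotrowD R m) (@dotrowZ R m) (@dotrow_continuous R m)
  (@dotrow_separates R m) (@rowball_compact R m) n cg e1 gM.
exists f => // V mV iV EV.
have ig : int1 P (fun w => g (V w)).
  by apply: (@int1_bounded _ _ _ _ _ M) => //; exact: measurable_continuous_row.
have if_ : int1 P (fun w => f (V w)).
  apply: (@int1_bounded _ _ _ _ _ (M + e)) => //.
  by apply: measurable_continuous_row => //; exact: (trig_continuous (@dotrow_continuous R m) tf).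
rewrite -ExB//; have n1 : (0 : R) < n%:R by rewrite ltr0n.
have nB : 1 + (2 * M + 1) * `|C| * 2 / eps <= n%:R by exact/ltW/truncnS_gt.
apply: le_trans (_ : Ex P (fun w => e + (2 * M + 1) / n%:R * `|V w| ^+ 2) <= _).
  apply: Ex_norm_le; first exact: int1B.
    by apply: int1D; [exact: int1_cst|exact: int1Z].
  move=> w; have [Vn|Vn] := leP `|V w| n%:R.
    rewrite distrC; apply: le_trans (fg _ Vn) _.
    by rewrite lerDl mulr_ge0 ?divr_ge0 ?sqr_ge0 ?addr_ge0 ?mulr_ge0.
  apply: le_trans (_ : 2 * M + 1 <= _).
    apply: le_trans (ler_normB _ _) _; have := gM (V w); have := fM (V w).
    have : e <= 1 by rewrite ge_min lexx orbT.
    lra.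
  have n_ge1 : (1 : R) <= n%:R.
    by apply: le_trans nB; rewrite lerDl divr_ge0 ?mulr_ge0 ?addr_ge0 ?mulr_ge0// ltW.
  have V2 : n%:R <= `|V w| ^+ 2 by rewrite expr2; nra.
  suff : 2 * M + 1 <= (2 * M + 1) / n%:R * `|V w| ^+ 2 by lra.
  by rewrite mulrAC ler_pdivlMr// ler_wpM2l// addr_ge0// mulr_ge0.
rewrite ExD ?ExZ ?Ex_cst//; [|exact: int1_cst|exact: int1Z].
have eh : e <= eps / 2 by rewrite ge_min lexx.
have H : (2 * M + 1) / n%:R * Ex P (fun w => `|V w| ^+ 2) <= eps / 2.
  apply: le_trans (_ : (2 * M + 1) / n%:R * `|C| <= _).
    by rewrite ler_wpM2l ?divr_ge0 ?addr_ge0 ?mulr_ge0//; exact: le_trans EV (ler_norm _).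
  rewrite mulrAC ler_pdivrMr//.
  have h0 : 0 <= eps / 2 by lra.
  have := ler_wpM2l h0 nB; rewrite mulrDr mulr1.
  have -> : eps / 2 * ((2 * M + 1) * `|C| * 2 / eps) = (2 * M + 1) * `|C|.
    by field; rewrite gt_eqF.
  lra.
lra.
Qed.

Definition L2_bounded (V : nat -> Om -> 'rV[R]_m) := exists C, forall N,
  int1 P (fun w => `|V N w| ^+ 2) /\ Ex P (fun w => `|V N w| ^+ 2) <= C.

Lemma Ex_trig_cvg (V : nat -> Om -> 'rV[R]_m) (c : 'rV[R]_m -> R -> R) f : trig dot f ->
  (forall N t, measurable_fun setT (fun w => dot t (V N w))) ->
  (forall t b, Ex P (fun w => cos (dot t (V N w) + b)) @[N --> \oo] --> c t b) ->
  exists l : R, Ex P (fun w => f (V N w)) @[N --> \oo] --> l.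
Proof.
move=> [s ->] mV hc; rewrite /trig_sum.
have i N t b : int1 P (fun w => cos (dot t (V N w) + b)).
  apply: (@int1_bounded _ _ _ _ _ 1) => //; last by move=> w; exact: cos_max.
  by apply: measurable_fun_cos; exact: measurable_funD.
have -> : (fun N => Ex P (fun w => \sum_(z <- s) z.1.1 * cos (dot z.1.2 (V N w) + z.2))) =
    (fun N => \sum_(z <- s) z.1.1 * Ex P (fun w => cos (dot z.1.2 (V N w) + z.2))).
  apply/funext => N; rewrite Ex_sum => [|z]; last exact: int1Z.
  by apply: eq_bigr => z _; rewrite ExZ.
exists (\sum_(z <- s) z.1.1 * c z.1.2 z.2).
elim: s => [|z s IH]; first by under eq_fun do rewrite big_nil; rewrite big_nil; exact: cvg_cst.
under eq_fun do rewrite big_cons; rewrite big_cons.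
by apply: cvgD => //; apply: cvgM; [exact: cvg_cst|exact: hc].
Qed.

Lemma Ex_continuous_cvg (V : nat -> Om -> 'rV[R]_m) (c : 'rV[R]_m -> R -> R) (g : 'rV[R]_m -> R) M :
  (forall N t, measurable_fun setT (fun w => dot t (V N w))) -> L2_bounded V ->
  (forall t b, Ex P (fun w => cos (dot t (V N w) + b)) @[N --> \oo] --> c t b) ->
  continuous g -> (forall x, `|g x| <= M) ->
  exists l : R, Ex P (fun w => g (V N w)) @[N --> \oo] --> l.
Proof.
move=> mV [C hC] hc cg gM; apply/cvg_ex/cauchy_cvgP/cauchyP => e e0.
have e4 : 0 < e / 4 by lra.
have [f tf hf] := trig_controls C cg gM e4.
have [l hl] := Ex_trig_cvg tf mV hc.
exists l; move/cvgrPdist_le: hl => /(_ _ e4); apply: filterS => N hN.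
have [iN CN] := hC N; have := hf (V N) (mV N) iN CN => h.
rewrite -ball_normE/=.
have -> : l - Ex P (fun w => g (V N w)) = (l - Ex P (fun w => f (V N w))) -
  (Ex P (fun w => g (V N w)) - Ex P (fun w => f (V N w))) by ring.
apply: le_lt_trans (ler_normB _ _) _; lra.
Qed.

Lemma Ex_trig_sub (V V' : nat -> Om -> 'rV[R]_m) f : trig dot f ->
  (forall N t, measurable_fun setT (fun w => dot t (V N w))) ->
  (forall N t, measurable_fun setT (fun w => dot t (V' N w))) ->
  (forall t b, Ex P (fun w => cos (dot t (V N w) + b)) -
    Ex P (fun w => cos (dot t (V' N w) + b)) @[N --> \oo] --> 0) ->
  Ex P (fun w => f (V N w)) - Ex P (fun w => f (V' N w)) @[N --> \oo] --> 0.
Proof.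
move=> [s ->] mV mV' hc; rewrite /trig_sum.
have i U N t b : (forall N t, measurable_fun setT (fun w => dot t (U N w))) ->
    int1 P (fun w => cos (dot t (U N w) + b)).
  move=> mU; apply: (@int1_bounded _ _ _ _ _ 1) => //; last by move=> w; exact: cos_max.
  by apply: measurable_fun_cos; exact: measurable_funD.
have E N : Ex P (fun w => \sum_(z <- s) z.1.1 * cos (dot z.1.2 (V N w) + z.2)) -
    Ex P (fun w => \sum_(z <- s) z.1.1 * cos (dot z.1.2 (V' N w) + z.2)) =
    \sum_(z <- s) z.1.1 * (Ex P (fun w => cos (dot z.1.2 (V N w) + z.2)) -
      Ex P (fun w => cos (dot z.1.2 (V' N w) + z.2))).
  rewrite !Ex_sum => [|z|z]; [|by apply: int1Z; exact: i..].
  rewrite -sumrB; apply: eq_bigr => z _; rewrite !ExZ ?mulrBr//; exact: i.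
apply: cvg_ext (fun N => esym (E N)) _.
elim: s {E} => [|z s IH]; first by under eq_fun do rewrite big_nil; exact: cvg_cst.
have H : z.1.1 * (Ex P (fun w => cos (dot z.1.2 (V N w) + z.2)) -
    Ex P (fun w => cos (dot z.1.2 (V' N w) + z.2))) +
  \sum_(z <- s) z.1.1 * (Ex P (fun w => cos (dot z.1.2 (V N w) + z.2)) -
    Ex P (fun w => cos (dot z.1.2 (V' N w) + z.2))) @[N --> \oo] --> z.1.1 * 0 + 0.
  by apply: cvgD => //; apply: cvgM; [exact: cvg_cst|exact: hc].
by rewrite mulr0 addr0 in H; apply: cvg_ext H => N; rewrite big_cons.
Qed.

Lemma Ex_continuous_sub (V V' : nat -> Om -> 'rV[R]_m) (g : 'rV[R]_m -> R) M :
  (forall N t, measurable_fun setT (fun w => dot t (V N w))) -> L2_bounded V ->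
  (forall N t, measurable_fun setT (fun w => dot t (V' N w))) -> L2_bounded V' ->
  (forall t b, Ex P (fun w => cos (dot t (V N w) + b)) -
    Ex P (fun w => cos (dot t (V' N w) + b)) @[N --> \oo] --> 0) ->
  continuous g -> (forall x, `|g x| <= M) ->
  Ex P (fun w => g (V N w)) - Ex P (fun w => g (V' N w)) @[N --> \oo] --> 0.
Proof.
move=> mV [C hC] mV' [C' hC'] hc cg gM; apply/cvgrPdist_le => e e0.
have e4 : 0 < e / 4 by lra.
have [f tf hf] := trig_controls (Num.max C C') cg gM e4.
have /cvgrPdist_le/(_ _ e4) := Ex_trig_sub tf mV mV' hc; apply: filterS => N.
have [iN CN] := hC N; have [iN' CN'] := hC' N.
have C1 : Ex P (fun w => `|V N w| ^+ 2) <= Num.max C C' by rewrite le_max CN.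
have C2 : Ex P (fun w => `|V' N w| ^+ 2) <= Num.max C C' by rewrite le_max CN' orbT.
have := hf (V N) (mV N) iN C1; have := hf (V' N) (mV' N) iN' C2.
move: (Ex P _) (Ex P _) (Ex P _) (Ex P _) => a b c k h1 h2; rewrite !sub0r !normrN => h3.
have -> : b - k = (b - a) + (a - c) - (k - c) by ring.
apply: le_trans (ler_normB _ _) _; have := ler_normD (b - a) (a - c); lra.
Qed.

End one_space.

End laws_on_row_vectors.

Lemma cvg_bigsum (R : realType) (I : Type) (r : seq I) (u : I -> nat -> R) (l : I -> R) :
  (forall i, u i N @[N --> \oo] --> l i) ->
  \sum_(i <- r) u i N @[N --> \oo] --> \sum_(i <- r) l i.
Proof.
move=> h; elim: r => [|i r IH].
  by rewrite big_nil; apply: cvg_ext (cvg_cst _) => N; rewrite big_nil.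
have : u i N + \sum_(i <- r) u i N @[N --> \oo] --> l i + \sum_(i <- r) l i.
  by apply: cvgD; [exact: h|exact: IH].
by rewrite big_cons; apply: cvg_ext => N; rewrite big_cons.
Qed.

Lemma powD_le (R : realType) (x y : R) n : 0 <= x -> 0 <= y ->
  (x + y) ^+ n <= 2 ^+ n * (x ^+ n + y ^+ n).
Proof.
move=> x0 y0; wlog xy : x y x0 y0 / x <= y => [h|].
  have [/h|/ltW/h] := leP x y; first by apply.
  by rewrite addrC [y ^+ n + _]addrC; apply.
apply: le_trans (_ : (2 * y) ^+ n <= _).
  by rewrite lerXn2r ?nnegrE ?addr_ge0 ?mulr_ge0//; lra.
by rewrite exprMn ler_wpM2l ?exprn_ge0// lerDr exprn_ge0.
Qed.

Lemma pow_sum_le (R : realType) (I : Type) (r : seq I) n : exists2 K : R, 0 <= K &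
  forall y : I -> R, (forall i, 0 <= y i) ->
  (1 + \sum_(i <- r) y i) ^+ n <= K * (1 + \sum_(i <- r) y i ^+ n).
Proof.
elim: r => [|i r [K K0 IH]].
  by exists 1 => // y _; rewrite !big_nil addr0 expr1n mul1r.
exists (2 ^+ n * (1 + K)) => [|y y0]; first by rewrite mulr_ge0 ?exprn_ge0 ?addr_ge0.
have S0 : 0 <= \sum_(i <- r) y i by exact: sumr_ge0.
have Sn : 0 <= \sum_(i <- r) y i ^+ n by apply: sumr_ge0 => j _; rewrite exprn_ge0.
rewrite !big_cons addrCA; apply: le_trans (powD_le n (y0 i) _) _; first by rewrite addr_ge0.
rewrite -mulrA ler_wpM2l ?exprn_ge0//; have := IH y y0; have := exprn_ge0 n (y0 i).
move: (\sum_(i <- r) y i ^+ n) (_ ^+ n) Sn ((1 + _) ^+ n) => s t s0 u t0 us.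
have : 0 <= K * t by exact: mulr_ge0.
nra.
Qed.

(** * From convergence in law to convergence of moments *)

Section laws_of_polynomials.
Context {R : realType} {H : hilbertType R} d (Om : measurableType d).
Context (P : probability Om R) (W : H -> {RV P >-> R}).
Hypothesis isoW : isonormal W.
Context d' (Om' : measurableType d') (P' : probability Om' R).

Definition wpow (a : wexp H) k := iter k (Wmul a) (Wc 1).

Lemma ev_wpow a k w : ev W (wpow a k) w = ev W a w ^+ k.
Proof. by elim: k => //= k ->; rewrite exprS. Qed.

Lemma ev_moment_le a D k : (wdeg a <= D)%N ->
  Ex P (fun w => (ev W a w ^+ k) ^+ 2) <= momC D k * Ex P (fun w => ev W a w ^+ 2) ^+ k.
Proof.
move=> aD; pose s := vecs a.
have := @gE_moment_le _ (alg_of isoW s) D k (tr_of isoW s a)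
  (degle_leq (@degle_tr _ _ (alg_of isoW s) (@onb _ _ s) a) aD).
have -> : tr_of isoW s a ^+ k = tr_of isoW s (wpow a k).
  by elim: k => [|k IH]; rewrite ?expr0 ?exprS ?IH /tr_of /= ?scale1r.
rewrite !gE_tr_of_sqr//; last first.
  by elim: k => //= k IH u; rewrite mem_cat => /orP[|/IH].
by under [X in Ex P X <= _ -> _]eq_fun do rewrite ev_wpow.
Qed.

Lemma ev_moments_bounded (F : nat -> wexp H) D C k : (forall N, (wdeg (F N) <= D)%N) ->
  (forall N, Ex P (fun w => ev W (F N) w ^+ 2) <= C) ->
  exists C', forall N, Ex P (fun w => `|ev W (F N) w| ^+ k) <= C'.
Proof.
move=> FD FC; exists (1 + momC D k * C ^+ k) => N.
have mF := ev_moments isoW (F N).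
have i2 : int1 P (fun w => (ev W (F N) w ^+ k) ^+ 2) by exact/moments_int1/momentsX/momentsX.
apply: le_trans (_ : Ex P (fun w => 1 + (ev W (F N) w ^+ k) ^+ 2) <= _).
  apply: Ex_le.
  - by case: mF.
  - by apply: int1D => //; exact: int1_cst.
  - move=> w; rewrite -normrX -(real_normK (num_real (ev W (F N) w ^+ k))).
    by have := sqr_ge0 (`|ev W (F N) w ^+ k| - 1); have := normr_ge0 (ev W (F N) w ^+ k); nra.
rewrite ExD ?Ex_cst//; last exact: int1_cst.
rewrite lerD2l; apply: le_trans (ev_moment_le k (FD N)) _.
rewrite ler_wpM2l ?momC_ge0// lerXn2r ?nnegrE//.
  by apply: Ex_ge0 => w; exact: sqr_ge0.
by apply: le_trans (FC N); apply: Ex_ge0 => w; exact: sqr_ge0.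
Qed.

Lemma eventually_bounded (u : nat -> R) M : (\forall N \near \oo, u N <= M) ->
  exists C, forall N, u N <= C.
Proof.
move=> [N0 _ h]; exists (`|M| + \sum_(i < N0) `|u i|) => N.
have S0 (n : nat) : 0 <= \sum_(i < n) `|u i| by apply: sumr_ge0.
have [NN|NN] := leqP N0 N.
  by apply: le_trans (h N NN) _; apply: le_trans (ler_norm _) _; rewrite lerDl.
apply: le_trans (ler_norm _) _; rewrite -[leLHS]add0r lerD//.
by rewrite (bigD1 (Ordinal NN))//= lerDl sumr_ge0.
Qed.

(* Paley-Zygmund: by hypercontractivity [E min(F^2 / E F^2, 2 K) >= 1/2], so a large
   second moment would be visible on a bounded continuous test function. *)
Lemma bounded_of_law (F : nat -> wexp H) D (V : nat -> Om -> R) (V' : Om' -> R) :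
  (forall N, (wdeg (F N) <= D)%N) -> (forall N, sqi P (V N)) ->
  Ex P (fun w => (V N w - ev W (F N) w) ^+ 2) @[N --> \oo] --> 0 ->
  measurable_fun setT V' ->
  (forall g : R -> R, continuous g -> (exists M, forall x, `|g x| <= M) ->
    Ex P (fun w => g (V N w)) @[N --> \oo] --> Ex P' (fun w => g (V' w))) ->
  exists C, forall N, Ex P (fun w => ev W (F N) w ^+ 2) <= C.
Proof.
move=> FD sV cFV mV' law.
(* Chosen above [momC D 2], so that the fourth-moment term below contributes less than one half. *)
pose K : R := 1 + momC D 2; have K0 : 0 < K by rewrite ltr_pwDl// momC_ge0.
pose h (M : nat) (x : R) := Num.min (2 * x ^+ 2 / M.+1%:R) (2 * K).
have h0 M x : 0 <= h M x.
  rewrite /h le_min; apply/andP; split; last by rewrite mulr_ge0// ltW.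
  by rewrite divr_ge0// mulr_ge0// sqr_ge0.
have hK M x : `|h M x| <= 2 * K by rewrite ger0_norm// /h ge_min lexx orbT.
have ch M : continuous (h M).
  move=> x; apply: (@continuous_min _ _ (fun x : R => 2 * x ^+ 2 / M.+1%:R) (fun=> 2 * K));
    last exact: cst_continuous.
  apply: (continuousM (s := fun x : R => 2 * x ^+ 2)); last exact: cst_continuous.
  apply: (continuousM (s := fun=> 2)); first exact: cst_continuous.
  exact: exprn_continuous.
have mh M : measurable_fun setT (fun w => h M (V' w)).
  exact: measurableT_comp (continuous_measurable_fun (ch M)) mV'.
have hlim : Ex P' (fun w => h M (V' w)) @[M --> \oo] --> 0.
  have hw w : h M (V' w) @[M --> \oo] --> (0 : R).
    apply: (@squeeze0 _ _ (fun M => 2 * V' w ^+ 2 * M.+1%:R^-1)) => [M|].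
      by rewrite h0/= /h ge_min lexx.
    rewrite [X in _ --> X](_ : 0 = 2 * V' w ^+ 2 * 0); last by rewrite mulr0.
    by apply: cvgM; [exact: cvg_cst|exact: cvg_harmonic].
  have [c _] := @Ex_dominated _ _ _ P' (fun M w => h M (V' w)) (fun=> 0) (fun=> 2 * K) mh
    hw (int1_cst _ _) (fun M w => hK M _).
  by rewrite Ex_cst in c.
have e8 : 0 < 8^-1 :> R by rewrite invr_gt0.
have [M hM] : exists M, Ex P' (fun w => h M (V' w)) <= 8^-1.
  have /cvgrPdist_le/(_ _ e8)[M _ /(_ M (leqnn M))] := hlim.
  rewrite sub0r normrN => hM; exists M; exact: le_trans (ler_norm _) hM.
apply: (@eventually_bounded _ M.+1%:R).
have L1 := law (h M) (ch M) (ex_intro _ (2 * K) (hK M)).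
have /cvgrPdist_le/(_ _ e8) := L1; have /cvgrPdist_le/(_ _ e8) := cFV.
apply: filterS2 => N; rewrite sub0r normrN => hD hV.
have {}hD := le_trans (ler_norm _) hD.
have {}hV : Ex P (fun w => h M (V N w)) <= 4^-1.
  have e : 8^-1 + 8^-1 = 4^-1 :> R by field.
  by move: hV; rewrite ler_norml => /andP[h1 _]; lra.
rewrite leNgt; apply/negP => Ma.
set a := Ex P _ in Ma; have a0 : 0 < a by apply: le_lt_trans Ma.
have m1 : (0 : R) < M.+1%:R by rewrite ltr0n.
have mF := ev_moments isoW (F N).
have i2 : int1 P (fun w => ev W (F N) w ^+ 2) by exact/moments_int1/momentsX.
have i4 : int1 P (fun w => (ev W (F N) w ^+ 2) ^+ 2) by exact/moments_int1/momentsX/momentsX.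
have iV : int1 P (fun w => h M (V N w)).
  apply: (@int1_bounded _ _ _ _ _ (2 * K)) => //.
  by apply: measurableT_comp (continuous_measurable_fun (ch M)) _; case: (sV N).
have iD : int1 P (fun w => (V N w - ev W (F N) w) ^+ 2).
  by have [] := sqiB (sV N) (moments_sqi mF).
(* If [f^2 / a] is at most [2 K] it is compared with [h M v], using [a > M + 1]; otherwise it is
   below its own square divided by [2 K]. *)
have pw w : a^-1 * ev W (F N) w ^+ 2 <= h M (V N w) + 2 * (V N w - ev W (F N) w) ^+ 2 +
    (a ^+ 2 * (2 * K))^-1 * (ev W (F N) w ^+ 2) ^+ 2.
  rewrite mulrC [_^-1 * _ ^+ 2]mulrC.
  set f := ev W (F N) w; set v := V N w.
  have fv : f ^+ 2 <= 2 * v ^+ 2 + 2 * (v - f) ^+ 2.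
    by have := sqr_ge0 (v + (v - f)); rewrite !expr2; nra.
  pose y := f ^+ 2 / a; rewrite -/y.
  have y0 : 0 <= y by rewrite divr_ge0 ?sqr_ge0// ltW.
  have -> : (f ^+ 2) ^+ 2 / (a ^+ 2 * (2 * K)) = y ^+ 2 / (2 * K).
    by rewrite /y; field; rewrite !gt_eqF.
  have K2 : 0 < 2 * K by rewrite mulr_gt0.
  have s0 := sqr_ge0 (v - f).
  have yM : y <= 2 * v ^+ 2 / M.+1%:R + 2 * (v - f) ^+ 2.
    apply: le_trans (_ : f ^+ 2 / M.+1%:R <= _).
      by rewrite ler_wpM2l ?sqr_ge0// lef_pV2 ?posrE// ltW.
    rewrite ler_pdivrMr// mulrDl divfK ?gt_eqF//; apply: le_trans fv _; rewrite lerD2l.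
    by apply: ler_peMr; [exact: mulr_ge0|rewrite ler1n].
  have [yK|yK] := leP y (2 * K).
    have : 0 <= y ^+ 2 / (2 * K) by rewrite divr_ge0 ?sqr_ge0// ltW.
    suff : y <= h M v + 2 * (v - f) ^+ 2 by lra.
    rewrite /h minEle; case: ifP => _; first exact: yM.
    by apply: le_trans yK _; rewrite lerDl mulr_ge0.
  have : y <= y ^+ 2 / (2 * K) by rewrite ler_pdivlMr// expr2 ler_wpM2l// ltW.
  have := h0 M v; lra.
(* After integration the left side is 1, while the three terms on the right are at most 1/4, at most
   1/4 and less than 1/2. *)
have := Ex_le (int1Z a^-1 i2) _ pw.
rewrite !(ExD, ExZ)//; [|exact: int1Z|exact: int1D iV (int1Z _ iD)|exact: int1Z].
move=> /(_ (int1D (int1D iV (int1Z _ iD)) (int1Z _ i4))).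
rewrite -/a mulVf ?gt_eqF//.
have := ev_moment_le 2 (FD N); rewrite -/a => h4.
have p0 : 0 < a ^+ 2 * (2 * K) by rewrite !mulr_gt0 ?exprn_gt0.
have : (a ^+ 2 * (2 * K))^-1 * Ex P (fun w => (ev W (F N) w ^+ 2) ^+ 2) < 2^-1.
  rewrite ltr_pdivrMl//; apply: le_lt_trans h4 _.
  have -> : a ^+ 2 * (2 * K) * 2^-1 = a ^+ 2 * K by field.
  by rewrite mulrC ltr_pM2l ?exprn_gt0// /K ltrDr.
have e4 : 4^-1 = 2 * 8^-1 :> R by field.
have e2 : 2^-1 = 4 * 8^-1 :> R by field.
have e1 : 1 = 8 * 8^-1 :> R by field.
lra.
Qed.

Section joint_law.
Variables (m D : nat) (F : 'I_m -> nat -> wexp H) (V : 'I_m -> nat -> Om -> R) (V' : 'I_m -> Om' -> R).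
Hypothesis FD : forall j N, (wdeg (F j N) <= D)%N.
Hypothesis sV : forall j N, sqi P (V j N).
Hypothesis cFV : forall j, Ex P (fun w => (V j N w - ev W (F j N) w) ^+ 2) @[N --> \oo] --> 0.
Hypothesis mV' : forall j, measurable_fun setT (V' j).
Let rV N w : 'rV[R]_m := \row_j V j N w.
Let rV' w : 'rV[R]_m := \row_j V' j w.
Definition evrow (G : 'I_m -> wexp H) w : 'rV[R]_m := \row_j ev W (G j) w.
Let rF N := evrow (fun j => F j N).
Hypothesis law : forall g : 'rV[R]_m -> R, continuous g -> (exists M, forall x, `|g x| <= M) ->
  Ex P (fun w => g (rV N w)) @[N --> \oo] --> Ex P' (fun w => g (rV' w)).

Lemma row_meas d0 (Om0 : measurableType d0) (U : 'I_m -> Om0 -> R) t :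
  (forall j, measurable_fun setT (U j)) -> measurable_fun setT (fun w => dotrow t (\row_j U j w)).
Proof.
move=> mU; apply: measurable_sum => j.
by under eq_fun do rewrite mxE; exact: measurable_funM.
Qed.

Lemma row_norm_le (x : 'rV[R]_m) : `|x| <= \sum_j `|x 0 j|.
Proof.
apply: rV_norm_le => [|j]; first by apply: sumr_ge0.
by rewrite (bigD1 j)//= lerDl sumr_ge0.
Qed.

Lemma row_sqr_le (x : 'rV[R]_m) : `|x| ^+ 2 <= m%:R * \sum_j x 0 j ^+ 2.
Proof.
apply: le_trans (_ : (\sum_j `|x 0 j|) ^+ 2 <= _).
  by rewrite lerXn2r ?nnegrE ?row_norm_le ?sumr_ge0.
have := cauchy_schwarz_sum (index_enum 'I_m) (fun=> 1) (fun j => `|x 0 j|).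
under eq_bigr do rewrite mul1r.
under [X in X * _]eq_bigr do rewrite expr1n; rewrite sumr_const cardE size_enum_ord.
by under [X in _ * X]eq_bigr do rewrite real_normK ?num_real//.
Qed.

Lemma row_L2 (U : 'I_m -> nat -> Om -> R) (C : R) : (forall j N, sqi P (U j N)) ->
  (forall j N, Ex P (fun w => U j N w ^+ 2) <= C) ->
  L2_bounded P (fun N w => \row_j U j N w).
Proof.
move=> sU UC; exists (m%:R * \sum_(j < m) C) => N.
have i2 : int1 P (fun w => m%:R * \sum_j U j N w ^+ 2).
  by apply: int1Z; apply: int1_sum => j; case: (sU j N).
have le w : `|\row_j U j N w| ^+ 2 <= m%:R * \sum_j U j N w ^+ 2.
  by apply: le_trans (row_sqr_le _) _; rewrite ler_wpM2l// ler_sum// => j _; rewrite mxE.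
have i1 : int1 P (fun w => `|\row_j U j N w| ^+ 2).
  apply: int1_le _ i2 _ => [|w]; last by rewrite ger0_norm ?sqr_ge0.
  apply: (@measurable_continuous_row _ _ _ _ _ _ (fun x => `|x| ^+ 2)).
    by move=> t; apply: row_meas => j; case: (sU j N).
  move=> x; apply: (@continuous_comp _ _ _ (fun x : 'rV[R]_m => `|x|) (fun y : R => y ^+ 2)).
    exact: norm_continuous.
  exact: exprn_continuous.
split=> //; apply: le_trans (Ex_le i1 i2 le) _.
rewrite ExZ; last by apply: int1_sum => j; case: (sU j N).
rewrite ler_wpM2l// Ex_sum => [|j]; last by case: (sU j N).
by apply: ler_sum => j _; exact: UC.
Qed.

Lemma F_bounded : exists C, forall j N, Ex P (fun w => ev W (F j N) w ^+ 2) <= C.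
Proof.
have B1 j : exists C, forall N, Ex P (fun w => ev W (F j N) w ^+ 2) <= C.
  apply: (bounded_of_law (FD j) (sV j) (cFV j) (mV' j)) => g cg [M gM].
  have cgj : continuous (fun x : 'rV[R]_m => g (x 0 j)).
    by move=> x; apply: (@continuous_comp _ _ _ (fun x : 'rV[R]_m => x 0 j) g);
      [exact: coord_continuous|exact: cg].
  have L := law cgj (ex_intro _ M (fun x => gM _)).
  have E : Ex P' (fun w => g (rV' w 0 j)) = Ex P' (fun w => g (V' j w)).
    by congr Ex; apply/funext => w; rewrite mxE.
  by rewrite E in L; apply: cvg_ext L => N; congr Ex; apply/funext => w; rewrite mxE.
have [C hC] := choice B1; exists (\sum_j `|C j|) => j N.
apply: le_trans (hC j N) _; apply: le_trans (ler_norm _) _.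
by rewrite (bigD1 j)//= lerDl sumr_ge0.
Qed.

Lemma V_bounded : exists C, forall j N, Ex P (fun w => V j N w ^+ 2) <= C.
Proof.
have [C hC] := F_bounded.
have B1 j : exists C, forall N, Ex P (fun w => V j N w ^+ 2) <= C.
  have [M [_ HM]] := cvg_seq_bounded (cFV j); exists (2 * M + 2 * C) => N.
  have sF := moments_sqi (ev_moments isoW (F j N)).
  have := Ex_sqrD_le (sqiB (sV j N) sF) sF; under eq_fun do rewrite subrK.
  by have := hC j N; have := le_trans (ler_norm _) (HM N); lra.
have [C' hC'] := choice B1; exists (\sum_j `|C' j|) => j N.
apply: le_trans (hC' j N) _; apply: le_trans (ler_norm _) _.
by rewrite (bigD1 j)//= lerDl sumr_ge0.
Qed.

Lemma cos_lip (x y : R) : `|cos x - cos y| <= `|x - y|.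
Proof.
have [t _ ->] := @mean_value R cos (fun x => - sin x) y x (fun x => is_derive_cos x).
by rewrite normrM normrN ler_piMl// sin_max.
Qed.

Lemma rF_meas N t : measurable_fun setT (fun w => dotrow t (rF N w)).
Proof. by apply: row_meas => j; case: (ev_moments isoW (F j N)). Qed.

(** The cosine is 1-Lipschitz, so an L^2 approximation of the coordinates transfers to
    characteristic functions. *)
Lemma rF_cos t b : Ex P (fun w => cos (dotrow t (rV N w) + b)) -
  Ex P (fun w => cos (dotrow t (rF N w) + b)) @[N --> \oo] --> 0.
Proof.
have sF j N := moments_sqi (ev_moments isoW (F j N)).
have mV N : measurable_fun setT (fun w => dotrow t (rV N w)).
  by apply: row_meas => j; case: (sV j N).
have i1 N : int1 P (fun w => cos (dotrow t (rV N w) + b)).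
  apply: (@int1_bounded _ _ _ _ _ 1); last by move=> w; exact: cos_max.
  by apply: measurable_fun_cos; exact: measurable_funD.
have i2 N : int1 P (fun w => cos (dotrow t (rF N w) + b)).
  apply: (@int1_bounded _ _ _ _ _ 1); last by move=> w; exact: cos_max.
  by apply: measurable_fun_cos; apply: measurable_funD => //; exact: rF_meas.
have i3 j N : int1 P (fun w => `|V j N w - ev W (F j N) w|).
  by apply/int1_norm/sqi_int1/sqiB.
apply/norm_cvg0P.
apply: (@squeeze0 _ _ (fun N => \sum_j `|t 0 j| * Num.sqrt (Ex P (fun w => (V j N w - ev W (F j N) w) ^+ 2)))).
  move=> N; rewrite normr_ge0/= -ExB//.
  apply: le_trans (_ : Ex P (fun w => \sum_j `|t 0 j| * `|V j N w - ev W (F j N) w|) <= _).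
    apply: Ex_norm_le; [exact: int1B|by apply: int1_sum => j; exact: int1Z|] => w.
    apply: le_trans (cos_lip _ _) _;
    have -> : dotrow t (rV N w) + b - (dotrow t (rF N w) + b) =
        \sum_j t 0 j * (V j N w - ev W (F j N) w).
      rewrite opprD addrACA subrr addr0 /dotrow -sumrB; apply: eq_bigr => j _.
      by rewrite !mxE mulrBr.
    by apply: le_trans (ler_norm_sum _ _ _) _; apply: ler_sum => j _; rewrite normrM.
  rewrite Ex_sum => [|j]; last exact: int1Z.
  apply: ler_sum => j _; rewrite ExZ// ler_wpM2l//.
  apply: le_trans (ler_norm _) _; have sB := sqiB (sV j N) (sF j N).
  have sN : sqi P (fun w => `|V j N w - ev W (F j N) w|).
    apply: (sqi_le (G := fun w => V j N w - ev W (F j N) w)) => //; last by move=> w; rewrite normr_id.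
    by apply: int1_meas; exact: i3.
  apply: le_trans (Ex_norm_sqrt sN) _.
  by under eq_fun do rewrite real_normK ?num_real//.
have : \sum_j `|t 0 j| * Num.sqrt (Ex P (fun w => (V j N w - ev W (F j N) w) ^+ 2)) @[N --> \oo] -->
    \sum_(j < m) `|t 0 j| * 0.
  by apply: cvg_bigsum => j; apply: cvgM; [exact: cvg_cst|apply: cvg_sqrt0; exact: cFV].
have -> // : \sum_(j < m) `|t 0 j| * 0 = 0.
by rewrite big1// => j _; rewrite mulr0.
Qed.

Lemma poly_law_bounded (g : 'rV[R]_m -> R) M : continuous g -> (forall x, `|g x| <= M) ->
  Ex P (fun w => g (rF N w)) @[N --> \oo] --> Ex P' (fun w => g (rV' w)).
Proof.
move=> cg gM; have [CF hCF] := F_bounded; have [CV hCV] := V_bounded.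
have mV N t : measurable_fun setT (fun w => dotrow t (rV N w)).
  by apply: row_meas => j; case: (sV j N).
have bV := row_L2 sV hCV.
have bF := row_L2 (fun j N => moments_sqi (ev_moments isoW (F j N))) hCF.
have S := Ex_continuous_sub mV bV rF_meas bF rF_cos cg gM.
have L : Ex P (fun w => g (rV N w)) - (Ex P (fun w => g (rV N w)) - Ex P (fun w => g (rF N w)))
    @[N --> \oo] --> Ex P' (fun w => g (rV' w)) - 0.
  exact: cvgB (law cg (ex_intro _ M gM)) S.
rewrite subr0 in L; apply: cvg_ext L => N; ring.
Qed.

(** Polynomial growth is affordable because hypercontractivity bounds E[g^2] along the sequence, and
    Fatou's lemma in the limit: clamping at level [n] costs [1 / n] times this bound on both
    sides. *)
Lemma poly_law (g : 'rV[R]_m -> R) : continuous g -> growth g ->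
  int1 P' (fun w => g (rV' w)) /\
  Ex P (fun w => g (rF N w)) @[N --> \oo] --> Ex P' (fun w => g (rV' w)).
Proof.
move=> cg /growth_norm[C [k [C0 hC]]].
have [CF hCF] := F_bounded.
have mF N : measurable_fun setT (fun w => g (rF N w)).
  exact: (measurable_continuous_row (rF_meas N) cg).
have mg' : measurable_fun setT (fun w => g (rV' w)).
  by apply: measurable_continuous_row => // t; exact: row_meas.
have mN N : moments P (fun w => \sum_j `|ev W (F j N) w|).
  by apply: moments_sum => j; exact/moments_norm/ev_moments.
have gF N w : `|g (rF N w)| <= C * (1 + \sum_j `|ev W (F j N) w|) ^+ k.
  apply: le_trans (hC _) _; rewrite ler_wpM2l// lerXn2r ?nnegrE ?addr_ge0 ?sumr_ge0// lerD2l.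
  by apply: le_trans (row_norm_le _) _; apply: ler_sum => j _; rewrite mxE.
have mG N : moments P (fun w => g (rF N w)).
  apply: (moments_le (G := fun w => C * (1 + \sum_j `|ev W (F j N) w|) ^+ k)) => //.
    by apply/momentsZ/momentsX/momentsD => //; exact: moments_cst.
  by move=> w; apply: le_trans (gF N w) (ler_norm _).
have iG2 N : int1 P (fun w => g (rF N w) ^+ 2) by exact/moments_int1/momentsX.
have [B hB] : exists B, forall N, Ex P (fun w => g (rF N w) ^+ 2) <= B.
  have [K K0 hK] := @pow_sum_le R _ (index_enum 'I_m) (k * 2).
  have Cj j : exists C', forall N, Ex P (fun w => `|ev W (F j N) w| ^+ (k * 2)) <= C'.
    exact: ev_moments_bounded (FD j) (hCF j).
  have [C' hC'] := choice Cj; exists (C ^+ 2 * K * (1 + \sum_j C' j)) => N.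
  have ij j : int1 P (fun w => `|ev W (F j N) w| ^+ (k * 2)).
    exact/moments_int1/momentsX/moments_norm/ev_moments.
  have iS : int1 P (fun w => 1 + \sum_j `|ev W (F j N) w| ^+ (k * 2)).
    by apply: int1D; [exact: int1_cst|exact: int1_sum].
  apply: le_trans (_ : Ex P (fun w => C ^+ 2 * K * (1 + \sum_j `|ev W (F j N) w| ^+ (k * 2))) <= _).
    apply: Ex_le => //; first exact: int1Z.
    move=> w; rewrite -(real_normK (num_real (g _))).
    apply: le_trans (_ : (C * (1 + \sum_j `|ev W (F j N) w|) ^+ k) ^+ 2 <= _).
      by rewrite lerXn2r ?nnegrE// mulr_ge0// exprn_ge0// addr_ge0// sumr_ge0.
    by rewrite exprMn -exprM -mulrA ler_wpM2l ?sqr_ge0// hK.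
  rewrite ExZ// ler_wpM2l ?mulr_ge0 ?sqr_ge0// ExD ?Ex_cst; [|exact: int1_cst|exact: int1_sum].
  by rewrite lerD2l Ex_sum//; apply: ler_sum => j _; exact: hC'.
have cc n : continuous (fun x => clamp n (g x) ^+ 2).
  move=> x; apply: (@continuous_comp _ _ _ (fun x => clamp n (g x)) (fun y : R => y ^+ 2)).
    exact: clamp_continuous.
  exact: exprn_continuous.
have cb n x : `|clamp n (g x) ^+ 2| <= n%:R ^+ 2.
  by rewrite normrX lerXn2r ?nnegrE// clamp_le.
have icn n : int1 P' (fun w => clamp n (g (rV' w)) ^+ 2).
  apply: (@int1_bounded _ _ _ _ _ (n%:R ^+ 2)) => //.
  exact: (measurableT_comp (continuous_measurable_fun (@exprn_continuous _ 2))
    (measurableT_comp (continuous_measurable_fun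
      (@clamp_continuous R R n id (fun x => @cvg_id _ _))) mg')).
have ccl w : clamp n (g (rV' w)) ^+ 2 @[n --> \oo] --> g (rV' w) ^+ 2.
  have : clamp n (g (rV' w)) * clamp n (g (rV' w)) @[n --> \oo] --> g (rV' w) * g (rV' w).
    by apply: cvgM; exact: clamp_cvg.
  by rewrite -expr2; apply: cvg_ext => n; rewrite expr2.
have leB n : Ex P' (fun w => clamp n (g (rV' w)) ^+ 2) <= B.
  apply: cvg_le (poly_law_bounded (cc n) (cb n)) => N; apply: le_trans (hB N).
  apply: Ex_le => // [|w].
    apply: (@int1_bounded _ _ _ _ _ (n%:R ^+ 2)) => //.
    exact: (measurable_continuous_row (rF_meas N) (cc n)).
  rewrite -(real_normK (num_real (clamp _ _))) -(real_normK (num_real (g _))).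
  by rewrite lerXn2r ?nnegrE// clamp_norm.
have iG' : int1 P' (fun w => g (rV' w) ^+ 2).
  by apply: (int1_fatou icn _ ccl leB) => n w; exact: sqr_ge0.
have B' : Ex P' (fun w => g (rV' w) ^+ 2) <= B.
  have le n w : `|clamp n (g (rV' w)) ^+ 2| <= g (rV' w) ^+ 2.
    by rewrite normrX -(real_normK (num_real (g _))) lerXn2r ?nnegrE// clamp_norm.
  have [c _] := Ex_dominated (fun n => int1_meas (icn n)) ccl iG' le.
  exact: cvg_le leB c.
have sg' : sqi P' (fun w => g (rV' w)) by [].
have iT n : int1 P' (fun w => clamp n (g (rV' w))).
  apply: (@int1_bounded _ _ _ _ _ n%:R); last by move=> w; exact: clamp_le.
  exact: (measurableT_comp (continuous_measurable_fun
      (@clamp_continuous R R n id (fun x => @cvg_id _ _))) mg').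
have iT' n N : int1 P (fun w => clamp n (g (rF N w))).
  apply: (@int1_bounded _ _ _ _ _ n%:R); last by move=> w; exact: clamp_le.
  exact: (measurable_continuous_row (rF_meas N) (clamp_continuous (n := n) cg)).
have cut (n : nat) (y : R) : (0 < n)%N -> `|y - clamp n y| <= n%:R^-1 * y ^+ 2.
  move=> n0; have n1 : (0 : R) < n%:R by rewrite ltr0n.
  have [yn|yn] := leP `|y| n%:R.
    by rewrite clamp_id// subrr normr0 mulr_ge0 ?sqr_ge0 ?invr_ge0.
  apply: le_trans (_ : `|y| <= _).
    have [y0|y0] := leP 0 y.
      rewrite ger0_norm// in yn; rewrite (ger0_norm y0).
      have -> : clamp n y = n%:R.
        by rewrite /clamp (min_idPl (ltW yn)) (max_idPr _)//; lra.
      by rewrite ger0_norm; lra.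
    rewrite ltr0_norm// in yn; rewrite (ltr0_norm y0).
    have yn' : y <= n%:R by lra.
    have -> : clamp n y = - n%:R by rewrite /clamp (min_idPr yn') (max_idPl _)//; lra.
    by rewrite ler0_norm; lra.
  rewrite ler_pdivlMl// -(real_normK (num_real y)) expr2 ler_wpM2r// ltW//.
split; first exact: sqi_int1.
have B0 : 0 <= B by apply: le_trans (hB 0%N); apply: Ex_ge0 => w; exact: sqr_ge0.
apply/cvgrPdist_le => e e0.
pose n := (Num.truncn (4 * B / e)).+1.
have nB : n%:R^-1 * B <= e / 4.
  have h : 4 * B / e <= n%:R by exact/ltW/truncnS_gt.
  rewrite ler_pdivrMl ?ltr0n//; move: h; rewrite ler_pdivrMr// => h; lra.
have e2 : 0 < e / 2 by lra.
have /cvgrPdist_le/(_ _ e2) := poly_law_bounded (clamp_continuous (n := n) cg)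
  (fun x => clamp_le n (g x)).
apply: filterS => N.
have D1 : `|Ex P' (fun w => g (rV' w)) - Ex P' (fun w => clamp n (g (rV' w)))| <= e / 4.
  rewrite -ExB//; last exact: sqi_int1.
  apply: le_trans (_ : Ex P' (fun w => n%:R^-1 * g (rV' w) ^+ 2) <= _).
    apply: Ex_norm_le; [by apply: int1B => //; exact: sqi_int1|exact: int1Z|].
    by move=> w; exact: cut.
  by rewrite ExZ//; apply: le_trans nB; rewrite ler_wpM2l ?invr_ge0.
have D2 : `|Ex P (fun w => g (rF N w)) - Ex P (fun w => clamp n (g (rF N w)))| <= e / 4.
  rewrite -ExB//; last exact: moments_int1.
  apply: le_trans (_ : Ex P (fun w => n%:R^-1 * g (rF N w) ^+ 2) <= _).
    apply: Ex_norm_le; [by apply: int1B => //; exact: moments_int1|exact: int1Z|].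
    by move=> w; exact: cut.
  by rewrite ExZ//; apply: le_trans nB; rewrite ler_wpM2l ?invr_ge0.
move: (Ex P' _) (Ex P' _) (Ex P _) (Ex P _) D1 D2 => a b c k' D1 D2 D3.
have -> : b - k' = (b - a) + (a - c) - (k' - c) by ring.
apply: le_trans (ler_normB _ _) _; have := ler_normD (b - a) (a - c); lra.
Qed.

End joint_law.

End laws_of_polynomials.

(** * Polynomial approximants of the given sequences *)

Section approximants.
Context {R : realType} {H : hilbertType R} d (Om : measurableType d).
Context (P : probability Om R) (W : H -> {RV P >-> R}).
Hypothesis isoW : isonormal W.
Context (T : forall n, tensor_power H n) (I : forall n, T n -> {RV P >-> R}).
Hypothesis hI : multiple_integral W I.

Lemma approximant_sequence n (f : T n) : (0 < n)%N -> symmetric_tensor f ->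
  exists b : nat -> wexp H, [/\ forall l, (wdeg (b l) <= n)%N,
    forall l s, {subset vecs (b l) <= s} -> chaos n (tr_of isoW s (b l)) &
    Ex P (fun w => (I f w - ev W (b l) w) ^+ 2) @[l --> \oo] --> 0].
Proof.
move=> n0 sf.
have h l : exists b : wexp H, [/\ (wdeg b <= n)%N,
    forall s, {subset vecs b <= s} -> chaos n (tr_of isoW s b) &
    Ex P (fun w => (I f w - ev W b w) ^+ 2) <= l.+1%:R^-1].
  by apply: chaos_approx => //; rewrite invr_gt0 ltr0n.
have [b hb] := choice h; exists b; split.
- by move=> l; case: (hb l).
- by move=> l; case: (hb l).
- apply: (@squeeze0 _ _ (fun l => l.+1%:R^-1)); last exact: cvg_harmonic.
  by move=> l; have [_ _ ->] := hb l; rewrite Ex_ge0// => w; exact: sqr_ge0.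
Qed.

(** For each [N], finitely many errors, those of [X N] and of the first [K] iterates, tend to 0
    along the approximations of the two tensors; one common index makes all of them at most
    [1 / (N + 1)]. *)
Theorem approximants (p q K : nat) (f : nat -> T p) (g : nat -> T q) (X : nat -> {RV P >-> R})
    (Y : nat -> nat -> {RV P >-> R}) (DX : nat -> Om -> H) (DY : nat -> nat -> Om -> H) :
  (0 < p)%N -> (0 < q)%N -> (forall N, symmetric_tensor (f N)) -> (forall N, symmetric_tensor (g N)) ->
  (forall N, X N = I (f N)) -> (forall N, Y 0%N N = I (g N)) ->
  (forall N, malliavin_derivative W (X N) (DX N)) ->
  (forall r N, malliavin_derivative W (Y r N) (DY r N)) ->
  (forall r N, \forall w \ae P, Y r.+1 N w = inner H (DX N w) (DY r N w)) ->
  (forall N, sqi P (X N)) /\ (forall r N, sqi P (Y r N)) /\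
  exists A B : nat -> wexp H, [/\ forall N, (wdeg (A N) <= p)%N, forall N, (wdeg (B N) <= q)%N,
    forall N s, {subset vecs (A N) <= s} -> chaos p (tr_of isoW s (A N)),
    forall N s, {subset vecs (B N) <= s} -> chaos q (tr_of isoW s (B N)) &
    Ex P (fun w => (X N w - ev W (A N) w) ^+ 2) @[N --> \oo] --> 0 /\
    forall r, (r < K)%N ->
      Ex P (fun w => (Y r N w - ev W (wY (A N) (B N) r) w) ^+ 2) @[N --> \oo] --> 0].
Proof.
move=> p0 q0 sf sg XE YE hX hY YS.
have sX N : sqi P (X N) by rewrite XE; case: (integral_sqi hI (sf N)).
have sY0 N : sqi P (Y 0%N N) by rewrite YE; case: (integral_sqi hI (sg N)).
have seqs N : exists A B : nat -> wexp H, [/\ forall l, (wdeg (A l) <= p)%N,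
    forall l, (wdeg (B l) <= q)%N,
    forall l s, {subset vecs (A l) <= s} -> chaos p (tr_of isoW s (A l)),
    forall l s, {subset vecs (B l) <= s} -> chaos q (tr_of isoW s (B l)) &
    Ex P (fun w => (X N w - ev W (A l) w) ^+ 2) @[l --> \oo] --> 0 /\
    forall r, sqi P (Y r N) /\
      Ex P (fun w => (Y r N w - ev W (wY (A l) (B l) r) w) ^+ 2) @[l --> \oo] --> 0].
  have [A [A1 A2 A3]] := approximant_sequence p0 (sf N).
  have [B [B1 B2 B3]] := approximant_sequence q0 (sg N).
  rewrite -XE in A3; rewrite -YE in B3; exists A, B; split=> //; split=> //.
  apply: (iterated_derivatives_cvg isoW (D := (p + q)%N) (hX N) (fun r => hY r N) (fun r => YS r N)) => //.
  - by move=> l; apply: leq_trans (A1 l) _; exact: leq_addr.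
  - by move=> l; apply: leq_trans (B1 l) _; exact: leq_addl.
split=> //; split; first by move=> r N; have [A [B [_ _ _ _ [_ h]]]] := seqs N; case: (h r).
have pick N : exists AB : wexp H * wexp H, [/\ (wdeg AB.1 <= p)%N, (wdeg AB.2 <= q)%N,
    forall s, {subset vecs AB.1 <= s} -> chaos p (tr_of isoW s AB.1),
    forall s, {subset vecs AB.2 <= s} -> chaos q (tr_of isoW s AB.2) &
    Ex P (fun w => (X N w - ev W AB.1 w) ^+ 2) <= N.+1%:R^-1 /\
    forall r : 'I_K, Ex P (fun w => (Y r N w - ev W (wY AB.1 AB.2 r) w) ^+ 2) <= N.+1%:R^-1].
  have [A [B [A1 B1 A2 B2 [A3 h]]]] := seqs N.
  have e0 : 0 < N.+1%:R^-1 :> R by rewrite invr_gt0 ltr0n.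
  have near0 (u : nat -> R) : u l @[l --> \oo] --> 0 -> \forall l \near \oo, u l <= N.+1%:R^-1.
    move=> /cvgrPdist_le/(_ _ e0); apply: filterS => l; rewrite sub0r normrN.
    exact: le_trans (ler_norm _).
  have nX := near0 _ A3.
  have nY : \forall l \near \oo, forall r : 'I_K,
      Ex P (fun w => (Y r N w - ev W (wY (A l) (B l) r) w) ^+ 2) <= N.+1%:R^-1.
    by apply: filter_forall => r; apply: near0; case: (h r).
  have [l [l1 l2]] := filter_ex (filterI nX nY).
  by exists (A l, B l); split=> //=; [exact: A2|exact: B2].
have [AB hAB] := choice pick.
exists (fun N => (AB N).1), (fun N => (AB N).2); split.
- by move=> N; case: (hAB N).
- by move=> N; case: (hAB N).
- by move=> N; case: (hAB N).
- by move=> N; case: (hAB N).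
have sq (u : nat -> Om -> R) : (forall N, Ex P (fun w => u N w ^+ 2) <= N.+1%:R^-1) ->
    Ex P (fun w => u N w ^+ 2) @[N --> \oo] --> 0.
  move=> h; apply: (@squeeze0 _ _ (fun l => l.+1%:R^-1)); last exact: cvg_harmonic.
  by move=> N; rewrite h Ex_ge0// => w; exact: sqr_ge0.
split; first by apply: sq => N; case: (hAB N) => _ _ _ _ [].
by move=> r rK; apply: sq => N; case: (hAB N) => _ _ _ _ [_ /(_ (Ordinal rK))].
Qed.

End approximants.

Lemma expr_le_fact_expR {R : realType} (x : R) : 0 <= x -> forall n, x ^+ n <= n`!%:R * expR x.
Proof.
move=> x0 [|n]; first by rewrite expr0 fact0 mul1r; have := expR_ge1Dx x; lra.
rewrite mulrC -ler_pdivrMr ?ltr0n ?fact_gt0//.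
by apply: le_trans (expR_ge1Dxn n x0); rewrite lerDr.
Qed.

(** * Vanishing of Y_2, ..., Y_a *)

Section moment_limits.
Context {R : realType} {H : hilbertType R} d (Om : measurableType d).
Context (P : probability Om R) (W : H -> {RV P >-> R}).
Hypothesis isoW : isonormal W.
Variables (p q a : nat) (A B : nat -> wexp H).
Hypotheses (p_gt0 : (0 < p)%N) (a_gt0 : (0 < a)%N).
Hypothesis apq : (a * p < q < a.+1 * p)%N.
Hypothesis dA : forall N, (wdeg (A N) <= p)%N.
Hypothesis dB : forall N, (wdeg (B N) <= q)%N.
Hypothesis cA : forall N s, {subset vecs (A N) <= s} -> chaos p (tr_of isoW s (A N)).
Hypothesis cB : forall N s, {subset vecs (B N) <= s} -> chaos q (tr_of isoW s (B N)).
Variable s2 : R.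
Hypothesis s2_gt0 : 0 < s2.
Hypothesis A2 : Ex P (fun w => ev W (A N) w ^+ 2) @[N --> \oo] --> s2.
Hypothesis A4 : Ex P (fun w => (ev W (A N) w ^+ 2) ^+ 2) @[N --> \oo] --> 3 * s2 ^+ 2.
Context d' (Om' : measurableType d') (P' : probability Om' R) (Yl : nat -> Om' -> R).
Hypothesis Yl_moments : forall r, (r <= a)%N -> moments P' (Yl r).
Hypothesis Ylim : forall r i j, (r < a)%N ->
  Ex P (fun w => ev W (wY (A N) (B N) r.+1) w ^+ i * ev W (wY (A N) (B N) r) w ^+ j) @[N --> \oo] -->
  Ex P' (fun w => Yl r.+1 w ^+ i * Yl r w ^+ j).
Hypothesis Yl_exp : forall r t, (0 < r <= a)%N -> int1 P' (fun w => expR (t * Yl r w)).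

Let s N := vecs (A N) ++ vecs (B N).
Let alg N := alg_of isoW (s N).
Let x N : alg N := tr_of isoW (s N) (A N).
Let y N : alg N := tr_of isoW (s N) (B N).

Let sA N : {subset vecs (A N) <= s N}. Proof. by move=> u uA; rewrite mem_cat uA. Qed.
Let sB N : {subset vecs (B N) <= s N}. Proof. by move=> u uB; rewrite mem_cat uB orbT. Qed.

Let sY r N : {subset vecs (wY (A N) (B N) r) <= s N}.
Proof.
elim: r => [|r IH]; first exact: sB.
by move=> u /vecs_wgam /orP[/sA|/IH].
Qed.

Let sM N m i j r : {subset vecs (Wmul (Wmul (wpow (A N) m) (wpow (wY (A N) (B N) r.+1) i))
  (wpow (wY (A N) (B N) r) j)) <= s N}.
Proof.
have pw (c : wexp H) k : {subset vecs c <= s N} -> {subset vecs (wpow c k) <= s N}.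
  by move=> h; elim: k => [//|k IH] u /=; rewrite mem_cat => /orP[/h|/IH].
have h1 := pw _ m (@sA N); have h2 := pw _ i (@sY r.+1 N); have h3 := pw _ j (@sY r N).
move=> u; change (u \in (vecs (wpow (A N) m) ++ vecs (wpow (wY (A N) (B N) r.+1) i)) ++
  vecs (wpow (wY (A N) (B N) r) j) -> u \in s N).
by rewrite !mem_cat -orbA => /or3P[/h1|/h2|/h3]; rewrite mem_cat.
Qed.

Lemma gY_tr r N : gY x y r N = tr_of isoW (s N) (wY (A N) (B N) r).
Proof.
elim: r => [//|r IH]; rewrite /gY iterS -/(gY x y r N) IH /x -tr_of_wgam//; exact: sA.
Qed.

Lemma tr_wpow N (c : wexp H) k : tr_of isoW (s N) (wpow c k) = tr_of isoW (s N) c ^+ k.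
Proof. by elim: k => [|k IH]; rewrite ?expr0 ?exprS -?IH /tr_of /= ?scale1r. Qed.

Lemma gE_monomial N m i j r : gE (alg N) (x N ^+ m * gY x y r.+1 N ^+ i * gY x y r N ^+ j) =
  Ex P (fun w => ev W (A N) w ^+ m * ev W (wY (A N) (B N) r.+1) w ^+ i * ev W (wY (A N) (B N) r) w ^+ j).
Proof.
rewrite !gY_tr -!tr_wpow -[_ * _ * _]/(tr_of isoW (s N) (Wmul (Wmul _ _) _)) gE_tr_of.
  by congr Ex; apply/funext => w; rewrite /= !ev_wpow.
exact: sM.
Qed.

Lemma x_chaos N : chaos p (x N). Proof. exact: cA. Qed.
Lemma y_chaos N : chaos q (y N). Proof. exact: cB. Qed.

Lemma gE_x2 : gE (alg N) (x N ^+ 2) @[N --> \oo] --> s2.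
Proof. by apply: cvg_ext A2 => N; rewrite gE_tr_of_sqr//; exact: sA. Qed.

Lemma gE_x4 : gE (alg N) ((x N ^+ 2) ^+ 2) @[N --> \oo] --> 3 * s2 ^+ 2.
Proof.
apply: cvg_ext A4 => N; rewrite /x -(tr_wpow N (A N) 2) gE_tr_of_sqr.
  by congr Ex; apply/funext => w; rewrite ev_wpow.
move=> u; change (u \in vecs (A N) ++ vecs (A N) ++ [::] -> u \in s N).
by rewrite cats0 mem_cat orbb => /sA.
Qed.

Lemma gE_Y r i j : (r < a)%N -> gE (alg N) (x N ^+ 0 * gY x y r.+1 N ^+ i * gY x y r N ^+ j) @[N --> \oo] -->
  Ex P' (fun w => Yl r.+1 w ^+ i * Yl r w ^+ j).
Proof.
move=> ra; have L := @Ylim r i j ra; apply: cvg_ext L => N; rewrite gE_monomial; congr Ex.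
by apply/funext => w; rewrite expr0 mul1r.
Qed.

Lemma y_bdd : gbdd y.
Proof.
have h := @gE_Y 0%N 0%N 2 a_gt0; have [M [_ HM]] := cvg_seq_bounded h.
exists q, M => N; split; first by case: (y_chaos N).
by have := le_trans (ler_norm _) (HM N); rewrite !expr0 !mul1r.
Qed.

Lemma gY_bdd r : gbdd (gY x y r).
Proof. exact: (@gbdd_gY _ alg x p s2 x_chaos gE_x2 y y_bdd). Qed.

Section vanishing.
Variable r : nat.
Hypotheses (r0 : (0 < r)%N) (ra : (r < a)%N).
Hypothesis null2 : gnull (gY x y r.+2).

(** Joint convergence with X is not assumed: integration by parts lowers the power of X until only
    moments of Y_r and Y_(r+1) remain. *)
Let cvgs m : forall i j, exists l : R,
  gE (alg N) (x N ^+ m * gY x y r.+1 N ^+ i * gY x y r N ^+ j) @[N --> \oo] --> l.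
Proof.
elim/ltn_ind: m => -[_ i j|m IH i j].
  by exists (Ex P' (fun w => Yl r.+1 w ^+ i * Yl r w ^+ j)); exact: gE_Y.
have m1 : (m.-1 < m.+1)%N by lia.
have [l1 h1] := IH m.-1 m1 i j.
have [l2 h2] := IH m (ltnSn m) i.+1 j.-1.
eexists; exact: (gE_Xmul_cvg p_gt0 x_chaos gE_x2 gE_x4 y_bdd null2 h1 h2).
Qed.

Let h m i j : R := lim (gE (alg N) (x N ^+ m * gY x y r.+1 N ^+ i * gY x y r N ^+ j) @[N --> \oo]).

Let hP m i j : gE (alg N) (x N ^+ m * gY x y r.+1 N ^+ i * gY x y r N ^+ j) @[N --> \oo] --> h m i j.
Proof. by have [l hl] := cvgs m i j; rewrite /h (cvg_lim _ hl). Qed.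

Lemma limit_recursion m i j :
  h m.+1 i j = m%:R * s2 * h m.-1 i j + j%:R * p%:R^-1 * h m i.+1 j.-1.
Proof.
have L := gE_Xmul_cvg p_gt0 x_chaos gE_x2 gE_x4 y_bdd null2 (@hP m.-1 i j) (@hP m i.+1 j.-1).
by apply: (cvg_lim (@Rhausdorff R)); exact: L.
Qed.

Lemma limit_base i j : h 0 i j = Ex P' (fun w => Yl r.+1 w ^+ i * Yl r w ^+ j).
Proof. by rewrite /h (cvg_lim (@Rhausdorff R) (@gE_Y r i j ra)). Qed.

Lemma limit_base_ge0 i j : ~~ odd i -> ~~ odd j -> 0 <= h 0 i j.
Proof.
move=> oi oj; rewrite limit_base; apply: Ex_ge0 => w.
by rewrite mulr_ge0// exprn_even_ge0.
Qed.

Lemma limit_cauchy_schwarz m : h m m m ^+ 2 <= h m.*2 m.*2 0 * h 0 0 m.*2.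
Proof.
have L : gE (alg N) (x N ^+ m * gY x y r.+1 N ^+ m * gY x y r N ^+ m) *
    gE (alg N) (x N ^+ m * gY x y r.+1 N ^+ m * gY x y r N ^+ m) @[N --> \oo] -->
    h m m m * h m m m by exact: cvgM (@hP _ _ _) (@hP _ _ _).
have L' : gE (alg N) (x N ^+ m.*2 * gY x y r.+1 N ^+ m.*2 * gY x y r N ^+ 0) *
    gE (alg N) (x N ^+ 0 * gY x y r.+1 N ^+ 0 * gY x y r N ^+ m.*2) @[N --> \oo] -->
    h m.*2 m.*2 0 * h 0 0 m.*2 by exact: cvgM (@hP _ _ _) (@hP _ _ _).
rewrite expr2; apply: (ler_cvg_to L L'); apply: nearW => N; rewrite -expr2.
apply: le_trans (gE_cauchy_schwarz _ _) _.
by rewrite !expr0 !mulr1 !mul1r exprMn -!exprM !muln2.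
Qed.

(** From |x|^(2m) <= (2m)! e^|x| and e^|x| <= e^x + e^(-x), at x = t Y_r. *)
Lemma exp_moment_bound (t : R) : 0 < t -> exists K, forall m,
  Ex P' (fun w => Yl r w ^+ m.*2) * t ^+ m.*2 <= m.*2`!%:R * K.
Proof.
move=> t0; have r1 : (0 < r <= a)%N by rewrite r0 ltnW.
have i1 := Yl_exp t r1; have i2 := Yl_exp (- t) r1.
exists (Ex P' (fun w => expR (t * Yl r w) + expR (- t * Yl r w))) => m.
have mY := Yl_moments (ltnW ra).
have iY : int1 P' (fun w => Yl r w ^+ m.*2) by exact/moments_int1/momentsX.
rewrite mulrC -ExZ// -ExZ; last exact: int1D.
apply: Ex_le; [exact: int1Z|by apply: int1Z; exact: int1D|].
move=> w; rewrite -exprMn.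
have f0 : 0 < m.*2`!%:R :> R by rewrite ltr0n fact_gt0.
have -> : (t * Yl r w) ^+ m.*2 = `|t * Yl r w| ^+ m.*2.
  by rewrite -normrX ger0_norm// exprn_even_ge0// odd_double.
have b := expr_le_fact_expR (normr_ge0 (t * Yl r w)) m.*2.
apply: le_trans b _; apply: ler_wpM2l; first exact: ltW.
have [z0|z0] := leP 0 (t * Yl r w).
  by rewrite ger0_norm// lerDl expR_ge0.
by rewrite ltr0_norm// -mulNr lerDr expR_ge0.
Qed.

(** [two_step_moments] and [gY_power_ge] provide one factorial each, so E[U^(2m)] grows at least
    like [m!^2] times a power; exponential moments of every order forbid this unless E[V^2] = 0. *)
Lemma limit_vanishes : Ex P' (fun w => Yl r.+1 w ^+ 2) = 0 /\ gnull (gY x y r.+1).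
Proof.
set v2 := Ex P' _.
have v2E : v2 = h 0 2 0.
  by rewrite limit_base /v2; congr Ex; apply/funext => w; rewrite expr0 mulr1.
have L1 : gE (alg N) (gY x y r.+1 N ^+ 2) @[N --> \oo] --> v2.
  by rewrite v2E; have L := @hP 0 2 0; apply: cvg_ext L => N; rewrite !expr0 mul1r mulr1.
suff v20 : v2 = 0.
  split; first exact: v20.
  have [D [M hM]] := gY_bdd r.+1.
  exists D => [N|]; first by case: (hM N).
  by rewrite -v20.
have v2_ge0 : 0 <= v2 by apply: Ex_ge0 => w; exact: sqr_ge0.
have p1 : (0 : R) < p%:R by rewrite ltr0n.
have main m : m`!%:R ^+ 2 * ((p%:R^-1) ^+ 2 * v2 / (2 * s2)) ^+ m <= Ex P' (fun w => Yl r w ^+ m.*2).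
  have p2 : 0 <= p%:R^-1 :> R by rewrite invr_ge0.
  have T := two_step_moments (ltW s2_gt0) p2 limit_recursion
    limit_base_ge0 limit_cauchy_schwarz m.
  have rpq : (r.+1 * p < q)%N.
    have /andP[h1 _] := apq; apply: leq_ltn_trans h1; by rewrite leq_mul2r ra orbT.
  have L2 : gE (alg N) ((gY x y r.+1 N ^+ m) ^+ 2) @[N --> \oo] --> h 0 m.*2 0.
    by have L := @hP 0 m.*2 0; apply: cvg_ext L => N; rewrite !expr0 mul1r mulr1 -exprM muln2.
  have G := gY_power_ge p_gt0 x_chaos gE_x2 gE_x4 y_chaos y_bdd rpq L1 L2.
  have hU : h 0 0 m.*2 = Ex P' (fun w => Yl r w ^+ m.*2).
    by rewrite limit_base; congr Ex; apply/funext => w; rewrite expr0 mul1r.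
  rewrite -hU expr_div_n exprMn mulrA ler_pdivrMr; last by rewrite exprn_gt0// mulr_gt0.
  rewrite [leRHS]mulrC; apply: le_trans T.
  rewrite expr2 -!mulrA ler_wpM2l// mulrCA ler_wpM2l// exprn_ge0// exprn_ge0// invr_ge0 ltW//.
have c0 : 0 < p%:R^-1 ^+ 2 / (2 * s2) by rewrite divr_gt0 ?mulr_gt0 ?invr_gt0 ?p1.
have c1 : 0 <= p%:R^-1 ^+ 2 * v2 / (2 * s2) by rewrite mulrAC mulr_ge0// ltW.
have /eqP := factorial_growth_eq0 c1 main exp_moment_bound.
by rewrite mulrAC mulf_eq0 gt_eqF//= => /eqP.
Qed.

End vanishing.

(** Descent from [a + 1], where the order of the chaos is exhausted. The step to [r] uses
    exponential moments of Y_(r-1), hence the bound [2 <= r]. *)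
Lemma gY_null_from2 r : (2 <= r <= a.+1)%N -> gnull (gY x y r).
Proof.
move=> /andP[r2 ra].
have top : gnull (gY x y a.+1).
  have /andP[h1 h2] := apq.
  by apply: (gY_vanish p_gt0 x_chaos gE_x2 gE_x4 y_chaos y_bdd h2); rewrite mulSn; lia.
move: r2; rewrite -(subKn ra); elim: (a.+1 - r)%N => [|k IH] h; first by rewrite subn0.
have E : (a.+1 - k = (a.+1 - k.+1).+1)%N by lia.
have IH' : gnull (gY x y (a.+1 - k.+1).-1.+2).
  have -> : ((a.+1 - k.+1).-1.+2 = a.+1 - k)%N by lia.
  by apply: IH; lia.
have -> : (a.+1 - k.+1 = (a.+1 - k.+1).-1.+1)%N by lia.
by apply: (limit_vanishes _ _ IH').2; lia.
Qed.

Lemma Yl_eq0 r : (2 <= r <= a)%N -> {ae P', forall w, Yl r w = 0}.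
Proof.
move=> /andP[r2 ra]; have n2 : gnull (gY x y r.-1.+2) by apply: gY_null_from2; lia.
have [|//|E _] := limit_vanishes (r := r.-1) _ _ n2; [by lia|by lia|].
apply: Ex_sqr_eq0; first exact/moments_sqi/Yl_moments.
by move: E; have -> : (r.-1.+1 = r)%N by lia.
Qed.

Lemma L2_null_mul (F : nat -> wexp H) k : gnull (fun N => tr_of isoW (s N) (F N)) ->
  (forall N, {subset vecs (F N) <= s N}) ->
  Ex P (fun w => (ev W (F N) w * ev W (wY (A N) (B N) 1) w ^+ k) ^+ 2) @[N --> \oo] --> 0.
Proof.
move=> nF sF; have [D _ c] := gnullM nF (gbddX k (gY_bdd 1)).
apply: cvg_ext c => N; rewrite gY_tr -tr_wpow.
rewrite -[tr_of _ _ _ * _]/(tr_of isoW (s N) (Wmul (F N) (wpow (wY (A N) (B N) 1) k))) gE_tr_of_sqr.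
  by congr Ex; apply/funext => w; rewrite [ev _ _ _]/= ev_wpow.
move=> u /=; rewrite mem_cat => /orP[/sF//|h].
by apply: (@sM N 0 k 0 0); rewrite /= cats0.
Qed.

Lemma gam_null_mul k : Ex P (fun w => ((ev W (wgam (A N) (A N)) w - p%:R * s2) *
  ev W (wY (A N) (B N) 1) w ^+ k) ^+ 2) @[N --> \oo] --> 0.
Proof.
have h := @L2_null_mul (fun N => wsub (wgam (A N) (A N)) (Wc (p%:R * s2))) k.
have nF : gnull (fun N => tr_of isoW (s N) (wsub (wgam (A N) (A N)) (Wc (p%:R * s2)))).
  apply: gnull_ext (gam_XX_null x_chaos gE_x2 gE_x4) => N.
  by rewrite /tr_of tr_wsub -!/(tr_of _ _ _) tr_of_wgam//; exact: sA.
have sF N : {subset vecs (wsub (wgam (A N) (A N)) (Wc (p%:R * s2))) <= s N}.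
  by move=> u; rewrite /= cats0 => /vecs_wgam; rewrite orbb => /sA.
apply: cvg_ext (h nF sF) => N; congr Ex; apply/funext => w.
by rewrite ev_wsub.
Qed.

Lemma wY2_null_mul k : Ex P (fun w => (ev W (wY (A N) (B N) 2) w *
  ev W (wY (A N) (B N) 1) w ^+ k) ^+ 2) @[N --> \oo] --> 0.
Proof.
apply: L2_null_mul => [|N]; last exact: sY.
apply: gnull_ext (gY_null_from2 (r := 2) _) => [N|]; first exact: gY_tr.
by rewrite leqnn ltnS a_gt0.
Qed.

End moment_limits.

(** * Integration by parts against trigonometric functions *)

Section chaos_integration_by_parts.
Context {R : realType}.

(** The variable in the square is orthogonal to every [G], in particular to itself. The equation p F
    = - L F is needed almost surely, since test variables such as cosines lie outside the polynomial
    algebra. *)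
Lemma chaos_generator (A : gaussian_algebra R) p (F : A) : chaos p F ->
  gE A ((\sum_i (gx i * gd i F - gd i (gd i F)) - p%:R *: F) ^+ 2) = 0.
Proof.
move=> cF; set Z := \sum_i _.
have ZG G : gE A (Z * G) = gE A (gam F G).
  rewrite /Z mulr_suml /gam !gE_sum; apply: eq_bigr => i _.
  by rewrite mulrBl -mulrA gEB gE_ibp gdM gED addrAC subrr add0r.
by rewrite expr2 mulrBl gEB ZG (chaos_gE_gam _ cF) -scalerAl gEZ subrr.
Qed.

Context {H : hilbertType R} d (Om : measurableType d).
Context (P : probability Om R) (W : H -> {RV P >-> R}).
Hypothesis isoW : isonormal W.
Local Notation ip := (inner H).

Lemma gvec_orthonormal (A : gaussian_algebra R) (e : 'I_(gdim A) -> H) i : orthonormal e ->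
  gvec e (e i) = gx i.
Proof.
move=> oe; rewrite /gvec (bigD1 i)//= big1 => [|j ji]; last first.
  by rewrite (oe i j) eq_sym (negPf ji) scale0r.
by rewrite (oe i i) eqxx scale1r addr0.
Qed.

Lemma spanned_grad n (e : 'I_n -> H) a w : (forall u, u \in vecs a -> spanned e u) ->
  spanned e (grad W a w).
Proof.
have sD x y : spanned e x -> spanned e y -> spanned e (x + y).
  rewrite /spanned => {1}-> {1}->; rewrite -big_split; apply: eq_bigr => i _ /=.
  by rewrite ipDl scalerDl.
have sZ c x : spanned e x -> spanned e (c *: x).
  rewrite /spanned => {1}->; rewrite scaler_sumr; apply: eq_bigr => i _ /=.
  by rewrite ipZl scalerA.
elim: a => [c|u|a IHa b IHb|a IHa b IHb] /= sa.
- by rewrite /spanned big1// => i _; rewrite ip0l scale0r.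
- by apply: sa; rewrite inE.
- by apply: sD; [apply: IHa|apply: IHb] => u ua; apply: sa; rewrite mem_cat ua ?orbT.
- by apply: sD; apply: sZ; [apply: IHa|apply: IHb] => u ua; apply: sa; rewrite mem_cat ua ?orbT.
Qed.

Lemma sum_dirw n (e : 'I_n -> H) a b w : (forall u, u \in vecs a -> spanned e u) ->
  \sum_i ev W (dirw (e i) a) w * ev W (dirw (e i) b) w = ev W (wgam a b) w.
Proof.
move=> sa; rewrite -ip_grad_grad [in RHS](spanned_grad w sa) ip_suml.
by apply: eq_bigr => i _; rewrite ipZl -!ip_grad [ip (e i) _]ipC.
Qed.

Lemma dircyl_cos e (F F' : Om -> R) : dircyl W e F F' ->
  dircyl W e (fun w => cos (F w)) (fun w => - (sin (F w) * F' w)).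
Proof.
move=> [n [h [f [f' [[c1 c2 g1 g2 df] FE F'E]]]]].
exists n, h, (fun x => cos (f x)), (fun x => - (sin (f x) * f' x)); split; first split.
- by move=> x; apply: (@continuous_comp _ _ _ f cos); [exact: c1|exact: (@continuous_cos R)].
- move=> x; have cs : {for x, continuous (fun x => sin (f x))}.
    by apply: (@continuous_comp _ _ _ f sin); [exact: c1|exact: (@continuous_sin R)].
  exact: continuousN (continuousM cs (c2 x)).
- by exists 1, 0%N => x; rewrite expr0 mulr1; exact: cos_max.
- have [C [k Ck]] := g2; exists C, k => x; rewrite normrN normrM.
  by apply: le_trans (Ck x); rewrite ler_piMl// sin_max.
- move=> x t; have D := df x t.
  have := @is_derive1_comp _ cos (fun t => f (x + t *: \row_j ip (h j) e)) t _ _ (is_derive_cos _) D.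
  by move=> h1; apply: is_derive_eq h1 _; rewrite /GRing.scale/= mulNr.
- by move=> w; rewrite FE.
- by move=> w; rewrite FE F'E.
Qed.

Variables (s : seq H) (p : nat) (A : wexp H).
Hypothesis sA : {subset vecs A <= s}.
Hypothesis cA : chaos p (tr_of isoW s A).
Let e := @onb R H s.
Let oe : orthonormal e := @onb_orthonormal R H s.

Let e_spanned i : spanned e (e i).
Proof.
rewrite /spanned (bigD1 i)//= big1 => [|j ji]; last first.
  by rewrite (oe i j) eq_sym (negPf ji) scale0r.
by rewrite (oe i i) eqxx scale1r addr0.
Qed.

Let A_spanned u : u \in vecs A -> spanned e u.
Proof. by move=> /sA; exact: onb_spanned. Qed.

Lemma vecs_wsum n (f : 'I_n -> wexp H) u : u \in vecs (wsum f) -> exists i, u \in vecs (f i).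
Proof.
rewrite /wsum; elim: (index_enum _) => [|i r IH]; rewrite ?big_nil// big_cons /= mem_cat.
by case/orP => [h|/IH //]; exists i.
Qed.

Let gen i := wsub (Wmul (Wv (e i)) (dirw (e i) A)) (dirw (e i) (dirw (e i) A)).

Lemma chaos_ev : {ae P, forall w, \sum_i (W (e i) w * ev W (dirw (e i) A) w -
  ev W (dirw (e i) (dirw (e i) A)) w) = p%:R * ev W A w}.
Proof.
pose L := wsub (wsum gen) (Wmul (Wc p%:R) A).
have sL u : u \in vecs L -> spanned e u.
  rewrite /= mem_cat => /orP[h|]; last exact: A_spanned.
  have [k] := vecs_wsum h.
  rewrite /= inE mem_cat => /or3P[/eqP->|/vecs_dirw|/vecs_dirw/vecs_dirw].
  - exact: e_spanned.
  - exact: A_spanned.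
  - exact: A_spanned.
have E0 : Ex P (fun w => ev W L w ^+ 2) = 0.
  have -> : (fun w => ev W L w ^+ 2) = ev W (Wmul L L) by [].
  rewrite -(gE_tr isoW (oe)); last first.
    by move=> u; rewrite mem_cat => /orP[]; exact: sL.
  rewrite -(chaos_generator cA); congr (gE _ _).
  rewrite [tr _ _]/= -expr2 -/(tr _ _); congr (_ ^+ 2).
  rewrite tr_wsum !mulr_algl scaleN1r; congr (_ - _); apply: eq_bigr => i _.
  rewrite /gen tr_wsub /tr_of !gd_tr -/e; congr (_ * _ - _).
  exact: (gvec_orthonormal (A := alg_of isoW s)).
have := Ex_sqr_eq0 (moments_sqi (ev_moments isoW L)) E0.
apply: filterS => w; rewrite ev_wsub ev_wsum /= => /eqP; rewrite subr_eq0 => /eqP <-.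
by apply: eq_bigr => i _; rewrite mulN1r.
Qed.

(** The counterpart of [chaos_gE_gam] for cylindrical test variables: p A is replaced by the
    divergence of its gradient, and Gaussian integration by parts is applied in each direction
    [e i]. *)
Lemma chaos_ibp_dircyl (Phi : Om -> R) (Phi' : 'I_(gdim (alg_of isoW s)) -> Om -> R) :
  moments P Phi -> (forall i, dircyl W (e i) Phi (Phi' i)) ->
  p%:R * Ex P (fun w => ev W A w * Phi w) =
  Ex P (fun w => \sum_i ev W (dirw (e i) A) w * Phi' i w).
Proof.
move=> mPhi hPhi; have mW u := W_moments isoW u; have mev a := ev_moments isoW a.
have mPhi' i : moments P (Phi' i) by have [] := dircyl_moments isoW (hPhi i).
pose D i := ev W (dirw (e i) A); pose D2 i := ev W (dirw (e i) (dirw (e i) A)).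
have mM i : moments P (fun w => W (e i) w * (D i w * Phi w)).
  by apply: momentsM; [exact: mW|apply: momentsM; [exact: mev|]].
have -> : p%:R * Ex P (fun w => ev W A w * Phi w) =
    Ex P (fun w => \sum_i (W (e i) w * (D i w * Phi w) - D2 i w * Phi w)).
  rewrite -ExZ; last exact/moments_int1/momentsM.
  apply: Ex_ae.
  - by apply: measurable_funM => //; have [] := momentsM (mev A) mPhi.
  - apply: measurable_sum => i; have [+ _] := mM i => m1.
    by apply: measurable_funB => //; have [] := momentsM (mev (dirw (e i) (dirw (e i) A))) mPhi.
  - apply: filterS chaos_ev => w E; rewrite mulrA -E mulr_suml; apply: eq_bigr => i _.
    by rewrite mulrBl mulrA.
rewrite Ex_sum => [|i]; last first.
  by apply: int1B; apply: moments_int1; [exact: mM|apply: momentsM; [exact: mev|]].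
rewrite Ex_sum => [|i]; last exact/moments_int1/momentsM.
apply: eq_bigr => i _; rewrite ExB; [|exact: moments_int1|exact/moments_int1/(momentsM (mev _) mPhi)].
rewrite (dircyl_ibp isoW (dircylM (dircyl_ev W (e i) (dirw (e i) A)) (hPhi i))).
rewrite ExD; [|exact/moments_int1/momentsM|exact/moments_int1/momentsM].
by rewrite addrAC subrr add0r.
Qed.

Lemma chaos_ibp_cos (F K : wexp H) :
  p%:R * Ex P (fun w => ev W A w * (cos (ev W F w) * ev W K w)) =
  Ex P (fun w => cos (ev W F w) * ev W (wgam A K) w - sin (ev W F w) * ev W (wgam A F) w * ev W K w).
Proof.
rewrite (@chaos_ibp_dircyl _ (fun i w => - (sin (ev W F w) * ev W (dirw (e i) F) w) * ev W K w +
    cos (ev W F w) * ev W (dirw (e i) K) w)).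
- congr Ex; apply/funext => w; rewrite -!(sum_dirw _ _ A_spanned).
  rewrite !mulr_sumr mulr_suml -sumrB; apply: eq_bigr => i _; ring.
- apply: moments_cos; last exact: ev_moments.
  by case: (ev_moments isoW F).
- by move=> i; apply: dircylM; [apply: dircyl_cos|]; exact: dircyl_ev.
Qed.

End chaos_integration_by_parts.

(** * Characteristic function of the limit *)

Section iterated_differential_equation.
Context {R : realType}.

Lemma is_derive_bigsum (I : Type) (r : seq I) (F : I -> R -> R) (F' : I -> R) (x : R) :
  (forall i, is_derive x (1 : R) (F i) (F' i)) ->
  is_derive x (1 : R) (fun x => \sum_(i <- r) F i x) (\sum_(i <- r) F' i).
Proof.
move=> h; elim: r => [|i r IH].
  by under eq_fun do rewrite big_nil; rewrite big_nil; exact: is_derive_cst.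
under eq_fun do rewrite big_cons; rewrite big_cons.
exact: (@is_deriveD _ _ _ (F i) (fun x => \sum_(i <- r) F i x)).
Qed.

Lemma is_derive_lin (a x : R) : is_derive x (1 : R) (fun x : R => a * x) a.
Proof.
have D := @is_deriveZ _ _ _ (fun x : R => x) a x (1 : R) 1 (is_derive_id _ _).
by apply: is_derive_eq D _; rewrite /GRing.scale/= mulr1.
Qed.

Lemma is_derive_mul (f g : R -> R) (df dg x : R) : is_derive x (1 : R) f df ->
  is_derive x (1 : R) g dg -> is_derive x (1 : R) (fun x => f x * g x) (df * g x + f x * dg).
Proof.
move=> hf hg; have D := @is_deriveM _ _ f g x (1 : R) df dg hf hg.
by apply: is_derive_eq D _; rewrite /GRing.scale/=; ring.
Qed.

Lemma is_derive_expn (a : R) k (x : R) : is_derive x (1 : R) (fun x : R => (a * x) ^+ k)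
  (k%:R * a * (a * x) ^+ k.-1).
Proof.
elim: k => [|k IH].
  under eq_fun do rewrite expr0; rewrite !mul0r; exact: is_derive_cst.
under eq_fun do rewrite exprS.
apply: is_derive_eq (is_derive_mul (is_derive_lin a x) IH) _.
case: k {IH} => [|k]; first by rewrite !mul0r mulr0 addr0 mul1r.
by rewrite /= exprS -[k.+2%:R]natr1; ring.
Qed.

Lemma is_derive_exp_term (a c : R) k (x : R) :
  is_derive x (1 : R) (fun x => (a * x) ^+ k.+1 / k.+1`!%:R * c)
    (a * ((a * x) ^+ k / k`!%:R * c)).
Proof.
have D := is_derive_mul (is_derive_expn a k.+1 x) (is_derive_cst (c / k.+1`!%:R) x (1 : R)).
have f0 : k`!%:R != 0 :> R by rewrite pnatr_eq0 -lt0n fact_gt0.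
have k0 : k.+1%:R != 0 :> R by rewrite pnatr_eq0.
have -> : (fun x => (a * x) ^+ k.+1 / k.+1`!%:R * c) = (fun x => (a * x) ^+ k.+1 * (c / k.+1`!%:R)).
  by apply/funext => y; rewrite mulrAC mulrA.
apply: is_derive_eq D _; rewrite factS natrM /=; field.
by rewrite f0 nat1r.
Qed.

(** Taylor's formula for a chain f_k' = mu f_(k+1) with errors [r k]. The induction on [K] compares
    derivatives instead of integrating; the last function only needs the bound [M]. *)
Lemma differential_chain (f f' : nat -> R -> R) (mu M : R) (r : nat -> R) :
  (forall k x, is_derive x (1 : R) (f k) (f' k x)) ->
  (forall k x, 0 <= x <= 1 -> `|f' k x - mu * f k.+1 x| <= r k) ->
  forall K j, (forall x, 0 <= x <= 1 -> `|f (j + K)%N x| <= M) -> forall t, 0 <= t <= 1 ->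
  `|f j t - \sum_(k < K) (mu * t) ^+ k / k`!%:R * f (j + k)%N 0| <=
  \sum_(k < K) `|mu| ^+ k * r (j + k)%N + (`|mu| * t) ^+ K / K`!%:R * M.
Proof.
move=> df hr; elim=> [|K IH] j hM t t01.
  rewrite !big_ord0 subr0 add0r expr0 fact0 divr1 mul1r -[j]addn0; exact: hM.
have r0 k : 0 <= r k.
  by apply: le_trans (hr k 0 _); rewrite ?lexx ?ler01//.
have hM' x : 0 <= x <= 1 -> `|f (j.+1 + K)%N x| <= M by rewrite addSnnS; exact: hM.
have {}IH := IH j.+1 hM'.
pose S x := \sum_(k < K) (mu * x) ^+ k / k`!%:R * f (j.+1 + k)%N 0.
pose B := \sum_(k < K) `|mu| ^+ k * r (j.+1 + k)%N.
pose g x := f j x - \sum_(k < K.+1) (mu * x) ^+ k / k`!%:R * f (j + k)%N 0.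
pose h x := (r j + `|mu| * B) * x + (`|mu| * x) ^+ K.+1 / K.+1`!%:R * M.
pose g' x := f' j x - mu * S x.
pose h' x := (r j + `|mu| * B) + `|mu| * ((`|mu| * x) ^+ K / K`!%:R * M).
have dg x : is_derive x (1 : R) g (g' x).
  have -> : g = fun x => f j x - (f j 0 + \sum_(k < K) (mu * x) ^+ k.+1 / k.+1`!%:R * f (j.+1 + k)%N 0).
    apply/funext => y; rewrite /g big_ord_recl expr0 fact0 divr1 mul1r addn0; congr (_ - (_ + _)).
    by apply: eq_bigr => k _; rewrite lift0 addSnnS.
  have D : is_derive x (1 : R) (fun x => \sum_(k < K) (mu * x) ^+ k.+1 / k.+1`!%:R * f (j.+1 + k)%N 0)
      (\sum_(k < K) mu * ((mu * x) ^+ k / k`!%:R * f (j.+1 + k)%N 0)).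
    by apply: is_derive_bigsum => k; exact: is_derive_exp_term.
  have D' := is_deriveD (is_derive_cst (f j 0) x (1 : R)) D.
  apply: is_derive_eq (is_deriveB (df j x) D') _.
  by rewrite /g' /S add0r mulr_sumr.
have dh x : is_derive x (1 : R) h (h' x).
  exact: is_deriveD (is_derive_lin _ x) (is_derive_exp_term _ _ _ x).
have /andP[t0 t1] := t01.
have bound x : 0 <= x <= t -> `|g' x| <= h' x.
  move=> /andP[x0 xt]; have x01 : 0 <= x <= 1 by rewrite x0 (le_trans xt).
  have -> : g' x = (f' j x - mu * f j.+1 x) + mu * (f j.+1 x - S x) by rewrite /g'; ring.
  apply: le_trans (ler_normD _ _) _; rewrite /h' -addrA lerD ?hr//.
  by rewrite normrM -mulrDr ler_wpM2l//; exact: IH.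
have g0 : g 0 = 0.
  rewrite /g big_ord_recl expr0 fact0 divr1 mul1r addn0 big1 ?addr0 ?subrr// => k _.
  by rewrite mulr0 expr0n /= mul0r mul0r.
have h0 : h 0 = 0 by rewrite /h !mulr0 expr0n /= !mul0r addr0.
have -> : \sum_(k < K.+1) `|mu| ^+ k * r (j + k)%N + (`|mu| * t) ^+ K.+1 / K.+1`!%:R * M =
    (r j + `|mu| * B) + (`|mu| * t) ^+ K.+1 / K.+1`!%:R * M.
  congr (_ + _); rewrite big_ord_recl expr0 mul1r addn0 /B mulr_sumr; congr (_ + _).
  by apply: eq_bigr => k _; rewrite lift0 addSnnS exprS mulrA.
apply: le_trans (_ : h t <= _); last first.
  rewrite /h lerD2r ler_piMr// addr_ge0// mulr_ge0// sumr_ge0// => k _.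
  by rewrite mulr_ge0// exprn_ge0.
rewrite ler_norml; apply/andP; split.
  have L := @le_derive _ (fun x => - g x) h (fun x => - g' x) h' t.
  have dgN x : is_derive x (1 : R) (fun x0 => - g x0) (- g' x) by apply: is_deriveN; exact: dg.
  have bN x : 0 <= x <= t -> - g' x <= h' x.
    by move=> /bound; rewrite ler_norml lerNl => /andP[].
  by rewrite lerNl; apply: (L dgN dh t0 bN); rewrite g0 h0 oppr0.
apply: (@le_derive _ g h g' h' t dg dh t0); last by rewrite g0 h0.
by move=> x /bound; exact: le_trans (ler_norm _).
Qed.

Lemma exp_partial_sum_le (x : R) K : \sum_(k < K) `|x| ^+ k / k`!%:R <= expR `|x|.
Proof.
rewrite [leRHS]/expR.
have -> : \sum_(k < K) `|x| ^+ k / k`!%:R = series (exp_coeff `|x|) K.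
  by rewrite /series /= big_mkord; apply: eq_bigr => k _; rewrite /exp_coeff.
apply: nondecreasing_cvgn_le; last exact: is_cvg_series_exp_coeff.
by apply: nondecreasing_series => k _; rewrite /exp_coeff mulr_ge0 ?exprn_ge0 ?invr_ge0.
Qed.

(** Interchange of limits: for fixed [K] the main term and the error converge in [N], and then [K]
    tends to infinity. *)
Lemma three_limits (u : nat -> R) (S B : nat -> nat -> R) (S' B' : nat -> R) (l : R) :
  (forall K N, `|u N - S K N| <= B K N) ->
  (forall K, S K N @[N --> \oo] --> S' K) -> (forall K, B K N @[N --> \oo] --> B' K) ->
  S' K @[K --> \oo] --> l -> B' K @[K --> \oo] --> 0 -> u N @[N --> \oo] --> l.
Proof.
move=> h cS cB cS' cB'; apply/cvgrPdist_le => e e0.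
have e4 : 0 < e / 4 by rewrite divr_gt0.
have [K [K1 K2]] : exists K, `|l - S' K| <= e / 4 /\ `|0 - B' K| <= e / 4.
  move/cvgrPdist_le: cS' => /(_ _ e4) n1; move/cvgrPdist_le: cB' => /(_ _ e4) n2.
  exact: filter_ex (filterI n1 n2).
have := cS K; move/cvgrPdist_le => /(_ _ e4) n1; have := cB K; move/cvgrPdist_le => /(_ _ e4) n2.
near=> N.
have h1 : `|S' K - S K N| <= e / 4 by near: N.
have h2 : `|B' K - B K N| <= e / 4 by near: N.
have := h K N; move: K1 K2 h1 h2; rewrite !ler_norml.
by move=> /andP[? ?] /andP[? ?] /andP[? ?] /andP[? ?] /andP[? ?]; lra.
Unshelve. all: end_near. Qed.

End iterated_differential_equation.

Section characteristic_function_equation.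
Context {R : realType} {H : hilbertType R} d (Om : measurableType d).
Context (P : probability Om R) (W : H -> {RV P >-> R}).
Hypothesis isoW : isonormal W.
Variables (p : nat) (A B : nat -> wexp H) (s2 u v b : R).
Hypotheses (p_gt0 : (0 < p)%N) (s2_ge0 : 0 <= s2).
Hypothesis cA : forall N, chaos p (tr_of isoW (vecs (A N)) (A N)).
Let Y1 N := wY (A N) (B N) 1.
Let Y2 N := wY (A N) (B N) 2.
Hypothesis gam_null : forall k, Ex P (fun w => ((ev W (wgam (A N) (A N)) w - p%:R * s2) *
  ev W (Y1 N) w ^+ k) ^+ 2) @[N --> \oo] --> 0.
Hypothesis Y2_null : forall k, Ex P (fun w => (ev W (Y2 N) w * ev W (Y1 N) w ^+ k) ^+ 2) @[N --> \oo] --> 0.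

Let th s N w := s * ev W (A N) w + (v * ev W (B N) w + b).
Let m k N s := Ex P (fun w => cos (th s N w) * ev W (Y1 N) w ^+ k).

Lemma sin_subpihalf (x : R) : sin (x - pi / 2) = - cos x.
Proof. by rewrite sin_cos -addrA -opprD -splitr cosB cospi sinpi mulr0 addr0 mulrN1. Qed.

Let mev a := ev_moments isoW a.

Lemma grad_wpow a k w : grad W (wpow a k) w = (k%:R * ev W a w ^+ k.-1) *: grad W a w.
Proof.
elim: k => [|k IH] /=; first by rewrite mul0r scale0r.
rewrite IH ev_wpow scalerA -scalerDl; congr (_ *: _).
by case: k {IH} => [|k] /=; rewrite ?expr0 ?mul0r ?mulr0 ?addr0 ?mul1r// exprS -[k.+2%:R]natr1; ring.
Qed.

Let th_meas s N : measurable_fun setT (th s N).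
Proof.
have [mA _] := mev (A N); have [mB _] := mev (B N).
by apply: measurable_funD; [exact: measurable_funM|apply: measurable_funD => //; exact: measurable_funM].
Qed.

Let Y1_moments N k : moments P (fun w => ev W (Y1 N) w ^+ k).
Proof. exact/momentsX/mev. Qed.

Let cos_moments s N (F : Om -> R) : moments P F -> moments P (fun w => cos (th s N w) * F w).
Proof. exact: moments_cos. Qed.

Let sin_moments s N (F : Om -> R) : moments P F -> moments P (fun w => sin (th s N w) * F w).
Proof.
move=> mF; under eq_fun do rewrite sin_cos; apply: moments_cos => //.
exact: measurable_funB.
Qed.

(** The two negligible terms of the integration by parts: one from the derivative of Y_1 along X,
    one from the fluctuation of <DX, DX>. *)
Let eps k N s := k%:R * Ex P (fun w => sin (th s N w) * (ev W (Y2 N) w * ev W (Y1 N) w ^+ k.-1)) +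
  s * Ex P (fun w => cos (th s N w) *
    ((ev W (wgam (A N) (A N)) w - p%:R * s2) * ev W (Y1 N) w ^+ k)).

Let m' k N s := - (s * s2 * m k N s + v / p%:R * m k.+1 N s + eps k N s / p%:R).

Lemma is_derive_m k N s : is_derive s (1 : R) (m k N) (m' k N s).
Proof.
have mA := mev (A N); have [mB _] := mev (B N).
have mB' : measurable_fun setT (fun w => v * ev W (B N) w + b).
  by apply: measurable_funD => //; exact: measurable_funM.
apply: is_derive_eq (is_derive_Ex_cos s mA mB' (Y1_moments N k)) _.
(* The phase [- pi / 2] turns the cosine of [chaos_ibp_cos] into the sine produced by
   differentiation. *)
pose F := Wadd (Wmul (Wc s) (A N)) (Wadd (Wmul (Wc v) (B N)) (Wc (b - pi / 2))).
have FE w : ev W F w = th s N w - pi / 2 by rewrite /= /th; ring.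
have := chaos_ibp_cos (fun u h => h) (cA N) F (wpow (Y1 N) k).
have p0 : p%:R != 0 :> R by rewrite pnatr_eq0 -lt0n.
have -> : Ex P (fun w => ev W (A N) w * (cos (ev W F w) * ev W (wpow (Y1 N) k) w)) =
    - Ex P (fun w => - (sin (th s N w) * (ev W (A N) w * ev W (Y1 N) w ^+ k))).
  rewrite -mulN1r -ExZ; last first.
    under eq_fun do rewrite -mulN1r; apply/int1Z/moments_int1/sin_moments.
    exact: momentsM.
  by congr Ex; apply/funext => w; rewrite FE -sin_cos ev_wpow; ring.
have -> : Ex P (fun w => cos (ev W F w) * ev W (wgam (A N) (wpow (Y1 N) k)) w -
    sin (ev W F w) * ev W (wgam (A N) F) w * ev W (wpow (Y1 N) k) w) =
    s * (p%:R * s2) * m k N s + v * m k.+1 N s + eps k N s.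
  have mG : moments P (fun w => (ev W (wgam (A N) (A N)) w - p%:R * s2) * ev W (Y1 N) w ^+ k).
    by apply: momentsM => //; apply: momentsB => //; exact: moments_cst.
  have mZ : moments P (fun w => ev W (Y2 N) w * ev W (Y1 N) w ^+ k.-1) by exact: momentsM.
  pose f1 w := cos (th s N w) * ev W (Y1 N) w ^+ k.
  pose f2 w := cos (th s N w) * ev W (Y1 N) w ^+ k.+1.
  pose f3 w := sin (th s N w) * (ev W (Y2 N) w * ev W (Y1 N) w ^+ k.-1).
  pose f4 w := cos (th s N w) *
    ((ev W (wgam (A N) (A N)) w - p%:R * s2) * ev W (Y1 N) w ^+ k).
  have i1 : int1 P f1 by exact/moments_int1/cos_moments.
  have i2 : int1 P f2 by exact/moments_int1/cos_moments.
  have i3 : int1 P f3 by exact/moments_int1/sin_moments.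
  have i4 : int1 P f4 by exact/moments_int1/cos_moments.
  have -> : (fun w => cos (ev W F w) * ev W (wgam (A N) (wpow (Y1 N) k)) w -
      sin (ev W F w) * ev W (wgam (A N) F) w * ev W (wpow (Y1 N) k) w) =
      (fun w => s * (p%:R * s2) * f1 w + v * f2 w + (k%:R * f3 w + s * f4 w)).
    apply/funext => w; rewrite FE -sin_cos sin_subpihalf ev_wpow.
    rewrite -!ip_grad_grad grad_wpow ipZr [grad W F w]/= !scaler0 !add0r !addr0 !ipDr !ipZr.
    rewrite /f1 /f2 /f3 /f4 !ip_grad_grad exprS -/(Y1 N) -/(Y2 N); ring.
  rewrite ExD ?ExD ?ExZ //; do ?[exact: int1Z|apply: int1D].
move=> E; rewrite /m'.
have -> : Ex P (fun w => - (sin (th s N w) * (ev W (A N) w * ev W (Y1 N) w ^+ k))) =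
  - ((s * (p%:R * s2) * m k N s + v * m k.+1 N s + eps k N s) / p%:R).
  by rewrite -E mulrAC divff// mul1r opprK.
by field.
Qed.

Let G := expR (s2 * u ^+ 2 / 2).

(** Along [s = t u] with [t] in [0, 1], the exponential cancels the term [s s2 m] of the derivative
    and leaves a chain for [differential_chain] with ratio [- u v / p]. *)
Let f k N t := expR (s2 * u ^+ 2 / 2 * t ^+ 2) * m k N (t * u).
Let f' k N t := s2 * u ^+ 2 * t * f k N t + expR (s2 * u ^+ 2 / 2 * t ^+ 2) * (u * m' k N (t * u)).

Lemma is_derive_f k N t : is_derive t (1 : R) (f k N) (f' k N t).
Proof.
pose c := s2 * u ^+ 2 / 2.
have D1 : is_derive t (1 : R) (fun t => c * t ^+ 2) (c * (2 * t)).
  have D := is_derive_mul (is_derive_cst c t (1 : R)) (is_derive_expn 1 2 t).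
  have -> : (fun t => c * t ^+ 2) = (fun t => c * (1 * t) ^+ 2).
    by apply/funext => x; rewrite mul1r.
  by apply: is_derive_eq D _; rewrite mul0r add0r /= !mul1r expr1 mulr1.
have D2 := @is_derive1_comp _ expR _ t _ _ (is_derive_expR _) D1.
have D3 : is_derive t (1 : R) (fun t => t * u) u.
  by have D := is_derive_lin u t; have -> // : (fun t => t * u) = (fun t => u * t); apply/funext => x; rewrite mulrC.
have D4 := @is_derive1_comp _ (m k N) _ t _ _ (is_derive_m k N (t * u)) D3.
apply: is_derive_eq (is_derive_mul D2 D4) _.
by rewrite /f' /f /c /GRing.scale/=; field.
Qed.

Let r k N := `|u| * G / p%:R *
  (k%:R * Num.sqrt (Ex P (fun w => (ev W (Y2 N) w * ev W (Y1 N) w ^+ k.-1) ^+ 2)) +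
   `|u| * Num.sqrt (Ex P (fun w => ((ev W (wgam (A N) (A N)) w - p%:R * s2) *
     ev W (Y1 N) w ^+ k) ^+ 2))).

Let trig_le (g F : Om -> R) : measurable_fun setT g -> (forall w, `|g w| <= 1) -> moments P F ->
  `|Ex P (fun w => g w * F w)| <= Num.sqrt (Ex P (fun w => F w ^+ 2)).
Proof.
move=> mg g1 mF; have mgF : moments P (fun w => g w * F w).
  by apply: momentsM => //; exact: moments_bounded mg g1.
apply: le_trans (Ex_norm_sqrt (moments_sqi mgF)) _; rewrite ler_wsqrtr//.
have i1 h : moments P h -> int1 P (fun w => h w ^+ 2) by move=> mh; exact/moments_int1/momentsX.
apply: Ex_le; [exact: i1|exact: i1|] => w.
rewrite exprMn ler_piMl ?sqr_ge0//.
by rewrite -(real_normK (num_real (g w))) expr_le1.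
Qed.

Let f_equation k N t : 0 <= t <= 1 -> `|f' k N t - (- (u * v / p%:R)) * f k.+1 N t| <= r k N.
Proof.
move=> /andP[t0 t1]; pose e := expR (s2 * u ^+ 2 / 2 * t ^+ 2).
have p1 : 0 < p%:R :> R by rewrite ltr0n.
have -> : f' k N t - (- (u * v / p%:R)) * f k.+1 N t = - (e * u / p%:R * eps k N (t * u)).
  by rewrite /f' /f /m' -/e; field; rewrite gt_eqF.
have e0 : 0 < e by exact: expR_gt0.
have eG : e <= G.
  rewrite /e /G ler_expR ler_piMr ?expr_le1//.
  by rewrite mulr_ge0// mulr_ge0// sqr_ge0.
rewrite normrN normrM /r; apply: ler_pM => //.
  rewrite normrM (gtr0_norm (_ : 0 < p%:R^-1)) ?invr_gt0// ler_wpM2r ?invr_ge0 ?ler0n//.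
  by rewrite normrM mulrC (gtr0_norm e0) ler_wpM2l.
have mth := th_meas (t * u) N.
have mG : moments P (fun w => (ev W (wgam (A N) (A N)) w - p%:R * s2) * ev W (Y1 N) w ^+ k).
  by apply: momentsM => //; apply: momentsB => //; exact: moments_cst.
have mZ : moments P (fun w => ev W (Y2 N) w * ev W (Y1 N) w ^+ k.-1) by exact: momentsM.
rewrite /eps; apply: le_trans (ler_normD _ _) _; apply: lerD; rewrite normrM.
  rewrite normr_nat ler_wpM2l//; apply: trig_le => // [|w]; last exact: sin_max.
  under eq_fun do rewrite sin_cos; apply: measurable_fun_cos; exact: measurable_funB.
apply: ler_pM => //.
  by rewrite normrM ler_piMl// ger0_norm.
apply: trig_le => // [|w]; last exact: cos_max.
exact: measurable_fun_cos.
Qed.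

Let r_cvg k : r k N @[N --> \oo] --> 0.
Proof.
rewrite [X in _ --> X](_ : 0 = `|u| * G / p%:R * (k%:R * 0 + `|u| * 0)); last by ring.
apply: cvgM; first exact: cvg_cst.
by apply: cvgD; apply: cvgM; try exact: cvg_cst; apply: cvg_sqrt0; [exact: Y2_null|exact: gam_null].
Qed.

Variables (c a : nat -> R) (l : R).
Hypothesis c_lim : forall k,
  Ex P (fun w => cos (v * ev W (B N) w + b) * ev W (Y1 N) w ^+ k) @[N --> \oo] --> c k.
Hypothesis a_lim : forall k, Ex P (fun w => `|ev W (Y1 N) w| ^+ k) @[N --> \oo] --> a k.
Hypothesis l_lim : \sum_(k < K) (- (u * v / p%:R)) ^+ k / k`!%:R * c k @[K --> \oo] --> l.
Hypothesis a_small : `|u * v / p%:R| ^+ K / K`!%:R * a K @[K --> \oo] --> 0.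

(** At [t = 0] the variable X has disappeared, so the Taylor coefficients converge by [c_lim]; the
    remainder is controlled by the absolute moments of Y_1. *)
Theorem characteristic_limit :
  Ex P (fun w => cos (u * ev W (A N) w + v * ev W (B N) w + b)) @[N --> \oo] -->
  expR (- (s2 * u ^+ 2) / 2) * l.
Proof.
have G0 : 0 < G by exact: expR_gt0.
pose mu := - (u * v / p%:R).
have main : f 0 N 1 @[N --> \oo] --> l.
  apply: (@three_limits _ _ (fun K N => \sum_(k < K) mu ^+ k / k`!%:R * f k N 0)
    (fun K N => \sum_(k < K) `|mu| ^+ k * r k N + `|mu| ^+ K / K`!%:R * (G * Ex P (fun w => `|ev W (Y1 N) w| ^+ K)))
    (fun K => \sum_(k < K) mu ^+ k / k`!%:R * c k)
    (fun K => `|mu| ^+ K / K`!%:R * (G * a K))).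
  - move=> K N; have := @differential_chain _ (fun k => f k N) (fun k => f' k N) mu
      (G * Ex P (fun w => `|ev W (Y1 N) w| ^+ K)) (fun k => r k N)
      (fun k x => is_derive_f k N x) (fun k x => @f_equation k N x) K 0.
    move=> /(_ _ 1); rewrite lexx ler01 !mulr1; apply=> // x /andP[x0 x1].
    rewrite add0n /f normrM (gtr0_norm (expR_gt0 _)); apply: ler_pM => //.
      rewrite /G ler_expR ler_piMr ?expr_le1//.
      by rewrite mulr_ge0// mulr_ge0// sqr_ge0.
    have mY := Y1_moments N K.
    rewrite /m; apply: Ex_norm_le.
    + exact/moments_int1/cos_moments.
    + by apply/moments_int1/momentsX/moments_norm/mev.
    + by move=> w; rewrite normrM normrX ler_piMl// cos_max.
  - move=> K; apply: cvg_bigsum => k; apply: cvgM; first exact: cvg_cst.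
    have L := @c_lim k; apply: cvg_ext L => N; rewrite /f /m expr0n /= mulr0 expR0 mul1r mul0r.
    by congr Ex; apply/funext => w; rewrite /th mul0r add0r.
  - move=> K; rewrite [X in _ --> X](_ : _ = \sum_(k < K) `|mu| ^+ k * 0 + `|mu| ^+ K / K`!%:R * (G * a K)).
      apply: cvgD; first by apply: cvg_bigsum => k; apply: cvgM; [exact: cvg_cst|exact: r_cvg].
      by do 2![apply: cvgM; first exact: cvg_cst]; exact: a_lim.
    by rewrite big1 ?add0r// => k _; rewrite mulr0.
  - exact: l_lim.
  - rewrite [X in _ --> X](_ : 0 = G * 0); last by rewrite mulr0.
    have L : G * (`|u * v / p%:R| ^+ K / K`!%:R * a K) @[K --> \oo] --> G * 0.
      by apply: cvgM; [exact: cvg_cst|exact: a_small].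
    by apply: cvg_ext L => K; rewrite /mu normrN; ring.
have L : expR (- (s2 * u ^+ 2) / 2) * f 0 N 1 @[N --> \oo] --> expR (- (s2 * u ^+ 2) / 2) * l.
  by apply: cvgM; [exact: cvg_cst|exact: main].
apply: cvg_ext L => N; rewrite /f mulrA -expRD expr1n mulr1 mul1r mulNr addNr expR0 mul1r /m.
by congr Ex; apply/funext => w; rewrite expr0 mulr1 /th addrA.
Qed.

End characteristic_function_equation.

(** * Moments of the normal limit *)

Section normal_moments.
Context {R : realType} (s : R).
Hypothesis s0 : s != 0.

Lemma normal_moment_step k : Ex (normal_prob 0 s) (fun x => x ^+ k.+2) =
  s ^+ 2 * (k.+1%:R * Ex (normal_prob 0 s) (fun x => x ^+ k)).
Proof.
have D (x : R) : is_derive x (1 : R) (fun x : R => x ^+ k.+1) (k.+1%:R * x ^+ k).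
  have h := is_derive_expn 1 k.+1 x.
  have -> : (fun x : R => x ^+ k.+1) = (fun x => (1 * x) ^+ k.+1).
    by apply/funext => y; rewrite mul1r.
  by apply: is_derive_eq h _; rewrite /= mulr1 mul1r.
have g k' c : growth1 (fun x : R => c * x ^+ k').
  exists `|c|, k' => x; rewrite normrM normrX ler_wpM2l// lerXn2r ?nnegrE ?addr_ge0//.
  by rewrite lerDr.
have g' k' : growth1 (fun x : R => x ^+ k').
  by have [C [n h]] := g k' 1; exists C, n => x; have := h x; rewrite mul1r.
have cc : continuous (fun x : R => k.+1%:R * x ^+ k : R).
  by move=> x; exact: (continuousM (@cst_continuous R R k.+1%:R x) (@exprn_continuous R k x)).
have := normal_ibp s0 D cc (g' _) (g _ _).
under eq_fun do rewrite -exprS; move=> ->; congr (_ * _); rewrite ExZ//.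
by apply/moments_int1/momentsX/moments_normal.
Qed.

Lemma normal_moment2 : Ex (normal_prob 0 s) (fun x => x ^+ 2) = s ^+ 2.
Proof.
rewrite normal_moment_step mul1r; under eq_fun do rewrite expr0.
by rewrite Ex_cst mulr1.
Qed.

Lemma normal_moment4 : Ex (normal_prob 0 s) (fun x => (x ^+ 2) ^+ 2) = 3 * (s ^+ 2) ^+ 2.
Proof.
under eq_fun do rewrite -exprM.
have := normal_moment_step 2; rewrite normal_moment2 => E; etransitivity; first exact: E.
by ring.
Qed.

End normal_moments.

Section normal_limit.
Context {R : realType} {H : hilbertType R} d (Om : measurableType d).
Context (P : probability Om R) (W : H -> {RV P >-> R}).
Hypothesis isoW : isonormal W.
Variables (s : R) (D : nat) (A : nat -> wexp H) (X : nat -> Om -> R).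
Hypothesis s0 : s != 0.
Hypothesis dA : forall N, (wdeg (A N) <= D)%N.
Hypothesis sX : forall N, sqi P (X N).
Hypothesis XA : Ex P (fun w => (X N w - ev W (A N) w) ^+ 2) @[N --> \oo] --> 0.
Hypothesis law : forall g : R -> R, continuous g -> (exists M, forall x, `|g x| <= M) ->
  Ex P (fun w => g (X N w)) @[N --> \oo] --> Ex (normal_prob 0 s) g.

(** [poly_law] in dimension one. The cases of the second and fourth moments are the input of the
    fourth cumulant argument. *)
Lemma normal_limit_moment k :
  Ex P (fun w => ev W (A N) w ^+ k) @[N --> \oo] --> Ex (normal_prob 0 s) (fun x => x ^+ k).
Proof.
have rc : continuous (fun x : R => const_mx x : 'rV[R]_1).
  move=> x; apply/cvgrPdist_le => e e0.
  have := (@cvg_id _ (nbhs x)) => /cvgrPdist_le/(_ _ e0); apply: filterS => y h.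
  apply: rV_norm_le => [|j]; first exact: ltW.
  by rewrite !mxE.
have row1 (x : R) : \row_(j < 1) x = const_mx x by apply/rowP => j; rewrite !mxE.
have law1 (g : 'rV[R]_1 -> R) : continuous g -> (exists M, forall x, `|g x| <= M) ->
    Ex P (fun w => g (\row_j X N w)) @[N --> \oo] --> Ex (normal_prob 0 s) (fun x => g (\row_j x)).
  move=> cg [M gM]; have cg' : continuous (fun x : R => g (const_mx x)).
    by move=> x; apply: (@continuous_comp _ _ _ (fun x : R => const_mx x : 'rV[R]_1) g); [exact: rc|exact: cg].
  have L := law cg' (ex_intro _ M (fun x => gM _)).
  have -> : (fun x : R => g (\row_j x)) = (fun x => g (const_mx x)).
    by apply/funext => x; rewrite row1.
  apply: cvg_ext L => N.
  by congr Ex; apply/funext => w; rewrite row1.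
have := @poly_law R H _ Om P W isoW _ (measurableTypeR R) (normal_prob 0 s) 1 D (fun _ => A) (fun _ => X)
  (fun _ x => x) (fun _ => dA) (fun _ => sX) (fun _ => XA) (fun _ => @measurable_id _ _ _) law1
  (fun x => x 0 0 ^+ k).
case.
- move=> x; apply: (@continuous_comp _ _ _ (fun x : 'rV[R]_1 => x 0 0) (fun y : R => y ^+ k)).
    exact: coord_continuous.
  exact: exprn_continuous.
- elim: k => [|k IH]; first by under eq_fun do rewrite expr0; exact: growth_cst.
  by under eq_fun do rewrite exprS; apply: growthM IH; exact: growth_coord.
move=> _; have -> : (fun x : R => (\row_(j < 1) x) 0 0 ^+ k) = (fun x => x ^+ k).
  by apply/funext => x; rewrite mxE.
by move=> L; apply: cvg_ext L => N; congr Ex; apply/funext => w; rewrite mxE.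
Qed.

End normal_limit.

(** * Limit of the joint characteristic function *)

Section joint_limit.
Context {R : realType} {H : hilbertType R} d (Om : measurableType d).
Context (P : probability Om R) (W : H -> {RV P >-> R}).
Hypothesis isoW : isonormal W.
Context d' (Om' : measurableType d') (P' : probability Om' R).
Variables (p q a : nat) (A B : nat -> wexp H).
Hypotheses (p_gt0 : (0 < p)%N) (a_gt0 : (0 < a)%N).
Hypothesis apq : (a * p < q < a.+1 * p)%N.
Hypothesis dA : forall N, (wdeg (A N) <= p)%N.
Hypothesis dB : forall N, (wdeg (B N) <= q)%N.
Hypothesis cA : forall N s, {subset vecs (A N) <= s} -> chaos p (tr_of isoW s (A N)).
Hypothesis cB : forall N s, {subset vecs (B N) <= s} -> chaos q (tr_of isoW s (B N)).
Variable s2 : R.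
Hypothesis s2_gt0 : 0 < s2.
Hypothesis A2 : Ex P (fun w => ev W (A N) w ^+ 2) @[N --> \oo] --> s2.
Hypothesis A4 : Ex P (fun w => (ev W (A N) w ^+ 2) ^+ 2) @[N --> \oo] --> 3 * s2 ^+ 2.
Variables (V : 'I_a.+1 -> nat -> Om -> R) (Yl : 'I_a.+1 -> Om' -> R).
Hypothesis sV : forall r N, sqi P (V r N).
Hypothesis VF : forall r : 'I_a.+1,
  Ex P (fun w => (V r N w - ev W (wY (A N) (B N) r) w) ^+ 2) @[N --> \oo] --> 0.
Hypothesis mYl : forall r, measurable_fun setT (Yl r).
Hypothesis law : forall g : 'rV[R]_a.+1 -> R, continuous g -> (exists M, forall x, `|g x| <= M) ->
  Ex P (fun w => g (\row_r V r N w)) @[N --> \oo] --> Ex P' (fun w => g (\row_r Yl r w)).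
Hypothesis Yl_exp : forall (r : 'I_a.+1) t, (0 < r)%N -> int1 P' (fun w => expR (t * Yl r w)).

Let Y r := Yl (inord r).

Lemma growthX m (f : 'rV[R]_m -> R) k : growth f -> growth (fun x => f x ^+ k).
Proof.
move=> gf; elim: k => [|k IH]; first by under eq_fun do rewrite expr0; exact: growth_cst.
by under eq_fun do rewrite exprS; exact: growthM.
Qed.

Lemma continuous_expn m (f : 'rV[R]_m -> R) k : continuous f -> continuous (fun x => f x ^+ k).
Proof.
move=> cf x; apply: (@continuous_comp _ _ _ f (fun y : R => y ^+ k)); first exact: cf.
exact: exprn_continuous.
Qed.

Let law_of (g : 'rV[R]_a.+1 -> R) : continuous g -> growth g ->
  int1 P' (fun w => g (\row_r Yl r w)) /\
  Ex P (fun w => g (evrow W (fun r : 'I_a.+1 => wY (A N) (B N) r) w)) @[N --> \oo] -->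
  Ex P' (fun w => g (\row_r Yl r w)).
Proof.
have dF (r : 'I_a.+1) N : (wdeg (wY (A N) (B N) r) <= a * (p + q) + (p + q))%N.
  have h := @wdeg_wY R H (A N) (B N) r (p + q).
  apply: leq_trans (h _ _) _.
  - by apply: leq_trans (dA N) _; exact: leq_addr.
  - by apply: leq_trans (dB N) _; exact: leq_addl.
  - by rewrite leq_add2r leq_mul2r -ltnS ltn_ord orbT.
exact: (poly_law isoW dF sV VF mYl law).
Qed.

Let coord_c (r : 'I_a.+1) : continuous (fun x : 'rV[R]_a.+1 => x 0 r).
Proof. exact: coord_continuous. Qed.

Lemma limit_moments r : moments P' (Yl r).
Proof.
split=> // k; have [|//|+ _] := @law_of (fun x => `|x 0 r| ^+ k).
- apply: continuous_expn => x; apply: (@continuous_comp _ _ _ (fun x : 'rV[R]_a.+1 => x 0 r) (fun y : R => `|y|)).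
    exact: coord_c.
  exact: norm_continuous.
- by apply: growthX; exists 1, 1%N => x; rewrite normr_id expr1 mul1r (le_trans (ler_coord_norm _ _))// lerDr.
- by under eq_fun do rewrite mxE.
Qed.

Let Y_moments r : (r <= a)%N -> moments P' (Y r).
Proof. by move=> _; exact: limit_moments. Qed.

Lemma limit_monomials (r r' : 'I_a.+1) i j :
  Ex P (fun w => ev W (wY (A N) (B N) r) w ^+ i * ev W (wY (A N) (B N) r') w ^+ j) @[N --> \oo] -->
  Ex P' (fun w => Yl r w ^+ i * Yl r' w ^+ j).
Proof.
have [||_ L] := @law_of (fun x => x 0 r ^+ i * x 0 r' ^+ j).
- move=> x; have c1 : continuous (fun x : 'rV[R]_a.+1 => x 0 r ^+ i) by exact: continuous_expn.
  have c2 : continuous (fun x : 'rV[R]_a.+1 => x 0 r' ^+ j) by exact: continuous_expn.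
  exact: continuousM (c1 x) (c2 x).
- by apply: growthM; apply: growthX; exact: growth_coord.
have E : Ex P' (fun w => (\row_r Yl r w) 0 r ^+ i * (\row_r Yl r w) 0 r' ^+ j) =
    Ex P' (fun w => Yl r w ^+ i * Yl r' w ^+ j).
  by congr Ex; apply/funext => w; rewrite !mxE.
rewrite E in L; apply: cvg_ext L => N; congr Ex; apply/funext => w; rewrite !mxE//.
Qed.

Let Ylim r i j : (r < a)%N ->
  Ex P (fun w => ev W (wY (A N) (B N) r.+1) w ^+ i * ev W (wY (A N) (B N) r) w ^+ j) @[N --> \oo] -->
  Ex P' (fun w => Y r.+1 w ^+ i * Y r w ^+ j).
Proof.
move=> ra; have := @limit_monomials (inord r.+1) (inord r) i j.
by rewrite !inordK// ltnS ltnW.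
Qed.

Let Y_exp r t : (0 < r <= a)%N -> int1 P' (fun w => expR (t * Y r w)).
Proof. by move=> /andP[r0 ra]; apply: Yl_exp; rewrite inordK. Qed.

Lemma limit_eq0 (r : 'I_a.+1) : (2 <= r)%N -> {ae P', forall w, Yl r w = 0}.
Proof.
move=> r2; have ra : (r <= a)%N by rewrite -ltnS.
have r2a : (2 <= r <= a)%N by rewrite r2.
have := Yl_eq0 p_gt0 a_gt0 apq cA cB s2_gt0 A2 A4 Y_moments Ylim Y_exp r2a.
by rewrite /Y inord_val.
Qed.

Variables (u v b : R).
Let mu : R := - (u * v / p%:R).
Let i1 : 'I_a.+1 := inord 1.
Let i1E : i1 = 1%N :> nat. Proof. by rewrite /i1 inordK. Qed.

(** Integrable by the exponential moments of Y_1 at both signs, and above every partial sum of the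
    exponential series, also in absolute value. *)
Let dom w := expR (mu * Yl i1 w) + expR (- mu * Yl i1 w).

Let dom_int1 : int1 P' dom.
Proof. by apply: int1D; apply: Yl_exp; rewrite i1E. Qed.

Let dom_ge w : expR `|mu * Yl i1 w| <= dom w.
Proof.
rewrite /dom; have [z0|z0] := leP 0 (mu * Yl i1 w).
  by rewrite ger0_norm// lerDl expR_ge0.
by rewrite ltr0_norm// -mulNr lerDr expR_ge0.
Qed.

Let cosY_meas : measurable_fun setT (fun w => cos (v * Yl ord0 w + b)).
Proof.
by apply: measurable_fun_cos; apply: measurable_funD => //; exact: measurable_funM.
Qed.

Let termE (x y : R) k : (x * y) ^+ k / k`!%:R = x ^+ k / k`!%:R * y ^+ k.
Proof. by rewrite exprMn mulrAC. Qed.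

Lemma exponential_series_limit :
  \sum_(k < K) mu ^+ k / k`!%:R * Ex P' (fun w => cos (v * Yl ord0 w + b) * Yl i1 w ^+ k) @[K --> \oo] -->
  Ex P' (fun w => cos (v * Yl ord0 w + b) * expR (mu * Yl i1 w)).
Proof.
pose F K w := cos (v * Yl ord0 w + b) * \sum_(k < K) (mu * Yl i1 w) ^+ k / k`!%:R.
have iF k : int1 P' (fun w => cos (v * Yl ord0 w + b) * Yl i1 w ^+ k).
  apply/moments_int1/moments_cos; last exact/momentsX/limit_moments.
  by apply: measurable_funD => //; exact: measurable_funM.
have [||||L _] := @Ex_dominated _ _ _ P' F (fun w => cos (v * Yl ord0 w + b) * expR (mu * Yl i1 w)) dom.
- move=> K; apply: measurable_funM => //; apply: measurable_sum => k.
  by apply: measurable_funM => //; apply: measurable_funX; exact: measurable_funM.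
- move=> w; apply: cvgM; first exact: cvg_cst.
  have L : series (exp_coeff (mu * Yl i1 w)) K @[K --> \oo] --> expR (mu * Yl i1 w).
    exact: is_cvg_series_exp_coeff.
  by apply: cvg_ext L => K; rewrite /series /= big_mkord; apply: eq_bigr => k _; rewrite /exp_coeff.
- exact: dom_int1.
- move=> K w; rewrite /F normrM; apply: le_trans (dom_ge w).
  apply: le_trans (exp_partial_sum_le _ K).
  apply: le_trans (_ : `|\sum_(k < K) (mu * Yl i1 w) ^+ k / k`!%:R| <= _).
    by rewrite ler_piMl// cos_max.
  apply: le_trans (ler_norm_sum _ _ _) _; apply: ler_sum => k _.
  by rewrite normrM normrX (ger0_norm (_ : 0 <= k`!%:R^-1))// invr_ge0.
apply: cvg_ext L => K; rewrite /F.
under eq_fun do rewrite mulr_sumr.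
rewrite Ex_sum => [|k].
  apply: eq_bigr => k _; rewrite -ExZ//; congr Ex; apply/funext => w.
  by rewrite termE; ring.
have -> : (fun w => cos (v * Yl ord0 w + b) * ((mu * Yl i1 w) ^+ k / k`!%:R)) =
    (fun w => mu ^+ k / k`!%:R * (cos (v * Yl ord0 w + b) * Yl i1 w ^+ k)).
  by apply/funext => w; rewrite termE; ring.
exact: int1Z.
Qed.

Lemma exponential_term_limit :
  `|u * v / p%:R| ^+ K / K`!%:R * Ex P' (fun w => `|Yl i1 w| ^+ K) @[K --> \oo] --> 0.
Proof.
pose F K w := `|mu * Yl i1 w| ^+ K / K`!%:R.
have [||||L _] := @Ex_dominated _ _ _ P' F (fun=> 0) dom.
- move=> K; apply: measurable_funM => //; apply: measurable_funX; apply: measurableT_comp => //.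
  exact: measurable_funM.
- by move=> w; exact: (cvg_series_cvg_0 (is_cvg_series_exp_coeff `|mu * Yl i1 w|)).
- exact: dom_int1.
- move=> K w; apply: le_trans (dom_ge w).
  rewrite /F ger0_norm ?divr_ge0 ?exprn_ge0// ler_pdivrMr ?ltr0n ?fact_gt0// [leRHS]mulrC.
  exact: expr_le_fact_expR.
rewrite Ex_cst in L; apply: cvg_ext L => K; rewrite /F.
have iY : int1 P' (fun w => `|Yl i1 w| ^+ K) by case: (limit_moments i1).
rewrite -ExZ//; congr Ex; apply/funext => w.
by rewrite normrM termE /mu normrN.
Qed.

Theorem joint_characteristic_limit :
  Ex P (fun w => cos (u * ev W (A N) w + v * ev W (B N) w + b)) @[N --> \oo] -->
  expR (- (s2 * u ^+ 2) / 2) *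
    Ex P' (fun w => cos (v * Yl ord0 w + b) * expR (- (u * v / p%:R) * Yl i1 w)).
Proof.
have c1 k : Ex P (fun w => cos (v * ev W (B N) w + b) * ev W (wY (A N) (B N) 1) w ^+ k) @[N --> \oo] -->
    Ex P' (fun w => cos (v * Yl ord0 w + b) * Yl i1 w ^+ k).
  have [||_ L] := @law_of (fun x => cos (v * x 0 ord0 + b) * x 0 i1 ^+ k).
  - move=> x; have c : {for x, continuous (fun x : 'rV[R]_a.+1 => cos (v * x 0 ord0 + b))}.
      apply: (@continuous_comp _ _ _ (fun x : 'rV[R]_a.+1 => v * x 0 ord0 + b) cos).
        exact: (continuousD (continuousM (@cst_continuous _ _ v x) (@coord_c ord0 x)) (@cst_continuous _ _ b x)).
      exact: (@continuous_cos R).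
    have c2 : continuous (fun x : 'rV[R]_a.+1 => x 0 i1 ^+ k) by exact: continuous_expn.
    exact: continuousM c (c2 x).
  - apply: growthM; last exact/growthX/growth_coord.
    by exists 1, 0%N => x; rewrite expr0 mulr1 cos_max.
  have E : Ex P' (fun w => cos (v * (\row_r Yl r w) 0 ord0 + b) * (\row_r Yl r w) 0 i1 ^+ k) =
      Ex P' (fun w => cos (v * Yl ord0 w + b) * Yl i1 w ^+ k).
    by congr Ex; apply/funext => w; rewrite !mxE.
  by rewrite E in L; apply: cvg_ext L => N; congr Ex; apply/funext => w; rewrite !mxE i1E.
have c2 k : Ex P (fun w => `|ev W (wY (A N) (B N) 1) w| ^+ k) @[N --> \oo] -->
    Ex P' (fun w => `|Yl i1 w| ^+ k).
  have [||_ L] := @law_of (fun x => `|x 0 i1| ^+ k).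
  - apply: continuous_expn => x; apply: (@continuous_comp _ _ _ (fun x : 'rV[R]_a.+1 => x 0 i1) (fun y : R => `|y|)).
      exact: coord_c.
    exact: norm_continuous.
  - by apply: growthX; exists 1, 1%N => x; rewrite normr_id expr1 mul1r (le_trans (ler_coord_norm _ _))// lerDr.
  have E : Ex P' (fun w => `|(\row_r Yl r w) 0 i1| ^+ k) = Ex P' (fun w => `|Yl i1 w| ^+ k).
    by congr Ex; apply/funext => w; rewrite !mxE.
  by rewrite E in L; apply: cvg_ext L => N; congr Ex; apply/funext => w; rewrite !mxE i1E.
exact: (characteristic_limit p_gt0 (ltW s2_gt0) (fun N => cA (fun u h => h))
  (gam_null_mul a_gt0 cA cB A2 A4 Ylim)
  (wY2_null_mul p_gt0 a_gt0 apq cA cB s2_gt0 A2 A4 Y_moments Ylim Y_exp)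
  c1 c2 exponential_series_limit exponential_term_limit).
Qed.

End joint_limit.

(** * Daniell integral *)

Lemma caratheodory_probability {R : realType} (T : pointedType) (mu : {outer_measure set T -> \bar R}) :
  mu setT = 1%E -> exists Q : probability (caratheodory_type mu) R, forall A, Q A = mu A.
Proof.
move=> mu1; pose nu : {measure set (caratheodory_type mu) -> \bar R} := mu.
pose Q : probability (caratheodory_type mu) R := HB.pack (measure_function.Measure.sort nu)
  (Measure_isProbability.Build _ (caratheodory_type mu) R (measure_function.Measure.sort nu) mu1).
by exists Q.
Qed.

Section daniell.
Context {R : realType} (E : pointedType) (C : (E -> R) -> Prop) (L : (E -> R) -> R).
Hypothesis C_cst : forall c, C (fun=> c).
Hypothesis C_add : forall f g, C f -> C g -> C (fun x => f x + g x).
Hypothesis C_mul : forall f g, C f -> C g -> C (fun x => f x * g x).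
Hypothesis C_min : forall f g, C f -> C g -> C (fun x => Num.min (f x) (g x)).
Hypothesis C_bounded : forall f, C f -> exists M, forall x, `|f x| <= M.
Hypothesis L_add : forall f g, C f -> C g -> L (fun x => f x + g x) = L f + L g.
Hypothesis L_scale : forall c f, C f -> L (fun x => c * f x) = c * L f.
Hypothesis L_ge0 : forall f, C f -> (forall x, 0 <= f x) -> 0 <= L f.
Hypothesis L_one : L (fun=> 1) = 1.
Hypothesis L_smooth : forall h : nat -> E -> R, (forall n, C (h n)) ->
  (forall n x, 0 <= h n x) -> (forall n x, h n.+1 x <= h n x) ->
  (forall x, h n x @[n --> \oo] --> 0) -> L (h n) @[n --> \oo] --> 0.

Lemma C_scale c f : C f -> C (fun x => c * f x).
Proof. by move=> Cf; exact: C_mul. Qed.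

Lemma C_sub f g : C f -> C g -> C (fun x => f x - g x).
Proof.
move=> Cf Cg; have := C_add Cf (C_scale (-1) Cg).
by under eq_fun do rewrite mulN1r.
Qed.

Lemma L_sub f g : C f -> C g -> L (fun x => f x - g x) = L f - L g.
Proof.
move=> Cf Cg; rewrite -mulN1r -L_scale// -L_add//; last exact: C_scale.
by congr L; apply/funext => x; rewrite mulN1r.
Qed.

Lemma L_le f g : C f -> C g -> (forall x, f x <= g x) -> L f <= L g.
Proof.
move=> Cf Cg fg; rewrite -subr_ge0 -L_sub//; apply: L_ge0; first exact: C_sub.
by move=> x; rewrite subr_ge0.
Qed.

Lemma L_cst c : L (fun=> c) = c.
Proof. by have := @L_scale c (fun=> 1) (C_cst 1); rewrite L_one mulr1. Qed.

Definition dominating (A : set E) (g : E -> R) :=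
  [/\ C g, forall x, 0 <= g x & forall x, A x -> 1 <= g x].

(** The cost of covering [A] by a single function of the class; countable covers enter through the
    outer measure generated by it. *)
Definition cover_cost (A : set E) : R := inf [set L g | g in dominating A].

Let cost_has_inf A : has_inf [set L g | g in dominating A].
Proof.
split; first by exists (L (fun=> 1)); exists (fun=> 1) => //; split.
by exists 0 => _ [g [Cg g0 _] <-]; exact: L_ge0.
Qed.

Lemma cover_cost_ge0 A : 0 <= cover_cost A.
Proof. by apply: lb_le_inf; [have [] := cost_has_inf A|move=> _ [g [Cg g0 _] <-]; exact: L_ge0]. Qed.

Lemma cover_cost_le A g : dominating A g -> cover_cost A <= L g.
Proof. by move=> h; apply: ge_inf; [have [] := cost_has_inf A|exists g]. Qed.

Lemma cover_cost_adherent A e : 0 < e -> exists2 g, dominating A g & L g < cover_cost A + e.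
Proof. by move=> e0; have [_ [g hg <-] ?] := inf_adherent e0 (cost_has_inf A); exists g. Qed.

Lemma cover_cost0 : cover_cost set0 = 0.
Proof.
apply/eqP; rewrite eq_le cover_cost_ge0 andbT -[leRHS](L_cst 0).
by apply: cover_cost_le; split.
Qed.

(** All subsets are declared measurable, so that the outer measure generated by [cost] ranges over
    covers by arbitrary sets. *)
Let ET := g_sigma_algebraType [set: set E].
Let cost (A : set ET) : \bar R := (cover_cost A)%:E.

Let mET (A : set ET) : measurable A.
Proof. exact: sub_sigma_algebra. Qed.

Let cost0 : cost set0 = 0%E. Proof. by rewrite /cost cover_cost0. Qed.
Let cost_ge0 A : (0 <= cost A)%E. Proof. by rewrite lee_fin cover_cost_ge0. Qed.

Definition daniell_measure (A : set E) : \bar R := mu_ext cost A.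

HB.instance Definition _ := isOuterMeasure.Build R E daniell_measure
  (mu_ext0 cost0 cost_ge0) (mu_ext_ge0 cost_ge0) (@le_mu_ext _ ET R cost)
  (mu_ext_sigma_subadditive cost_ge0).

Let mu : {outer_measure set E -> \bar R} := daniell_measure.

Lemma daniell_le_cost A : (mu A <= (cover_cost A)%:E)%E.
Proof.
apply: ereal_inf_lbound; exists (fun k => if k is 0%N then A else set0).
  by split => // x Ax; exists 0%N.
rewrite (nneseries_split _ 1) //= big_nat1 [X in (_ + X)%E]eseries0 ?adde0//.
by move=> [|k]// _ _; rewrite cost0.
Qed.

Let C_sum (n : nat) (g : nat -> E -> R) : (forall k, C (g k)) -> C (fun x => \sum_(k < n) g k x).
Proof.
move=> Cg; elim: n => [|n IH].
  by under eq_fun do rewrite big_ord0; exact: C_cst.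
by under eq_fun do rewrite big_ord_recr /=; exact: C_add.
Qed.

Let L_sum (n : nat) (g : nat -> E -> R) : (forall k, C (g k)) ->
  L (fun x => \sum_(k < n) g k x) = \sum_(k < n) L (g k).
Proof.
move=> Cg; elim: n => [|n IH].
  by under eq_fun do rewrite big_ord0; rewrite big_ord0 L_cst.
under eq_fun do rewrite big_ord_recr /=.
by rewrite big_ord_recr /= -IH L_add//; exact: C_sum.
Qed.

Lemma geometric_half_le (e : R) n : 0 <= e -> \sum_(k < n) e / 2 / (2 ^ k)%:R <= e.
Proof.
move=> e0; suff -> : \sum_(k < n) e / 2 / (2 ^ k)%:R = e - e / (2 ^ n)%:R.
  by rewrite lerBlDr lerDl divr_ge0.
elim: n => [|n IH]; first by rewrite big_ord0 expn0; field.
have h : (2 ^ n)%:R != 0 :> R by rewrite pnatr_eq0 expn_eq0.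
by rewrite big_ord_recr /= IH expnS natrM; field.
Qed.

(** For a countable cover of [B] by sets dominated by the [g k], the functions
    [psi - min(psi, g_0 + ... + g_(n-1))] decrease to 0; the continuity of [L] along decreasing
    sequences enters here. *)
Lemma daniell_ge (psi : E -> R) (B : set E) : C psi -> (forall x, 0 <= psi x <= 1) ->
  [set x | 0 < psi x] `<=` B -> ((L psi)%:E <= mu B)%E.
Proof.
move=> Cp p01 pB; apply: le_ereal_inf_tmp => _ [A [_ BA] <-].
apply/lee_addgt0Pr => e e0; have e2 : 0 < e / 2 by rewrite divr_gt0.
(* Half of [e] is spread over the cover, the other half is kept for the continuity of [L]. *)
have e4 k : 0 < e / 2 / 2 / (2 ^ k)%:R by rewrite divr_gt0 ?divr_gt0// ltr0n expn_gt0.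
have pick k : exists g, dominating (A k) g /\ L g < cover_cost (A k) + e / 2 / 2 / (2 ^ k)%:R.
  by have [g h1 h2] := cover_cost_adherent (A k) (e4 k); exists g.
have [g hg] := choice pick.
have Cg k : C (g k) by have [[]] := hg k.
have g0 k x : 0 <= g k x by have [[]] := hg k.
have g1 k x : A k x -> 1 <= g k x by have [[_ _ +] _] := hg k; exact.
pose s n x := \sum_(k < n) g k x.
have Cs n : C (s n) by exact: C_sum.
have s_le n m x : (n <= m)%N -> s n x <= s m x.
  move=> /subnKC <-; elim: (m - n)%N => [|k IH]; first by rewrite addn0.
  by rewrite addnS; apply: le_trans IH _; rewrite /s big_ord_recr lerDl.
pose h n x := psi x - Num.min (psi x) (s n x).
have Ch n : C (h n) by apply: C_sub => //; exact: C_min.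
have h0 : L (h n) @[n --> \oo] --> 0.
  apply: L_smooth => [//|n x|n x|x].
  - by rewrite subr_ge0 ge_min lexx.
  - by rewrite /h lerD2l lerN2 le_min !ge_min lexx /= s_le ?leqnSn// orbT.
  - have [p0|p0] := ltP 0 (psi x); last first.
      have px : psi x = 0 by apply/eqP; rewrite eq_le p0; case/andP: (p01 x).
      have -> : (fun n => h n x) = fun=> 0; last exact: cvg_cst.
      apply/funext => n; rewrite /h px min_l ?subrr//.
      by apply: sumr_ge0 => k _.
    have [k _ Akx] := BA x (pB x p0).
    apply: cvg_near_cst; near=> n.
    have kn : (k < n)%N by near: n; exact: nbhs_infty_gt.
    rewrite /h min_l ?subrr//; case/andP: (p01 x) => _ p1; apply: le_trans p1 _.
    apply: le_trans (g1 k x Akx) _; rewrite /s (bigD1 (Ordinal kn))//= lerDl.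
    by apply: sumr_ge0.
have [n hn] : exists n, L (h n) <= e / 2.
  have : \forall n \near \oo, L (h n) <= e / 2.
    move/cvgrPdist_le: h0 => /(_ _ e2); apply: filterS => n; rewrite sub0r normrN.
    exact: le_trans (ler_norm _).
  exact: filter_ex.
have main : L psi <= \sum_(k < n) cover_cost (A k) + e.
  have -> : L psi = L (h n) + L (fun x => Num.min (psi x) (s n x)).
    by rewrite -L_add//; [congr L; apply/funext => x; rewrite /h subrK|exact: C_min].
  have Lm : L (fun x => Num.min (psi x) (s n x)) <= \sum_(k < n) L (g k).
    rewrite -L_sum//; apply: (L_le (C_min Cp (Cs n)) (Cs n)) => x.
    by rewrite ge_min lexx orbT.
  have Lg : \sum_(k < n) L (g k) <= \sum_(k < n) cover_cost (A k) + \sum_(k < n) e / 2 / 2 / (2 ^ k)%:R.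
    by rewrite -big_split; apply: ler_sum => k _; have [_ /ltW] := hg k.
  have := geometric_half_le n (ltW e2); lra.
apply: (@le_trans _ _ ((\sum_(k < n) cover_cost (A k))%:E + e%:E)%E); first by rewrite -EFinD lee_fin.
apply: leeD => //; rewrite -sumEFin.
have := @nneseries_lim_ge R (fun k => cost (A k)) xpredT 0 n (fun k _ _ => cost_ge0 (A k)).
by rewrite big_mkord.
Unshelve. all: end_near. Qed.

Section level_sets.
Variable f : E -> R.
Hypotheses (Cf : C f) (f01 : forall x, 0 <= f x <= 1).

Let B n := [set x | (2 ^ n)%:R^-1 <= f x].
Let D k := [set x | (2 ^ k.+1)%:R^-1 <= f x < (2 ^ k)%:R^-1].
Let A := [set x | 0 < f x].
(** A cut-off inside [C]: it is 1 where [f >= 2 / 2 ^ k] and vanishes with [f]. *)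
Let m k x := Num.min 1 ((2 ^ k)%:R / 2 * f x).

Let pow_gt0 k : 0 < (2 ^ k)%:R :> R. Proof. by rewrite ltr0n expn_gt0. Qed.

Let Cm k : C (m k).
Proof. by apply: C_min; [exact: C_cst|exact: C_scale]. Qed.

Let halve k : (2 ^ k.+1)%:R / 2 = (2 ^ k)%:R :> R.
Proof. by rewrite expnS natrM; field. Qed.

Let m01 k x : 0 <= m k x <= 1.
Proof.
have /andP[f0 f1] := f01 x; have pf : 0 <= (2 ^ k)%:R / 2 * f x by rewrite mulr_ge0 ?divr_ge0.
by rewrite /m le_min ler01 pf ge_min lexx.
Qed.

Let m_mono k x : m k x <= m k.+1 x.
Proof.
rewrite /m le_min !ge_min lexx /=; apply/orP; right.
apply: ler_wpM2r; first by case/andP: (f01 x).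
by rewrite ler_wpM2r ?invr_ge0// ler_nat leq_exp2l.
Qed.

(* m_(k+2) is 1 and m_k is at most 1/2 on D k. *)
Lemma cost_annulus k : cover_cost (D k) <= 2 * (L (m k.+2) - L (m k)).
Proof.
rewrite -L_sub// -L_scale; last exact: C_sub.
apply: cover_cost_le; split; first by apply/C_scale/C_sub.
  by move=> x; rewrite mulr_ge0// subr_ge0; exact: le_trans (m_mono _ _) (m_mono _ _).
move=> x /andP[x1 x2].
have -> : m k.+2 x = 1.
  rewrite /m min_l// halve.
  by rewrite -ler_pdivrMl// mulr1.
have : m k x <= 2^-1.
  rewrite /m ge_min; apply/orP; right; rewrite mulrAC -[leRHS]mul1r ler_wpM2r//.
  by rewrite -ler_pdivlMl// mulr1 ltW.
lra.
Qed.

(** The bounds of [cost_annulus] telescope with step 2 between values of [L] in [0, 1], whence the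
    bound 4. *)
Let annuli_finite : (\sum_(k <oo) cost (D k) < +oo)%E.
Proof.
apply: (@le_lt_trans _ _ 4%:E); last exact: ltry.
apply: lime_le; first by apply: is_cvg_nneseries => n _ _; exact: cost_ge0.
apply: nearW => n; rewrite sumEFin lee_fin big_mkord.
apply: le_trans (ler_sum _ (fun (k : 'I_n) _ => cost_annulus k)) _.
have -> : \sum_(k < n) 2 * (L (m k.+2) - L (m k)) = 2 * (L (m n.+1) + L (m n) - L (m 1) - L (m 0)).
  elim: n => [|n IH]; first by rewrite big_ord0; ring.
  by rewrite big_ord_recr /= IH; ring.
have L1 k : 0 <= L (m k) <= 1.
  rewrite L_ge0//=; last by move=> x; case/andP: (m01 k x).
  by rewrite -L_one; apply: L_le => // x; case/andP: (m01 k x).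
have /andP[? ?] := L1 n; have /andP[? ?] := L1 n.+1; have /andP[? ?] := L1 0; have /andP[? ?] := L1 1.
lra.
Qed.

(** The cut-off [m n.+1] is 1 on [B n] and 0 outside [A]; multiplying a dominating function by it
    and by its complement splits the cost. *)
Lemma daniell_split X n : (mu (X `&` B n) + mu (X `&` ~` A) <= mu X)%E.
Proof.
apply: le_ereal_inf_tmp => _ [F [_ XF] <-].
have cs k : (cost (F k `&` B n) + cost (F k `&` ~` A) <= cost (F k))%E.
  rewrite -EFinD lee_fin; apply/ler_addgt0Pr => e e0.
  have [g [Cg g0 g1] /ltW Lg] := cover_cost_adherent (F k) e0.
  apply: le_trans Lg.
  have Ch : C (m n.+1) := Cm n.+1.
  have -> : L g = L (fun x => g x * m n.+1 x) + L (fun x => g x * (1 - m n.+1 x)).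
    rewrite -L_add; [|exact: C_mul|by apply: C_mul => //; exact: C_sub].
    by congr L; apply/funext => x; ring.
  apply: lerD; apply: cover_cost_le; split.
  - exact: C_mul.
  - by move=> x; rewrite mulr_ge0//; case/andP: (m01 n.+1 x).
  - move=> x [Fx Bx]; have -> : m n.+1 x = 1; last by rewrite mulr1; exact: g1.
    rewrite /m min_l// halve.
    by rewrite -ler_pdivrMl// mulr1.
  - by apply: C_mul => //; exact: C_sub.
  - by move=> x; rewrite mulr_ge0// subr_ge0; case/andP: (m01 n.+1 x).
  - move=> x [Fx /negP]; rewrite -leNgt => f0.
    have fx : f x = 0 by apply/eqP; rewrite eq_le f0; case/andP: (f01 x).
    by rewrite /m fx mulr0 min_r// subr0 mulr1; exact: g1.
have cov (Z : set E) : X `&` Z `<=` \bigcup_k (F k `&` Z).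
  by move=> x [/XF[k _ Fx] Zx]; exists k.
have le1 Z : (mu (X `&` Z) <= \sum_(k <oo) cost (F k `&` Z))%E.
  by apply: ereal_inf_lbound; exists (fun k => F k `&` Z) => //; split.
apply: le_trans (leeD (le1 (B n)) (le1 (~` A))) _.
rewrite -nneseriesD; [|by move=> *; exact: cost_ge0..].
by apply: lee_nneseries => k _ //; rewrite adde_ge0.
Qed.

Lemma daniell_tail X n : (mu (X `&` A) <= mu (X `&` B n) + \sum_(n <= k <oo) cost (D k))%E.
Proof.
have sub : X `&` A `<=` (X `&` B n) `|` \bigcup_(k in ~` `I_n) D k.
  move=> x [Xx Ax]; have [h|h] := leP (2 ^ n)%:R^-1 (f x); first by left.
  right; have [k kP] : exists k, (2 ^ k)%:R^-1 <= f x.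
    exists (Num.truncn (f x)^-1).+1; rewrite invf_ple ?posrE//.
    apply: ltW; apply: lt_le_trans (truncnS_gt _) _.
    by rewrite ler_nat ltnW// ltn_expl.
  have [j jP jmin] := ex_minnP (ex_intro (fun k => (2 ^ k)%:R^-1 <= f x) k kP).
  have nj : (n < j)%N.
    rewrite ltnNge; apply/negP => jn; move: h; rewrite ltNge => /negP; apply.
    apply: le_trans jP; rewrite lef_pV2 ?posrE// ler_nat leq_exp2l//.
  case: j jP jmin nj => [//|j] jP jmin nj; exists j; first by apply/negP; rewrite -leqNgt.
  by rewrite /D /= jP ltNge; apply/negP => /jmin; rewrite ltnn.
apply: le_trans (le_outer_measure mu _ _ sub) _.
apply: le_trans (outer_measureU2 mu _ _) _; apply: leeD => //.
apply: le_trans (outer_measure_sigma_subadditive_tail mu n D) _.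
apply: lee_nneseries => k _; first by move=> _; exact: outer_measure_ge0.
exact: daniell_le_cost.
Qed.

(** Carathéodory's criterion for separated sets: [B n] and the complement of [A] are split exactly,
    and what [B n] misses of [A] lies in annuli whose total cost converges, so the tail vanishes. *)
Lemma daniell_measurable_pos : mu.-caratheodory A.
Proof.
apply: le_caratheodory_measurable => X.
have tail0 : (\sum_(n <= k <oo) cost (D k))%E @[n --> \oo] --> 0%E.
  by apply: nneseries_tail_cvg => // k _ _; exact: cost_ge0.
have step n : (mu (X `&` A) + mu (X `&` ~` A) <= mu X + \sum_(n <= k <oo) cost (D k))%E.
  apply: le_trans (leeD2r _ (daniell_tail X n)) _.
  by rewrite addeAC; apply: leeD2r; exact: daniell_split.
have Lm : (mu X + \sum_(n <= k <oo) cost (D k))%E @[n --> \oo] --> (mu X + 0)%E.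
  apply: cvgeD => //; last exact: cvg_cst.
  by rewrite fin_num_adde_defl.
rewrite adde0 in Lm; rewrite -(cvg_lim (@ereal_hausdorff R) Lm).
by apply: lime_ge; [exact: cvgP Lm|exact: nearW].
Qed.

End level_sets.

Let C_max f g : C f -> C g -> C (fun x => Num.max (f x) (g x)).
Proof.
move=> Cf Cg; have CN h : C h -> C (fun x => - h x).
  by move=> Ch; have := C_scale (-1) Ch; under eq_fun do rewrite mulN1r.
have := CN _ (C_min (CN _ Cf) (CN _ Cg)).
by under eq_fun do rewrite oppr_min !opprK.
Qed.

Lemma daniell_measurable_fun f : C f -> measurable_fun setT (f : caratheodory_type mu -> R).
Proof.
move=> Cf; apply: (@measurability _ _ (caratheodory_type mu) (measurableTypeR R) setT f _ (RGenOInfty.measurableE R)).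
move=> _ [_ [t ->] <-]; rewrite setTI.
pose f' x := Num.min 1 (Num.max 0 (f x - t)).
have Cf' : C f' by apply: C_min => //; apply: C_max => //; exact: C_sub.
have f'01 x : 0 <= f' x <= 1 by rewrite /f' le_min ler01 le_max lexx ge_min lexx.
have -> : f @^-1` `]t, +oo[ = [set x | 0 < f' x].
  apply/seteqP; split => x; rewrite /= in_itv/= andbT /f' lt_min ltr01 lt_max ltxx /= subr_gt0//.
exact: (daniell_measurable_pos Cf' f'01).
Qed.

Let daniell_setT : mu setT = 1%E.
Proof.
apply/eqP; rewrite eq_le; apply/andP; split.
  apply: le_trans (daniell_le_cost _) _; rewrite lee_fin -[leRHS]L_one.
  by apply: cover_cost_le; split.
rewrite -[X in (X%:E <= _)%E]L_one; apply: daniell_ge => // x.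
by rewrite ler01 lexx.
Qed.

Lemma staircase (x : R) n : (0 < n)%N -> 0 <= x <= 1 ->
  x = \sum_(j < n) (Num.min x (j.+1%:R / n%:R) - Num.min x (j%:R / n%:R)).
Proof.
move=> n0 /andP[x0 x1]; have n1 : n%:R != 0 :> R by rewrite pnatr_eq0 -lt0n.
have -> : \sum_(j < n) (Num.min x (j.+1%:R / n%:R) - Num.min x (j%:R / n%:R)) =
    Num.min x (n%:R / n%:R) - Num.min x (0 / n%:R).
  rewrite -(telescope_sumr (fun j => Num.min x (j%:R / n%:R)) (leq0n n)) big_mkord.
  by apply: eq_bigr.
by rewrite divff// mul0r min_l// min_r// subr0.
Qed.

Let le_of_inv (x y : R) : (forall n, (0 < n)%N -> x <= n%:R^-1 + y) -> x <= y.
Proof.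
move=> h; rewrite leNgt; apply/negP => yx.
have d0 : 0 < x - y by rewrite subr_gt0.
have := h (Num.truncn (x - y)^-1).+1 isT; rewrite -lerBlDr leNgt => /negP; apply.
by rewrite invf_plt ?posrE// truncnS_gt.
Qed.

(** For [g] with values in [0, 1] it is enough to bound [L g] above by the integral: the same bound
    for [1 - g] gives the converse. A bounded [f] is reduced to this case by an affine change. *)
Theorem daniell_representation : exists (disp : measure_display) (T : measurableType disp)
  (Q : probability T R) (phi : T -> E), forall f, C f ->
  measurable_fun setT (fun w => f (phi w)) /\ Ex Q (fun w => f (phi w)) = L f.
Proof.
pose U := caratheodory_type mu; have [Q QE] := caratheodory_probability daniell_setT.
exists _, U, Q, (fun x => x) => f Cf; have mf g : C g -> measurable_fun setT (g : U -> R).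
  exact: daniell_measurable_fun.
split; first exact: mf.
have iC g : C g -> int1 Q g.
  by move=> Cg; have [M gM] := C_bounded Cg; apply: (@int1_bounded _ _ _ _ _ M) => //; exact: mf.
have upper g : C g -> (forall x, 0 <= g x <= 1) -> L g <= Ex Q g.
  move=> Cg g01; apply: le_of_inv => n n0.
  have n1 : n%:R != 0 :> R by rewrite pnatr_eq0 -lt0n.
  have n2 : 0 < n%:R :> R by rewrite ltr0n.
  pose psi j x := n%:R * (Num.min (g x) (j.+1%:R / n%:R) - Num.min (g x) (j%:R / n%:R)).
  have lt_step j : (j%:R / n%:R < j.+1%:R / n%:R :> R) by rewrite ltr_pM2r ?invr_gt0// ltr_nat.
  have step1 j : j.+1%:R / n%:R = j%:R / n%:R + n%:R^-1 :> R by rewrite -natr1 mulrDl mul1r.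
  have Cpsi j : C (psi j) by apply: C_scale; apply: C_sub; apply: C_min.
  have psi01 j x : 0 <= psi j x <= 1.
    rewrite mulr_ge0 ?ler0n//=; last by rewrite subr_ge0 le_min !ge_min lexx /= (ltW (lt_step j)) orbT.
    rewrite /psi -ler_pdivlMl// mulr1 lerBlDl.
    rewrite ge_min step1; case: (leP (g x) (j%:R / n%:R)) => [h|h].
      by rewrite lerDl invr_ge0 ltW.
    by rewrite lexx orbT.
  have psi_pos j x : 0 < psi j x -> j%:R / n%:R < g x.
    rewrite /psi pmulr_rgt0// subr_gt0 => h; rewrite ltNge; apply/negP => gj.
    by move: h; rewrite (min_l gj) min_l ?ltxx// (le_trans gj)// ltW.
  have psi_one j x : j.+1%:R / n%:R < g x -> 1 <= psi j x.
    move=> h; rewrite /psi (min_r (ltW h)) min_r; last by rewrite ltW// (lt_trans (lt_step j)).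
    by rewrite step1 addrAC subrr add0r mulfV.
  (* Where [psi j.+1] is positive [psi j] equals 1, so [daniell_ge] applies to that set; the shift
     by one layer costs [1 / n] in the sum. *)
  have chain j : L (psi j.+1) <= Ex Q (psi j).
    pose B : set U := [set x | 1 <= psi j x].
    have mB : measurable B.
      have -> : B = psi j @^-1` `[1, +oo[ by apply/seteqP; split => x; rewrite /B /= in_itv/= andbT.
      by rewrite -[X in measurable X]setTI; apply: (mf _ (Cpsi j)).
    have h1 : ((L (psi j.+1))%:E <= Q B)%E.
      by rewrite QE; apply: daniell_ge => // x /psi_pos /psi_one.
    have i2 : int1 Q (fun x => \1_B x).
      apply: (@int1_bounded _ _ _ _ _ 1) => [|x]; first exact: measurable_indic.
      by rewrite indicE; case: (_ \in _); rewrite ?normr1 ?normr0.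
    have QB : Q B = (Ex Q (fun x => \1_B x))%:E.
      by rewrite Ex_fin// integral_indic// setIT.
    rewrite QB lee_fin in h1; apply: le_trans h1 _.
    apply: Ex_le => // [|x]; first exact: iC.
    rewrite indicE; case: (boolP (x \in B)) => [|_]; first by rewrite inE.
    by case/andP: (psi01 j x).
  have LgE : L g = n%:R^-1 * \sum_(j < n) L (psi j).
    rewrite -L_sum// -L_scale; last exact: C_sum.
    congr L; apply/funext => x; rewrite [LHS](@staircase _ n)// mulr_sumr.
    by apply: eq_bigr => j _; rewrite /psi mulKf.
  have EgE : Ex Q g = n%:R^-1 * \sum_(j < n) Ex Q (psi j).
    rewrite -Ex_sum => [|j]; last exact: iC.
    rewrite -ExZ; last by apply: int1_sum => j; exact: iC.
    congr Ex; apply/funext => x; rewrite [LHS](@staircase _ n)// mulr_sumr.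
    by apply: eq_bigr => j _; rewrite /psi mulKf.
  rewrite LgE EgE -[X in _ <= X + _]mulr1 -mulrDr ler_wpM2l ?invr_ge0 ?ler0n//.
  case: n n0 {n1 n2 lt_step step1 LgE EgE} psi Cpsi psi01 psi_pos psi_one chain => [//|n] _ psi Cpsi psi01 _ _ chain.
  rewrite big_ord_recl [X in _ <= 1 + X]big_ord_recr /=; apply: lerD.
    by rewrite -[leRHS]L_one; apply: L_le => // x; case/andP: (psi01 0 x).
  apply: ler_wpDr; first by apply: Ex_ge0 => x; case/andP: (psi01 n x).
  by apply: ler_sum => j _; rewrite /bump /= add1n; exact: chain.
have eq01 g : C g -> (forall x, 0 <= g x <= 1) -> Ex Q g = L g.
  move=> Cg g01; apply/eqP; rewrite eq_le upper// andbT.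
  have := upper (fun x => 1 - g x) (C_sub (C_cst 1) Cg).
  rewrite L_sub// L_one ExB; [|exact: iC|exact: iC]; rewrite Ex_cst lerD2l lerN2; apply => x.
  by have /andP[g0 g1] := g01 x; rewrite subr_ge0 g1 lerBlDl lerDr.
have [M fM] := C_bounded Cf.
have M0 : 0 < `|M| + 1 by rewrite ltr_wpDl.
pose k := 2 * (`|M| + 1); have k0 : 0 < k by rewrite mulr_gt0.
pose g x := k^-1 * (f x + (`|M| + 1)).
have Cg : C g by apply: C_scale; exact: C_add.
have := eq01 g Cg; rewrite L_scale; last exact: C_add.
rewrite L_add// L_cst ExZ; last by apply: int1D; apply: iC.
rewrite ExD; [|exact: iC|exact: iC]; rewrite Ex_cst => h.
have {}h := h _; apply: (addIr (`|M| + 1)); apply: (mulfI (_ : k^-1 != 0)).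
  by rewrite invr_eq0 gt_eqF.
apply: h => x; have := le_trans (fM x) (ler_norm M); rewrite ler_norml => /andP[h1 h2].
rewrite /g mulr_ge0 ?invr_ge0 ?(ltW k0)//=; last lra.
by rewrite ler_pdivrMl// mulr1 /k; lra.
Qed.

End daniell.

(** * Existence of the limit law *)

Section limit_law.
Context {R : realType} {m : nat}.

(** Near each point some [h n] is already below [e] and stays so for larger indices; compactness of
    the ball makes the index uniform. *)
Lemma dini (h : nat -> 'rV[R]_m -> R) (K : nat) (e : R) : (forall n, continuous (h n)) ->
  (forall n x, h n.+1 x <= h n x) -> (forall x, h n x @[n --> \oo] --> 0) -> 0 < e ->
  exists n, forall x, rowball K x -> h n x <= e.
Proof.
move=> ch hS h0 e0; have h_le n k x : (n <= k)%N -> h k x <= h n x.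
  move=> /subnKC <-; elim: (k - n)%N => [|j IH]; first by rewrite addn0.
  by rewrite addnS; apply: le_trans (hS _ _) IH.
have /compact_near_coveringP near_cover := @rowball_compact R m K.
suff H : forall x, rowball K x -> \forall x' \near x & n \near \oo, h n x' <= e.
  have [n _ hn] := near_cover nat \oo (fun n x => h n x <= e) _ H.
  by exists n; exact: (hn n (leqnn n)).
move=> x _; have [n hn] : exists n, h n x < e.
  have : \forall n \near \oo, h n x < e.
    move/cvgrPdist_lt: (h0 x) => /(_ _ e0); apply: filterS => n; rewrite sub0r normrN.
    exact: le_lt_trans (ler_norm _).
  exact: filter_ex.
have nb : \forall y \near x, h n y < e.
  have := ch n x => /cvgrPdist_lt/(_ (e - h n x)); rewrite subr_gt0 => /(_ hn).
  by apply: filterS => y; rewrite ltr_norml => /andP[h1 h2]; lra.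
exists ([set y | h n y < e], [set k | (n <= k)%N]); first by split => //; exists n.
by move=> [y k] [/= yn nk]; apply: le_trans (h_le _ _ _ nk) (ltW yn).
Qed.

Context d (Om : measurableType d) (P : probability Om R).
Variables (V : nat -> Om -> 'rV[R]_m) (c : 'rV[R]_m -> R -> R).
Hypothesis mV : forall N t, measurable_fun setT (fun w => dotrow t (V N w)).
Hypothesis bV : L2_bounded P V.
Hypothesis cosV : forall t b, Ex P (fun w => cos (dotrow t (V N w) + b)) @[N --> \oo] --> c t b.

Let C (g : 'rV[R]_m -> R) := continuous g /\ exists M, forall x, `|g x| <= M.
Let L (g : 'rV[R]_m -> R) : R := lim (Ex P (fun w => g (V N w)) @[N --> \oo]).

Let L_cvg g : C g -> Ex P (fun w => g (V N w)) @[N --> \oo] --> L g.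
Proof.
move=> [cg [M gM]]; have [l hl] := Ex_continuous_cvg mV bV cosV cg gM.
by rewrite /L (cvg_lim (@Rhausdorff R) hl).
Qed.

Let i1 g N : C g -> int1 P (fun w => g (V N w)).
Proof.
move=> [cg [M gM]]; apply: (@int1_bounded _ _ _ _ _ M) => [|w]; last exact: gM.
exact: (measurable_continuous_row (mV N) cg).
Qed.

Let L_eq g l : C g -> Ex P (fun w => g (V N w)) @[N --> \oo] --> l -> L g = l.
Proof. by move=> Cg; exact: (cvg_lim (@Rhausdorff R)). Qed.

(** The Daniell functional is the limit of expectations. Its continuity along decreasing sequences
    combines Dini's theorem on a large ball with Chebyshev's inequality outside it, uniformly in
    [N]. *)
Theorem limit_law_exists : exists (disp : measure_display) (T : measurableType disp)
  (Q : probability T R) (phi : T -> 'rV[R]_m), forall g : 'rV[R]_m -> R, continuous g -> (exists M, forall x, `|g x| <= M) ->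
  measurable_fun setT (fun w => g (phi w)) /\
  Ex P (fun w => g (V N w)) @[N --> \oo] --> Ex Q (fun w => g (phi w)).
Proof.
have C_cst a : C (fun=> a) by split; [exact: cst_continuous|exists `|a|].
have C_add f g : C f -> C g -> C (fun x => f x + g x).
  move=> [cf [M fM]] [cg [M' gM]]; split; first by move=> x; exact: continuousD (cf x) (cg x).
  by exists (M + M') => x; apply: le_trans (ler_normD _ _) _; exact: lerD.
have C_mul f g : C f -> C g -> C (fun x => f x * g x).
  move=> [cf [M fM]] [cg [M' gM]]; split; first by move=> x; exact: continuousM (cf x) (cg x).
  by exists (M * M') => x; rewrite normrM ler_pM.
have C_min f g : C f -> C g -> C (fun x => Num.min (f x) (g x)).
  move=> [cf [M fM]] [cg [M' gM]]; split; first by move=> x; exact: (@continuous_min _ _ f g x (cf x) (cg x)).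
  exists (Num.max M M') => x; have := fM x; have := gM x; rewrite le_max minEle.
  by case: ifP => _ h1 h2; rewrite ?h1 ?h2 ?orbT.
have [T0 [T [Q [phi H]]]] : exists (disp : measure_display) (T : measurableType disp)
    (Q : probability T R) (phi : T -> 'rV[R]_m), forall f, C f ->
    measurable_fun setT (fun w => f (phi w)) /\ Ex Q (fun w => f (phi w)) = L f.
  apply: daniell_representation => //.
  - by move=> f [].
  - move=> f g Cf Cg; apply: L_eq; first exact: C_add.
    by apply: cvg_ext (cvgD (L_cvg Cf) (L_cvg Cg)) => N; rewrite ExD//; exact: i1.
  - move=> a f Cf; apply: L_eq; first exact: C_mul.
    have D : a * Ex P (fun w => f (V N w)) @[N --> \oo] --> a * L f.
      by apply: cvgM; [exact: cvg_cst|exact: L_cvg].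
    by apply: cvg_ext D => N; rewrite ExZ//; exact: i1.
  - move=> f Cf f0; apply: cvg_ge (L_cvg Cf) => N; exact: Ex_ge0.
  - apply: L_eq => //; under eq_fun do rewrite Ex_cst; exact: cvg_cst.
  - move=> h Ch h0 hS hc; apply/cvgrPdist_le => e e0.
    have [B HB] := bV; have B0 : 0 <= B.
      by have [_] := HB 0%N; apply: le_trans; apply: Ex_ge0 => w; exact: sqr_ge0.
    have [M hM] := (Ch 0%N).2; have M0 : 0 <= M := le_trans (normr_ge0 _) (hM 0).
    have h_le n x : h n x <= M.
      apply: le_trans (_ : h 0%N x <= _); last exact: le_trans (ler_norm _) (hM x).
      by elim: n => [//|n IH]; exact: le_trans (hS n x) IH.
    have e2 : 0 < e / 2 by rewrite divr_gt0.
    pose K := (Num.truncn (M * B / (e / 2))).+1.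
    have K0 : 0 < K%:R :> R by rewrite ltr0n.
    have KP : M * B / K%:R ^+ 2 <= e / 2.
      rewrite ler_pdivrMr ?exprn_gt0// [leRHS]mulrC -ler_pdivrMr//.
      apply: le_trans (ltW (truncnS_gt _)) _; rewrite -/K -natrX ler_nat.
      by rewrite expnS expn1 leq_pmulr.
    have [n hn] := dini K (fun n => (Ch n).1) hS hc e2.
    near=> k; have nk : (n <= k)%N by near: k; exact: nbhs_infty_ge.
    have hk x : rowball K x -> h k x <= e / 2.
      move=> /hn; apply: le_trans; move: nk => /subnKC <-.
      elim: (k - n)%N => [|j IH]; first by rewrite addn0.
      by rewrite addnS; apply: le_trans (hS _ _) IH.
    have bound N : Ex P (fun w => h k (V N w)) <= e.
      have [iV EV] := HB N.
      have i2 : int1 P (fun w => e / 2 + M / K%:R ^+ 2 * `|V N w| ^+ 2).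
        by apply: int1D; [exact: int1_cst|exact: int1Z].
      have le w : h k (V N w) <= e / 2 + M / K%:R ^+ 2 * `|V N w| ^+ 2.
        have [vK|vK] := leP `|V N w| K%:R.
          by apply: le_trans (hk _ vK) _; rewrite lerDl mulr_ge0 ?sqr_ge0// divr_ge0 ?sqr_ge0.
        apply: ler_wpDl; first exact: ltW.
        apply: le_trans (h_le k _) _; rewrite mulrAC -mulrA ler_peMr//.
        by rewrite ler_pdivlMr ?exprn_gt0// mul1r lerXn2r ?nnegrE ?ler0n ?normr_ge0// ltW.
      apply: le_trans (Ex_le (i1 N (Ch k)) i2 le) _.
      rewrite ExD; [|exact: int1_cst|exact: int1Z]; rewrite Ex_cst ExZ//.
      have : M / K%:R ^+ 2 * Ex P (fun w => `|V N w| ^+ 2) <= M / K%:R ^+ 2 * B.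
        by rewrite ler_wpM2l// divr_ge0// sqr_ge0.
      by move: KP; rewrite mulrAC; lra.
    have L0 : 0 <= L (h k) by apply: cvg_ge (L_cvg (Ch k)) => N; exact: Ex_ge0.
    by rewrite sub0r normrN ger0_norm//; apply: cvg_le (L_cvg (Ch k)).
exists T0, T, Q, phi => g cg bg; have [|h1 h2] := H g; first by split.
by split=> //; rewrite h2; apply: L_cvg; split.
Unshelve. all: end_near. Qed.

End limit_law.

(** * Identification of laws on the line *)

Section laws_on_the_line.
Context {R : realType}.

(** Continuous ramps converge to the indicators of the half-lines []t, +oo[], a generating class
    stable under intersection. *)
Lemma law_unique (mu nu : probability (measurableTypeR R) R) :
  (forall g : R -> R, continuous g -> (exists M, forall x, `|g x| <= M) -> Ex mu g = Ex nu g) ->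
  forall A : set R, measurable A -> mu A = nu A.
Proof.
move=> H; have ray (Q : probability (measurableTypeR R) R) (t : R) :
    Ex Q (fun x => Num.min 1 (Num.max 0 (k%:R * (x - t)))) @[k --> \oo] --> Ex Q (fun x => \1_`]t, +oo[%classic x).
  have [||||+ _] // := @Ex_dominated _ _ _ Q (fun k (x : R) => Num.min 1 (Num.max 0 (k%:R * (x - t))))
    (fun x => \1_`]t, +oo[%classic x) (fun=> 1).
  - move=> k; apply: measurable_minr => //; apply: measurable_maxr => //.
    by apply: measurable_funM => //; exact: measurable_funB.
  - move=> x; rewrite indicE; have [tx|tx] := ltP t x; last first.
      rewrite memNset ?in_itv/= ?andbT; last by rewrite /= in_itv/= andbT; apply/negP; rewrite -leNgt.
      have -> : (fun k => Num.min 1 (Num.max 0 (k%:R * (x - t)))) = fun=> 0.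
        apply/funext => k; rewrite (max_idPl _) ?(min_idPr _)//.
        by rewrite mulr_ge0_le0 ?ler0n ?subr_le0.
      exact: cvg_cst.
    rewrite mem_set ?in_itv/= ?andbT//; last by rewrite /= in_itv/= andbT.
    have d0 : 0 < x - t by rewrite subr_gt0.
    apply: cvg_near_cst; near=> k; rewrite (min_idPl _)// le_max; apply/orP; right.
    rewrite -ler_pdivrMr// mul1r; near: k; exact: nbhs_infty_ger.
  - exact: int1_cst.
  - by move=> k x; rewrite ger0_norm ?ge_min ?lexx// le_min ler01 le_max lexx.
have rayE (Q : probability (measurableTypeR R) R) (t : R) :
    Q `]t, +oo[%classic = (Ex Q (fun x => \1_`]t, +oo[%classic x))%:E.
  have i1 : int1 Q (fun x => \1_`]t, +oo[%classic x).
    apply: (@int1_bounded _ _ _ _ _ 1) => [|x]; first exact: measurable_indic.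
    by rewrite indicE; case: (_ \in _); rewrite ?normr1 ?normr0.
  by rewrite Ex_fin// integral_indic// setIT.
apply: (@measure_unique _ R (measurableTypeR R) (@RGenOInfty.G R) (fun n => `]- n%:R, +oo[%classic)
  (@RGenOInfty.measurableE R)).
- move=> _ _ [x ->] [y ->]; exists (Num.max x y); apply/seteqP; split => z /=;
    rewrite !in_itv/= !andbT gt_max.
    by move=> [-> ->].
  by move=> /andP[].
- by move=> n; exists (- n%:R).
- apply/seteqP; split => // x _; exists (Num.truncn (- x)).+1 => //=.
  by rewrite in_itv/= andbT ltrNl truncnS_gt.
- move=> _ [t ->]; apply: etrans (rayE mu t) (etrans _ (esym (rayE nu t))); congr EFin.
  have h := ray mu t; have h' := ray nu t.
  have h2 : Ex mu (fun x => Num.min 1 (Num.max 0 (k%:R * (x - t)))) @[k --> \oo] --> Ex nu (fun x => \1_(`]t, +oo[ : set R) x).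
    apply: cvg_ext h' => k; apply/esym; apply: H.
      move=> x; apply: (@continuous_min _ _ (fun=> 1) (fun x : R => Num.max 0 (k%:R * (x - t)))); first exact: cst_continuous.
      apply: (@continuous_max _ _ (fun=> 0) (fun x : R => k%:R * (x - t))); first exact: cst_continuous.
      have c1 : {for x, continuous (fun x : R => x - t)}.
        by apply: (@continuousB _ _ _ (fun x : R => x) (fun=> t)) => //; exact: cst_continuous.
      exact: continuousM (@cst_continuous R R k%:R x) c1.
    by exists 1 => x; rewrite ger0_norm ?ge_min ?lexx// le_min ler01 le_max lexx.
  by rewrite -(cvg_lim (@Rhausdorff R) h) (cvg_lim (@Rhausdorff R) h2).
- by move=> k; apply: le_lt_trans (probability_le1 _ _) _; [exact: measurable_itv|exact: ltry].
Unshelve. all: end_near. Qed.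

End laws_on_the_line.

Lemma image_law {R : realType} d d' (T : measurableType d) (S : measurableType d') (Q : probability T R)
  (X : T -> S) : measurable_fun setT X ->
  exists N : probability S R, forall A : set S, measurable A -> Q (X @^-1` A) = N A.
Proof.
move=> mX; pose X' : {mfun T >-> S} := HB.pack X (isMeasurableFun.Build _ _ _ _ X mX).
by exists (distribution Q X').
Qed.

Section pairs.
Context {R : realType} d (Om : measurableType d) (P : probability Om R).
Variables (X Y : nat -> Om -> R) (c : R -> R -> R -> R).
Hypotheses (sX : forall N, sqi P (X N)) (sY : forall N, sqi P (Y N)).
Variable B : R.
Hypothesis XB : forall N, Ex P (fun w => X N w ^+ 2) <= B.
Hypothesis YB : forall N, Ex P (fun w => Y N w ^+ 2) <= B.
Hypothesis cosXY : forall u v b,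
  Ex P (fun w => cos (u * X N w + v * Y N w + b)) @[N --> \oo] --> c u v b.

Definition pair_row (x y : R) : 'rV[R]_2 := \row_j (if j == ord0 then x else y).

Lemma dotrow_pair (t : 'rV[R]_2) x y : dotrow t (pair_row x y) = t 0 ord0 * x + t 0 ord_max * y.
Proof.
rewrite /dotrow big_ord_recl big_ord1 !mxE /=.
by congr (_ + t 0 _ * _); exact/val_inj.
Qed.

Let row_pair (x : 'rV[R]_2) : R * R := (x 0 ord0, x 0 ord_max).

Let pair_rowK z : row_pair (pair_row z.1 z.2) = z.
Proof. by case: z => x y; rewrite /row_pair !mxE /=. Qed.

Let row_pair_continuous : continuous row_pair.
Proof. move=> x; have h1 : (fun y : 'rV[R]_2 => y 0 ord0) @ x --> x 0 ord0 by exact: coord_continuous.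
have h2 : (fun y : 'rV[R]_2 => y 0 ord_max) @ x --> x 0 ord_max by exact: coord_continuous.
exact: (cvg_pair h1 h2). Qed.

(** The abstract space of [limit_law_exists] is pushed forward to the plane; its coordinates are
    measurable as limits of clamped ones, which are bounded continuous functions. *)
Theorem joint_law_exists : exists mu : probability (measurableTypeR R * measurableTypeR R)%type R,
  forall g : R * R -> R, continuous g -> (exists M, forall z, `|g z| <= M) ->
  int1 mu g /\ Ex P (fun w => g (X N w, Y N w)) @[N --> \oo] --> Ex mu g.
Proof.
pose V N w := pair_row (X N w) (Y N w).
have VE N : V N = fun w => \row_j (if j == ord0 then X N w else Y N w) by [].
have mV N t : measurable_fun setT (fun w => dotrow t (V N w)).
  under eq_fun do rewrite dotrow_pair; apply: measurable_funD; apply: measurable_funM => //.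
    by case: (sX N).
  by case: (sY N).
have bV : L2_bounded P V.
  apply: (@row_L2 R _ Om P 2 (fun j N w => if j == ord0 then X N w else Y N w) B).
    by move=> j N; case: eqP.
  by move=> j N; case: eqP.
have cV t b : Ex P (fun w => cos (dotrow t (V N w) + b)) @[N --> \oo] --> c (t 0 ord0) (t 0 ord_max) b.
  have h := @cosXY (t 0 ord0) (t 0 ord_max) b; apply: cvg_ext h => N.
  by congr Ex; apply/funext => w; rewrite dotrow_pair.
have [T0 [T [Q [phi H]]]] := limit_law_exists mV bV cV.
have mcoord j : measurable_fun setT (fun w => phi w 0 j).
  apply: (measurable_fun_cvg (h := fun n w => clamp n (phi w 0 j))).
    move=> n; have [||//] := H (fun x => clamp n (x 0 j)).
      by apply: clamp_continuous; exact: coord_continuous.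
    by exists n%:R => x; exact: clamp_le.
  by move=> w _; exact: clamp_cvg.
pose UV w : (measurableTypeR R * measurableTypeR R)%type := row_pair (phi w).
have mUV : measurable_fun setT UV.
  exact: (@measurable_fun_pair _ _ _ T (measurableTypeR R) (measurableTypeR R) _ _ (mcoord _) (mcoord _)).
have [mu muE] := image_law Q mUV.
exists mu => g cg [M gM].
have mg : measurable_fun setT (g : (measurableTypeR R * measurableTypeR R)%type -> R).
  have mrow t : measurable_fun setT
      (fun z : (measurableTypeR R * measurableTypeR R)%type => dotrow t (pair_row z.1 z.2)).
    have m1 : measurable_fun setT
      (fun z : (measurableTypeR R * measurableTypeR R)%type => z.1 : measurableTypeR R) := measurable_fst.
    have m2 : measurable_fun setT
      (fun z : (measurableTypeR R * measurableTypeR R)%type => z.2 : measurableTypeR R) := measurable_snd.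
    by under eq_fun do rewrite dotrow_pair; apply: measurable_funD; exact: measurable_funM.
  have cg' : continuous (fun x => g (row_pair x)).
    by move=> x; apply: (@continuous_comp _ _ _ row_pair g); [exact: row_pair_continuous|exact: cg].
  have := measurable_continuous_row mrow cg'.
  by under eq_fun do rewrite pair_rowK.
have ig : int1 mu g by apply: (@int1_bounded _ _ _ _ _ M).
split=> //.
have [||_ L] := H (fun x => g (row_pair x)).
- by move=> x; apply: (@continuous_comp _ _ _ row_pair g); [exact: row_pair_continuous|exact: cg].
- by exists M => x; exact: gM.
have E := Ex_law mUV muE ig.
rewrite -E; apply: cvg_ext L => N; congr Ex; apply/funext => w.
by rewrite /V -[in RHS](pair_rowK (X N w, Y N w)).
Qed.

End pairs.

Lemma measurable_fun_expR {R : realType} d (T : measurableType d) (f : T -> R) :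
  measurable_fun setT f -> measurable_fun setT (fun w => expR (f w)).
Proof.
move=> mf; apply: (measurableT_comp _ mf); exact: (continuous_measurable_fun (@continuous_expR R)).
Qed.

Section complex_exponents.
Context {R : realType} d (T : measurableType d) (P : probability T R).

Lemma Re_mul_real (c : R[i]) (y : R) : complex.Re (c * y%:C%C) = complex.Re c * y.
Proof. by case: c => a b /=; rewrite mulr0 subr0. Qed.

Lemma Im_mul_real (c : R[i]) (y : R) : complex.Im (c * y%:C%C) = complex.Im c * y.
Proof. by case: c => a b /=; rewrite mulr0 add0r. Qed.

Lemma Re_sum (I : Type) (r : seq I) (Q : pred I) (F : I -> R[i]) :
  complex.Re (\sum_(i <- r | Q i) F i) = \sum_(i <- r | Q i) complex.Re (F i).
Proof. by apply: (@big_rec2 _ _ (fun (x : R[i]) (y : R) => complex.Re x = y)) => // i x y _ <-; case: (F i) x => a b []. Qed.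

Lemma Im_sum (I : Type) (r : seq I) (Q : pred I) (F : I -> R[i]) :
  complex.Im (\sum_(i <- r | Q i) F i) = \sum_(i <- r | Q i) complex.Im (F i).
Proof. by apply: (@big_rec2 _ _ (fun (x : R[i]) (y : R) => complex.Im x = y)) => // i x y _ <-; case: (F i) x => a b []. Qed.

Lemma cexp_i_add (x a : R) :
  cexp ('i%C * x%:C%C + a%:C%C) = Complex (expR a * cos x) (expR a * sin x).
Proof. by rewrite /cexp /= !(mul0r, mulr0, mul1r, oppr0, add0r, addr0). Qed.

Lemma cexp_i (x : R) : cexp ('i%C * x%:C%C) = Complex (cos x) (sin x).
Proof. by have := cexp_i_add x 0; rewrite rmorph0 addr0 expR0 !mul1r. Qed.

Lemma real_mul_Complex (k a b : R) : k%:C%C * Complex a b = Complex (k * a) (k * b).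
Proof. by apply/eqP; rewrite eq_complex /= !mul0r subr0 addr0 !eqxx. Qed.

Lemma cexpectation_ae (F G : T -> R[i]) :
  measurable_fun setT (fun w => complex.Re (F w)) -> measurable_fun setT (fun w => complex.Im (F w)) ->
  measurable_fun setT (fun w => complex.Re (G w)) -> measurable_fun setT (fun w => complex.Im (G w)) ->
  {ae P, forall w, F w = G w} ->
  cexpectation P F = Complex (Ex P (fun w => complex.Re (G w))) (Ex P (fun w => complex.Im (G w))).
Proof.
move=> m1 m2 m3 m4 FG; rewrite /cexpectation -!ExE; congr Complex; apply: Ex_ae => //.
  by apply: filterS FG => w ->.
by apply: filterS FG => w ->.
Qed.

Variables (n : nat) (c : 'I_n -> R[i]) (Y : 'I_n -> T -> R) (Z : T -> R) (Q : pred 'I_n).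
Hypotheses (mY : forall r, measurable_fun setT (Y r)) (mZ : measurable_fun setT Z).
Let S w : R[i] := 'i%C * (Z w)%:C%C + \sum_(r < n | Q r) c r * (Y r w)%:C%C.

Lemma measurable_exponent : measurable_fun setT (fun w => complex.Re (S w)) /\
  measurable_fun setT (fun w => complex.Im (S w)).
Proof.
have ReD (x y : R[i]) : complex.Re (x + y) = complex.Re x + complex.Re y by case: x; case: y.
have ImD (x y : R[i]) : complex.Im (x + y) = complex.Im x + complex.Im y by case: x; case: y.
have mS (k : 'I_n -> R) : measurable_fun setT (fun w => \sum_(r < n | Q r) k r * Y r w).
  rewrite (_ : (fun w => _) = fun w => \sum_(r < n) (if Q r then k r * Y r w else 0)); last first.
    by apply/funext => w; rewrite big_mkcond.
  by apply: measurable_sum => r; case: (Q r) => //; exact: measurable_funM.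
split.
  under eq_fun do rewrite ReD Re_mul_real Re_sum.
  apply: measurable_funD; first exact: measurable_funM.
  by under eq_fun do under eq_bigr do rewrite Re_mul_real; exact: mS.
under eq_fun do rewrite ImD Im_mul_real Im_sum.
apply: measurable_funD; first exact: measurable_funM.
by under eq_fun do under eq_bigr do rewrite Im_mul_real; exact: mS.
Qed.

Lemma measurable_cexp : measurable_fun setT (fun w => complex.Re (cexp (S w))) /\
  measurable_fun setT (fun w => complex.Im (cexp (S w))).
Proof.
have [mR mI] := measurable_exponent.
have mE : measurable_fun setT (fun w => expR (complex.Re (S w))).
  exact: measurable_fun_expR.
split; apply: measurable_funM => //; first exact: measurable_fun_cos.
under eq_fun do rewrite sin_cos; apply: measurable_fun_cos; exact: measurable_funB.
Qed.

End complex_exponents.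

(** * From the approximants to the given variables *)

Lemma cvg_law_Ex {R : realType} d d' (Om : measurableType d) (Om' : measurableType d')
  (P : probability Om R) (P' : probability Om' R) (E : topologicalType)
  (X_ : nat -> Om -> E) (X : Om' -> E) (g : E -> R) :
  cvg_in_distribution P P' X_ X -> continuous g -> (exists M, forall x, `|g x| <= M) ->
  int1 P' (fun w => g (X w)) -> Ex P (fun w => g (X_ N w)) @[N --> \oo] --> Ex P' (fun w => g (X w)).
Proof.
move=> law cg bg ig; have h := law g cg bg.
have {}h : expectation P (g \o X_ N) @[N --> \oo] --> (Ex P' (fun w => g (X w)))%:E.
  by rewrite -(Ex_expectation ig).
have -> : (fun N => Ex P (fun w => g (X_ N w))) = fine \o (fun N => expectation P (g \o X_ N)).
  by apply/funext => N; rewrite ExE.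
by apply: fine_cvg; exact: h.
Qed.

Lemma L2_limit_bounded {R : realType} d (Om : measurableType d) (P : probability Om R)
  (X F : nat -> Om -> R) (l : R) : (forall N, sqi P (X N)) -> (forall N, sqi P (F N)) ->
  Ex P (fun w => F N w ^+ 2) @[N --> \oo] --> l ->
  Ex P (fun w => (X N w - F N w) ^+ 2) @[N --> \oo] --> 0 ->
  exists B, forall N, Ex P (fun w => X N w ^+ 2) <= B.
Proof.
move=> sX sF Fl XF; have [M [_ HM]] := cvg_seq_bounded Fl; have [M' [_ HM']] := cvg_seq_bounded XF.
exists (2 * M' + 2 * M) => N.
have := Ex_sqrD_le (sqiB (sX N) (sF N)) (sF N).
under eq_fun do rewrite subrK; move=> h; apply: le_trans h _.
have h1 := le_trans (ler_norm _) (HM N); have h2 := le_trans (ler_norm _) (HM' N).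
lra.
Qed.

Lemma int1_expR_mgf {R : realType} d (Om : measurableType d) (P : probability Om R) (X : Om -> R) (t : R) :
  measurable_fun setT X -> (mmt_gen_fun P X t < +oo)%E -> int1 P (fun w => expR (t * X w)).
Proof.
move=> mX; rewrite /mmt_gen_fun unlock => h; apply/integrableP; split.
  apply/measurable_EFinP; apply: measurable_fun_expR.
  exact: measurable_funM.
apply: le_lt_trans h; rewrite le_eqVlt; apply/orP; left; apply/eqP; apply: eq_integral => w _.
by rewrite /= ger0_norm ?expR_ge0// mulrC.
Qed.

Lemma measurable_continuous_pair {R : realType} d (Om : measurableType d) (X Y : Om -> R) (g : R * R -> R) :
  measurable_fun setT X -> measurable_fun setT Y -> continuous g ->
  measurable_fun setT (fun w => g (X w, Y w)).
Proof.
move=> mX mY cg.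
have mrow t : measurable_fun setT (fun w => dotrow t (pair_row (X w) (Y w))).
  by under eq_fun do rewrite dotrow_pair; apply: measurable_funD; exact: measurable_funM.
have cg' : continuous (fun x : 'rV[R]_2 => g (x 0 ord0, x 0 ord_max)).
  move=> x; apply: (@continuous_comp _ _ _ (fun x : 'rV[R]_2 => (x 0 ord0, x 0 ord_max)) g); last exact: cg.
  have h1 : (fun y : 'rV[R]_2 => y 0 ord0) @ x --> x 0 ord0 by exact: coord_continuous.
  have h2 : (fun y : 'rV[R]_2 => y 0 ord_max) @ x --> x 0 ord_max by exact: coord_continuous.
  exact: (cvg_pair h1 h2).
have := measurable_continuous_row mrow cg'.
by under eq_fun do rewrite !mxE /=.
Qed.

Theorem corollary2 (R : realType)
  (H : hilbertType R) (Hsep : separable H)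
  (d : measure_display) (Omega : measurableType d) (P : probability Omega R)
  (W : H -> {RV P >-> R}) (W_isonormal : isonormal W)
  (T : forall n : nat, tensor_power H n)
  (I : forall n : nat, T n -> {RV P >-> R})
  (I_integral : multiple_integral W I)
  (p q a : nat) (p_ge2 : (2 <= p)%N) (a_ge1 : (1 <= a)%N)
  (apq : (a * p < q < a.+1 * p)%N)
  (f : nat -> T p) (f_sym : forall N, symmetric_tensor (f N))
  (g : nat -> T q) (g_sym : forall N, symmetric_tensor (g N))
  (X : nat -> {RV P >-> R}) (X_def : forall N, X N = I p (f N))
  (sigma : R) (sigma_gt0 : 0 < sigma ^+ 2)
  (X_cvg : cvg_in_distribution P (normal_prob 0 sigma)
             (fun N w => X N w) (fun x : measurableTypeR R => x : R))
  (* [Y r N] is Y_{r,N}; [DX N] and [DY r N] are the Malliavin derivatives of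
     X_N and Y_{r,N}. *)
  (Y : nat -> nat -> {RV P >-> R})
  (DX : nat -> Omega -> H) (DY : nat -> nat -> Omega -> H)
  (DX_def : forall N, malliavin_derivative W (X N) (DX N))
  (DY_def : forall r N, malliavin_derivative W (Y r N) (DY r N))
  (Y0_def : forall N, Y 0%N N = I q (g N))
  (YS_def : forall r N, \forall w \ae P,
              Y r.+1 N w = inner H (DX N w) (DY r N w))
  (* The limit vector (Y, Y_1, ..., Y_a), with Y = [Yl ord0]. *)
  (d' : measure_display) (Omega' : measurableType d')
  (P' : probability Omega' R) (Yl : 'I_a.+1 -> {RV P' >-> R})
  (Y_cvg : cvg_in_distribution P P'
             (fun N w => \row_(r < a.+1) Y r N w)
             (fun w => \row_(r < a.+1) Yl r w))
  (Yl_exp : forall (r : 'I_a.+1) (t : R), (0 < r)%N ->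
              (mmt_gen_fun P' (Yl r) t < +oo)%E) :
  (* [mu] is the law of the limit (Z, Y) of (X_N, Y_N). *)
  exists mu : probability (measurableTypeR R * measurableTypeR R)%type R,
  [/\ cvg_in_distribution P mu (fun N w => (X N w, Y 0%N N w))
        (fun z : measurableTypeR R * measurableTypeR R => (z : R * R)),
      forall A : set R, measurable A ->
        mu (fst @^-1` A) = normal_prob 0 sigma A,
      forall A : set R, measurable A ->
        mu (snd @^-1` A) = distribution P' (Yl ord0) A &
      forall u v : R,
        charfun2 mu u v =
        (expR (- (sigma ^+ 2 * u ^+ 2) / 2))%:C%C *
        cexpectation P' (fun w => cexp (
          'i%C * (v * Yl ord0 w)%:C%C +
          \sum_(r < a.+1 | (0 < r)%N)
            ((-1) ^+ r * 'i%C ^+ r.-1 / r`!%:R) *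
            (u ^+ r * v ^+ r / p%:R ^+ r)%:C%C * (Yl r w)%:C%C))].
Proof.
have p_gt0 : (0 < p)%N by apply: leq_trans p_ge2.
have q_gt0 : (0 < q)%N by case/andP: apq => /(leq_trans _) h _; apply: h.
have s0 : sigma != 0 by apply: contraTneq sigma_gt0 => ->; rewrite expr0n ltxx.
(* [K = a + 1] covers Y_0, ..., Y_a; the vanishing of Y_(a+1) is obtained on the polynomial side. *)
have [sX [sY [A [B [dA dB cA cB [XA YA]]]]]] :=
  approximants W_isonormal I_integral a.+1 p_gt0 q_gt0 f_sym g_sym X_def Y0_def DX_def DY_def YS_def.
have X_law (h : R -> R) : continuous h -> (exists M, forall x, `|h x| <= M) ->
    Ex P (fun w => h (X N w)) @[N --> \oo] --> Ex (normal_prob 0 sigma) h.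
  move=> ch bh; apply: (cvg_law_Ex X_cvg ch bh); have [M hM] := bh.
  by apply: (@int1_bounded _ _ _ _ _ M) => //; exact: continuous_measurable_fun.
have A2 : Ex P (fun w => ev W (A N) w ^+ 2) @[N --> \oo] --> sigma ^+ 2.
  have h := @normal_limit_moment _ _ _ _ _ _ W_isonormal _ _ _ _ dA sX XA X_law 2.
  by rewrite (normal_moment2 s0) in h.
have A4 : Ex P (fun w => (ev W (A N) w ^+ 2) ^+ 2) @[N --> \oo] --> 3 * (sigma ^+ 2) ^+ 2.
  have h := @normal_limit_moment _ _ _ _ _ _ W_isonormal _ _ _ _ dA sX XA X_law (2 * 2).
  rewrite -(normal_moment4 s0); under [X in _ --> Ex _ X]eq_fun do rewrite -exprM.
  by apply: cvg_ext h => N; congr Ex; apply/funext => w; rewrite exprM.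
have mYl r : measurable_fun setT (Yl r) by exact: measurable_funPT.
have Y_law (h : 'rV[R]_a.+1 -> R) : continuous h -> (exists M, forall x, `|h x| <= M) ->
    Ex P (fun w => h (\row_(r < a.+1) Y r N w)) @[N --> \oo] --> Ex P' (fun w => h (\row_r Yl r w)).
  move=> ch bh; apply: (cvg_law_Ex Y_cvg ch bh); have [M hM] := bh.
  apply: (@int1_bounded _ _ _ _ _ M) => //; apply: measurable_continuous_row => // t.
  exact: row_meas.
have Y_exp (r : 'I_a.+1) t : (0 < r)%N -> int1 P' (fun w => expR (t * Yl r w)).
  by move=> r0; apply: int1_expR_mgf => //; exact: Yl_exp.
pose V (r : 'I_a.+1) N : Omega -> R := Y r N.
have VF (r : 'I_a.+1) : Ex P (fun w => (V r N w - ev W (wY (A N) (B N) r) w) ^+ 2) @[N --> \oo] --> 0.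
  exact: (YA r (ltn_ord r)).
have sV r N : sqi P (V r N) by exact: sY.
pose i1 : 'I_a.+1 := inord 1.
have i1E : i1 = 1%N :> nat by rewrite inordK.
(* The phase [b] keeps cosine and sine in one family: [b = 0] and [b = - pi / 2] give the real and
   imaginary parts. *)
pose lim_cos u v b := expR (- (sigma ^+ 2 * u ^+ 2) / 2) *
  Ex P' (fun w => cos (v * Yl ord0 w + b) * expR (- (u * v / p%:R) * Yl i1 w)).
have cosAB u v b : Ex P (fun w => cos (u * ev W (A N) w + v * ev W (B N) w + b)) @[N --> \oo] --> lim_cos u v b.
  exact: (@joint_characteristic_limit _ _ _ _ _ _ _ _ _ _ _ _ _ _ _ p_gt0 a_ge1 apq dA dB cA cB _
    sigma_gt0 A2 A4 _ _ sV VF mYl Y_law Y_exp u v b).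
have Yl0 (r : 'I_a.+1) : (2 <= r)%N -> {ae P', forall w, Yl r w = 0}.
  exact: (@limit_eq0 _ _ _ _ _ _ _ _ _ _ _ _ _ _ _ p_gt0 a_ge1 apq dA dB cA cB _
    sigma_gt0 A2 A4 _ _ sV VF mYl Y_law Y_exp r).
have XY0 : forall j : 'I_2, Ex P (fun w => ((if j == ord0 then X N w else Y 0%N N w) -
    ev W (if j == ord0 then A N else B N) w) ^+ 2) @[N --> \oo] --> 0.
  by move=> j; case: eqP => _; [exact: XA|exact: (YA 0%N (ltn0Sn a))].
have cosXY u v b : Ex P (fun w => cos (u * X N w + v * Y 0%N N w + b)) @[N --> \oo] --> lim_cos u v b.
  have sXY (j : 'I_2) N : sqi P (fun w => if j == ord0 then X N w else Y 0%N N w) by case: eqP.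
  (* The limit known for the polynomial approximants passes to [X N] and [Y 0 N], at L^2 distance
     tending to 0 from them. *)
  have h := @rF_cos _ _ _ _ _ _ W_isonormal 2 (fun j N => if j == ord0 then A N else B N)
    (fun j N w => if j == ord0 then X N w else Y 0%N N w) sXY XY0 (pair_row u v) b.
  have addc (u1 u2 : nat -> R) (l1 l2 : R) : u1 N @[N --> \oo] --> l1 -> u2 N @[N --> \oo] --> l2 ->
      u1 N + u2 N @[N --> \oo] --> l1 + l2 by exact: cvgD.
  have D := addc _ _ _ _ h (@cosAB u v b); rewrite add0r in D; apply: cvg_ext D => N.
  have -> : (fun w => cos (u * ev W (A N) w + v * ev W (B N) w + b)) =
      (fun w => cos (dotrow (pair_row u v) (evrow W (fun j : 'I_2 => if j == ord0 then A N else B N) w) + b)).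
    by apply/funext => w; rewrite /dotrow big_ord_recl big_ord1 !mxE /=.
  rewrite /= subrK; congr Ex; apply/funext => w.
  by rewrite /dotrow big_ord_recl big_ord1 !mxE /=.
have sev a0 := moments_sqi (ev_moments W_isonormal a0).
have [BX XB] := L2_limit_bounded sX (fun N => sev (A N)) A2 XA.
have YY := @limit_monomials _ _ _ _ _ _ W_isonormal _ _ _ _ _ _ _ _ dA dB _ _ sV VF mYl Y_law ord0 ord0 2 0.
have [BY YB] : exists B0, forall N, Ex P (fun w => Y 0%N N w ^+ 2) <= B0.
  apply: (@L2_limit_bounded _ _ _ _ (Y 0%N) (fun N => ev W (B N)) _ (sY 0%N) (fun N => sev (B N)) _ (YA 0%N (ltn0Sn a))).
  by apply: cvg_ext YY => N; congr Ex; apply/funext => w; rewrite expr0 mulr1.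
have XB' N : Ex P (fun w => X N w ^+ 2) <= Num.max BX BY by rewrite le_max XB.
have YB' N : Ex P (fun w => Y 0%N N w ^+ 2) <= Num.max BX BY by rewrite le_max YB orbT.
have [mu H_mu] := joint_law_exists sX (sY 0%N) XB' YB' cosXY.
have bounded_cos (u v b : R) : continuous (fun z : R * R => cos (u * z.1 + v * z.2 + b)).
  move=> z; apply: (@continuous_comp _ _ _ (fun z : R * R => u * z.1 + v * z.2 + b) cos); last exact: (@continuous_cos R).
  have c1 : {for z, continuous (fun z : R * R => z.1)} by exact: cvg_fst.
  have c2 : {for z, continuous (fun z : R * R => z.2)} by exact: cvg_snd.
  exact: (continuousD (continuousD (continuousM (@cst_continuous _ _ u z) c1)
    (continuousM (@cst_continuous _ _ v z) c2)) (@cst_continuous _ _ b z)).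
have mu_cos u v b : int1 mu (fun z => cos (u * z.1 + v * z.2 + b)) /\
    Ex mu (fun z => cos (u * z.1 + v * z.2 + b)) = lim_cos u v b.
  have [|i L] := H_mu _ (@bounded_cos u v b); first by exists 1 => z; exact: cos_max.
  by split=> //; rewrite -(cvg_lim (@Rhausdorff R) L) (cvg_lim (@Rhausdorff R) (@cosXY u v b)).
exists mu; split.
- move=> h ch bh; have [ih L] := H_mu h ch bh.
  have ihN N : int1 P (fun w => h (X N w, Y 0%N N w)).
    have [M hM] := bh; apply: (@int1_bounded _ _ _ _ _ M) => //.
    exact: measurable_continuous_pair.
  rewrite [X in _ --> X](Ex_expectation ih).
  have -> : (fun N => expectation P (h \o (fun w => (X N w, Y 0%N N w)))) =
      (fun N => (Ex P (fun w => h (X N w, Y 0%N N w)))%:E).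
    by apply/funext => N; rewrite -(Ex_expectation (ihN N)).
  by apply: cvg_EFin; [exact: nearW|exact: L].
(* Test functions of the first coordinate have the limit of [X N] alone, and [law_unique] identifies
   the marginal. *)
- move=> A0 mA0; have m1 : measurable_fun setT
      (fun z : (measurableTypeR R * measurableTypeR R)%type => z.1 : measurableTypeR R) := measurable_fst.
  have [N1 N1E] := image_law mu m1.
  rewrite [LHS](N1E A0 mA0); apply: law_unique mA0 => h ch [M hM].
  have ih : int1 N1 h by apply: (@int1_bounded _ _ _ _ _ M) => //; exact: continuous_measurable_fun.
  rewrite -(Ex_law m1 N1E ih).
  have [||_ L] := H_mu (fun z => h z.1).
  + by move=> z; apply: (@continuous_comp _ _ _ (fun z : R * R => z.1) h); [exact: cvg_fst|exact: ch].
  + by exists M.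
  rewrite -(cvg_lim (@Rhausdorff R) L); apply: (cvg_lim (@Rhausdorff R)); apply: X_law => //.
  by exists M.
- move=> A0 mA0; have m2 : measurable_fun setT
      (fun z : (measurableTypeR R * measurableTypeR R)%type => z.2 : measurableTypeR R) := measurable_snd.
  have [N2 N2E] := image_law mu m2.
  have [N3 N3E] := image_law P' (mYl ord0 : measurable_fun setT (Yl ord0 : Omega' -> measurableTypeR R)).
  rewrite [LHS](N2E A0 mA0) [RHS](N3E A0 mA0); apply: law_unique mA0 => h ch [M hM].
  have ih2 : int1 N2 h by apply: (@int1_bounded _ _ _ _ _ M) => //; exact: continuous_measurable_fun.
  have ih3 : int1 N3 h by apply: (@int1_bounded _ _ _ _ _ M) => //; exact: continuous_measurable_fun.
  rewrite -(Ex_law m2 N2E ih2) -(Ex_law (mYl ord0 : measurable_fun setT (Yl ord0 : Omega' -> measurableTypeR R)) N3E ih3).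
  have [||_ L] := H_mu (fun z => h z.2).
  + by move=> z; apply: (@continuous_comp _ _ _ (fun z : R * R => z.2) h); [exact: cvg_snd|exact: ch].
  + by exists M.
  have c0 : continuous (fun x : 'rV[R]_a.+1 => h (x 0 ord0)).
    by move=> x; apply: (@continuous_comp _ _ _ (fun x : 'rV[R]_a.+1 => x 0 ord0) h); [exact: coord_continuous|exact: ch].
  have L' := Y_law _ c0 (ex_intro _ M (fun x => hM _)).
  rewrite -(cvg_lim (@Rhausdorff R) L); apply: (cvg_lim (@Rhausdorff R)).
  have -> : (fun w => h (Yl ord0 w)) = (fun w => h ((\row_r Yl r w) 0 ord0)).
    by apply/funext => w; rewrite mxE.
  by apply: cvg_ext L' => N; congr Ex; apply/funext => w; rewrite mxE.
- move=> u v; pose cr (r : 'I_a.+1) : R[i] :=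
    ((-1) ^+ r * 'i%C ^+ r.-1 / r`!%:R) * (u ^+ r * v ^+ r / p%:R ^+ r)%:C%C.
  have mZ : measurable_fun setT (fun w => v * Yl ord0 w) by exact: measurable_funM.
  have [mR mI] := @measurable_cexp R _ Omega' _ cr (fun r w => Yl r w) (fun w => v * Yl ord0 w)
    (fun r => (0 < r)%N) mYl mZ.
  have mE : measurable_fun setT (fun w => expR (- (u * v / p%:R) * Yl i1 w)).
    by apply: measurable_fun_expR; exact: measurable_funM.
  have ae2 : {ae P', forall w, forall r : 'I_a.+1, (2 <= r)%N -> Yl r w = 0}.
    apply: filter_forall => r; have [r2|r2] := boolP (2 <= r)%N.
      by apply: filterS (Yl0 r r2) => w.
    by apply: aeW => w.
  pose G w := cexp ('i%C * (v * Yl ord0 w)%:C%C + (- (u * v / p%:R) * Yl i1 w)%:C%C).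
  have ReG : (fun w => complex.Re (G w)) =
      (fun w => cos (v * Yl ord0 w + 0) * expR (- (u * v / p%:R) * Yl i1 w)).
    by apply/funext => w; rewrite /G cexp_i_add /= addr0 mulrC.
  have ImG : (fun w => complex.Im (G w)) =
      (fun w => cos (v * Yl ord0 w - pi / 2) * expR (- (u * v / p%:R) * Yl i1 w)).
    by apply/funext => w; rewrite /G cexp_i_add /= sin_cos mulrC.
  have mG b : measurable_fun setT (fun w => cos (v * Yl ord0 w + b) * expR (- (u * v / p%:R) * Yl i1 w)).
    by apply: measurable_funM => //; apply: measurable_fun_cos; exact: measurable_funD.
  have mReG : measurable_fun setT (fun w => complex.Re (G w)) by rewrite ReG.
  have mImG : measurable_fun setT (fun w => complex.Im (G w)) by rewrite ImG.
  have SG : {ae P', forall w, cexp ('i%C * (v * Yl ord0 w)%:C%C +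
      \sum_(r < a.+1 | (0 < r)%N) cr r * (Yl r w)%:C%C) = G w}.
    apply: filterS ae2 => w Y0; congr (cexp (_ + _)).
    (* Almost surely only [r = 1] remains in the sum, with the real coefficient [- u v / p]. *)
    rewrite (bigD1 i1) ?i1E//= big1 ?addr0 => [|r /andP[r0 r1]]; last first.
      rewrite Y0 ?rmorph0 ?mulr0//; rewrite ltn_neqAle r0 andbT.
      by apply: contraNneq r1 => r1; apply/eqP/val_inj; rewrite /= i1E.
    by rewrite /cr i1E /= !expr1 expr0 mulr1 divr1 mulN1r mulNr -rmorphM -rmorphN /= mulNr.
  rewrite (cexpectation_ae mR mI mReG mImG SG) real_mul_Complex ReG ImG.
  rewrite /charfun2 /cexpectation -!ExE.
  have [_ c1] := mu_cos u v 0; have [_ c2] := mu_cos u v (- (pi / 2)).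
  have -> : (fun z : measurableTypeR R * measurableTypeR R =>
      complex.Re (cexp ('i%C * (u * z.1 + v * z.2)%:C%C))) = (fun z => cos (u * z.1 + v * z.2 + 0)).
    by apply/funext => z; rewrite cexp_i /= addr0.
  have -> : (fun z : measurableTypeR R * measurableTypeR R =>
      complex.Im (cexp ('i%C * (u * z.1 + v * z.2)%:C%C))) = (fun z => cos (u * z.1 + v * z.2 - pi / 2)).
    by apply/funext => z; rewrite cexp_i /= sin_cos.
  by rewrite c1 c2.
Qed.
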